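(* Let $S$, $T$, $\Psi$, $S^q$ and $\mathcal F^{S^q}_K$ be as in the context. Let $\kappa>0$ and let $\{\Phi^q\}_{q\ge Q}$ satisfy $\Phi^q\in\mathcal F^{S^q}_{K_q}$ where $K_q=1+O(2^{-q\kappa})$. Then $\Phi^q\circ\Psi^{-1}:T\to T$ converges uniformly on every compact subset of the interior of $T$ to the identity map of $T$.
   Context: $S\subset\mathbb R^d$ is a compact polyhedral surface homeomorphic to a closed disk, triangulated as $(V,E,F)$ with planar triangular faces; three distinct boundary vertices $v_1,v_2,v_3$, positively ordered, are marked. $T$ is the closed equilateral triangle with corners $t_\ell=e^{i(\ell-1)2\pi/3}$. For a vertex $v_i$, $\theta_{i,j}$ is the angle at $v_i$ of incident face $f_j$, $\theta_i=\sum_j\theta_{i,j}$; $\Theta_i=2\pi$ (interior), $\pi$ (other boundary vertices), $\pi/3$ ($v_1,v_2,v_3$); $\gamma_i=\Theta_i/\theta_i$. Fix $0<\zeta<1/4$; $\Omega_i$ is the (relative) interior of the convex hull over the surface of $v_i$ and the points $\zeta v_i+(1-\zeta)v_{i'}$, $v_{i'}$ neighbours of $v_i$; $\varphi_i:\Omega_i\to\mathbb C$ unfolds the faces around $v_i$ isometrically into the plane with $v_i$ at $0$ and applies $re^{i\phi}\mapsto r^{\gamma_i}e^{i\gamma_i\phi}$ (continuously). $\Psi:S\to T$ is the unique homeomorphism conformal in the interior with respect to these charts with $\Psi(v_\ell)=t_\ell$. $S^0=S$, $S^{q+1}$ is obtained from $S^q=(V^q,E^q,F^q)$ by 1-to-4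 midpoint subdivision. Each $f_j\in F^2$ is associated with a chart $i=i_j$ ($v_i$ a vertex of the original face containing $f_j$, $\overline{f_j}\subset\Omega_i$); faces of $F^q$, $q>2$, inherit their $F^2$-ancestor's chart. For $f_j\in F^q$ with vertices $v_{j_\ell}$, $z_\ell=\varphi_{i_j}(v_{j_\ell})$; for a continuous $\Phi$ affine on faces of $S^q$, $A_j$ is the affine map with $A_j(z_\ell)=\Phi(v_{j_\ell})$ and $\mathrm{DCD}(\Phi|_{f_j})$ is the ratio of the larger to smaller singular value of its linear part. $\mathcal F^{S^q}_K$ is the set of continuous maps $S\to\mathbb C$, affine on each face of $S^q$, mapping $\partial S$ bijectively onto $\partial T$ with $v_\ell\mapsto t_\ell$, which are orientation-preserving homeomorphisms onto $T$ with $\mathrm{DCD}(\Phi|_{f_j})\le K$ for all $f_j\in F^q$. Standing assumption: $S$ has been refined so that for every vertex $v_i$ and incident face $f_j$, $\lceil\gamma_i\rceil\theta_{i,j}<\pi/2$ and $\theta_{i,j}<60.4^\circ$, and every face incident to a vertex $v_i$ with $\gamma_i\neq1$ is isosceles with equal sides meeting at $v_i$. *)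

(* Defs.v *)
From HB Require Import structures.
From mathcomp Require Import all_boot all_order all_algebra.
From mathcomp Require Import all_classical all_reals all_analysis.
From mathcomp Require Import complex.
Set Implicit Arguments.
Unset Strict Implicit.
Unset Printing Implicit Defensive.
Import Order.TTheory GRing.Theory Num.Theory.
Import numFieldNormedType.Exports.
Local Open Scope ring_scope.
Local Open Scope classical_set_scope.
Local Open Scope complex_scope.

Section Euclid.
Variables (R : realType) (d : nat).
Local Notation pt := 'rV[R]_d.

Definition edot (u v : pt) : R := \sum_(k < d) u 0 k * v 0 k.
Definition enorm (u : pt) : R := Num.sqrt (edot u u).
Definition eangle (u v : pt) : R := acos (edot u v / (enorm u * enorm v)).

Definition conv_fam (I : finType) (A : {set I}) (P : I -> pt) : set pt :=
  [set x | exists l : I -> R, (forall k, 0 <= l k) /\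
     (forall k, k \notin A -> l k = 0) /\ \sum_(k in A) l k = 1 /\
     x = \sum_(k in A) l k *: P k].

Definition conv3 (a b c : pt) : set pt :=
  [set x | exists l1 l2 l3 : R, [/\ 0 <= l1, 0 <= l2, 0 <= l3,
     l1 + l2 + l3 = 1 & x = l1 *: a + l2 *: b + l3 *: c]].
Definition conv2 (a b : pt) : set pt :=
  [set x | exists l1 l2 : R, [/\ 0 <= l1, 0 <= l2, l1 + l2 = 1 &
     x = l1 *: a + l2 *: b]].

Definition midp (a b : pt) : pt := 2^-1 *: (a + b).
End Euclid.

Definition homeo_sets (U V : topologicalType) (A : set U) (B : set V)
    (f : U -> V) (g : V -> U) : Prop :=
  [/\ (forall x, A x -> B (f x)), (forall y, B y -> A (g y)),
      (forall x, A x -> g (f x) = x) /\ (forall y, B y -> f (g y) = y),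
      {within A, continuous f} & {within B, continuous g}].

Definition rel_interior (U : topologicalType) (S A : set U) : set U :=
  [set x | A x /\ nbhs x [set y | S y -> A y]].

Section Complex.
Variable R : realType.
Local Notation C := R[i].

(* complex differentiability: the derivative along 1 over the field R[i] *)
Definition conformal_on (U : set C^o) (g : C -> C) : Prop :=
  open U /\ forall z, U z ->
    derivable (g : C^o -> C^o) z 1 /\ 'D_1 (g : C^o -> C^o) z != 0.

Definition polarC (r t : R) : C := (r * cos t) +i* (r * sin t).

(* the corners t_l = e^{i (l-1) 2 pi / 3}, l = 1,2,3 (here l = 0,1,2) *)
Definition tcorner (l : nat) : C := polarC 1 (l%:R * (2 * pi / 3)).

Definition conv3C (a b c : C) : set C :=
  [set z | exists l1 l2 l3 : R, [/\ 0 <= l1, 0 <= l2, 0 <= l3,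
     l1 + l2 + l3 = 1 & z = l1%:C * a + l2%:C * b + l3%:C * c]].
Definition conv2C (a b : C) : set C :=
  [set z | exists l1 l2 : R, [/\ 0 <= l1, 0 <= l2, l1 + l2 = 1 &
     z = l1%:C * a + l2%:C * b]].

Definition Tri : set C^o := conv3C (tcorner 0) (tcorner 1) (tcorner 2).
Definition bdTri : set C :=
  conv2C (tcorner 0) (tcorner 1) `|` conv2C (tcorner 1) (tcorner 2)
  `|` conv2C (tcorner 2) (tcorner 0).

Definition closed_disk : set C^o := [set z | `|z| <= 1].

Definition c2v (z : C) : 'rV[R]_2 :=
  \row_(k < 2) (if k == ord0 then complex.Re z else complex.Im z).

Definition cross2 (u v : C) : R :=
  complex.Re u * complex.Im v - complex.Im u * complex.Re v.

Definition singular_value (L : 'M[R]_2) (s : R) : Prop :=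
  0 <= s /\ eigenvalue (L^T *m L) (s ^+ 2).

(* DCD(A) <= K, where A is the affine map sending z_l to w_l: the linear
   part L (acting on row vectors) has ratio largest/smallest singular
   value at most K. *)
Definition DCD_le (K : R) (z1 z2 z3 w1 w2 w3 : C) : Prop :=
  exists L : 'M[R]_2,
    [/\ c2v (z2 - z1) *m L = c2v (w2 - w1),
        c2v (z3 - z1) *m L = c2v (w3 - w1) &
        forall s1 s2, singular_value L s1 -> singular_value L s2 ->
          s1 <= K * s2].
End Complex.

(* A triangulated surface: nV vertices with positions pos, nF faces;
   face j has vertices face j 0, face j 1, face j 2 listed in the order
   given by a (coherent) orientation of the surface. *)
Record TriSurf (R : realType) (d : nat) := {
  nV : nat;
  nF : nat;
  pos : 'I_nV -> 'rV[R]_d;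
  face : 'I_nF -> 'I_3 -> 'I_nV }.

Definition succ3 (k : 'I_3) : 'I_3 := inord ((k.+1) %% 3).

Section Surface.
Variables (R : realType) (d : nat) (X : TriSurf R d).
Local Notation pt := 'rV[R]_d.
Local Notation V := 'I_(nV X).
Local Notation Fc := 'I_(nF X).
Local Notation P := (@pos _ _ X).
Local Notation F := (@face _ _ X).
Local Notation Tri := (@Tri R).
Local Notation bdTri := (@bdTri R).
Local Notation tcorner := (@tcorner R).

Definition faceset (j : Fc) : {set V} := [set F j k | k : 'I_3].
Definition conv_verts (A : {set V}) : set pt := conv_fam A P.
Definition cface (j : Fc) : set pt := conv_verts (faceset j).

Definition surf : set pt := \bigcup_(j in [set: Fc]) cface j.

Definition oedge (a b : V) : bool :=
  [exists j, exists k, (F j k == a) && (F j (succ3 k) == b)].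
Definition bedge (a b : V) : bool := oedge a b && ~~ oedge b a.
Definition bvertex (a : V) : bool := [exists b, bedge a b || bedge b a].
Definition bdsurf : set pt :=
  [set x | exists a b, bedge a b /\ conv2 (P a) (P b) x].

Definition triangulated_disk : Prop :=
  [/\
      [/\ injective P, (forall j, injective (F j)) &
          (forall j, let u := P (F j 1) - P (F j 0) in
                     let v := P (F j 2) - P (F j 0) in
                     0 < edot u u * edot v v - (edot u v) ^+ 2)],
      [/\ (forall a : V, exists j, a \in faceset j),
          (forall j j', j != j' -> faceset j != faceset j') &
          (forall j j', cface j `&` cface j' = conv_verts (faceset j :&: faceset j'))],
      (* coherent orientation: each oriented edge occurs in at most one face *)
      (forall j j' k k', F j k = F j' k' -> F j (succ3 k) = F j' (succ3 k') ->
          j = j') &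
      exists h : R[i]^o -> pt, exists g, homeo_sets (@closed_disk R) surf h g].

(* v1, v2, v3 are distinct boundary vertices, positively ordered along the
   positively oriented boundary (boundary traversed along bedge) *)
Definition marked_vertices (v1 v2 v3 : V) : Prop :=
  [/\ [&& v1 != v2, v2 != v3 & v1 != v3],
      [&& bvertex v1, bvertex v2 & bvertex v3] &
      (exists s, [/\ path bedge v1 s, last v1 s = v2 & v3 \notin s]) /\
      (exists s, [/\ path bedge v2 s, last v2 s = v3 & v1 \notin s])].

Definition theta_at (j : Fc) (k : 'I_3) : R :=
  eangle (P (F j (succ3 k)) - P (F j k)) (P (F j (succ3 (succ3 k))) - P (F j k)).

Definition theta (i : V) : R :=
  \sum_(j : Fc) \sum_(k : 'I_3 | F j k == i) theta_at j k.

Definition bigTheta (v1 v2 v3 i : V) : R :=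
  if (i == v1) || (i == v2) || (i == v3) then pi / 3
  else if bvertex i then pi else 2 * pi.

Definition gam (v1 v2 v3 i : V) : R := bigTheta v1 v2 v3 i / theta i.

Definition standing_assumption (v1 v2 v3 : V) : Prop :=
  forall (j : Fc) (k : 'I_3),
    let i := F j k in
    [/\ (Num.ceil (gam v1 v2 v3 i))%:~R * theta_at j k < pi / 2,
        theta_at j k < (604 / 10) * (pi / 180) &
        (gam v1 v2 v3 i != 1 ->
          enorm (P (F j (succ3 k)) - P i) =
          enorm (P (F j (succ3 (succ3 k))) - P i))].

Definition star (zeta : R) (i : V) : set pt :=
  [set x | exists j k, F j k = i /\
     conv3 (P i) (zeta *: P i + (1 - zeta) *: P (F j (succ3 k)))
                 (zeta *: P i + (1 - zeta) *: P (F j (succ3 (succ3 k)))) x].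
Definition Omega (zeta : R) (i : V) : set pt := rel_interior surf (star zeta i).

(* phi is the chart phi_i: faces around v_i are unfolded isometrically (and
   compatibly with the orientation) into the plane with v_i at 0, the face j
   occupying the angular sector [alpha j, alpha j + theta_{i,j}] starting from
   the edge v_i -> F j (k+1), then r e^{i t} |-> r^gamma e^{i gamma t}; the
   result is continuous on Omega_i. *)
Definition is_chart (v1 v2 v3 : V) (zeta : R) (i : V) (phi : pt -> R[i]^o) : Prop :=
  let g := gam v1 v2 v3 i in
  (exists alpha : Fc -> R, forall j k x, F j k = i ->
      Omega zeta i x -> cface j x ->
      phi x = polarC (enorm (x - P i) `^ g)
                 (g * (alpha j + eangle (x - P i) (P (F j (succ3 k)) - P i))))
  /\ {within Omega zeta i, continuous phi}.

Definition is_Psi (v1 v2 v3 : V) (zeta : R) (phi : V -> pt -> R[i]^o)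
    (Psi : pt -> R[i]^o) (Psiinv : R[i]^o -> pt) : Prop :=
  [/\ homeo_sets surf Tri Psi Psiinv,
      Psi (P v1) = tcorner 0, Psi (P v2) = tcorner 1, Psi (P v3) = tcorner 2 &
      forall i : V, exists g : R[i] -> R[i], exists U : set R[i]^o,
        [/\ conformal_on U g,
            (forall x, Omega zeta i x -> ~ bdsurf x -> U (phi i x)) &
            (forall x, Omega zeta i x -> ~ bdsurf x -> Psi x = g (phi i x))]].

(* 1-to-4 midpoint subdivision; faces of S^q are indexed by an original
   face j and a sequence p of length q of children indices in 'I_4. *)
Definition child (t : pt * pt * pt) (c : 'I_4) : pt * pt * pt :=
  let: (a, b, e) := t in
  match val c with
  | 0 => (a, midp a b, midp e a)
  | 1 => (midp a b, b, midp b e)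
  | 2 => (midp e a, midp b e, e)
  | _ => (midp b e, midp e a, midp a b)
  end.

Definition subface (j : Fc) (p : seq 'I_4) : pt * pt * pt :=
  foldl child (P (F j 0), P (F j 1), P (F j 2)) p.

Definition cface3 (t : pt * pt * pt) : set pt :=
  let: (a, b, e) := t in conv3 a b e.

Definition chart_assignment (zeta : R) (chart : Fc -> seq 'I_4 -> V) : Prop :=
  forall j p, size p = 2%N ->
    (exists k, F j k = chart j p) /\ cface3 (subface j p) `<=` Omega zeta (chart j p).

Definition in_FK (v1 v2 v3 : V) (phi : V -> pt -> R[i]^o)
    (chart : Fc -> seq 'I_4 -> V) (K : R) (q : nat) (Phi : pt -> R[i]^o) : Prop :=
  [/\
      (forall j p, size p = q -> let: (a, b, e) := subface j p in
         forall l1 l2 l3 : R, 0 <= l1 -> 0 <= l2 -> 0 <= l3 -> l1 + l2 + l3 = 1 ->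
           Phi (l1 *: a + l2 *: b + l3 *: e) =
             l1%:C * Phi a + l2%:C * Phi b + l3%:C * Phi e),
      (exists g, homeo_sets surf Tri Phi g),
      (forall j p, size p = q -> let: (a, b, e) := subface j p in
         0 < cross2 (Phi b - Phi a) (Phi e - Phi a)),
      [/\ Phi @` bdsurf = bdTri,
          Phi (P v1) = tcorner 0, Phi (P v2) = tcorner 1 & Phi (P v3) = tcorner 2] &
      (* DCD(Phi|_{f_j}) <= K, computed in the chart of the F^2-ancestor *)
      (forall j p, size p = q -> let: (a, b, e) := subface j p in
         let i := chart j (take 2 p) in
         DCD_le K (phi i a) (phi i b) (phi i e) (Phi a) (Phi b) (Phi e))].
End Surface.

Arguments marked_vertices {R d} X v1 v2 v3.
Arguments standing_assumption {R d} X v1 v2 v3.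
Arguments is_chart {R d} X v1 v2 v3 zeta i phi.
Arguments chart_assignment {R d} X zeta chart.
Arguments is_Psi {R d} X v1 v2 v3 zeta phi Psi Psiinv.
Arguments in_FK {R d} X v1 v2 v3 phi chart K q Phi.

(* Main.v *)
(* Put u = Phi^q - Psi on the vertices of S^q. On a small triangle, in a flat
   coordinate, the Dirichlet energy of u is comparable to |dz u|^2 + |dbar u|^2,
   and |dz u|^2 - |dbar u|^2 is a multiple of the oriented area of u. Since Phi^q
   and Psi map every boundary edge into the same side of T, the areas of u sum to
   zero over the surface. Off small stars of the vertices, dbar Psi is small by
   Cauchy estimates, Psi being holomorphic across the edges after reflection at the
   boundary, and dbar Phi^q is small because K_q tends to 1. Inside a star, the
   positivity of the area of Phi^q bounds the area of u by an integral along a chord,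
   which the oscillation of Psi near the vertex controls. Hence the energy of u off
   the stars tends to 0. By the length-area principle u is almost constant along many
   chords where the hat function of a vertex is constant. These chords cross each
   other and the dual graph is connected, so u is almost the same constant on all of
   them, and the three sides of T force it to be almost 0.

   Enclose a point x by such chords. The segment from Phi^q(x) to a corner of T, pulled
   back by Phi^q, crosses one of them, and the barycentric coordinate of that corner
   increases along the segment; so no barycentric coordinate of Phi^q(x) can be much
   larger than that of Psi(x), and both triples sum to 1. *)
Require Import Defs.
From HB Require Import structures.
From mathcomp Require Import all_boot all_order all_algebra.
From mathcomp Require Import all_classical all_reals all_analysis.
From mathcomp Require Import complex.
From mathcomp Require Import ring lra zify.
Import Order.TTheory GRing.Theory Num.Theory.
Import numFieldNormedType.Exports.
Local Open Scope ring_scope.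
Local Open Scope classical_set_scope.
Local Open Scope complex_scope.
Set Implicit Arguments.
Unset Strict Implicit.
Unset Printing Implicit Defensive.

(** * Complex differentiation and Cauchy estimates *)

(** No modulus of continuity of [Phi q] uniform in [q] is available; the uniform data are
    orientation, distortion and the side of [T] to which each boundary edge goes. Hence the
    comparison runs through a quadratic form on finite lattices, and pointwise control comes first
    on chords and is carried inside by topology. The vertices are the obstacle: there a chart is a
    power whose exponent need not be an integer, so no Taylor estimate is uniform near them. The
    corner triangles of generation [H] are cut off, with [H] fixed by the oscillation of [Psi]
    before [q] grows; most other constants may depend on [H]. The bound on the chord of a corner
    must not, and it does not because the Cauchy estimate is invariant under scaling. The Cauchy
    theory tolerates a horizontal line on which the function is only continuous, so that
    continuation across an edge or a side falls under the same estimate. Distortion measured in a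
    chart can be read in the flat coordinate because, away from its vertex, the chart is a
    holomorphic function of that coordinate. *)

Section ComplexModulus.
Variable R : realType.
Implicit Types z w : R[i].

(* The library norm of R[i] takes its values in R[i]; cn is the real modulus. *)
Definition cn z : R := Normc.normc z.

Lemma normcn z : `|z| = (cn z)%:C. Proof. by []. Qed.
Lemma cn_ge0 z : 0 <= cn z. Proof. by case: z => x y; exact: sqrtr_ge0. Qed.
Lemma cn0 : cn 0 = 0. Proof. exact: Normc.normc0. Qed.
Lemma cn_eq0 z : (cn z == 0) = (z == 0).
Proof. by apply/eqP/eqP => [/Normc.eq0_normc//|->]; rewrite cn0. Qed.
Lemma cn_gt0 z : (0 < cn z) = (z != 0).
Proof. by rewrite lt_def cn_ge0 andbT cn_eq0. Qed.
Lemma cnM z w : cn (z * w) = cn z * cn w. Proof. exact: Normc.normcM. Qed.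
Lemma cnV z : cn z^-1 = (cn z)^-1. Proof. exact: Normc.normcV. Qed.
Lemma cnD z w : cn (z + w) <= cn z + cn w. Proof. exact: le_normcD. Qed.
Lemma cnN z : cn (- z) = cn z. Proof. exact: (@normcN R). Qed.
Lemma cnB z w : cn (z - w) <= cn z + cn w.
Proof. by rewrite -[cn w]cnN; exact: cnD. Qed.
Lemma cnC z w : cn (z - w) = cn (w - z).
Proof. by rewrite -cnN opprB. Qed.
Lemma cn_tri w z v : cn (z - v) <= cn (z - w) + cn (w - v).
Proof. by rewrite (_ : z - v = (z - w) + (w - v)) ?cnD//; ring. Qed.
Lemma cnE z : cn z = Num.sqrt (complex.Re z ^+ 2 + complex.Im z ^+ 2).
Proof. by case: z. Qed.
Lemma cn2E z : cn z ^+ 2 = complex.Re z ^+ 2 + complex.Im z ^+ 2.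
Proof. by rewrite cnE sqr_sqrtr// addr_ge0 ?sqr_ge0. Qed.
Lemma cnR (x : R) : cn x%:C = `|x|.
Proof. by rewrite cnE /= expr0n /= addr0 sqrtr_sqr. Qed.
Lemma cni : cn 'i = 1 :> R.
Proof. by rewrite cnE /= expr0n /= add0r expr1n sqrtr1. Qed.
Lemma cn_Re z : `|complex.Re z| <= cn z.
Proof. by rewrite cnE -sqrtr_sqr ler_wsqrtr// lerDl sqr_ge0. Qed.
Lemma cn_Im z : `|complex.Im z| <= cn z.
Proof. by rewrite cnE -sqrtr_sqr ler_wsqrtr// lerDr sqr_ge0. Qed.
Lemma cn_le z : cn z <= `|complex.Re z| + `|complex.Im z|.
Proof.
rewrite cnE -[leRHS]ger0_norm ?addr_ge0// -sqrtr_sqr ler_wsqrtr//.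
rewrite sqrrD !real_normK ?num_real// -addrA lerD2l lerDr.
by rewrite mulrn_wge0// mulr_ge0.
Qed.
Lemma ReD z w : complex.Re (z + w) = complex.Re z + complex.Re w.
Proof. by case: z => a b; case: w. Qed.
Lemma ImD z w : complex.Im (z + w) = complex.Im z + complex.Im w.
Proof. by case: z => a b; case: w. Qed.
Lemma ReN z : complex.Re (- z) = - complex.Re z. Proof. by case: z. Qed.
Lemma ImN z : complex.Im (- z) = - complex.Im z. Proof. by case: z. Qed.
Lemma ReMc z w : complex.Re (z * w) =
  complex.Re z * complex.Re w - complex.Im z * complex.Im w.
Proof. by case: z => a b; case: w. Qed.
Lemma ImMc z w : complex.Im (z * w) =
  complex.Re z * complex.Im w + complex.Im z * complex.Re w.
Proof. by case: z => a b; case: w. Qed.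
Lemma ReIm_eq z w : complex.Re z = complex.Re w -> complex.Im z = complex.Im w -> z = w.
Proof. by case: z => a b; case: w => c d /= -> ->. Qed.
Lemma ReIm z : z = (complex.Re z)%:C + 'i * (complex.Im z)%:C.
Proof. by apply: ReIm_eq; rewrite ?(ReD, ImD, ReMc, ImMc) /=; ring. Qed.

Definition ccont (f : R[i] -> R[i]) := forall z e, 0 < e ->
  exists2 d, 0 < d & forall w, cn (w - z) < d -> cn (f w - f z) < e.
(** There is no quotient: the inequality also holds at [w = z], composes without case distinction,
    and, restricted to a face, gives one-sided derivatives. *)
Definition cder (f : R[i] -> R[i]) z D := forall e, 0 < e ->
  exists2 d, 0 < d & forall w, cn (w - z) < d ->
    cn (f w - f z - D * (w - z)) <= e * cn (w - z).
End ComplexModulus.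

Section ComplexIntegral.
Variable R : realType.
Local Notation mu := (@lebesgue_measure R).
Implicit Types (f g : R -> R[i]) (a b c : R).

Definition rcont f := forall x e, 0 < e ->
  exists2 d, 0 < d & forall y, `|y - x| < d -> cn (f y - f x) < e.

Definition ri (h : R -> R) a b : R := \int[mu]_(x in `[a, b]) h x.
Definition ci f a b : R[i] :=
  ri (fun x => complex.Re (f x)) a b +i* ri (fun x => complex.Im (f x)) a b.

Lemma rcont_Re f : rcont f -> continuous (fun x => complex.Re (f x)).
Proof.
move=> cf x; apply/cvgrPdist_lt => /= e e0; have [d d0 H] := cf x e e0.
apply/nbhs_ballP; exists d => // y; rewrite /ball /= => xy.
by rewrite distrC -ReN -ReD (le_lt_trans (cn_Re _))// H// distrC.
Qed.
Lemma rcont_Im f : rcont f -> continuous (fun x => complex.Im (f x)).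
Proof.
move=> cf x; apply/cvgrPdist_lt => /= e e0; have [d d0 H] := cf x e e0.
apply/nbhs_ballP; exists d => // y; rewrite /ball /= => xy.
by rewrite distrC -ImN -ImD (le_lt_trans (cn_Im _))// H// distrC.
Qed.

Lemma ri_int (h : R -> R) a b : continuous h -> mu.-integrable `[a, b] (EFin \o h).
Proof.
move=> ch; apply: continuous_compact_integrable; first exact: segment_compact.
exact: continuous_subspaceT.
Qed.

Lemma ri_add (h : R -> R) a b c : continuous h -> a <= b -> b <= c ->
  ri h a c = ri h a b + ri h b c.
Proof.
move=> ch ab bc; rewrite /ri.
have := @Rintegral_itvB R h (BLeft a) (BRight c) b (ri_int a c ch).
rewrite !bnd_simp => /(_ ab bc) H; apply/eqP; rewrite -subr_eq0.
rewrite opprD addrA subr_eq0; apply/eqP; rewrite H.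
rewrite Rintegral_itv_obnd_cbnd//.
apply: integrableS (ri_int b c ch) => //.
by apply: subset_itv; rewrite ?bnd_simp.
Qed.

Lemma ri_lin (g h : R -> R) k l a b : continuous g -> continuous h ->
  ri (fun x => k * g x + l * h x) a b = k * ri g a b + l * ri h a b.
Proof.
move=> cg ch; rewrite /ri RintegralD//; last 2 first.
- by apply: ri_int => x; apply: cvgM; [exact: cvg_cst|exact: cg].
- by apply: ri_int => x; apply: cvgM; [exact: cvg_cst|exact: ch].
by rewrite !RintegralZl//; exact: ri_int.
Qed.

Lemma ri_bound (h : R -> R) a b M : a <= b -> continuous h ->
  (forall x, a <= x <= b -> `|h x| <= M) -> `|ri h a b| <= M * (b - a).
Proof.
move=> ab ch H; rewrite /ri; apply: (le_trans (le_normr_Rintegral _ _)) => //.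
  exact: ri_int.
have -> : M * (b - a) = \int[mu]_(x in `[a, b]) M.
  rewrite Rintegral_cst//= lebesgue_measure_itv/= lte_fin; congr (_ * _).
  by case: ltP => //= ba; rewrite (@le_anti _ _ a b) ?ab// subrr.
apply: le_Rintegral => //=.
- by apply: ri_int => x; apply: cvg_norm; exact: ch.
- by apply: ri_int => x; exact: cvg_cst.
Qed.

Lemma ri_prim (H h : R -> R) a b : a <= b -> continuous h ->
  (forall x : R, is_derive x (1 : R) H (h x)) -> ri h a b = H b - H a.
Proof.
rewrite le_eqVlt => /predU1P[->|ab] ch dH.
  by rewrite subrr /ri set_itv1 Rintegral_set1.
have cH x : {for x, continuous H}.
  by apply: differentiable_continuous; apply/derivable1_diffP; have [] := dH x.
rewrite /ri /Rintegral (@continuous_FTC2 _ h H)//.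
- exact: continuous_subspaceT.
- split.
  + by move=> x _; have [] := dH x.
  + by apply: cvg_at_right_filter; exact: cH.
  + by apply: cvg_at_left_filter; exact: cH.
- by move=> x _; rewrite derive1E; have [_] := dH x.
Qed.

Lemma ci_add f a b c : rcont f -> a <= b -> b <= c ->
  ci f a c = ci f a b + ci f b c.
Proof.
move=> cf ab bc; rewrite /ci.
by rewrite (ri_add (rcont_Re cf) ab bc) (ri_add (rcont_Im cf) ab bc).
Qed.

Lemma ci_lin f g k l a b : rcont f -> rcont g ->
  ci (fun x => k * f x + l * g x) a b = k * ci f a b + l * ci g a b.
Proof.
move=> cf cg.
have cRf := rcont_Re cf; have cIf := rcont_Im cf.
have cRg := rcont_Re cg; have cIg := rcont_Im cg.
have lc (p q : R) (u v : R -> R) : continuous u -> continuous v ->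
    continuous (fun x => p * u x + q * v x).
  move=> cu cv x; apply: cvgD; apply: cvgM; by [exact: cvg_cst|exact: cu|exact: cv].
apply: ReIm_eq; rewrite ?(ReD, ImD, ReMc, ImMc) /=.
- under [X in ri X]eq_fun => x.
    rewrite ?(ReD, ImD, ReMc, ImMc).
    have -> : complex.Re k * complex.Re (f x) - complex.Im k * complex.Im (f x) +
      (complex.Re l * complex.Re (g x) - complex.Im l * complex.Im (g x)) =
      1 * (complex.Re k * complex.Re (f x) + - complex.Im k * complex.Im (f x)) +
      1 * (complex.Re l * complex.Re (g x) + - complex.Im l * complex.Im (g x)) by ring.
    over.
  by rewrite !ri_lin//; try exact: lc; ring.
- under [X in ri X]eq_fun => x.
    rewrite ?(ReD, ImD, ReMc, ImMc).
    have -> : complex.Re k * complex.Im (f x) + complex.Im k * complex.Re (f x) +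
      (complex.Re l * complex.Im (g x) + complex.Im l * complex.Re (g x)) =
      1 * (complex.Re k * complex.Im (f x) + complex.Im k * complex.Re (f x)) +
      1 * (complex.Re l * complex.Im (g x) + complex.Im l * complex.Re (g x)) by ring.
    over.
  by rewrite !ri_lin//; try exact: lc; ring.
Qed.

(** The factor 2 comes from bounding the real and the imaginary part separately. *)
Lemma ci_bound f a b M : a <= b -> rcont f ->
  (forall x, a <= x <= b -> cn (f x) <= M) -> cn (ci f a b) <= 2 * M * (b - a).
Proof.
move=> ab cf H; apply: (le_trans (cn_le _)) => /=.
have := ri_bound ab (rcont_Re cf) (fun x h => le_trans (cn_Re _) (H x h)).
have := ri_bound ab (rcont_Im cf) (fun x h => le_trans (cn_Im _) (H x h)).
lra.
Qed.

Lemma eq_ci f g a b : (forall x, f x = g x) -> ci f a b = ci g a b.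
Proof. by move=> /funext ->. Qed.

Lemma rcont_cst (k : R[i]) : rcont (fun=> k).
Proof. by move=> x e e0; exists 1 => // y _; rewrite subrr cn0. Qed.

Lemma ci_cst (k : R[i]) a b : a <= b -> ci (fun=> k) a b = k * (b - a)%:C.
Proof.
move=> ab; have H : fine (mu `[a, b]) = b - a.
  rewrite lebesgue_measure_itv/= lte_fin.
  by case: ltP => //= ba; rewrite (@le_anti _ _ a b) ?ab// subrr.
apply: ReIm_eq; rewrite ?(ReMc, ImMc) /= /ri Rintegral_cst//= [X in _ * X]H; ring.
Qed.

Lemma rcont_id : rcont (fun x => x%:C).
Proof.
move=> x e e0; exists e => // y h.
by rewrite -[_ - _]/((y - x) +i* (0 - 0)) subrr -[_ +i* 0]/((y - x)%:C) cnR.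
Qed.

Lemma ci_id a b : a <= b -> ci (fun x => x%:C) a b = ((b ^+ 2 - a ^+ 2) / 2)%:C.
Proof.
move=> ab; rewrite /ci /=; apply: ReIm_eq => /=; last first.
  by rewrite /ri Rintegral_cst//= mul0r.
have Hd (x : R) : is_derive x (1 : R) (fun x : R => x ^+ 2 / 2) x.
  have -> : (fun x : R => x ^+ 2 / 2) = (2^-1 \*: (fun x : R => x ^+ 2)).
    by apply/funext => y /=; rewrite mulrC.
  apply: is_derive_eq.
  by rewrite /= scaler1 /GRing.scale /=; field.
have cid : continuous (fun x : R => x) by move=> x; exact: cvg_id.
by rewrite (ri_prim ab cid Hd); field.
Qed.
End ComplexIntegral.

(** * Goursat's theorem on rectangles *)

Section Goursat.
Variable R : realType.
Implicit Types (f g : R[i] -> R[i]).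

Lemma nested_interval (a b : nat -> R) :
  (forall n, a n <= a n.+1) -> (forall n, b n.+1 <= b n) -> (forall n, a n <= b n) ->
  exists c, forall n, a n <= c <= b n.
Proof.
move=> ha hb hab.
have am n m : (n <= m)%N -> a n <= a m.
  by apply: (@homo_leq _ a (fun x y => x <= y)) => // y x z; exact: le_trans.
have bm n m : (n <= m)%N -> b m <= b n.
  by apply: (@homo_leq _ b (fun x y => y <= x)) => // y x z /[swap]; exact: le_trans.
have abm n m : a n <= b m.
  apply: (le_trans (am n (maxn n m) (leq_maxl _ _))).
  by apply: (le_trans (hab _)); exact: bm (leq_maxr _ _).
exists (sup (range a)) => n; apply/andP; split.
  apply: ub_le_sup; last by exists n.
  by exists (b 0%N) => _ [k _ <-].
by apply: ge_sup; [exists (a 0%N); exists 0%N|move=> _ [k _ <-]].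
Qed.

Lemma small_pow (c d : R) : 0 < d -> exists N, forall n, (N <= n)%N -> c / 2 ^+ n < d.
Proof.
move=> d0; have [k hk] : exists k : nat, c / d < k%:R.
  by exists (Num.trunc (c / d)).+1; exact: truncnS_gt.
exists k => n kn; rewrite ltr_pdivrMr ?exprn_gt0//.
rewrite ltr_pdivrMr// in hk; apply: (lt_le_trans hk).
rewrite mulrC ler_pM2l// (@le_trans _ _ n%:R) ?ler_nat//.
by rewrite -natrX ler_nat ltnW// ltn_expl.
Qed.

(** By contraposition: a bad rectangle has a bad quarter, and nested bad quarters shrink to a point
    around which all small rectangles are good. [P n x y] speaks of the rectangle of generation [n]
    with lower left corner at [x], [y]. *)
Lemma bisection (w h : R) (P : nat -> R -> R -> Prop) (x0 y0 : R) : 0 <= w -> 0 <= h ->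
  (forall n (x y : R), P n.+1 x y -> P n.+1 (x + w / 2 ^+ n.+1) y ->
     P n.+1 x (y + h / 2 ^+ n.+1) -> P n.+1 (x + w / 2 ^+ n.+1) (y + h / 2 ^+ n.+1) ->
     P n x y) ->
  (forall x y : R, x0 <= x <= x0 + w -> y0 <= y <= y0 + h -> exists N, forall n, (N <= n)%N ->
     forall x' y' : R, x' <= x <= x' + w / 2 ^+ n -> y' <= y <= y' + h / 2 ^+ n ->
       P n x' y') ->
  P 0%N x0 y0.
Proof.
move=> w0 h0 step loc; apply: contrapT => nP0.
have ex n (p : R * R) : exists b : bool * bool, ~ P n p.1 p.2 ->
    ~ P n.+1 (p.1 + b.1%:R * (w / 2 ^+ n.+1)) (p.2 + b.2%:R * (h / 2 ^+ n.+1)).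
  apply: contrapT => /forallNP H.
  have H' (b : bool * bool) : ~ P n p.1 p.2 /\
    P n.+1 (p.1 + b.1%:R * (w / 2 ^+ n.+1)) (p.2 + b.2%:R * (h / 2 ^+ n.+1)).
    by have /not_implyP[? /contrapT ?] := H b; split.
  have [nP _] := H' (true, true); apply: nP; apply: step.
  - by have [_ /=] := H' (false, false); rewrite !mul0r !addr0.
  - by have [_ /=] := H' (true, false); rewrite !mul0r !addr0 !mul1r.
  - by have [_ /=] := H' (false, true); rewrite !mul0r !addr0 !mul1r.
  - by have [_ /=] := H' (true, true); rewrite !mul1r.
have {}ex np : exists b : bool * bool, ~ P np.1 np.2.1 np.2.2 ->
    ~ P np.1.+1 (np.2.1 + b.1%:R * (w / 2 ^+ np.1.+1)) (np.2.2 + b.2%:R * (h / 2 ^+ np.1.+1)).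
  exact: (ex np.1 np.2).
have [c hc] := choice ex.
pose S := fix S n : R * R := if n is m.+1 then
  ((S m).1 + (c (m, S m)).1%:R * (w / 2 ^+ m.+1),
   (S m).2 + (c (m, S m)).2%:R * (h / 2 ^+ m.+1)) else (x0, y0).
have nP n : ~ P n (S n).1 (S n).2.
  by elim: n => // n IH; exact: (hc (n, S n) IH).
have half (u : R) n : u / 2 ^+ n = u / 2 ^+ n.+1 + u / 2 ^+ n.+1.
  by rewrite exprS invfM mulrA; field; rewrite expf_neq0.
have pow0 (u : R) n : 0 <= u -> 0 <= u / 2 ^+ n by move=> u0; rewrite divr_ge0// exprn_ge0.
have mono (u : R) (s : nat -> R) (bs : nat -> bool) : 0 <= u ->
    (forall n, s n.+1 = s n + (bs n)%:R * (u / 2 ^+ n.+1)) ->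
    exists z, forall n, s n <= z <= s n + u / 2 ^+ n.
  move=> u0 hs; apply: nested_interval => n.
  - by rewrite hs lerDl; case: (bs n); rewrite ?mul1r ?mul0r// pow0.
  - rewrite hs (half u n); have := pow0 u n.+1 u0.
    by case: (bs n); rewrite ?mul1r ?mul0r; lra.
  - by rewrite lerDl pow0.
have [x hx] := mono w (fun n => (S n).1) (fun n => (c (n, S n)).1) w0 (fun n => erefl).
have [y hy] := mono h (fun n => (S n).2) (fun n => (c (n, S n)).2) h0 (fun n => erefl).
have := hx 0%N; have := hy 0%N; rewrite /= expr0 !divr1 => hy0 hx0.
have [N HN] := loc x y hx0 hy0.
exact: (nP N (HN N (leqnn _) _ _ (hx N) (hy N))).
Qed.

(** The counterclockwise integral of [f dz] along the boundary of a rectangle; on the vertical sides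
    dz is ['i] times dy. *)
Definition RI f x0 x1 y0 y1 : R[i] :=
  ci (fun x => f (x +i* y0)) x0 x1 - ci (fun x => f (x +i* y1)) x0 x1 +
  'i * (ci (fun y => f (x1 +i* y)) y0 y1 - ci (fun y => f (x0 +i* y)) y0 y1).

Lemma ccont_h f y : ccont f -> rcont (fun x => f (x +i* y)).
Proof.
move=> cf x e e0; have [d d0 H] := cf (x +i* y) e e0; exists d => // x' h.
apply: H; rewrite -[_ - _]/((x' - x) +i* (y - y)) subrr.
by rewrite -[_ +i* 0]/((x' - x)%:C) cnR.
Qed.
Lemma ccont_v f x : ccont f -> rcont (fun y => f (x +i* y)).
Proof.
move=> cf y e e0; have [d d0 H] := cf (x +i* y) e e0; exists d => // y' h.
apply: H; rewrite -[_ - _]/((x - x) +i* (y' - y)) subrr cnE /=.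
by rewrite expr0n /= add0r sqrtr_sqr.
Qed.

Lemma RI_splitx f x0 xm x1 y0 y1 : ccont f -> x0 <= xm -> xm <= x1 ->
  RI f x0 x1 y0 y1 = RI f x0 xm y0 y1 + RI f xm x1 y0 y1.
Proof.
move=> cf h0 h1; rewrite /RI (ci_add (ccont_h y0 cf) h0 h1) (ci_add (ccont_h y1 cf) h0 h1).
ring.
Qed.
Lemma RI_splity f x0 x1 y0 ym y1 : ccont f -> y0 <= ym -> ym <= y1 ->
  RI f x0 x1 y0 y1 = RI f x0 x1 y0 ym + RI f x0 x1 ym y1.
Proof.
move=> cf h0 h1; rewrite /RI (ci_add (ccont_v x0 cf) h0 h1) (ci_add (ccont_v x1 cf) h0 h1).
ring.
Qed.

Lemma ci_affine (p q : R[i]) (a b : R) : a <= b ->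
  ci (fun x => p + q * x%:C) a b = p * (b - a)%:C + q * ((b ^+ 2 - a ^+ 2) / 2)%:C.
Proof.
move=> ab.
transitivity (ci (fun x : R => p * 1 + q * x%:C) a b).
  by apply: eq_ci => x; rewrite mulr1.
rewrite (@ci_lin _ (fun=> 1) (fun x => x%:C)); [|exact: rcont_cst|exact: rcont_id].
by rewrite ci_cst// ci_id// mul1r.
Qed.

Lemma RI_affine (p q : R[i]) x0 x1 y0 y1 : x0 <= x1 -> y0 <= y1 ->
  RI (fun z => p + q * z) x0 x1 y0 y1 = 0.
Proof.
move=> hx hy.
have H y : ci (fun x => p + q * (x +i* y)) x0 x1 =
   (p + q * ('i * y%:C)) * (x1 - x0)%:C + q * ((x1 ^+ 2 - x0 ^+ 2) / 2)%:C.
  rewrite -ci_affine//; apply: eq_ci => x.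
  rewrite [x +i* y]ReIm /=; ring.
have V x : ci (fun y => p + q * (x +i* y)) y0 y1 =
   (p + q * x%:C) * (y1 - y0)%:C + (q * 'i) * ((y1 ^+ 2 - y0 ^+ 2) / 2)%:C.
  rewrite -ci_affine//; apply: eq_ci => y.
  rewrite [x +i* y]ReIm /=; ring.
rewrite /RI !H !V.
rewrite !rmorphB /=; ring.
Qed.

Lemma rcont_lin (k l : R[i]) (f g : R -> R[i]) : rcont f -> rcont g ->
  rcont (fun x => k * f x + l * g x).
Proof.
move=> cf cg x e e0.
have K0 : 0 < cn k + cn l + 1 by rewrite ltr_wpDl// addr_ge0// cn_ge0.
have e1 : 0 < e / (cn k + cn l + 1) by rewrite divr_gt0.
have [d d0 H] := cf x _ e1; have [d' d'0 H'] := cg x _ e1.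
exists (Num.min d d'); first by rewrite lt_min d0.
move=> y; rewrite lt_min => /andP[/H h /H' h'].
have -> : k * f y + l * g y - (k * f x + l * g x) = k * (f y - f x) + l * (g y - g x) by ring.
apply: (le_lt_trans (cnD _ _)); rewrite !cnM.
apply: (@le_lt_trans _ _ ((cn k + cn l) * (e / (cn k + cn l + 1)))).
  by rewrite mulrDl; apply: lerD; apply: ler_wpM2l; rewrite ?cn_ge0 ?ltW//.
rewrite mulrA ltr_pdivrMr// mulrC ltr_pM2l//; lra.
Qed.

Lemma ccont_lin (k l : R[i]) f g : ccont f -> ccont g ->
  ccont (fun x => k * f x + l * g x).
Proof.
move=> cf cg x e e0.
have K0 : 0 < cn k + cn l + 1 by rewrite ltr_wpDl// addr_ge0// cn_ge0.
have e1 : 0 < e / (cn k + cn l + 1) by rewrite divr_gt0.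
have [d d0 H] := cf x _ e1; have [d' d'0 H'] := cg x _ e1.
exists (Num.min d d'); first by rewrite lt_min d0.
move=> y; rewrite lt_min => /andP[/H h /H' h'].
have -> : k * f y + l * g y - (k * f x + l * g x) = k * (f y - f x) + l * (g y - g x) by ring.
apply: (le_lt_trans (cnD _ _)); rewrite !cnM.
apply: (@le_lt_trans _ _ ((cn k + cn l) * (e / (cn k + cn l + 1)))).
  by rewrite mulrDl; apply: lerD; apply: ler_wpM2l; rewrite ?cn_ge0 ?ltW//.
rewrite mulrA ltr_pdivrMr// mulrC ltr_pM2l//; lra.
Qed.

Lemma ccont_cst (k : R[i]) : ccont (fun=> k).
Proof. by move=> x e e0; exists 1 => // y _; rewrite subrr cn0. Qed.
Lemma ccont_id : ccont (fun z : R[i] => z).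
Proof. by move=> x e e0; exists e. Qed.

Lemma RI_lin (k l : R[i]) f g x0 x1 y0 y1 : ccont f -> ccont g ->
  RI (fun z => k * f z + l * g z) x0 x1 y0 y1 = k * RI f x0 x1 y0 y1 + l * RI g x0 x1 y0 y1.
Proof.
move=> cf cg; rewrite /RI.
rewrite (ci_lin k l _ _ (ccont_h y0 cf) (ccont_h y0 cg)).
rewrite (ci_lin k l _ _ (ccont_h y1 cf) (ccont_h y1 cg)).
rewrite (ci_lin k l _ _ (ccont_v x0 cf) (ccont_v x0 cg)).
rewrite (ci_lin k l _ _ (ccont_v x1 cf) (ccont_v x1 cg)).
ring.
Qed.

Lemma RI_bound f x0 x1 y0 y1 M : ccont f -> x0 <= x1 -> y0 <= y1 ->
  (forall x y, x0 <= x <= x1 -> y0 <= y <= y1 -> cn (f (x +i* y)) <= M) ->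
  cn (RI f x0 x1 y0 y1) <= 4 * M * ((x1 - x0) + (y1 - y0)).
Proof.
move=> cf hx hy H.
have B0 := ci_bound hx (ccont_h y0 cf) (fun x h => H x y0 h (introT andP (conj (lexx _) hy))).
have B1 := ci_bound hx (ccont_h y1 cf) (fun x h => H x y1 h (introT andP (conj hy (lexx _)))).
have B2 := ci_bound hy (ccont_v x0 cf) (fun y h => H x0 y (introT andP (conj (lexx _) hx)) h).
have B3 := ci_bound hy (ccont_v x1 cf) (fun y h => H x1 y (introT andP (conj hx (lexx _))) h).
rewrite /RI; apply: (le_trans (cnD _ _)); rewrite cnM cni mul1r.
apply: (le_trans (lerD (cnB _ _) (cnB _ _))); lra.
Qed.

(** Lets the first-order Taylor polynomial at a point be removed before the trivial bound [RI_bound]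
    is applied. *)
Lemma RI_sub_affine f (p q : R[i]) x0 x1 y0 y1 : ccont f -> x0 <= x1 -> y0 <= y1 ->
  RI (fun z => f z - (p + q * z)) x0 x1 y0 y1 = RI f x0 x1 y0 y1 /\
  ccont (fun z => f z - (p + q * z)).
Proof.
move=> cf hx hy.
have ca : ccont (fun z => p + q * z).
  have -> : (fun z : R[i] => p + q * z) = (fun z => 1 * (fun=> p) z + q * (fun z => z) z).
    by apply/funext => z; rewrite mul1r.
  by apply: ccont_lin; [exact: ccont_cst|exact: ccont_id].
have -> : (fun z => f z - (p + q * z)) = (fun z => 1 * f z + (-1) * (fun z => p + q * z) z).
  by apply/funext => z; rewrite mul1r mulN1r.
split; last exact: ccont_lin.
by rewrite RI_lin// RI_affine// mulr0 addr0 mul1r.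
Qed.

End Goursat.

Section Goursat2.
Variable R : realType.
Implicit Types (f g : R[i] -> R[i]).
(* The error budget is proportional to (w + h)^2, as in Goursat's argument, plus
   a term proportional to the length of the side lying on the exceptional line;
   both are additive under bisection. *)
Lemma goursat_side f (x0 y0 w h l : R) : ccont f -> 0 < w -> 0 < h ->
  (l <= y0 \/ y0 + h <= l) ->
  (forall z : R[i], x0 <= complex.Re z <= x0 + w -> y0 <= complex.Im z <= y0 + h ->
     complex.Im z != l -> exists D, cder f z D) ->
  RI f x0 (x0 + w) y0 (y0 + h) = 0.
Proof.
move=> cf w0 h0 side df; apply/eqP; rewrite -cn_eq0; apply/eqP/le_anti.
rewrite cn_ge0 andbT; apply/ler_addgt0Pr => /= e0 e0_gt0; rewrite add0r.
(* The budget of the whole rectangle, with both horizontal sides counted as exceptional. *)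
pose K : R := (w + h) ^+ 2 + w * 2.
have K0 : 0 < K by rewrite /K; nra.
pose e : R := e0 / K; have e_gt0 : 0 < e by rewrite divr_gt0.
pose P n (x y : R) := x0 <= x -> x + w / 2 ^+ n <= x0 + w -> y0 <= y -> y + h / 2 ^+ n <= y0 + h ->
  cn (RI f x (x + w / 2 ^+ n) y (y + h / 2 ^+ n)) <=
  e * (((w + h) / 2 ^+ n) ^+ 2 +
       w / 2 ^+ n * ((y == l)%:R + (y + h / 2 ^+ n == l)%:R)).
have half (u : R) n : u / 2 ^+ n = u / 2 ^+ n.+1 + u / 2 ^+ n.+1.
  by rewrite exprS invfM mulrA; field; rewrite expf_neq0.
have pow0 (u : R) n : 0 < u -> 0 < u / 2 ^+ n by move=> u0; rewrite divr_gt0// exprn_gt0.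
have : P 0%N x0 y0.
  apply: (bisection (w := w) (h := h)); [exact: ltW|exact: ltW| |].
  - move=> n /= x y P1 P2 P3 P4 hx hx1 hy hy1.
    have wn := pow0 w n.+1 w0; have hn := pow0 h n.+1 h0.
    (* The line [Im z = l] does not cut the open rectangle, so the bisecting side never lies on it
       and the exceptional terms of the quarters add up to that of the parent. *)
    have ym : (y + h / 2 ^+ n.+1 == l) = false.
      apply/negbTE/eqP => yl; rewrite (half h n) in hy1.
      by case: side => side; lra.
    rewrite (half w n) (half h n) in hx1 hy1 *.
    move: P1 P2 P3 P4; rewrite /P ym (_ : (false : nat)%:R = 0 :> R)//.
    rewrite (half (w + h) n).
    set a := w / 2 ^+ n.+1 in wn hx1 *; set b := h / 2 ^+ n.+1 in hn hy1 ym *.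
    set ab := (w + h) / 2 ^+ n.+1.
    rewrite -!(addrA x) -!(addrA y).
    have xa : x <= x + a by clear -wn; lra.
    have xa' : x + a <= x + (a + a) by clear -wn; lra.
    have yb : y <= y + b by clear -hn; lra.
    have yb' : y + b <= y + (b + b) by clear -hn; lra.
    move=> P1 P2 P3 P4.
    have {}P1 := P1 hx (le_trans xa' hx1) hy (le_trans yb' hy1).
    have {}P2 := P2 (le_trans hx xa) hx1 hy (le_trans yb' hy1).
    have {}P3 := P3 hx (le_trans xa' hx1) (le_trans hy yb) hy1.
    have {}P4 := P4 (le_trans hx xa) hx1 (le_trans hy yb) hy1.
    rewrite (RI_splitx _ _ cf xa xa').
    rewrite !(RI_splity _ _ cf yb yb').
    apply: (le_trans (cnD _ _)); apply: (le_trans (lerD (cnD _ _) (cnD _ _))).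
    apply: (le_trans (lerD (lerD P1 P3) (lerD P2 P4))).
    by rewrite le_eqVlt; apply/orP; left; apply/eqP; ring.
  - move=> /= x y hx hy.
    have near_pt n (x' y' r : R) : (w + h) / 2 ^+ n < r -> x' <= x <= x' + w / 2 ^+ n ->
        y' <= y <= y' + h / 2 ^+ n -> forall u v : R, x' <= u <= x' + w / 2 ^+ n ->
        y' <= v <= y' + h / 2 ^+ n ->
        cn ((u +i* v) - (x +i* y)) <= (w + h) / 2 ^+ n /\ cn ((u +i* v) - (x +i* y)) < r.
      move=> hr hx' hy' u v hu hv.
      have H : cn ((u +i* v) - (x +i* y)) <= (w + h) / 2 ^+ n.
        apply: (le_trans (cn_le _)) => /=; rewrite mulrDl.
        by apply: lerD; rewrite ler_norml; apply/andP; split; lra.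
      by split=> //; exact: le_lt_trans hr.
    have xlt (u v : R) : 0 < v -> u < u + v by move=> v0; rewrite ltrDl.
    have [yl|yl] := eqVneq y l.
    (* At a point of the line only continuity is available; [eta] makes the trivial bound equal to
       [e] times the width of the small rectangle. *)
    + pose eta : R := e * w / (4 * (w + h)).
      have eta0 : 0 < eta by apply: divr_gt0; [exact: mulr_gt0|rewrite mulr_gt0// addr_gt0].
      have [d d0 H] := cf (x +i* y) eta eta0.
      have [N HN] := small_pow (w + h) d0.
      exists N => n /HN Hn x' y' hx' hy' i1 i2 i3 i4.
      have wn := pow0 w n w0; have hn := pow0 h n h0.
      have [E cE] := @RI_sub_affine R f (f (x +i* y)) 0 x' (x' + w / 2 ^+ n) y' (y' + h / 2 ^+ n)
         cf (ltW (xlt _ _ wn)) (ltW (xlt _ _ hn)).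
      rewrite -E; apply: (le_trans (@RI_bound R _ _ _ _ _ eta cE (ltW (xlt _ _ wn)) (ltW (xlt _ _ hn)) _)).
        move=> u v hu hv; rewrite mul0r addr0; apply/ltW/H.
        by have [] := near_pt n x' y' d Hn hx' hy' u v hu hv.
      have -> : x' + w / 2 ^+ n - x' + (y' + h / 2 ^+ n - y') = (w + h) / 2 ^+ n.
        by rewrite mulrDl; ring.
      have -> : 4 * eta * ((w + h) / 2 ^+ n) = e * (w / 2 ^+ n).
        by rewrite /eta; field; rewrite expf_neq0//= gt_eqF//; lra.
      rewrite ler_pM2l//; apply: ler_wpDl; first exact: sqr_ge0.
      apply: ler_peMr; first exact: ltW.
      (* The small rectangle lies on one side of the line, so it meets the line only in a horizontal
         side. *)
      suff : (y' == l) || (y' + h / 2 ^+ n == l).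
        move=> yy; have : (1 <= (y' == l)%R + (y' + h / 2 ^+ n == l)%R)%N.
          by move: yy; case: (y' == l); case: (_ == l).
        rewrite -(ler_nat R) natrD => yy1; exact: yy1.
      move/andP: hy' => [hy'1 hy'2]; apply/orP; case: side => side; [left|right]; apply/eqP/le_anti/andP; split; lra.
    + have [|||D HD] := df (x +i* y) => //.
      have [d d0 H] := HD (e / 4) (divr_gt0 e_gt0 (ltr0n _ 4)).
      have [N HN] := small_pow (w + h) d0.
      exists N => n /HN Hn x' y' hx' hy' i1 i2 i3 i4.
      have wn := pow0 w n w0; have hn := pow0 h n h0.
      have [E cE] := @RI_sub_affine R f (f (x +i* y) - D * (x +i* y)) D x' (x' + w / 2 ^+ n)
         y' (y' + h / 2 ^+ n) cf (ltW (xlt _ _ wn)) (ltW (xlt _ _ hn)).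
      rewrite -E; apply: (le_trans (@RI_bound R _ _ _ _ _ (e / 4 * ((w + h) / 2 ^+ n)) cE (ltW (xlt _ _ wn)) (ltW (xlt _ _ hn)) _)).
        move=> u v hu hv; have [n1 n2] := near_pt n x' y' d Hn hx' hy' u v hu hv.
        have := H _ n2; rewrite (_ : f (u +i* v) - _ - _ = f (u +i* v) - (f (x +i* y) - D * (x +i* y) + D * (u +i* v))).
          by move=> h1; apply: (le_trans h1); rewrite ler_pM2l//; lra.
        by ring.
      have -> : x' + w / 2 ^+ n - x' + (y' + h / 2 ^+ n - y') = (w + h) / 2 ^+ n.
        by rewrite mulrDl; ring.
      have -> : 4 * (e / 4 * ((w + h) / 2 ^+ n)) * ((w + h) / 2 ^+ n) = e * ((w + h) / 2 ^+ n) ^+ 2.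
        by field; rewrite expf_neq0.
      rewrite ler_pM2l// lerDl; apply: mulr_ge0; first exact: ltW.
      by rewrite addr_ge0 ?ler0n.
rewrite /P expr0 !divr1 => /(_ (lexx _) (lexx _) (lexx _) (lexx _)) H.
apply: (le_trans H).
apply: (@le_trans _ _ (e * K)); last by rewrite /e divfK// gt_eqF.
rewrite ler_pM2l// /K lerD2l ler_pM2l//.
have bb (b : bool) : b%:R <= 1 :> R by case: b; [exact: lexx|exact: ler01].
by apply: (le_trans (lerD (bb _) (bb _))).
Qed.

Lemma ci_pt (f : R -> R[i]) a : ci f a a = 0.
Proof. by rewrite /ci /ri set_itv1 !Rintegral_set1. Qed.

(** An exceptional line through the interior cuts the rectangle into two rectangles that have it as
    a side. Degenerate rectangles are treated apart. *)
Lemma goursat f (x0 x1 y0 y1 l : R) : ccont f -> x0 <= x1 -> y0 <= y1 ->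
  (forall z : R[i], x0 <= complex.Re z <= x1 -> y0 <= complex.Im z <= y1 ->
     complex.Im z != l -> exists D, cder f z D) ->
  RI f x0 x1 y0 y1 = 0.
Proof.
move=> cf; rewrite le_eqVlt => /predU1P[-> _ _|hx].
  by rewrite /RI !ci_pt; ring.
rewrite le_eqVlt => /predU1P[-> _|hy df].
  by rewrite /RI !ci_pt; ring.
have G (a b : R) : y0 <= a -> a < b -> b <= y1 -> (l <= a \/ b <= l) -> RI f x0 x1 a b = 0.
  move=> h1 h2 h3 hl.
  have := @goursat_side f x0 a (x1 - x0) (b - a) l cf.
  rewrite ![_ + (_ - _)]addrC !subrK !subr_gt0; apply=> // z z1 /andP[z2 z3].
  by apply: df => //; rewrite (le_trans h1 z2) (le_trans z3 h3).
have [l0|l0] := leP l y0; first by apply: G => //; left.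
have [l1|l1] := leP y1 l; first by apply: G => //; right.
rewrite (RI_splity _ _ cf (ltW l0) (ltW l1)) !G ?addr0//; try exact: ltW; try exact: lexx.
- by left; exact: lexx.
- by right; exact: lexx.
Qed.
End Goursat2.

(** * The complex derivative and the exponential *)

Section ComplexDerivative.
Variable R : realType.
Implicit Types (f g : R[i] -> R[i]) (z w D E : R[i]) (e d : R).

Lemma cder_cont f z D : cder f z D -> forall e, 0 < e ->
  exists2 d, 0 < d & forall w, cn (w - z) < d -> cn (f w - f z) < e.
Proof.
move=> df e e0; have [d d0 H] := df 1 ltr01.
have K0 : 0 < cn D + 1 by rewrite ltr_wpDl// cn_ge0.
exists (Num.min d (e / (cn D + 1))); first by rewrite lt_min d0 divr_gt0.
move=> w; rewrite lt_min => /andP[/H h1 h2].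
rewrite ltr_pdivlMr// in h2; rewrite mul1r in h1.
rewrite (_ : f w - f z = (f w - f z - D * (w - z)) + D * (w - z)); last by ring.
apply: (le_lt_trans (cnD _ _)); rewrite cnM; apply: (le_lt_trans _ h2).
by rewrite [leRHS]mulrDr mulr1 addrC lerD// mulrC.
Qed.

Lemma cder_near f g z D d : 0 < d -> (forall w, cn (w - z) < d -> f w = g w) ->
  cder f z D -> cder g z D.
Proof.
move=> d0 fg df e e0; have [d' d'0 H] := df e e0.
exists (Num.min d d'); first by rewrite lt_min d0.
move=> w; rewrite lt_min => /andP[h1 h2]; rewrite -!fg ?subrr ?cn0//; exact: H.
Qed.

Lemma cder_cst k z : cder (fun=> k) z 0.
Proof.
by move=> e e0; exists 1 => // w _; rewrite subrr mul0r subr0 cn0 mulr_ge0 ?cn_ge0 ?ltW.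
Qed.

Lemma cder_affine p q z : cder (fun w => p + q * w) z q.
Proof.
move=> e e0; exists 1 => // w _.
by rewrite (_ : _ - _ - _ = 0) ?cn0 ?mulr_ge0 ?cn_ge0 ?ltW//; ring.
Qed.

Lemma cder_add f g z D E : cder f z D -> cder g z E ->
  cder (fun w => f w + g w) z (D + E).
Proof.
move=> df dg e e0; have e2 : 0 < e / 2 by rewrite divr_gt0.
have [d d0 H] := df _ e2; have [d' d'0 H'] := dg _ e2.
exists (Num.min d d'); first by rewrite lt_min d0.
move=> w; rewrite lt_min => /andP[/H h /H' h'].
rewrite (_ : _ - _ - _ = (f w - f z - D * (w - z)) + (g w - g z - E * (w - z))); last by ring.
apply: (le_trans (cnD _ _)); apply: (le_trans (lerD h h')).
by rewrite -mulrDl -splitr.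
Qed.

Lemma cder_comp f g z D E : cder f z D -> cder g (f z) E ->
  cder (fun w => g (f w)) z (E * D).
Proof.
move=> df dg e e0.
have K0 : 0 < cn E + cn D + 1 by rewrite ltr_wpDl// addr_ge0// cn_ge0.
pose e1 := Num.min 1 (e / (cn E + cn D + 1)).
have e1_gt0 : 0 < e1 by rewrite lt_min ltr01 divr_gt0.
have e11 : e1 <= 1 by rewrite ge_min lexx.
have e1e : e1 * (cn E + cn D + 1) <= e.
  by rewrite -ler_pdivlMr// ge_min lexx orbT.
have [d d0 H] := df _ e1_gt0; have [d' d'0 H'] := dg _ e1_gt0.
have [d1 d10 H1] := cder_cont df d'0.
exists (Num.min d d1); first by rewrite lt_min d0.
move=> w; rewrite lt_min => /andP[/H h /H1 /H' h'].
rewrite (_ : _ - _ - _ = (g (f w) - g (f z) - E * (f w - f z)) +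
   E * (f w - f z - D * (w - z))); last by ring.
apply: (le_trans (cnD _ _)); rewrite cnM.
have h2 : cn (f w - f z) <= (cn D + 1) * cn (w - z).
  rewrite (_ : f w - f z = (f w - f z - D * (w - z)) + D * (w - z)); last by ring.
  apply: (le_trans (cnD _ _)); rewrite cnM mulrDl mul1r addrC lerD2l.
  by apply: (le_trans h); rewrite ler_piMl ?cn_ge0.
apply: (le_trans (lerD (le_trans h' (ler_wpM2l (ltW e1_gt0) h2)) (ler_wpM2l (cn_ge0 E) h))).
rewrite [leLHS](_ : _ = (e1 * (cn E + cn D + 1)) * cn (w - z)); last by ring.
by apply: ler_wpM2r => //; exact: cn_ge0.
Qed.

Lemma cder_mul f g z D E : cder f z D -> cder g z E ->
  cder (fun w => f w * g w) z (D * g z + f z * E).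
Proof.
move=> df dg e e0.
have K0 : 0 < cn (g z) + cn (f z) + cn E + 1.
  by rewrite ltr_wpDl// !addr_ge0// cn_ge0.
pose e1 := Num.min 1 (e / (cn (g z) + cn (f z) + cn E + cn D + 2)).
have K1 : 0 < cn (g z) + cn (f z) + cn E + cn D + 2.
  by rewrite ltr_wpDl// !addr_ge0// cn_ge0.
have e1_gt0 : 0 < e1 by rewrite lt_min ltr01 divr_gt0.
have e11 : e1 <= 1 by rewrite ge_min lexx.
have e1e : e1 * (cn (g z) + cn (f z) + cn E + cn D + 2) <= e.
  by rewrite -ler_pdivlMr// ge_min lexx orbT.
have [d d0 H] := df _ e1_gt0; have [d' d'0 H'] := dg _ e1_gt0.
have [d1 d10 H1] := cder_cont dg e1_gt0.
exists (Num.min (Num.min d d1) d'); first by rewrite !lt_min d0 d10.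
move=> w; rewrite !lt_min => /andP[/andP[/H h /H1 h1] /H' h'].
rewrite (_ : _ - _ - _ = (f w - f z - D * (w - z)) * g z +
   f z * (g w - g z - E * (w - z)) + (f w - f z - D * (w - z)) * (g w - g z) +
   D * (w - z) * (g w - g z)); last by ring.
have t0 := cn_ge0 (w - z).
apply: (le_trans (cnD _ _)); rewrite [cn (D * _ * _)]cnM (cnM D).
apply: (le_trans (lerD (cnD _ _) (lexx _))).
apply: (le_trans (lerD (lerD (cnD _ _) (lexx _)) (lexx _))); rewrite !cnM.
apply: (@le_trans _ _ (e1 * cn (w - z) * cn (g z) + cn (f z) * (e1 * cn (w - z)) +
   (e1 * cn (w - z)) * 1 + cn D * cn (w - z) * e1)).
  apply: lerD; [apply: lerD; [apply: lerD|]|].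
  - by apply: ler_wpM2r => //; exact: cn_ge0.
  - by apply: ler_wpM2l => //; exact: cn_ge0.
  - apply: ler_pM => //; try exact: cn_ge0.
    by apply: ltW; exact: lt_le_trans h1 e11.
  - apply: ler_wpM2l; last exact: ltW.
    by apply: mulr_ge0 => //; exact: cn_ge0.
apply: (@le_trans _ _ ((e1 * (cn (g z) + cn (f z) + cn E + cn D + 2)) * cn (w - z))).
  have := cn_ge0 E; have := cn_ge0 D; move: t0 e1_gt0; clear.
  move: (cn E) (cn D) (cn (g z)) (cn (f z)) (cn (w - z)) e1 => a b c x y t *.
  have : 0 <= t * y * (a + 1) by rewrite !mulr_ge0// ?addr_ge0// ltW.
  lra.
exact: ler_wpM2r.
Qed.

Lemma cder_uniq f z D E : cder f z D -> cder f z E -> D = E.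
Proof.
move=> df dg; apply/eqP; rewrite -subr_eq0 -cn_eq0; apply/eqP/le_anti.
rewrite cn_ge0 andbT; apply/ler_addgt0Pr => /= e e0; rewrite add0r.
have e2 : 0 < e / 2 by rewrite divr_gt0.
have [d d0 H] := df _ e2; have [d' d'0 H'] := dg _ e2.
pose r := Num.min d d' / 2; have r0 : 0 < r by rewrite divr_gt0// lt_min d0.
have rm : r < Num.min d d' by rewrite /r ltr_pdivrMr// ltr_pMr ?ltr1n// lt_min d0.
rewrite lt_min in rm; move/andP: rm => [rd rd'].
have hr' : z + r%:C - z = r%:C by rewrite addrC addKr.
have hr : cn r%:C = r by rewrite cnR gtr0_norm.
have h := H (z + r%:C); have h' := H' (z + r%:C); rewrite hr' hr in h h'.
have {h'}h' := h' rd'; have {h}h := h rd.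
rewrite -(ler_pM2r r0) -{1}(gtr0_norm r0) -cnR -cnM.
rewrite (_ : (D - E) * r%:C = (f (z + r%:C) - f z - E * r%:C) - (f (z + r%:C) - f z - D * r%:C)); last by ring.
apply: (le_trans (cnB _ _)); apply: (le_trans (lerD h' h)).
by rewrite -mulrDl -splitr.
Qed.

Lemma deriv_eps (f : R -> R) (a D : R) : is_derive a (1 : R) f D ->
  forall e : R, 0 < e -> exists2 d : R, 0 < d & forall h : R, `|h| < d ->
    `|f (a + h) - f a - D * h| <= e * `|h|.
Proof.
move=> [df Df] e e0.
have := df; rewrite /derivable => /cvg_ex[/= l hl].
have lD : l = D by rewrite -Df; apply/esym/cvg_lim.
rewrite lD in hl; move/cvgrPdist_lt : hl => /(_ e e0) [/= d d0 H].
exists d => // h hd; have [->|h0] := eqVneq h 0.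
  by rewrite addr0 subrr mulr0 subr0 normr0 mulr0.
have := H h; rewrite /ball_ /= sub0r normrN => /(_ hd h0).
rewrite [h *: 1]mulr1 => h1.
rewrite (_ : f (a + h) - f a - D * h = - h * (D - h^-1 *: (f (h + a) - f a))).
  by rewrite normrM normrN mulrC ler_wpM2r// ltW.
by rewrite /GRing.scale /= (addrC h a); field.
Qed.

Definition cexp z : R[i] :=
  (expR (complex.Re z) * cos (complex.Im z)) +i* (expR (complex.Re z) * sin (complex.Im z)).

Lemma cexpD z w : cexp (z + w) = cexp z * cexp w.
Proof. by apply: ReIm_eq; rewrite ?(ReMc, ImMc) /= ReD ImD expRD (cosD, sinD); ring. Qed.
Lemma cexp0 : cexp 0 = 1.
Proof. by apply: ReIm_eq; rewrite /= expR0 mul1r (cos0, sin0). Qed.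
Lemma cn_cexp z : cn (cexp z) = expR (complex.Re z).
Proof.
rewrite cnE /= !exprMn -mulrDr cos2Dsin2 mulr1 sqrtr_sqr gtr0_norm//; exact: expR_gt0.
Qed.
Lemma cexp_neq0 z : cexp z != 0.
Proof. by rewrite -cn_gt0 cn_cexp expR_gt0. Qed.
Lemma cexpN z : cexp (- z) = (cexp z)^-1.
Proof.
by apply: (mulfI (cexp_neq0 z)); rewrite -cexpD subrr cexp0 divff// cexp_neq0.
Qed.
Lemma cexp_period (s t : R) : cexp (s +i* (t + pi *+ 2)) = cexp (s +i* t).
Proof. by rewrite /cexp /= cosD2pi sinD2pi. Qed.

Lemma cder_cexp0 : cder cexp 0 1.
Proof.
move=> e e0; pose e1 := Num.min 1 (e / 10).
have e1_gt0 : 0 < e1 by rewrite lt_min ltr01 divr_gt0.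
have e11 : e1 <= 1 by rewrite ge_min lexx.
have e1e : e1 * 10 <= e by rewrite -ler_pdivlMr// ge_min lexx orbT.
have [d1 d10 H1] := deriv_eps (is_derive_expR 0) e1_gt0.
have [d2 d20 H2] := deriv_eps (is_derive_cos 0) e1_gt0.
have [d3 d30 H3] := deriv_eps (is_derive_sin 0) e1_gt0.
exists (Num.min (Num.min d1 (e1 / 2)) (Num.min d2 d3)).
  by rewrite !lt_min d10 d20 d30 divr_gt0.
case=> x y; rewrite !subr0 !lt_min => /andP[/andP[h1 h4] /andP[h2 h3]].
have hx := cn_Re (x +i* y); have hy := cn_Im (x +i* y); rewrite /= in hx hy.
have {}H1 := H1 x (le_lt_trans hx h1); have {}H2 := H2 y (le_lt_trans hy h2).
have {}H3 := H3 y (le_lt_trans hy h3).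
rewrite !add0r expR0 mul1r in H1; rewrite !add0r cos0 sin0 oppr0 mul0r subr0 in H2.
rewrite !add0r cos0 sin0 subr0 mul1r in H3.
have x2 : `|x| <= e1 / 2 by exact: ltW (le_lt_trans hx h4).
rewrite cexp0 mul1r; apply: (le_trans (cn_le _)) => /=; rewrite subr0.
have E1 : `|expR x - 1| <= 2 * `|x|.
  rewrite (_ : expR x - 1 = (expR x - 1 - x) + x); last by ring.
  by apply: (le_trans (ler_normD _ _)); have := normr_ge0 x; nra.
have E2 : `|expR x| <= 2.
  rewrite (_ : expR x = (expR x - 1) + 1); last by ring.
  by apply: (le_trans (ler_normD _ _)); rewrite normr1; lra.
have A1 : `|expR x * cos y - 1 - x| <= e1 * `|x| + 2 * (e1 * `|y|).
  rewrite (_ : _ - _ - _ = (expR x - 1 - x) + expR x * (cos y - 1)); last by ring.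
  apply: (le_trans (ler_normD _ _)); rewrite normrM; apply: lerD => //.
  exact: ler_pM.
have A2 : `|expR x * sin y - y| <= 2 * (e1 * `|y|) + e1 * `|y|.
  rewrite (_ : _ - _ = expR x * (sin y - y) + (expR x - 1) * y); last by ring.
  apply: (le_trans (ler_normD _ _)); rewrite !normrM; apply: lerD.
    exact: ler_pM.
  apply: ler_wpM2r => //; lra.
apply: (le_trans (lerD A1 A2)).
apply: (@le_trans _ _ (e1 * 10 * cn (x +i* y))); last by rewrite ler_wpM2r ?cn_ge0.
have : 0 <= e1 * (cn (x +i* y) - `|x|) by rewrite mulr_ge0 ?subr_ge0// ltW.
have : 0 <= e1 * (cn (x +i* y) - `|y|) by rewrite mulr_ge0 ?subr_ge0// ltW.
have : 0 <= e1 * cn (x +i* y) by rewrite mulr_ge0 ?cn_ge0// ltW.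
lra.
Qed.

Lemma cder_cexp z : cder cexp z (cexp z).
Proof.
suff : cder (fun w => cexp z * cexp (- z + 1 * w)) z (cexp z).
  by apply: (cder_near ltr01) => w _; rewrite -cexpD; congr cexp; ring.
have h : cder (fun w => cexp (- z + 1 * w)) z (1 * 1).
  apply: cder_comp; first exact: cder_affine.
  by rewrite mul1r addNr; exact: cder_cexp0.
have := cder_mul (cder_cst (cexp z) z) h.
by rewrite mul0r add0r !mulr1.
Qed.

Lemma cder_ccont f : (forall z, exists D, cder f z D) -> ccont f.
Proof. by move=> df z e e0; have [D h] := df z; exact: cder_cont h e e0. Qed.

Lemma ccont_comp f g : ccont f -> ccont g -> ccont (fun z => g (f z)).
Proof.
move=> cf cg z e e0; have [d d0 H] := cg (f z) e e0; have [d' d'0 H'] := cf z d d0.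
by exists d' => // w /H' /H.
Qed.

Lemma ccont_mul f g : ccont f -> ccont g -> ccont (fun z => f z * g z).
Proof.
move=> cf cg z e e0.
pose K := cn (f z) + cn (g z) + 1.
have K0 : 0 < K by rewrite ltr_wpDl// addr_ge0// cn_ge0.
pose e1 := Num.min 1 (e / (K + 1)).
have K1 : 0 < K + 1 by rewrite addr_gt0.
have e1_gt0 : 0 < e1 by rewrite lt_min ltr01 divr_gt0.
have e11 : e1 <= 1 by rewrite ge_min lexx.
have e1e : e1 * (K + 1) <= e by rewrite -ler_pdivlMr// ge_min lexx orbT.
have [d d0 H] := cf z _ e1_gt0; have [d' d'0 H'] := cg z _ e1_gt0.
exists (Num.min d d'); first by rewrite lt_min d0.
move=> w; rewrite lt_min => /andP[/H h /H' h'].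
rewrite (_ : _ - _ = (f w - f z) * (g w - g z) + (f w - f z) * g z + f z * (g w - g z)); last by ring.
apply: (le_lt_trans (cnD _ _)); rewrite [cn (f z * _)]cnM.
apply: (le_lt_trans (lerD (cnD _ _) (lexx _))); rewrite !cnM.
apply: (@le_lt_trans _ _ (e1 * 1 + e1 * cn (g z) + cn (f z) * e1)).
  apply: lerD; [apply: lerD|].
  - apply: ler_pM; try exact: cn_ge0; try exact: ltW.
    by apply: ltW; exact: lt_le_trans h' e11.
  - by apply: ler_wpM2r; [exact: cn_ge0|exact: ltW].
  - by apply: ler_wpM2l; [exact: cn_ge0|exact: ltW].
apply: (lt_le_trans _ e1e); rewrite /K.
rewrite [ltLHS](_ : _ = e1 * K); last by rewrite /K; ring.
by rewrite -/K ltr_pM2l// ltrDl.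
Qed.
End ComplexDerivative.

(** * Cauchy's formula and its estimates on a square *)

Section CauchySquare.
Variable R : realType.

Lemma ci_dev (g : R -> R[i]) (a b K : R) (c : R[i]) : a <= b -> rcont g ->
  (forall x, a <= x <= b -> cn (g x - c) <= K) ->
  cn (ci g a b - c * (b - a)%:C) <= 2 * K * (b - a).
Proof.
move=> ab cg H.
have E : ci (fun x => 1 * g x + (-1) * (fun=> c) x) a b = ci g a b - c * (b - a)%:C.
  by rewrite ci_lin//; [rewrite ci_cst//; ring|exact: rcont_cst].
rewrite -E; apply: ci_bound => //; first by apply: rcont_lin => //; exact: rcont_cst.
by move=> x /H; rewrite mul1r mulN1r.
Qed.

Definition insq (z : R[i]) : Prop := `|complex.Re z| <= 1 /\ `|complex.Im z| <= 1.

Variables (f : R[i] -> R[i]) (l M : R).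
Hypotheses (cf : ccont f) (hM : forall z, insq z -> cn (f z - f 0) <= M).
Hypothesis (df : forall z, insq z -> complex.Im z != l -> exists D, cder f z D).

Let RI0 (x0 x1 y0 y1 : R) : -1 <= x0 -> x0 <= x1 -> x1 <= 1 ->
  -1 <= y0 -> y0 <= y1 -> y1 <= 1 -> RI f x0 x1 y0 y1 = 0.
Proof.
move=> h1 h2 h3 h4 h5 h6; apply: (goursat (l := l)) => // z /andP[z1 z2] /andP[z3 z4].
apply: df; split; rewrite ler_norml.
  by rewrite (le_trans h1 z1) (le_trans z2 h3).
by rewrite (le_trans h4 z3) (le_trans z4 h6).
Qed.

(** A primitive of [f], integrated along the bottom side and then along a vertical line. By
    Goursat's theorem its horizontal increments are integrals of [f] too. *)
Definition primit (z : R[i]) : R[i] := ci (fun s => f (s +i* (-1))) (-1) (complex.Re z) +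
  'i * ci (fun s => f (complex.Re z +i* s)) (-1) (complex.Im z).

Let G_h (x x' y : R) : -1 <= x -> x <= x' -> x' <= 1 -> -1 <= y -> y <= 1 ->
  primit (x' +i* y) - primit (x +i* y) = ci (fun s => f (s +i* y)) x x'.
Proof.
move=> h1 h2 h3 h4 h5; have := RI0 h1 h2 h3 (lexx _) h4 h5; rewrite /RI /primit /= => H.
rewrite (ci_add (ccont_h (-1) cf) h1 h2).
apply/eqP; rewrite -subr_eq0; apply/eqP; rewrite -[RHS]H; ring.
Qed.
Let G_v (x y y' : R) : -1 <= y -> y <= y' ->
  primit (x +i* y') - primit (x +i* y) = 'i * ci (fun s => f (x +i* s)) y y'.
Proof.
move=> h1 h2; rewrite /primit /= (ci_add (ccont_v x cf) h1 h2); ring.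
Qed.

Let G_hdev (x x' y K : R) (c : R[i]) : `|x| <= 1 -> `|x'| <= 1 -> `|y| <= 1 ->
  (forall s, `|s| <= 1 -> `|s - x| <= `|x' - x| -> cn (f (s +i* y) - c) <= K) ->
  cn (primit (x' +i* y) - primit (x +i* y) - c * (x' - x)%:C) <= 2 * K * `|x' - x|.
Proof.
move=> /ler_normlP[hx1 hx2] /ler_normlP[hx3 hx4] /ler_normlP[hy1 hy2] H.
have [xx|xx] := leP x x'.
  rewrite G_h//; try lra.
  rewrite ger0_norm ?subr_ge0//; apply: ci_dev => //; first exact: ccont_h.
  by move=> s /andP[s1 s2]; apply: H; [rewrite ler_norml|rewrite !ger0_norm]; lra.
rewrite -cnN (_ : - _ = (primit (x +i* y) - primit (x' +i* y)) - c * (x - x')%:C); last first.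
  by rewrite !rmorphB /=; ring.
rewrite G_h//; try lra.
rewrite distrC ger0_norm ?subr_ge0 ?(ltW xx)//; apply: ci_dev; [exact: ltW|exact: ccont_h|].
move=> s /andP[s1 s2]; apply: H; first by rewrite ler_norml; lra.
by rewrite distrC [leRHS]distrC !ger0_norm; lra.
Qed.
Let G_vdev (x y y' K : R) (c : R[i]) : `|y| <= 1 -> `|y'| <= 1 ->
  (forall s, `|s| <= 1 -> `|s - y| <= `|y' - y| -> cn (f (x +i* s) - c) <= K) ->
  cn (primit (x +i* y') - primit (x +i* y) - c * ('i * (y' - y)%:C)) <= 2 * K * `|y' - y|.
Proof.
move=> /ler_normlP[hx1 hx2] /ler_normlP[hx3 hx4] H.
have [xx|xx] := leP y y'.
  rewrite G_v//; try lra.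
  rewrite mulrCA -mulrBr cnM cni mul1r.
  rewrite ger0_norm ?subr_ge0//; apply: ci_dev => //; first exact: ccont_v.
  by move=> s /andP[s1 s2]; apply: H; [rewrite ler_norml|rewrite !ger0_norm]; lra.
rewrite -cnN (_ : - _ = (primit (x +i* y) - primit (x +i* y')) - c * ('i * (y - y')%:C)); last first.
  by rewrite !rmorphB /=; ring.
rewrite G_v//; try lra.
rewrite mulrCA -mulrBr cnM cni mul1r.
rewrite distrC ger0_norm ?subr_ge0 ?(ltW xx)//; apply: ci_dev; [exact: ltW|exact: ccont_v|].
move=> s /andP[s1 s2]; apply: H; first by rewrite ler_norml; lra.
by rewrite distrC [leRHS]distrC !ger0_norm; lra.
Qed.

(** Integrate along a horizontal and then a vertical segment: both stay in the square, and within
    twice the distance of the two points from [z]. *)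
Lemma prim_dev (z z' c : R[i]) (K : R) : insq z -> insq z' ->
  (forall w, insq w -> cn (w - z) <= 2 * cn (z' - z) -> cn (f w - c) <= K) ->
  cn (primit z' - primit z - c * (z' - z)) <= 4 * K * cn (z' - z).
Proof.
case: z => x y; case: z' => x' y'; rewrite /insq /= => -[hx hy] [hx' hy'] H.
have hX := cn_Re ((x' +i* y') - (x +i* y)); have hY := cn_Im ((x' +i* y') - (x +i* y)).
rewrite /= in hX hY; set N := cn ((x' +i* y') - (x +i* y)) in hX hY H *.
have N0 : 0 <= N by exact: cn_ge0.
have K0 : 0 <= K.
  by apply: (le_trans (cn_ge0 (f (x +i* y) - c))); apply: H; rewrite ?subrr ?cn0 ?mulr_ge0.
have D1 := @G_hdev x x' y K c hx hx' hy _.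
have {}D1 : cn (primit (x' +i* y) - primit (x +i* y) - c * (x' - x)%:C) <= 2 * K * `|x' - x|.
  apply: D1 => s hs hsx; apply: H => //; apply: (le_trans (cn_le _)) => /=.
  by rewrite subrr normr0 addr0 (le_trans hsx)// (le_trans hX)// ler_peMl// ler1n.
have D2 : cn (primit (x' +i* y') - primit (x' +i* y) - c * ('i * (y' - y)%:C)) <= 2 * K * `|y' - y|.
  apply: G_vdev => // s hs hsy; apply: H => //; apply: (le_trans (cn_le _)) => /=.
  by rewrite -[2]/(1 + 1) mulrDl mul1r lerD// (le_trans hsy).
rewrite (_ : _ - _ - _ = (primit (x' +i* y') - primit (x' +i* y) - c * ('i * (y' - y)%:C)) +
   (primit (x' +i* y) - primit (x +i* y) - c * (x' - x)%:C)); last first.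
  rewrite [(x' +i* y') - _]ReIm /=; ring.
apply: (le_trans (cnD _ _)); apply: (le_trans (lerD D2 D1)); nra.
Qed.

(** Retracting the plane onto the square makes the primitive continuous everywhere, as [goursat]
    asks, without changing it inside. *)
Definition clampR (t : R) : R := Num.max (-1) (Num.min 1 t).
Lemma clampR_in t : `|clampR t| <= 1.
Proof.
by rewrite /clampR ler_norml le_max lexx ge_max ge_min lexx /= !andbT; lra.
Qed.
Lemma clampR_id t : `|t| <= 1 -> clampR t = t.
Proof. by rewrite ler_norml => /andP[h1 h2]; rewrite /clampR min_r// max_r. Qed.
Lemma clampR_cases t : [\/ t <= -1 /\ clampR t = -1, -1 <= t <= 1 /\ clampR t = t | 1 <= t /\ clampR t = 1].
Proof.
rewrite /clampR; have [t1|t1] := leP 1 t.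
  by apply: Or33; split=> //; rewrite max_r//; lra.
have [t2|t2] := leP t (-1).
  by apply: Or31; split=> //; rewrite max_l.
by apply: Or32; split; rewrite ?ltW.
Qed.
Lemma clampR_lip s t : `|clampR s - clampR t| <= `|s - t|.
Proof.
have H (u v : R) : u <= v -> 0 <= clampR v - clampR u <= v - u.
  case: (clampR_cases u) => -[hu ->]; case: (clampR_cases v) => -[hv ->] uv;
  apply/andP; split; lra.
have [st|st] := leP s t.
  by rewrite distrC [leRHS]distrC; have /andP[h1 h2] := H _ _ st; rewrite !ger0_norm// (le_trans h1).
by have /andP[h1 h2] := H _ _ (ltW st); rewrite !ger0_norm// (le_trans h1).
Qed.

Definition clampC (z : R[i]) : R[i] := clampR (complex.Re z) +i* clampR (complex.Im z).
Lemma clampC_in z : insq (clampC z).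
Proof. by split; exact: clampR_in. Qed.
Lemma clampC_id z : insq z -> clampC z = z.
Proof. by case: z => x y [/= h1 h2]; rewrite /clampC /= !clampR_id. Qed.
Lemma clampC_lip z w : cn (clampC z - clampC w) <= 2 * cn (z - w).
Proof.
apply: (le_trans (cn_le _)) => /=.
have := clampR_lip (complex.Re z) (complex.Re w); have := clampR_lip (complex.Im z) (complex.Im w).
have := cn_Re (z - w); have := cn_Im (z - w); rewrite !(ReD, ImD, ReN, ImN); lra.
Qed.

Let g z := primit (clampC z).
Let insq_in z : cn z < 1 -> insq z.
Proof. by move=> h; split; apply: ltW; [exact: le_lt_trans (cn_Re _) h|exact: le_lt_trans (cn_Im _) h]. Qed.
Let M0 : 0 <= M.
Proof. by apply: (le_trans (cn_ge0 (f 0 - f 0))); apply: hM; split; rewrite normr0. Qed.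

Let g_ccont : ccont g.
Proof.
move=> z e e0; pose K := M + cn (f 0) + 1.
have K0 : 0 < K by rewrite /K ltr_wpDl// addr_ge0// cn_ge0.
exists (e / (8 * K)); first by rewrite divr_gt0// mulr_gt0.
move=> w; rewrite ltr_pdivlMr ?mulr_gt0// => hw.
have := @prim_dev (clampC z) (clampC w) 0 K (clampC_in _) (clampC_in _) _.
rewrite mul0r subr0 => H; apply: (le_lt_trans (H _)) => {H}.
  move=> v hv _; rewrite subr0 (_ : f v = (f v - f 0) + f 0); last by ring.
  by apply: (le_trans (cnD _ _)); have := hM hv; rewrite /K; lra.
by apply: (le_lt_trans _ hw); have := clampC_lip w z; nra.
Qed.

Let g_cder a : cn a < 1 -> cder g a (f a).
Proof.
move=> a1 e e0; have e4 : 0 < e / 4 by rewrite divr_gt0.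
have [d d0 H] := cf a e4.
exists (Num.min (d / 2) (1 - cn a)); first by rewrite lt_min subr_gt0 a1 divr_gt0.
move=> w; rewrite lt_min => /andP[h1 h2].
have w1 : cn w < 1 by have := cnD (w - a) a; rewrite subrK; lra.
have ha := insq_in a1; have hw := insq_in w1.
rewrite /g (clampC_id ha) (clampC_id hw).
rewrite (_ : e = 4 * (e / 4)); last by field.
apply: prim_dev => // v _ hv; apply/ltW/H; apply: (le_lt_trans hv); lra.
Qed.

Let gq a z := (g (a + cexp z) - g a) * cexp (- z).
Let gq_ccont a : ccont (gq a).
Proof.
apply: ccont_mul.
  have -> : (fun z => g (a + cexp z) - g a) = (fun z => 1 * (fun z => g (a + cexp z)) z + (-1) * (fun=> g a) z).
    by apply/funext => z; rewrite mul1r mulN1r.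
  apply: ccont_lin; last exact: ccont_cst.
  apply: (@ccont_comp _ (fun z => a + cexp z) g) => //.
  apply: cder_ccont => z; exists (0 + cexp z).
  by apply: cder_add; [exact: cder_cst|exact: cder_cexp].
apply: cder_ccont => z; exists (cexp (0 + (-1) * z) * (-1)).
have -> : (fun z => cexp (- z)) = (fun z => cexp (0 + (-1) * z)) :> (R[i] -> R[i]).
  by apply/funext => w; rewrite add0r mulN1r.
apply: (@cder_comp _ (fun z => 0 + -1 * z) (@cexp R)); first exact: cder_affine.
exact: cder_cexp.
Qed.

Let gq_cder a z : cn (a + cexp z) < 1 -> exists D, cder (gq a) z D.
Proof.
move=> h.
have d1 : cder (fun z => a + cexp z) z (0 + cexp z).
  by apply: cder_add; [exact: cder_cst|exact: cder_cexp].
have d2 := cder_comp d1 (g_cder h).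
have d3 := cder_add d2 (cder_cst (- g a) z).
have d4 : cder (fun z => cexp (- z)) z (cexp (0 + (-1) * z) * (-1)).
  have -> : (fun z => cexp (- z)) = (fun z => cexp (0 + (-1) * z)) :> (R[i] -> R[i]).
    by apply/funext => w; rewrite add0r mulN1r.
  apply: (@cder_comp _ (fun z => 0 + -1 * z) (@cexp R)); first exact: cder_affine.
  exact: cder_cexp.
by eexists; exact: (cder_mul d3 d4).
Qed.

Let pi2 : 0 < (pi : R) *+ 2. Proof. by rewrite mulrn_wgt0// pi_gt0. Qed.

(* Cauchy's formula for the derivative [f] of [g], obtained by applying Goursat's
   theorem to z |-> (g (a + e^z) - g a) e^-z on a strip of height 2 pi. *)
Let cauchy_strip a (s0 s1 : R) : cn a + expR s1 < 1 -> s0 <= s1 ->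
  ci (fun t => gq a (s1 +i* t)) 0 (pi *+ 2) = ci (fun t => gq a (s0 +i* t)) 0 (pi *+ 2).
Proof.
move=> h s01.
have H : RI (gq a) s0 s1 0 (pi *+ 2) = 0.
  apply: (goursat (l := 0)) => //; first exact: ltW.
  move=> z /andP[_ z1] _ _; apply: gq_cder; apply: (le_lt_trans (cnD _ _)).
  by apply: (le_lt_trans _ h); rewrite lerD2l cn_cexp ler_expR.
have P (x : R) : gq a (x +i* 0) = gq a (x +i* (pi *+ 2)).
  have E1 : cexp (x +i* (pi *+ 2)) = cexp (x +i* 0) by rewrite -(cexp_period x 0) add0r.
  by rewrite /gq !cexpN E1.
rewrite /RI (eq_ci _ _ P) subrr add0r in H.
have i0 : 'i != 0 :> R[i] by rewrite -cn_gt0 cni.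
by move/eqP: H; rewrite mulf_eq0 (negbTE i0) /= subr_eq0 => /eqP.
Qed.

Let cauchy a (s : R) : cn a + expR s < 1 ->
  ci (fun t => gq a (s +i* t)) 0 (pi *+ 2) = f a * (pi *+ 2)%:C.
Proof.
move=> h; apply/eqP; rewrite -subr_eq0 -cn_eq0; apply/eqP/le_anti.
rewrite cn_ge0 andbT; apply/ler_addgt0Pr => /= e e0; rewrite add0r.
have e1_gt0 : 0 < e / (2 * (pi *+ 2)) by rewrite divr_gt0// mulr_gt0.
have a1 : cn a < 1 by have := expR_gt0 s; lra.
have [d d0 H] := g_cder a1 e1_gt0.
(* The strip lets the radius shrink; on a circle of radius below [d] the difference quotient of [g]
   is within tolerance of [f a]. *)
pose s0 := Num.min s (ln (d / 2)).
have d2 : 0 < d / 2 by rewrite divr_gt0.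
have s0d : expR s0 < d.
  apply: (@le_lt_trans _ _ (d / 2)); last by lra.
  by rewrite -[leRHS](lnK d2) ler_expR ge_min lexx orbT.
rewrite (@cauchy_strip a s0 s)//; last by rewrite ge_min lexx.
have := @ci_dev (fun t => gq a (s0 +i* t)) 0 (pi *+ 2) (e / (2 * (pi *+ 2))) (f a) (ltW pi2) (ccont_v _ (@gq_ccont a)) _.
rewrite subr0 => D; apply: (le_trans (D _)); last first.
  by move: (pi *+ 2) pi2 => p p0; rewrite le_eqVlt; apply/orP; left; apply/eqP; field; rewrite gt_eqF.
move=> t _; rewrite /gq cexpN.
have H1 : cn (g (cexp (s0 +i* t) + a) - g a - f a * cexp (s0 +i* t)) <=
    e / (2 * (pi *+ 2)) * expR s0.
  by have := H (cexp (s0 +i* t) + a); rewrite addrK cn_cexp; exact.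
rewrite (_ : _ - _ = (g (cexp (s0 +i* t) + a) - g a - f a * cexp (s0 +i* t)) / cexp (s0 +i* t)); last first.
  by rewrite (addrC a); field; exact: cexp_neq0.
by rewrite cnM cnV cn_cexp /= ler_pdivrMr ?expR_gt0.
Qed.

(** Cauchy's formula at [a] and at [b] on circles of the same radius; the constant [k] goes under
    the integral because it is its own mean. *)
Let cauchy_diff a b (k : R[i]) (s K : R) : cn a + expR s < 1 -> cn b + expR s < 1 ->
  (forall w, cn w = expR s ->
     cn (primit (b + w) - primit b - (primit (a + w) - primit a) - k * w) <= K) ->
  cn (f b - f a - k) <= 2 * K / expR s.
Proof.
move=> ha hb H.
have K0 : 0 <= K by apply: (le_trans (cn_ge0 _) (H (cexp (s +i* 0)) _)); rewrite cn_cexp.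
have E : ci (fun t => 1 * (fun t => gq b (s +i* t)) t + (-1) * (fun t => gq a (s +i* t)) t) 0 (pi *+ 2) =
   (f b - f a) * (pi *+ 2)%:C.
  by rewrite ci_lin ?cauchy//; [ring|exact: ccont_v|exact: ccont_v].
have cg : rcont (fun t => 1 * (fun t => gq b (s +i* t)) t + (-1) * (fun t => gq a (s +i* t)) t).
  by apply: rcont_lin; exact: ccont_v.
have := @ci_dev _ 0 (pi *+ 2) (K / expR s) k (ltW pi2) cg _.
rewrite subr0 E -mulrBl cnM cnR (gtr0_norm pi2) => D.
rewrite -(ler_pM2r pi2) [leRHS](_ : _ = 2 * (K / expR s) * (pi *+ 2)); last by ring.
apply: D => t _; rewrite /gq cexpN; set w := cexp _.
have hw : cn w = expR s by rewrite cn_cexp.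
have w0 : w != 0 by exact: cexp_neq0.
have I u : cn u + expR s < 1 -> insq (u + w) /\ insq u.
  move=> hu; split; apply: insq_in; first by apply: (le_lt_trans (cnD _ _)); rewrite hw.
  by have := expR_gt0 s; lra.
have [ia ia'] := I a ha; have [ib ib'] := I b hb.
rewrite /g (clampC_id ia) (clampC_id ia') (clampC_id ib) (clampC_id ib').
rewrite (_ : _ - _ = (primit (b + w) - primit b - (primit (a + w) - primit a) - k * w) / w); last first.
  by field.
by rewrite cnM cnV hw ler_pM2r ?invr_gt0 ?expR_gt0//; exact: H.
Qed.

(** On circles of radius 1/2, the mixed difference of the primitive over [a], [b], [a + w], [b + w]
    is regrouped into two increments by [b - a], each within [4 * M * cn (b - a)] of
    [f 0 * (b - a)]. *)
Lemma cauchy_lip a b : cn a <= 4^-1 -> cn b <= 4^-1 -> cn (f b - f a) <= 32 * M * cn (b - a).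
Proof.
move=> ha hb.
have E : expR (ln 2^-1) = 2^-1 :> R by rewrite lnK// posrE invr_gt0.
have := @cauchy_diff a b 0 (ln 2^-1) (8 * M * cn (b - a)).
rewrite E !subr0 => H; apply: (le_trans (H _ _ _)); [lra|lra| |by rewrite invrK; lra].
move=> w hw; rewrite mul0r subr0.
have B u v : insq u -> insq v -> cn (primit v - primit u - f 0 * (v - u)) <= 4 * M * cn (v - u).
  by move=> hu hv; apply: prim_dev => // x hx _; exact: hM.
have I u : cn u <= 4^-1 -> insq (u + w) /\ insq u.
  move=> hu; split; apply: insq_in; last by lra.
  by apply: (le_lt_trans (cnD _ _)); rewrite hw; lra.
have [ia ia'] := I a ha; have [ib ib'] := I b hb.
have B1 := B _ _ ia' ib'; have B2 := B _ _ ia ib.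
have e1 : b + w - (a + w) = b - a by ring.
rewrite e1 in B2.
rewrite (_ : _ - _ = (primit (b + w) - primit (a + w) - f 0 * (b - a)) -
   (primit b - primit a - f 0 * (b - a))); last by ring.
apply: (le_trans (cnB _ _)); lra.
Qed.

(** The remainder is itself a Cauchy integral over the circle of radius 1/8. Its numerator is a
    difference of two first-order remainders of the primitive, each quadratic in [z] because [f] is
    Lipschitz. *)
Lemma cauchy_quad : exists D, forall z, cn z <= 16^-1 ->
  cn (f z - f 0 - D * z) <= (64 * 128) * M * cn z ^+ 2.
Proof.
have E : expR (ln 8^-1) = 8^-1 :> R by rewrite lnK// posrE invr_gt0.
pose s : R := ln 8^-1.
(* Cauchy's integral for the derivative at 0, written in the coordinate [w = cexp (s +i* t)]. *)
pose D := ci (fun t => (f (cexp (s +i* t)) - f 0) * cexp (- (s +i* t))) 0 (pi *+ 2) / (pi *+ 2)%:C.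
exists D => z hz.
have c1 : ccont (fun z : R[i] => cexp (- z)).
  apply: cder_ccont => x; exists (cexp (0 + (-1) * x) * (-1)).
  have -> : (fun z => cexp (- z)) = (fun z => cexp (0 + (-1) * z)) :> (R[i] -> R[i]).
    by apply/funext => w; rewrite add0r mulN1r.
  apply: (@cder_comp _ (fun z => 0 + -1 * z) (@cexp R)); first exact: cder_affine.
  exact: cder_cexp.
have c2 : ccont (fun z => (f (cexp z) - f 0) * cexp (- z)).
  apply: ccont_mul => //.
  have -> : (fun z => f (cexp z) - f 0) = (fun z => 1 * (fun z => f (cexp z)) z + (-1) * (fun=> f 0) z).
    by apply/funext => x; rewrite mul1r mulN1r.
  apply: ccont_lin; last exact: ccont_cst.
  apply: ccont_comp => //; apply: cder_ccont => x; exists (cexp x); exact: cder_cexp.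
have h0 : cn (0 : R[i]) + expR s < 1 by rewrite cn0 E; lra.
have hz1 : cn z + expR s < 1 by rewrite E; lra.
have cgz := @gq_ccont z; have cg0 := @gq_ccont 0.
pose F t := 1 * (fun t => 1 * (fun t => gq z (s +i* t)) t + (-1) * (fun t => gq 0 (s +i* t)) t) t
   + (- z) * (fun t => (f (cexp (s +i* t)) - f 0) * cexp (- (s +i* t))) t.
have cF0 : rcont (fun t => 1 * (fun t => gq z (s +i* t)) t + (-1) * (fun t => gq 0 (s +i* t)) t).
  by apply: rcont_lin; exact: ccont_v.
have cF : rcont F by apply: rcont_lin => //; exact: (ccont_v _ c2).
have EF : ci F 0 (pi *+ 2) = (f z - f 0 - D * z) * (pi *+ 2)%:C.
  rewrite /F ci_lin//; last exact: (ccont_v _ c2).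
  rewrite ci_lin ?cauchy//; try exact: ccont_v.
  rewrite (_ : ci _ _ _ = D * (pi *+ 2)%:C); first by ring.
  by rewrite /D divfK// -cn_gt0 cnR normr_gt0 gt_eqF.
have := @ci_bound _ F 0 (pi *+ 2) ((64 * 64) * M * cn z ^+ 2) (ltW pi2) cF _.
rewrite subr0 EF cnM cnR (gtr0_norm pi2) ler_pM2r// => H.
apply: (le_trans (H _)); last by lra.
move=> t _; rewrite /F /gq; have wN := cexpN (s +i* t); set w := cexp (s +i* t) in wN *.
rewrite wN; have hw : cn w = 8^-1 by rewrite cn_cexp.
have w0 : w != 0 by exact: cexp_neq0.
have I u : cn u <= 16^-1 -> insq (u + w) /\ insq u.
  move=> hu; split; apply: insq_in; last by lra.
  by apply: (le_lt_trans (cnD _ _)); rewrite hw; lra.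
have [iz iz'] := I z hz; have [i0 i0'] := I 0 ltac:(rewrite cn0; lra).
rewrite /g (clampC_id iz) (clampC_id iz') (clampC_id i0) (clampC_id i0').
have B u : cn u <= 8^-1 -> insq u -> insq (z + u) ->
    cn (primit (z + u) - primit u - f u * z) <= 256 * M * cn z ^+ 2.
  move=> hu iu iu'.
  have := @prim_dev u (z + u) (f u) (64 * M * cn z) iu iu'.
  rewrite addrK => P; apply: (le_trans (P _)); last by lra.
  move=> v hv; have /= := cauchy_lip (a := u) (b := v).
  move=> L hvu; apply: (le_trans (L _ _)); [lra| |].
    by have := cnD (v - u) u; rewrite subrK; lra.
  have : 0 <= M * (2 * cn z - cn (v - u)) by apply: mulr_ge0 => //; lra.
  lra.
have B1 : cn (primit (z + w) - primit w - f w * z) <= 256 * M * cn z ^+ 2.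
  by apply: B => //; [lra|have := i0; rewrite add0r].
have B2 : cn (primit z - primit 0 - f 0 * z) <= 256 * M * cn z ^+ 2.
  by have := B 0; rewrite addr0; apply=> //; rewrite cn0; lra.
rewrite (_ : _ + _ = ((primit (z + w) - primit w - f w * z) - (primit z - primit 0 - f 0 * z)) / w); last first.
  by rewrite !add0r; field.
rewrite cnM cnV hw invrK; have := cnB (primit (z + w) - primit w - f w * z) (primit z - primit 0 - f 0 * z).
lra.
Qed.
End CauchySquare.

Section CauchyEstimate.
Variable R : realType.

Definition near_sq (a : R[i]) (r : R) (z : R[i]) : Prop :=
  `|complex.Re (z - a)| <= r /\ `|complex.Im (z - a)| <= r.

Lemma ReRM (k : R) (z : R[i]) : complex.Re (k%:C * z) = k * complex.Re z.
Proof. by rewrite ReMc /= mul0r subr0. Qed.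
Lemma ImRM (k : R) (z : R[i]) : complex.Im (k%:C * z) = k * complex.Im z.
Proof. by rewrite ImMc /= mul0r addr0. Qed.
Lemma cnMr (k : R) (z : R[i]) : 0 <= k -> cn (k%:C * z) = k * cn z.
Proof. by move=> k0; rewrite cnM cnR ger0_norm. Qed.

(* F is only known to be continuous on the line Im z = l. *)
Lemma cauchy_estimate (F : R[i] -> R[i]) (a : R[i]) (r l M : R) : 0 < r ->
  (forall z, near_sq a r z -> forall e : R, 0 < e -> exists2 d : R, 0 < d &
     forall w, near_sq a r w -> cn (w - z) < d -> cn (F w - F z) < e) ->
  (forall z, `|complex.Re (z - a)| < r -> `|complex.Im (z - a)| < r ->
     complex.Im z != l -> exists D, cder F z D) ->
  (forall z, near_sq a r z -> cn (F z - F a) <= M) ->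
  exists D, forall z, cn (z - a) <= r / 32 ->
    cn (F z - F a) <= 64 * M / r * cn (z - a) /\
    cn (F z - F a - D * (z - a)) <= (32 * (32 * 32)) * M / r ^+ 2 * cn (z - a) ^+ 2.
Proof.
move=> r0 cF dF bF.
(* At half scale the unit square of [f] corresponds to a square strictly inside the given one, where
   [F] is differentiable off the line; clamping makes [f] continuous on the plane. *)
pose f (z : R[i]) := F (a + r%:C * clampC ((2^-1)%:C * z)).
have nsq (z : R[i]) : near_sq a r (a + r%:C * clampC z).
  have [h1 h2] := clampC_in z.
  by split; rewrite addrC addKr (ReRM, ImRM) normrM gtr0_norm// ler_piMr// ltW.
have cf : ccont f.
  move=> z e e0; have [d d0 H] := cF _ (nsq ((2^-1)%:C * z)) e e0.
  exists (d / r); first by rewrite divr_gt0.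
  move=> w hw; apply: H => //.
  rewrite (_ : _ - _ = r%:C * (clampC ((2^-1)%:C * w) - clampC ((2^-1)%:C * z))); last by ring.
  rewrite cnMr ?(ltW r0)//; rewrite ltr_pdivlMr// mulrC in hw; apply: (le_lt_trans _ hw).
  rewrite ler_pM2l//; apply: (le_trans (clampC_lip _ _)).
  by rewrite -mulrBr cnMr ?invr_ge0// mulrA divff// mul1r.
have insqh (z : R[i]) : cn z <= 2 -> insq ((2^-1)%:C * z).
  move=> hz; split; rewrite (ReRM, ImRM) normrM gtr0_norm ?invr_gt0// mulrC ler_pdivrMr// mul1r;
  by apply: le_trans hz; rewrite (cn_Re, cn_Im).
have fE (z : R[i]) : insq ((2^-1)%:C * z) -> f z = F (a + (r / 2)%:C * z).
  by move=> h; rewrite /f clampC_id// mulrA -rmorphM.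
have f0 : f 0 = F a by rewrite fE; [rewrite mulr0 addr0|apply: insqh; rewrite cn0].
have M_ge (z : R[i]) : insq z -> cn (f z - f 0) <= M.
  by move=> _; rewrite f0; apply: bF; exact: nsq.
have df (z : R[i]) : insq z -> complex.Im z != 2 * (l - complex.Im a) / r -> exists D, cder f z D.
  move=> [h1 h2] hl.
  have r2 : 0 < r / 2 by rewrite divr_gt0.
  have [|||D HD] := dF (a + (r / 2)%:C * z).
  - rewrite addrC addKr ReRM normrM gtr0_norm//; apply: (@le_lt_trans _ _ (r / 2)); last by lra.
    by rewrite ler_piMr// ltW.
  - rewrite addrC addKr ImRM normrM gtr0_norm//; apply: (@le_lt_trans _ _ (r / 2)); last by lra.
    by rewrite ler_piMr// ltW.
  - apply: contraNN hl => /eqP; rewrite ImD ImRM => hl; apply/eqP; rewrite -hl.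
    by field; rewrite gt_eqF.
  exists (D * (r / 2)%:C).
  apply: (@cder_near _ (fun z => F (a + (r / 2)%:C * z)) f z _ 1) => //; last first.
    by apply: (@cder_comp _ (fun z => a + (r / 2)%:C * z) F) => //; exact: cder_affine.
  move=> w hw; rewrite fE//; split; rewrite (ReRM, ImRM) normrM gtr0_norm ?invr_gt0//.
    have := ler_normD (complex.Re (w - z)) (complex.Re z); rewrite {1}ReD ReN subrK.
    by have := cn_Re (w - z); lra.
  have := ler_normD (complex.Im (w - z)) (complex.Im z); rewrite {1}ImD ImN subrK.
  by have := cn_Im (w - z); lra.
have [D HD] := cauchy_quad cf M_ge df.
have HL := cauchy_lip cf M_ge df.
exists (D * (2 / r)%:C) => z hz.
pose w := (2 / r)%:C * (z - a).
have r2 : 0 < 2 / r by rewrite divr_gt0.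
have cw : cn w = 2 / r * cn (z - a) by rewrite /w cnMr// ltW.
have w16 : cn w <= 16^-1.
  rewrite cw (_ : 16^-1 = 2 / r * (r / 32)); first by rewrite ler_pM2l.
  by field; rewrite gt_eqF.
have fw : f w = F z.
  rewrite fE; last by apply: insqh; lra.
  congr F; rewrite /w mulrA -rmorphM (_ : r / 2 * (2 / r) = 1) ?rmorph1; first by ring.
  by field; rewrite gt_eqF.
have cn0' : cn (0 : R[i]) <= 4^-1 by rewrite cn0.
have := HL 0 w cn0'; rewrite fw f0 subr0 cw => h1.
have := HD w w16; rewrite fw f0 cw => h2.
split.
  by apply: (le_trans (h1 _)); [lra|rewrite le_eqVlt; apply/orP; left; apply/eqP; field; rewrite gt_eqF].
rewrite (_ : D * (2 / r)%:C * (z - a) = D * w); last by rewrite /w mulrA.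
by apply: (le_trans h2); rewrite le_eqVlt; apply/orP; left; apply/eqP; field; rewrite gt_eqF.
Qed.
End CauchyEstimate.

(** * Logarithm and powers on the right half-plane *)

Section ComplexPower.
Variable R : realType.

Lemma cont_eps (f : R -> R) (x : R) : {for x, continuous f} -> forall e : R, 0 < e ->
  exists2 d : R, 0 < d & forall y, `|y - x| < d -> `|f y - f x| < e.
Proof.
move=> cf e e0; move/cvgrPdist_lt : cf => /(_ e e0) /nbhs_ballP[d /= d0 H].
by exists d => // y hy; rewrite distrC; apply: H; rewrite /ball /= distrC.
Qed.

(** The principal branch: the arctangent is the argument for positive real part, which is where
    [clog] is used. *)
Definition clog (z : R[i]) : R[i] := ln (cn z) +i* atan (complex.Im z / complex.Re z).

Lemma cos_arg (z : R[i]) : 0 < complex.Re z ->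
  cos (atan (complex.Im z / complex.Re z)) = complex.Re z / cn z.
Proof.
move=> x0; rewrite cos_atan.
have -> : cn z = complex.Re z * Num.sqrt (1 + (complex.Im z / complex.Re z) ^+ 2).
  rewrite cnE -{2}(gtr0_norm x0) -sqrtr_sqr -sqrtrM ?sqr_ge0//.
  by congr Num.sqrt; field; rewrite gt_eqF.
by rewrite invfM mulrA divff ?mul1r// gt_eqF.
Qed.

Lemma cexp_clog (z : R[i]) : 0 < complex.Re z -> cexp (clog z) = z.
Proof.
move=> x0; have cz : 0 < cn z by rewrite (lt_le_trans x0)// (le_trans (ler_norm _) (cn_Re _)).
set t := complex.Im z / complex.Re z.
have ct : cos (atan t) = complex.Re z / cn z by exact: cos_arg.
have st : sin (atan t) = t * (complex.Re z / cn z).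
  have := atanK t; rewrite /tan ct => h; rewrite -{2}h divfK// mulf_neq0 ?invr_eq0 ?gt_eqF//.
apply: ReIm_eq; rewrite /cexp /= -/t lnK ?posrE// (ct, st).
  by field; rewrite gt_eqF.
by rewrite /t; field; rewrite !gt_eqF.
Qed.

Lemma clog_cont (z : R[i]) (e : R) : 0 < complex.Re z -> 0 < e ->
  exists2 d, 0 < d & forall w, cn (w - z) < d -> cn (clog w - clog z) < e.
Proof.
move=> x0 e0; have cz : 0 < cn z by rewrite (lt_le_trans x0)// (le_trans (ler_norm _) (cn_Re _)).
have e2 : 0 < e / 2 by rewrite divr_gt0.
have [d1 d10 H1] := cont_eps (continuous_ln cz) e2.
have [d2 d20 H2] := cont_eps (@continuous_atan _ (complex.Im z / complex.Re z)) e2.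
pose x := complex.Re z; pose y := complex.Im z; rewrite -/x -/y in x0 H2.
have K0 : 0 < x + `|y| + 1 by rewrite ltr_wpDl// addr_ge0// ltW.
exists (Num.min d1 (Num.min (x / 2) (d2 * x ^+ 2 / (4 * (x + `|y| + 1))))).
  by rewrite !lt_min d10 !divr_gt0 ?mulr_gt0 ?exprn_gt0.
move=> w; rewrite !lt_min => /and3P[h1 h2 h3].
apply: (le_lt_trans (cn_le _)); rewrite /clog ReD ImD ReN ImN /= [e]splitr; apply: ltrD.
  apply: H1; apply: (le_lt_trans _ h1).
  have := cnD (w - z) z; have := cnD (z - w) w; rewrite !subrK (cnC z w) => t1 t2.
  by rewrite ler_norml; apply/andP; split; lra.
apply: H2; have := cn_Re (w - z); have := cn_Im (w - z); rewrite ReD ImD ReN ImN -/x -/y.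
set u := complex.Re w; set v := complex.Im w => hv hu.
have u2 : x / 2 < u by have := ler_norml (u - x) (cn (w - z)); rewrite hu => /esym/andP[]; lra.
have u0 : 0 < u by lra.
rewrite (_ : v / u - y / x = ((v - y) * x - y * (u - x)) / (u * x)); last by field; rewrite !gt_eqF.
rewrite normrM normrV ?unitfE ?mulf_neq0 ?gt_eqF// (gtr0_norm (mulr_gt0 u0 x0)).
rewrite ltr_pdivrMr ?mulr_gt0//.
apply: (le_lt_trans (ler_normB _ _)); rewrite !normrM (gtr0_norm x0).
apply: (@le_lt_trans _ _ (cn (w - z) * (x + `|y| + 1))).
  have := cn_ge0 (w - z); have := normr_ge0 y; nra.
rewrite ltr_pdivlMr in h3; last by rewrite mulr_gt0.
have : d2 * x * (x / 2) < d2 * x * u by rewrite ltr_pM2l// mulr_gt0.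
have : cn (w - z) * (4 * (x + `|y| + 1)) < d2 * x ^+ 2 by [].
have : 0 < d2 * x ^+ 2 by rewrite mulr_gt0 ?exprn_gt0.
rewrite expr2; lra.
Qed.

(** The logarithm inverts [cexp] and is continuous, so its derivative is the inverse of that of
    [cexp]; this requires first that the increment [h] of the logarithm be bounded by the increment
    of [z]. *)
Lemma cder_clog (z : R[i]) : 0 < complex.Re z -> cder clog z z^-1.
Proof.
move=> x0; have cz : 0 < cn z by rewrite (lt_le_trans x0)// (le_trans (ler_norm _) (cn_Re _)).
have z0 : z != 0 by rewrite -cn_gt0.
move=> e e0; pose e1 := Num.min (cn z / 2) (e * cn z ^+ 2 / 2).
have e1_gt0 : 0 < e1 by rewrite lt_min !divr_gt0// mulr_gt0// exprn_gt0.
have e11 : e1 <= cn z / 2 by rewrite ge_min lexx.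
have e12 : e1 <= e * cn z ^+ 2 / 2 by rewrite ge_min lexx orbT.
have [d1 d10 H1] := cder_cexp (clog z) e1_gt0.
have [d2 d20 H2] := clog_cont x0 d10.
exists (Num.min d2 (complex.Re z)); first by rewrite lt_min d20.
move=> w; rewrite lt_min => /andP[/H2 h1 h2].
have w0 : 0 < complex.Re w.
  have := cn_Re (w - z); rewrite ReD ReN => /(le_lt_trans)/(_ h2).
  by rewrite ltr_norml => /andP[]; lra.
have := H1 _ h1; rewrite !cexp_clog//; set h := clog w - clog z => hh.
have B : cn h * cn z <= 2 * cn (w - z).
  have : cn (z * h) <= cn (w - z) + cn (w - z - z * h).
    by rewrite [X in cn X](_ : _ = (w - z) - (w - z - z * h)) ?cnB//; ring.
  by rewrite cnM; have := cn_ge0 h; nra.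
rewrite (_ : h - z^-1 * (w - z) = - (w - z - z * h) / z); last by field.
rewrite cnM cnN cnV ler_pdivrMr//; apply: (le_trans hh).
have : cn h * (e * cn z ^+ 2 / 2 - e1) >= 0 by rewrite mulr_ge0 ?cn_ge0// subr_ge0.
have : e * cn z * (2 * cn (w - z) - cn h * cn z) >= 0.
  by rewrite mulr_ge0 ?subr_ge0// mulr_ge0 ?ltW.
by rewrite expr2; lra.
Qed.

Definition cpow (g : R) (z : R[i]) : R[i] := cexp (g%:C * clog z).

Lemma cder_cpow (g : R) (z : R[i]) : 0 < complex.Re z ->
  cder (cpow g) z (cpow g z * (g%:C / z)).
Proof.
move=> x0; have h := cder_clog x0.
have h2 := cder_comp h (cder_affine 0 g%:C (clog z)).
have h3 := cder_comp h2 (cder_cexp (0 + g%:C * clog z)).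
rewrite add0r in h3.
apply: (cder_near ltr01 _ h3) => w _; by rewrite add0r.
Qed.

Lemma cpow_neq0 (g : R) (z : R[i]) : cpow g z != 0.
Proof. exact: cexp_neq0. Qed.

(** The charts measure angles by [acos], which forgets the sign; on the upper half of the right
    half-plane it is the argument. *)
Lemma cpow_polar (g : R) (z : R[i]) : 0 < complex.Re z -> 0 <= complex.Im z ->
  polarC (cn z `^ g) (g * acos (complex.Re z / cn z)) = cpow g z.
Proof.
move=> x0 y0; have cz : 0 < cn z by rewrite (lt_le_trans x0)// (le_trans (ler_norm _) (cn_Re _)).
have -> : acos (complex.Re z / cn z) = atan (complex.Im z / complex.Re z).
  rewrite -cos_arg// cosK// in_itv /=; apply/andP; split.
    by rewrite -[leLHS](@atan0 R); apply: le_atan; rewrite divr_ge0// ltW.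
  by apply: ltW; apply: (lt_trans (atan_ltpi2 _)); have := pi_gt0 R; lra.
by rewrite /polarC /cpow /cexp /clog ReRM ImRM /= /powR gt_eqF.
Qed.
End ComplexPower.

(** * Geometry of the triangulated surface *)

Section FiniteQuantifiers.
Variable R : realType.
(** Finitely many positive thresholds have a positive minimum; this makes constants uniform over
    faces and vertices. *)
Lemma fin_delta (I : finType) (Q : I -> R -> Prop) :
  (forall i, exists2 d : R, 0 < d & Q i d) ->
  (forall i (d d' : R), 0 < d' -> d' <= d -> Q i d -> Q i d') ->
  exists2 d : R, 0 < d & forall i, Q i d.
Proof.
move=> hQ mQ.
have H (s : seq I) : exists2 d : R, 0 < d & forall i, i \in s -> Q i d.
  elim: s => [|i s [d d0 IH]]; first by exists 1.
  have [d' d'0 h] := hQ i; exists (Num.min d d'); first by rewrite lt_min d0.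
  move=> j; rewrite inE => /predU1P[->|/IH].
    by apply: mQ h; rewrite ?lt_min ?d0// ge_min lexx orbT.
  by apply: mQ; rewrite ?lt_min ?d0// ge_min lexx.
have [d d0 h] := H (enum I); exists d => // i; apply: h; exact: mem_enum.
Qed.
Lemma fin_nat (I : finType) (Q : I -> nat -> Prop) :
  (forall i, exists N, Q i N) ->
  (forall i (n m : nat), (n <= m)%N -> Q i n -> Q i m) -> exists N, forall i, Q i N.
Proof.
move=> hQ mQ.
have H (s : seq I) : exists N, forall i, i \in s -> Q i N.
  elim: s => [|i s [N IH]]; first by exists 0%N.
  have [N' h] := hQ i; exists (maxn N N').
  move=> j; rewrite inE => /predU1P[->|/IH].
    by apply: mQ h; exact: leq_maxr.
  by apply: mQ; exact: leq_maxl.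
have [N h] := H (enum I); exists N => i; apply: h; exact: mem_enum.
Qed.
End FiniteQuantifiers.

Section Succ3.
Lemma ord3P (k : 'I_3) : [\/ k = 0, k = 1 | k = 2].
Proof.
by case: k => [[|[|[|//]]] i]; [apply: Or31|apply: Or32|apply: Or33]; apply/val_inj.
Qed.
Lemma succ3_0 : succ3 0 = 1. Proof. by apply/val_inj; rewrite /= inordK. Qed.
Lemma succ3_1 : succ3 1 = 2. Proof. by apply/val_inj; rewrite /= inordK. Qed.
Lemma succ3_2 : succ3 2 = 0. Proof. by apply/val_inj; rewrite /= inordK. Qed.
Definition succ3E := (succ3_0, succ3_1, succ3_2).
Lemma succ3K k : succ3 (succ3 (succ3 k)) = k.
Proof. by case: (ord3P k) => ->; rewrite !succ3E. Qed.
Lemma succ3_neq k : (succ3 k == k) = false.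
Proof. by case: (ord3P k) => ->; rewrite !succ3E. Qed.
Lemma succ3_neq2 k : (succ3 (succ3 k) == k) = false.
Proof. by case: (ord3P k) => ->; rewrite !succ3E. Qed.
Lemma succ3_inj : injective succ3.
Proof. by move=> a b /(congr1 (fun x => succ3 (succ3 x))); rewrite !succ3K. Qed.
Lemma ord3_cases k m : [\/ m = k, m = succ3 k | m = succ3 (succ3 k)].
Proof.
by case: (ord3P k) => ->; case: (ord3P m) => ->; rewrite !succ3E;
   [apply: Or31|apply: Or32|apply: Or33|apply: Or33|apply: Or31|apply: Or32|apply: Or32|apply: Or33|apply: Or31].
Qed.
Lemma sum3 (V : nmodType) (k : 'I_3) (f : 'I_3 -> V) :
  \sum_(i < 3) f i = f k + f (succ3 k) + f (succ3 (succ3 k)).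
Proof.
rewrite (bigD1 k)//= (bigD1 (succ3 k)) ?succ3_neq//= (bigD1 (succ3 (succ3 k)))//=; last first.
  by rewrite succ3_neq2 succ3_neq.
rewrite big1 ?addr0 ?addrA// => i /andP[/andP[]].
by case: (ord3_cases k i) => ->; rewrite eqxx.
Qed.
End Succ3.

Section Euclid2.
Variables (R : realType) (d : nat).
Implicit Types u v w : 'rV[R]_d.
Lemma edotC u v : edot u v = edot v u.
Proof. by apply: eq_bigr => k _; rewrite mulrC. Qed.
Lemma edotDl u v w : edot (u + v) w = edot u w + edot v w.
Proof. by rewrite -big_split; apply: eq_bigr => k _; rewrite mxE mulrDl. Qed.
Lemma edotZl (a : R) u w : edot (a *: u) w = a * edot u w.
Proof. by rewrite /edot mulr_sumr; apply: eq_bigr => k _; rewrite mxE mulrA. Qed.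
Lemma edotNl u w : edot (- u) w = - edot u w.
Proof. by rewrite -scaleN1r edotZl mulN1r. Qed.
Lemma edotDr u v w : edot w (u + v) = edot w u + edot w v.
Proof. by rewrite ![edot w _]edotC edotDl. Qed.
Lemma edotZr (a : R) u w : edot w (a *: u) = a * edot w u.
Proof. by rewrite ![edot w _]edotC edotZl. Qed.
Lemma edotNr u w : edot w (- u) = - edot w u.
Proof. by rewrite ![edot w _]edotC edotNl. Qed.
Definition edotE := (edotDl, edotDr, edotZl, edotZr, edotNl, edotNr).
Lemma edot_ge0 u : 0 <= edot u u.
Proof. by apply: sumr_ge0 => k _; rewrite -expr2 sqr_ge0. Qed.
Lemma contB (T : topologicalType) (f g : T -> R) :
  continuous f -> continuous g -> continuous (fun x => f x - g x).
Proof. by move=> cf cg x; apply: cvgB; [exact: cf|exact: cg]. Qed.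
Lemma contM (T : topologicalType) (f g : T -> R) :
  continuous f -> continuous g -> continuous (fun x => f x * g x).
Proof. by move=> cf cg x; apply: cvgM; [exact: cf|exact: cg]. Qed.
Lemma contC (T : topologicalType) (k : R) : continuous ((fun=> k) : T -> R).
Proof. by move=> x; exact: cvg_cst. Qed.
Lemma cont_sum (T : topologicalType) (I : Type) (s : seq I) (f : I -> T -> R) :
  (forall i, continuous (f i)) -> continuous (fun x => \sum_(i <- s) f i x).
Proof.
move=> cf; elim: s => [|i s IH].
  rewrite (_ : (fun x => _) = (fun=> 0)); first by move=> x; exact: cvg_cst.
  by apply/funext => x; rewrite big_nil.
rewrite (_ : (fun x => _) = (fun x => f i x + \sum_(i <- s) f i x)).
  by move=> x; apply: cvgD; [exact: cf|exact: IH].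
by apply/funext => x; rewrite big_cons.
Qed.
Lemma edot_cont (w : 'rV[R]_d) : continuous (fun x : 'rV[R]_d => edot x w).
Proof.
apply: cont_sum => k.
by apply: contM; [exact: coord_continuous|exact: contC].
Qed.
Definition gram u v : R := edot u u * edot v v - edot u v ^+ 2.
Lemma cont_ball (f : 'rV[R]_d -> R) x : {for x, continuous f} -> forall e : R, 0 < e ->
  exists2 r : R, 0 < r & forall y, ball x r y -> `|f y - f x| < e.
Proof.
move=> cf e e0; move/cvgrPdist_lt : cf => /(_ e e0) /nbhs_ballP[r /= r0 H].
by exists r => // y hy; rewrite distrC; exact: H.
Qed.
End Euclid2.

Section Surface.
Variables (R : realType) (d : nat) (X : TriSurf R d).
Local Notation P := (@pos _ _ X).
Local Notation F := (@face _ _ X).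
Local Notation pt := 'rV[R]_d.
Implicit Types (j : 'I_(nF X)) (k m : 'I_3) (v w : 'I_(nV X)) (b : 'rV[R]_3).
Hypothesis TD : triangulated_disk X.

Lemma face_inj j : injective (F j). Proof. by case: TD => -[_ +]. Qed.

Definition eu j k : pt := P (F j (succ3 k)) - P (F j k).
Definition ev j k : pt := P (F j (succ3 (succ3 k))) - P (F j k).
Lemma euE j k : eu j k = P (F j (succ3 k)) - P (F j k). Proof. by []. Qed.
Lemma evE j k : ev j k = P (F j (succ3 (succ3 k))) - P (F j k). Proof. by []. Qed.

Lemma gram_succ j k : gram (eu j (succ3 k)) (ev j (succ3 k)) = gram (eu j k) (ev j k).
Proof.
have -> : eu j (succ3 k) = ev j k - eu j k by rewrite /eu /ev opprB addrA subrK.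
have -> : ev j (succ3 k) = - eu j k by rewrite /eu /ev succ3K opprB.
move: (eu j k) (ev j k) => u v; rewrite /gram !edotE (edotC v u); ring.
Qed.
Lemma gram_gt0 j k : 0 < gram (eu j k) (ev j k).
Proof.
have h0 : 0 < gram (eu j 0) (ev j 0).
  by case: TD => -[_ _ /(_ j)]; rewrite /gram /eu /ev !succ3E.
case: (ord3P k) => ->//; first by rewrite -succ3_0 gram_succ.
by rewrite -succ3_1 gram_succ -succ3_0 gram_succ.
Qed.

Definition ptj j b : pt := \sum_(k < 3) b 0 k *: P (F j k).
Definition isb b : Prop := (forall k, 0 <= b 0 k) /\ \sum_(k < 3) b 0 k = 1.

Lemma ptj_base j k b : \sum_(k < 3) b 0 k = 1 ->
  ptj j b = P (F j k) + (b 0 (succ3 k) *: eu j k + b 0 (succ3 (succ3 k)) *: ev j k).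
Proof.
rewrite /ptj !(sum3 k) => /eqP; rewrite -subr_eq0 => /eqP h.
have -> : b 0 k = 1 - b 0 (succ3 k) - b 0 (succ3 (succ3 k)).
  by apply/eqP; rewrite -subr_eq0; apply/eqP; rewrite -[RHS]h; ring.
rewrite /eu /ev !scalerBr !scalerBl scale1r.
by apply/rowP => i; rewrite !mxE; ring.
Qed.

(* Barycentric coordinates in face j by Cramer's rule, extended affinely to the
   whole ambient space. *)
Definition lamb j (x : pt) : 'rV[R]_3 :=
  let u := eu j 0 in let v := ev j 0 in let y := x - P (F j 0) in
  let c1 := (edot y u * edot v v - edot y v * edot u v) / gram u v in
  let c2 := (edot y v * edot u u - edot y u * edot u v) / gram u v in
  \row_k (if k == 0 then 1 - c1 - c2 else if k == 1 then c1 else c2).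

Lemma lamb_pt j b : \sum_(k < 3) b 0 k = 1 -> lamb j (ptj j b) = b.
Proof.
move=> hb; rewrite (ptj_base j 0 hb).
have g0 := gram_gt0 j 0.
rewrite (sum3 0) !succ3E in hb; rewrite !succ3E.
have h0 : b 0 0 = 1 - b 0 1 - b 0 2 by rewrite -hb; ring.
apply/rowP => k; rewrite /lamb mxE (addrC (P (F j 0))) addrK.
move: (eu j 0) (ev j 0) g0 => u v g0; rewrite !edotE (edotC v u).
have E1 : ((b 0 1 * edot u u + b 0 2 * edot u v) * edot v v -
  (b 0 1 * edot u v + b 0 2 * edot v v) * edot u v) / gram u v = b 0 1.
  by rewrite /gram; field; move: g0; rewrite /gram => /gt_eqF ->.
have E2 : ((b 0 1 * edot u v + b 0 2 * edot v v) * edot u u -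
  (b 0 1 * edot u u + b 0 2 * edot u v) * edot u v) / gram u v = b 0 2.
  by rewrite /gram; field; move: g0; rewrite /gram => /gt_eqF ->.
by rewrite E1 E2; case: (ord3P k) => -> /=; rewrite ?h0.
Qed.

Lemma lamb_cont j k : continuous (fun x => lamb j x 0 k).
Proof.
have c (w w' : pt) : continuous (fun x : pt => edot (x - w) w').
  rewrite (_ : (fun x => _) = (fun x => edot x w' - edot w w')).
    by apply: contB; [exact: edot_cont|exact: contC].
  by apply/funext => z; rewrite !edotE.
have c2 (w w1 w2 : pt) (p q r : R) : continuous (fun x : pt => (edot (x - w) w1 * p - edot (x - w) w2 * q) * r).
  apply: contM; last exact: contC.
  by apply: contB; apply: contM; by [exact: c|exact: contC].
pose c1 := fun x : pt => (edot (x - P (F j 0)) (eu j 0) * edot (ev j 0) (ev j 0) -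
  edot (x - P (F j 0)) (ev j 0) * edot (eu j 0) (ev j 0)) / gram (eu j 0) (ev j 0).
pose c2' := fun x : pt => (edot (x - P (F j 0)) (ev j 0) * edot (eu j 0) (eu j 0) -
  edot (x - P (F j 0)) (eu j 0) * edot (eu j 0) (ev j 0)) / gram (eu j 0) (ev j 0).
rewrite (_ : (fun x => _) = (fun x => if k == 0 then 1 - c1 x - c2' x else
   if k == 1 then c1 x else c2' x)); last by apply/funext => x; rewrite mxE.
case: (k == 0).
  by apply: contB; [apply: contB; [exact: contC|exact: c2]|exact: c2].
by case: (k == 1); exact: c2.
Qed.

Lemma mem_faceset j v : reflect (exists k, v = F j k) (v \in faceset j).
Proof. by apply: (iffP imsetP) => [[k _ ->]|[k ->]]; exists k. Qed.

Lemma cfaceP j (x : pt) : cface j x <-> exists2 b, isb b & x = ptj j b.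
Proof.
split=> [[l [l0 [lz [l1 ->]]]]|[b [b0 b1] ->]].
  exists (\row_k l (F j k)).
    split=> [k|]; first by rewrite mxE.
    rewrite -l1 /faceset big_imset /=; last by move=> a c _ _; exact: face_inj.
    by apply: eq_big => [k|k _]; rewrite ?mxE ?inE.
  rewrite /ptj /faceset big_imset /=; last by move=> a c _ _; exact: face_inj.
  by apply: eq_big => [k|k _]; rewrite ?mxE ?inE.
have E k : \sum_(m < 3 | F j m == F j k) b 0 m = b 0 k.
  rewrite (bigD1 k)//= big1 ?addr0// => m /andP[/eqP/face_inj -> ]; by rewrite eqxx.
exists (fun v => \sum_(k < 3 | F j k == v) b 0 k); split; last split; last split.
- by move=> v; apply: sumr_ge0.
- move=> v /mem_faceset h; apply: big1 => k /eqP kv; by case: h; exists k.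
- rewrite /faceset big_imset /=; last by move=> a c _ _; exact: face_inj.
  rewrite -[RHS]b1; apply: eq_big => [k|k _]; first by rewrite !inE.
  by rewrite E.
- rewrite /faceset big_imset /=; last by move=> a c _ _; exact: face_inj.
  apply: eq_big => [k|k _]; first by rewrite !inE.
  by rewrite E.
Qed.

Lemma surfP (x : pt) : surf X x <-> exists j, exists2 b, isb b & x = ptj j b.
Proof.
split=> [[j _ /cfaceP[b hb ->]]|[j [b hb ->]]]; first by exists j, b.
by exists j => //; apply/cfaceP; exists b.
Qed.

Lemma cface_lamb j (x : pt) : cface j x -> isb (lamb j x) /\ x = ptj j (lamb j x).
Proof. by move=> /cfaceP[b [b0 b1] ->]; rewrite lamb_pt. Qed.

(** The face is chosen arbitrarily, which [hat_face] shows to be immaterial; off the surface the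
    value is 0. *)
Definition hat v (x : pt) : R :=
  if pselect (exists j, cface j x) is left h then
    \sum_(k < 3 | F (projT1 (cid h)) k == v) lamb (projT1 (cid h)) x 0 k else 0.

Lemma conv_lamb j (A : {set 'I_(nV X)}) (l : 'I_(nV X) -> R) : A \subset faceset j ->
  (forall v, v \notin A -> l v = 0) -> \sum_(v in A) l v = 1 ->
  lamb j (\sum_(v in A) l v *: P v) = \row_k l (F j k).
Proof.
move=> Aj lz l1.
have S (V : nmodType) (f : 'I_(nV X) -> V) : (forall v, v \notin A -> f v = 0) ->
    \sum_(v in A) f v = \sum_(k < 3) f (F j k).
  move=> fz; transitivity (\sum_(v in faceset j) f v).
    rewrite [RHS](bigID (mem A)) /= [X in _ = _ + X]big1 ?addr0; last by move=> v /andP[_ /fz].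
    apply: eq_bigl => v; apply/idP/andP => [vA|[]//]; split=> //.
    exact: (fintype.subsetP Aj).
  rewrite /faceset big_imset /=; last by move=> a c _ _; exact: face_inj.
  by apply: eq_bigl => k; rewrite inE.
rewrite S; last by move=> v /lz ->; rewrite scale0r.
rewrite -[X in lamb j X](_ : ptj j (\row_k l (F j k)) = _); last first.
  by apply: eq_bigr => k _; rewrite mxE.
by rewrite lamb_pt// -[RHS]l1 S//; apply: eq_bigr => k _; rewrite mxE.
Qed.

(** Two faces meet in the hull of their common vertices, so the coordinates of [x] in both are the
    weights of one convex combination. *)
Lemma hat_face j (x : pt) v : cface j x -> hat v x = \sum_(k < 3 | F j k == v) lamb j x 0 k.
Proof.
move=> hx; rewrite /hat; case: pselect => [h|[]]; last by exists j.
case: cid => j' /= hx'.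
have : (cface j' `&` cface j) x by split.
case: TD => _ [_ _ ->] _ _ [l [l0 [lz [l1 ->]]]].
rewrite !(conv_lamb _ lz l1) ?subsetIl ?subsetIr//.
have E j0 : (forall w, w \notin faceset j' :&: faceset j -> l w = 0) ->
    \sum_(k < 3 | F j0 k == v) (\row_k l (F j0 k)) 0 k = if v \in faceset j0 then l v else 0.
  move=> _; case: ifPn => [/mem_faceset[k ->]|/mem_faceset nv].
    rewrite (bigD1 k)//= mxE big1 ?addr0// => m /andP[/eqP/face_inj ->]; by rewrite eqxx.
  by apply: big1 => k /eqP kv; case: nv; exists k.
rewrite !E//; case: ifPn => h1; case: ifPn => h2 //.
  by apply: lz; rewrite inE (negbTE h2) andbF.
by apply/esym/lz; rewrite inE (negbTE h1).
Qed.

Lemma hat_pt j b k : isb b -> hat (F j k) (ptj j b) = b 0 k.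
Proof.
move=> hb; rewrite (@hat_face j); last by apply/cfaceP; exists b.
rewrite lamb_pt; last by case: hb.
by rewrite (bigD1 k)//= big1 ?addr0// => m /andP[/eqP/face_inj ->]; rewrite eqxx.
Qed.
Lemma hat_pt0 j b v : isb b -> v \notin faceset j -> hat v (ptj j b) = 0.
Proof.
move=> hb /mem_faceset nv; rewrite (@hat_face j); last by apply/cfaceP; exists b.
by apply: big1 => k /eqP kv; case: nv; exists k.
Qed.

Lemma hat_ge0 v (x : pt) : surf X x -> 0 <= hat v x.
Proof.
move=> /surfP[j [b hb ->]]; have [/mem_faceset[k ->]|h] := boolP (v \in faceset j).
  by rewrite hat_pt//; case: hb.
by rewrite hat_pt0.
Qed.

Lemma isb_le1 b k : isb b -> b 0 k <= 1.
Proof.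
move=> [b0 b1]; rewrite -[leRHS]b1 (sum3 k) -addrA lerDl.
by rewrite addr_ge0.
Qed.

Lemma hat_le1 v (x : pt) : surf X x -> hat v x <= 1.
Proof.
move=> /surfP[j [b hb ->]]; have [/mem_faceset[k ->]|h] := boolP (v \in faceset j).
  by rewrite hat_pt//; exact: isb_le1.
by rewrite hat_pt0.
Qed.

Lemma hat_sum (x : pt) : surf X x -> x = \sum_v hat v x *: P v.
Proof.
move=> /surfP[j [b hb ->]].
rewrite (bigID (fun v => v \in faceset j)) /= [X in _ = _ + X]big1 ?addr0; last first.
  by move=> v nv; rewrite hat_pt0// scale0r.
rewrite /faceset big_imset /=; last by move=> a c _ _; exact: face_inj.
by apply: eq_big => [k|k _]; rewrite ?inE// hat_pt.
Qed.

(** A point misses a face either because a coordinate is negative or because, outside the plane of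
    the face, it differs from the point with the same coordinates. Both conditions are open. *)
Lemma cface_closed j (x : pt) : ~ cface j x ->
  exists2 r : R, 0 < r & forall y, ball x r y -> ~ cface j y.
Proof.
move=> nx.
have [[k hk]|hk] := pselect (exists k, lamb j x 0 k < 0).
  have [r r0 H] := cont_ball (@lamb_cont j k x) (ltac:(by rewrite oppr_gt0; exact: hk) : 0 < - lamb j x 0 k).
  exists r => // y /H h /cface_lamb[[/(_ k) l0 _] _].
  by move: h; rewrite ltr_norml => /andP[_]; lra.
have l0 k : 0 <= lamb j x 0 k by rewrite leNgt; apply/negP => h; apply: hk; exists k.
have l1 : \sum_(k < 3) lamb j x 0 k = 1.
  by rewrite (sum3 0) !succ3E !mxE /=; ring.
have [e hi] : exists i, x 0 i != ptj j (lamb j x) 0 i.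
  apply/existsP; rewrite -negb_forall; apply/forallP => h; apply: nx; apply/cfaceP.
  by exists (lamb j x) => //; apply/rowP => i; apply/eqP.
pose f (y : pt) := y 0 e - \sum_(k < 3) lamb j y 0 k * P (F j k) 0 e.
have fE y : f y = y 0 e - ptj j (lamb j y) 0 e.
  by rewrite /f /ptj summxE; congr (_ - _); apply: eq_bigr => k _; rewrite [RHS]mxE.
have cf : continuous f.
  apply: contB; first exact: coord_continuous.
  by apply: cont_sum => k; apply: contM; [exact: lamb_cont|exact: contC].
have f0 : 0 < `|f x| by rewrite normr_gt0 fE subr_eq0.
have [r r0 H] := cont_ball (cf x) f0.
exists r => // y /H h /cface_lamb[_ yE]; move: h.
by rewrite (_ : f y = 0) ?sub0r ?normrN ?ltxx// fE -yE subrr.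
Qed.

Lemma hat_cont v (x : pt) (e : R) : surf X x -> 0 < e ->
  exists2 r : R, 0 < r & forall y, surf X y -> ball x r y -> `|hat v y - hat v x| < e.
Proof.
move=> hx e0.
have [r r0 H] : exists2 r : R, 0 < r & forall j, forall y, cface j y -> ball x r y ->
    `|hat v y - hat v x| < e.
  apply: fin_delta => [j|j r r' r'0 r'r H y hy hb]; last first.
    by apply: H => //; exact: le_ball hb.
  have [hj|hj] := pselect (cface j x); last first.
    by have [r r0 H] := cface_closed hj; exists r => // y yj /H.
  pose f (y : pt) := \sum_(k < 3) (F j k == v)%:R * lamb j y 0 k.
  have fE y : cface j y -> hat v y = f y.
    move=> hy; rewrite (hat_face _ hy) /f big_mkcond; apply: eq_bigr => k _.
    by case: (F j k == v); rewrite ?mul1r ?mul0r.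
  have cf : continuous f.
    by apply: cont_sum => k; apply: contM; [exact: contC|exact: lamb_cont].
  have [r r0 H] := cont_ball (cf x) e0.
  by exists r => // y hy /H; rewrite !fE.
by exists r => // y [j _ hy]; exact: H hy.
Qed.
End Surface.

Arguments cn : simpl never.
Arguments cexp : simpl never.
Arguments clog : simpl never.
Arguments cpow : simpl never.
Arguments edot : simpl never.
Arguments enorm : simpl never.
Arguments gram : simpl never.
Arguments ptj : simpl never.
Arguments lamb : simpl never.
Arguments hat : simpl never.
Arguments polarC : simpl never.

(** * The flat complex coordinate of a face *)

Section FlatCoordinates.
Variables (R : realType) (d : nat) (X : TriSurf R d).
Local Notation P := (@pos _ _ X).
Local Notation F := (@face _ _ X).
Local Notation pt := 'rV[R]_d.
Implicit Types (j : 'I_(nF X)) (k m : 'I_3) (v w : 'I_(nV X)) (b : 'rV[R]_3) (z : R[i]).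
Hypothesis TD : triangulated_disk X.
Local Notation eu := (@eu R d X).
Local Notation ev := (@ev R d X).

Lemma euu_gt0 j k : 0 < edot (eu j k) (eu j k).
Proof.
have := gram_gt0 TD j k; rewrite /gram => g0.
have := edot_ge0 (eu j k); rewrite le_eqVlt => /predU1P[h|//].
by move: g0; rewrite -h mul0r sub0r oppr_gt0 ltNge sqr_ge0.
Qed.
Lemma evv_gt0 j k : 0 < edot (ev j k) (ev j k).
Proof.
have := gram_gt0 TD j k; rewrite /gram => g0.
have := edot_ge0 (ev j k); rewrite le_eqVlt => /predU1P[h|//].
by move: g0; rewrite -h mulr0 sub0r oppr_gt0 ltNge sqr_ge0.
Qed.

(* Shape of face j seen from its k-th vertex: the face is similar to the triangle
   0, 1, tau, with the k-th vertex at 0 and the next one at 1. *)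
Definition tau j k : R[i] :=
  (edot (eu j k) (ev j k) / edot (eu j k) (eu j k)) +i*
  (Num.sqrt (gram (eu j k) (ev j k)) / edot (eu j k) (eu j k)).
Definition zt j k b : R[i] :=
  (b 0 (succ3 k))%:C + tau j k * (b 0 (succ3 (succ3 k)))%:C.
(** Inverse of [zt] on the whole plane: the coordinates sum to 1 but may be negative, and [isb]
    singles out the points of the face. *)
Definition bz j k z : 'rV[R]_3 :=
  let l2 := complex.Im z / complex.Im (tau j k) in
  let l1 := complex.Re z - l2 * complex.Re (tau j k) in
  \row_m (if m == k then 1 - l1 - l2 else if m == succ3 k then l1 else l2).

Lemma tau_im_gt0 j k : 0 < complex.Im (tau j k).
Proof. by rewrite /= divr_gt0 ?euu_gt0// sqrtr_gt0 gram_gt0. Qed.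

Lemma Re_zt j k b : complex.Re (zt j k b) =
  b 0 (succ3 k) + complex.Re (tau j k) * b 0 (succ3 (succ3 k)).
Proof. by rewrite /zt ReD ReMc /= mulr0 subr0. Qed.
Lemma Im_zt j k b : complex.Im (zt j k b) = complex.Im (tau j k) * b 0 (succ3 (succ3 k)).
Proof. by rewrite /zt ImD ImMc /= mulr0 !add0r. Qed.

Lemma bz0 j k z : bz j k z 0 k =
  1 - (complex.Re z - complex.Im z / complex.Im (tau j k) * complex.Re (tau j k))
    - complex.Im z / complex.Im (tau j k).
Proof. by rewrite mxE eqxx. Qed.
Lemma bz1 j k z : bz j k z 0 (succ3 k) =
  complex.Re z - complex.Im z / complex.Im (tau j k) * complex.Re (tau j k).
Proof. by rewrite mxE succ3_neq eqxx. Qed.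
Lemma bz2 j k z : bz j k z 0 (succ3 (succ3 k)) = complex.Im z / complex.Im (tau j k).
Proof. by rewrite mxE succ3_neq2 succ3_neq. Qed.
Lemma bz_sum j k z : \sum_(m < 3) bz j k z 0 m = 1.
Proof. by rewrite (sum3 k) bz0 bz1 bz2; ring. Qed.
Lemma zt_bz j k z : zt j k (bz j k z) = z.
Proof.
have t0 := tau_im_gt0 j k; apply: ReIm_eq; rewrite ?Re_zt ?Im_zt bz2 ?bz1; first by ring.
by field; rewrite gt_eqF.
Qed.
Lemma bz_zt j k b : \sum_(m < 3) b 0 m = 1 -> bz j k (zt j k b) = b.
Proof.
rewrite (sum3 k) => hb; have t0 := tau_im_gt0 j k.
have E : complex.Im (zt j k b) / complex.Im (tau j k) = b 0 (succ3 (succ3 k)).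
  by rewrite Im_zt; field; rewrite gt_eqF.
apply/rowP => m; case: (ord3_cases k m) => ->; rewrite ?bz0 ?bz1 ?bz2 E ?Re_zt//; last by ring.
by rewrite -hb; ring.
Qed.

Lemma tau_succ j k : tau j (succ3 k) = (1 - tau j k)^-1.
Proof.
have t0 := tau_im_gt0 j k.
have n0 : 1 - tau j k != 0.
  apply: contraTneq t0 => /(congr1 (@complex.Im R)).
  by rewrite ImD ImN [complex.Im 1]/= sub0r [complex.Im 0]/= => /eqP; rewrite oppr_eq0 => /eqP ->; rewrite ltxx.
apply: (mulIf n0); rewrite mulVf//.
have g := gram_succ j k; have g0 := gram_gt0 TD j k.
have u0 := euu_gt0 j k; have u1 := euu_gt0 j (succ3 k).
have s2 : Num.sqrt (gram (eu j k) (ev j k)) ^+ 2 = gram (eu j k) (ev j k).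
  by rewrite sqr_sqrtr// ltW.
have Eu : eu j (succ3 k) = ev j k - eu j k by rewrite !euE !evE opprB addrA subrK.
have Ev : ev j (succ3 k) = - eu j k by rewrite !euE !evE succ3K opprB.
rewrite /tau g; move: g0 u0 u1 s2 {t0 n0 g}; rewrite Eu Ev /gram.
move: (eu j k) (ev j k) => u v; rewrite !edotE (edotC v u).
move: (Num.sqrt _) => s g0 u0 u1 s2.
have u1' : edot v v - edot u v + - (edot u v - edot u u) != 0.
  by apply: lt0r_neq0; move: u1; lra.
apply: ReIm_eq; rewrite ?(ReMc, ImMc, ReD, ImD, ReN, ImN) /=.
  apply/eqP; rewrite -subr_eq0; apply/eqP.
  transitivity ((s ^+ 2 - (edot u u * edot v v - edot u v ^+ 2)) /
     (edot u u * (edot v v - edot u v + - (edot u v - edot u u)))).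
    by field; apply/andP; split; apply: lt0r_neq0; move: u0 u1; lra.
  by rewrite s2 subrr mul0r.
by field; apply/andP; split; apply: lt0r_neq0; move: u0 u1; lra.
Qed.

Lemma tau_neq1 j k : tau j k - 1 != 0.
Proof.
have t0 := tau_im_gt0 j k; apply: contraTneq t0 => /(congr1 (@complex.Im R)).
by rewrite ImD ImN [complex.Im 1]/= subr0 [complex.Im 0]/= => ->; rewrite ltxx.
Qed.

Lemma zt_succ j k b : \sum_(m < 3) b 0 m = 1 ->
  zt j (succ3 k) b = (zt j k b - 1) / (tau j k - 1).
Proof.
rewrite (sum3 k) => hb; rewrite /zt tau_succ succ3K.
have n0 := tau_neq1 j k.
have -> : (b 0 k)%:C = 1 - (b 0 (succ3 k))%:C - (b 0 (succ3 (succ3 k)))%:C.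
  have -> : b 0 k = 1 - b 0 (succ3 k) - b 0 (succ3 (succ3 k)) by rewrite -hb; ring.
  by rewrite !rmorphB.
by field; rewrite n0 /= -opprB oppr_eq0.
Qed.

(** Holomorphy on a face therefore does not depend on the vertex from which its flat coordinate is
    taken. *)
Lemma zt_base j k m : exists p q : R[i], q != 0 /\
  forall b, \sum_(m < 3) b 0 m = 1 -> zt j m b = p + q * zt j k b.
Proof.
have S l : exists p q : R[i], q != 0 /\
    forall b, \sum_(m < 3) b 0 m = 1 -> zt j (succ3 l) b = p + q * zt j l b.
  exists (- (tau j l - 1)^-1), (tau j l - 1)^-1; split; first by rewrite invr_eq0 tau_neq1.
  by move=> b /zt_succ ->; field; exact: tau_neq1.
case: (ord3_cases k m) => ->; last 2 first.
- exact: S.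
- have [p [q [q0 H]]] := S k; have [p' [q' [q'0 H']]] := S (succ3 k).
  exists (p' + q' * p), (q' * q); split; first by rewrite mulf_neq0.
  by move=> b hb; rewrite H'// H//; ring.
by exists 0, 1; split; [exact: oner_neq0|move=> b _; ring].
Qed.

Definition bnorm b : R := \sum_(k < 3) `|b 0 k|.
Lemma bnorm_ge k b : `|b 0 k| <= bnorm b.
Proof.
rewrite /bnorm (sum3 k) -addrA lerDl; exact: addr_ge0.
Qed.

Lemma fin_bound (I : finType) (Q : I -> R -> Prop) : (forall i, exists C, Q i C) ->
  (forall i (C C' : R), C <= C' -> Q i C -> Q i C') -> exists2 C : R, 0 < C & forall i, Q i C.
Proof.
move=> hQ mQ.
have [|i dd dd' h1 h2|r r0 H] := @fin_delta R I (fun i r => Q i r^-1).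
- move=> i; have [C hC] := hQ i; exists (Num.max C 1)^-1.
    by rewrite invr_gt0 lt_max ltr01 orbT.
  by apply: mQ hC; rewrite invrK le_max lexx.
- by apply: mQ; rewrite lef_pV2// posrE// (lt_le_trans h1).
by exists r^-1 => //; rewrite invr_gt0.
Qed.

Lemma bz_lip : exists2 C : R, 0 < C & forall j k m z z',
  `|bz j k z 0 m - bz j k z' 0 m| <= C * cn (z - z').
Proof.
have [|[j k] C C' CC H m z z'|C C0 H] := @fin_bound ('I_(nF X) * 'I_3)%type (fun jk C =>
   forall m z z', `|bz jk.1 jk.2 z 0 m - bz jk.1 jk.2 z' 0 m| <= C * cn (z - z')); last first.
- by exists C => // j k; exact: (H (j, k)).
- by apply: (le_trans (H m z z')); rewrite ler_wpM2r// cn_ge0.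
case=> j k /=; have t0 := tau_im_gt0 j k.
set T := complex.Im (tau j k) in t0; set S := complex.Re (tau j k).
exists (1 + T^-1 * (1 + `|S|)) => m z z'.
have h1 := cn_Re (z - z'); have h2 := cn_Im (z - z'); rewrite ReD ReN in h1; rewrite ImD ImN in h2.
have N0 := cn_ge0 (z - z').
have e2 : `|bz j k z 0 (succ3 (succ3 k)) - bz j k z' 0 (succ3 (succ3 k))| <= T^-1 * cn (z - z').
  rewrite !bz2 -/T -mulrBl normrM (gtr0_norm (_ : 0 < T^-1)) ?invr_gt0// mulrC.
  by rewrite ler_pM2l ?invr_gt0.
have e1 : `|bz j k z 0 (succ3 k) - bz j k z' 0 (succ3 k)| <= (1 + T^-1 * `|S|) * cn (z - z').
  rewrite !bz1 -/T -/S (_ : _ - _ - _ = (complex.Re z - complex.Re z') -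
    (complex.Im z / T - complex.Im z' / T) * S); last by ring.
  apply: (le_trans (ler_normB _ _)); rewrite [leRHS]mulrDl mul1r; apply: lerD => //.
  rewrite normrM mulrAC; apply: ler_wpM2r => //.
  by move: e2; rewrite !bz2.
have TT : 0 < T^-1 by rewrite invr_gt0.
have TS : 0 <= T^-1 * `|S| by rewrite mulr_ge0// ltW.
case: (ord3_cases k m) => ->.
- rewrite (_ : _ - _ = - (bz j k z 0 (succ3 k) - bz j k z' 0 (succ3 k)) -
    (bz j k z 0 (succ3 (succ3 k)) - bz j k z' 0 (succ3 (succ3 k)))); last first.
    by rewrite !bz0 !bz1 !bz2; ring.
  apply: (le_trans (ler_normB _ _)); rewrite normrN; nra.
- by apply: (le_trans e1); nra.
- by apply: (le_trans e2); nra.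
Qed.

Lemma zt_lip : exists2 C : R, 0 < C & forall j k b b', cn (zt j k b - zt j k b') <= C * bnorm (b - b').
Proof.
have [|[j k] C C' CC H b b'|C C0 H] := @fin_bound ('I_(nF X) * 'I_3)%type (fun jk C =>
   forall b b', cn (zt jk.1 jk.2 b - zt jk.1 jk.2 b') <= C * bnorm (b - b')); last first.
- by exists C => // j k; exact: (H (j, k)).
- by apply: (le_trans (H b b')); rewrite ler_wpM2r// sumr_ge0.
case=> j k; exists (1 + cn (tau j k)) => b b'.
rewrite -[(j, k).1]/j -[(j, k).2]/k; have -> : zt j k b - zt j k b' = (b 0 (succ3 k) - b' 0 (succ3 k))%:C +
   tau j k * (b 0 (succ3 (succ3 k)) - b' 0 (succ3 (succ3 k)))%:C.
  by rewrite /zt !rmorphB /=; ring.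
apply: (le_trans (cnD _ _)); rewrite cnM !cnR [leRHS]mulrDl mul1r.
have h m := bnorm_ge m (b - b'); have h1 := h (succ3 k); have h2 := h (succ3 (succ3 k)).
rewrite !mxE in h1 h2; apply: lerD => //; apply: ler_wpM2l => //; exact: cn_ge0.
Qed.

Lemma edot_zt j k b : \sum_(m < 3) b 0 m = 1 ->
  edot (ptj j b - P (F j k)) (eu j k) = edot (eu j k) (eu j k) * complex.Re (zt j k b) /\
  edot (ptj j b - P (F j k)) (ptj j b - P (F j k)) = edot (eu j k) (eu j k) * cn (zt j k b) ^+ 2.
Proof.
move=> hb; rewrite (ptj_base j k hb) (addrC (P _)) addrK.
have u0 := euu_gt0 j k; have g0 := gram_gt0 TD j k.
have s2 : Num.sqrt (gram (eu j k) (ev j k)) ^+ 2 = gram (eu j k) (ev j k).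
  by rewrite sqr_sqrtr// ltW.
rewrite cn2E Re_zt Im_zt /tau /=; move: s2; rewrite /gram.
move: (eu j k) (ev j k) u0 => u v u0; move: (Num.sqrt _) => s s2.
rewrite !edotE (edotC v u); split; first by field; rewrite gt_eqF.
rewrite exprMn expr_div_n s2.
by field; rewrite gt_eqF.
Qed.
End FlatCoordinates.
Arguments zt : simpl never.
Arguments bz : simpl never.
Arguments tau : simpl never.
Arguments bnorm : simpl never.

Section Boundary.
Variables (R : realType) (d : nat) (X : TriSurf R d).
Local Notation P := (@pos _ _ X).
Local Notation F := (@face _ _ X).
Local Notation pt := 'rV[R]_d.
Implicit Types (j : 'I_(nF X)) (k m : 'I_3) (v w : 'I_(nV X)) (b : 'rV[R]_3).
Hypothesis TD : triangulated_disk X.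

Lemma oedgeP v w : reflect (exists j k, F j k = v /\ F j (succ3 k) = w) (oedge v w).
Proof.
apply: (iffP existsP) => [[j /existsP[k /andP[/eqP h1 /eqP h2]]]|[j [k [h1 h2]]]].
  by exists j, k.
by exists j; apply/existsP; exists k; rewrite h1 h2 !eqxx.
Qed.

Definition edgeb k (t : R) : 'rV[R]_3 :=
  \row_m (if m == k then 1 - t else if m == succ3 k then t else 0).
Lemma edgeb_isb k (t : R) : 0 <= t <= 1 -> isb (edgeb k t).
Proof.
move=> /andP[t0 t1]; split=> [m|]; last first.
  rewrite (sum3 k) !mxE eqxx succ3_neq eqxx succ3_neq2 succ3_neq; ring.
by rewrite mxE; case: (m == k); [rewrite subr_ge0|case: (m == _)].
Qed.
Lemma ptj_edgeb j k (t : R) : ptj j (edgeb k t) = (1 - t) *: P (F j k) + t *: P (F j (succ3 k)).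
Proof.
by rewrite /ptj (sum3 k) !mxE eqxx succ3_neq eqxx succ3_neq2 succ3_neq scale0r addr0.
Qed.

Lemma conv2_hat v w (x : pt) u : oedge v w -> conv2 (P v) (P w) x -> 0 < hat u x -> u = v \/ u = w.
Proof.
move=> /oedgeP[j [k [<- <-]]] [l1 [l2 [h1 h2 h3 ->]]].
have -> : l1 *: P (F j k) + l2 *: P (F j (succ3 k)) = ptj j (edgeb k l2).
  by rewrite ptj_edgeb -h3 addrK.
have hb : isb (edgeb k l2) by apply: edgeb_isb; rewrite h2 -h3 lerDr.
have [/mem_faceset[m ->]|h] := boolP (u \in faceset j); last by rewrite hat_pt0// ltxx.
rewrite hat_pt//; case: (ord3_cases k m) => ->; [by left|by right|].
by rewrite mxE succ3_neq2 succ3_neq ltxx.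
Qed.

(** Only the two ends of a boundary edge have positive hat functions on it, so the two positive
    coordinates identify the edge. The opposite order is excluded because the reverse of a boundary
    edge belongs to no face. *)
Lemma bdsurf_face j k b : isb b -> 0 < b 0 k -> 0 < b 0 (succ3 k) -> bdsurf X (ptj j b) ->
  b 0 (succ3 (succ3 k)) = 0 /\ bedge (F j k) (F j (succ3 k)).
Proof.
move=> hb b0 b1 [v [w [/andP[vw nwv] hx]]].
have H m : 0 < b 0 m -> F j m = v \/ F j m = w.
  by rewrite -(hat_pt TD j m hb) => h; apply: conv2_hat hx h.
have fi := face_inj TD (j := j).
have nk m : succ3 m <> m by move/eqP; rewrite succ3_neq.
have nk2 m : succ3 (succ3 m) <> m by move/eqP; rewrite succ3_neq2.
case: (H k b0) => ek; case: (H _ b1) => ek1.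
- by case: (nk k); apply: fi; rewrite ek ek1.
- split; last by rewrite ek ek1 /bedge vw.
  apply/eqP; rewrite eq_le (hb.1 _) andbT leNgt; apply/negP => /H[] h.
    by case: (nk2 k); apply: fi; rewrite ek h.
  by case: (nk (succ3 k)); apply: fi; rewrite ek1 h.
- case/negP: nwv; apply/oedgeP; exists j, k; split=> //.
- by case: (nk k); apply: fi; rewrite ek ek1.
Qed.
End Boundary.

Section ComplexTopology.
Variable R : realType.
Lemma ltC_cn (z : R[i]) (e : R) : (`|z| < e%:C) = (cn z < e).
Proof. by rewrite normcn ltcR. Qed.
Lemma ballC (z w : R[i]^o) (e : R) : ball z e%:C w <-> cn (w - z) < e.
Proof. by rewrite -ball_normE /= ltC_cn cnC. Qed.
Lemma gt0C (r : R[i]) : 0 < r -> r = (complex.Re r)%:C /\ 0 < complex.Re r.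
Proof. by case: r => a b; rewrite ltcE /= => /andP[/eqP -> a0]. Qed.
Lemma nbhs_cn (z : R[i]^o) (A : set R[i]^o) : nbhs z A <->
  exists2 e : R, 0 < e & forall w, cn (w - z) < e -> A w.
Proof.
split=> [/nbhs_ballP[r /= r0 H]|[e e0 H]].
  have [rE rr0] := gt0C r0; exists (complex.Re r) => // w h.
  by apply: H; rewrite rE; apply/ballC.
by apply/nbhs_ballP; exists e%:C => /=; [rewrite ltcR|move=> w /ballC; exact: H].
Qed.

Lemma derivable_cder (g : R[i] -> R[i]) (z : R[i]) : derivable (g : R[i]^o -> R[i]^o) z 1 ->
  cder g z ('D_1 (g : R[i]^o -> R[i]^o) z).
Proof.
move=> /cvg_ex[/= l hl].
have -> : 'D_1 (g : R[i]^o -> R[i]^o) z = l by apply: cvg_lim.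
move=> e e0; move/cvgrPdist_lt : hl => /(_ e%:C); rewrite ltcR => /(_ e0) /nbhs_cn[d d0 H].
exists d => // w hw; have [->|wz] := eqVneq w z.
  by rewrite !subrr mulr0 subr0 cn0 mulr0.
have h0 : w - z != 0 by rewrite subr_eq0.
have := H (w - z); rewrite subr0 => /(_ hw h0).
rewrite ltC_cn [(w - z) *: _]mulr1 subrK /GRing.scale /= => h1.
rewrite (_ : g w - g z - l * (w - z) = - (w - z) * (l - (w - z)^-1 * (g w - g z))).
  by rewrite cnM cnN mulrC ler_wpM2r ?cn_ge0// ltW.
by field.
Qed.

Lemma polarCM (r s a b : R) : polarC (r * s) (a + b) = polarC r a * polarC s b :> R[i].
Proof. by apply: ReIm_eq; rewrite ?(ReMc, ImMc) /polarC /= ?cosD ?sinD; ring. Qed.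
Lemma polarC_neq0 (r a : R) : 0 < r -> polarC r a != 0 :> R[i].
Proof.
move=> r0; rewrite -cn_gt0 cnE /polarC /= !exprMn -mulrDr cos2Dsin2 mulr1 sqrtr_sqr.
by rewrite normr_gt0 gt_eqF.
Qed.
End ComplexTopology.

(** * Cone charts in flat coordinates *)

Section Charts.
Variables (R : realType) (d : nat) (X : TriSurf R d).
Local Notation P := (@pos _ _ X).
Local Notation F := (@face _ _ X).
Local Notation pt := 'rV[R]_d.
Implicit Types (j : 'I_(nF X)) (k m : 'I_3) (v w i : 'I_(nV X)) (b : 'rV[R]_3).
Variables (v1 v2 v3 : 'I_(nV X)) (zeta : R) (phi : 'I_(nV X) -> pt -> R[i]^o).
Hypotheses (TD : triangulated_disk X) (zeta0 : 0 < zeta) (zeta1 : zeta < 4^-1).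
Hypothesis SA : standing_assumption X v1 v2 v3.
Hypothesis CH : forall i, is_chart X v1 v2 v3 zeta i (phi i).
Local Notation eu := (@eu R d X).
Local Notation ev := (@ev R d X).
Local Notation gamma := (gam v1 v2 v3).

Lemma enorm2 (u : pt) : enorm u ^+ 2 = edot u u.
Proof. by rewrite sqr_sqrtr// edot_ge0. Qed.
Lemma eu_gt0 j k : 0 < enorm (eu j k).
Proof. by rewrite sqrtr_gt0 euu_gt0. Qed.
Lemma ev_gt0 j k : 0 < enorm (ev j k).
Proof. by rewrite sqrtr_gt0 evv_gt0. Qed.

Lemma cos_theta j k : let t := edot (eu j k) (ev j k) / (enorm (eu j k) * enorm (ev j k)) in
  theta_at j k = acos t /\ -1 < t < 1.
Proof.
rewrite /=; split=> //; have := gram_gt0 TD j k; rewrite /gram -!enorm2.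
have := eu_gt0 j k; have := ev_gt0 j k.
move: (enorm _) (enorm _) (edot _ _) => q p s q0 p0 h.
have pq : 0 < p * q by exact: mulr_gt0.
have : `|s / (p * q)| < 1.
  rewrite -sqrtr_sqr -[ltRHS]sqrtr1 ltr_sqrt// expr_div_n ltr_pdivrMr ?exprn_gt0//.
  rewrite mul1r exprMn; move: h; lra.
by rewrite (mulrC q p) ltr_norml.
Qed.

Lemma theta_at_gt0 j k : 0 < theta_at j k.
Proof. by have [-> /andP[h1 h2]] := cos_theta j k; apply: acos_gt0; rewrite h2 ltW. Qed.

(** Angles below 60.4 degrees are acute. Seen from a vertex, the rest of the face then lies in the
    right half-plane, where [cpow] is holomorphic. *)
Lemma tau_re_gt0 j k : 0 < complex.Re (tau j k).
Proof.
rewrite /= divr_gt0 ?euu_gt0// ltNge; apply/negP => h.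
have [tE /andP[h1 h2]] := cos_theta j k; have [_ t90 _] := SA j k.
set t := _ / _ in tE h1 h2.
have t0 : t <= 0.
  by rewrite /t ler_pdivrMr ?mul0r// mulr_gt0// ?eu_gt0 ?ev_gt0.
have : cos (theta_at j k) = t by rewrite tE acosK// in_itv /= !ltW.
have pi0 := pi_gt0 R.
have : 0 < cos (theta_at j k).
  apply: cos_gt0_pihalf; apply/andP; split; first by have := theta_at_gt0 j k; lra.
  by apply: (lt_trans t90); lra.
lra.
Qed.

Lemma gam_gt0 i : 0 < gamma i.
Proof.
have pi0 := pi_gt0 R.
rewrite /gam; apply: divr_gt0.
  have p3 : 0 < pi / 3 :> R by exact: divr_gt0.
  have p2 : 0 < 2 * pi :> R by exact: mulr_gt0.
  by rewrite /Defs.bigTheta; case: (_ || _) => //; case: (bvertex i).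
case: TD => _ [hc _ _] _ _; have [j /mem_faceset[k ->]] := hc i.
rewrite /theta (bigD1 j)//= (bigD1 k)//=; apply: ltr_pwDl.
  apply: ltr_pwDl; first exact: theta_at_gt0.
  by apply: sumr_ge0 => m _; apply/ltW/theta_at_gt0.
by apply: sumr_ge0 => j' _; apply: sumr_ge0 => m _; apply/ltW/theta_at_gt0.
Qed.

Lemma Re_zt_gt0 j k b : isb b -> b 0 k < 1 -> 0 < complex.Re (zt j k b).
Proof.
move=> [b0 b1] bk; rewrite Re_zt; have t0 := tau_re_gt0 j k.
rewrite (sum3 k) in b1.
have h1 := b0 (succ3 k); have h2 := b0 (succ3 (succ3 k)).
have [h3|h3] := ltP 0 (b 0 (succ3 k)); first by rewrite ltr_pwDl// mulr_ge0// ltW.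
by rewrite ltr_wpDl// mulr_gt0//; lra.
Qed.
Lemma Im_zt_ge0 j k b : isb b -> 0 <= complex.Im (zt j k b).
Proof. by move=> [b0 _]; rewrite Im_zt mulr_ge0// ltW// tau_im_gt0. Qed.

Lemma star_hat i (x : pt) : surf X x -> zeta <= hat i x -> star zeta i x.
Proof.
move=> /surfP -/(_ TD)[j [b hb ->]].
have [/mem_faceset[k ->]|h] := boolP (i \in faceset j); last first.
  by rewrite hat_pt0// leNgt zeta0.
rewrite hat_pt// => hk; exists j, k; split=> //.
have z1 : 0 < 1 - zeta by move: zeta1; lra.
exists (1 - b 0 (succ3 k) / (1 - zeta) - b 0 (succ3 (succ3 k)) / (1 - zeta)).
exists (b 0 (succ3 k) / (1 - zeta)), (b 0 (succ3 (succ3 k)) / (1 - zeta)).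
have [b0 b1] := hb; rewrite (sum3 k) in b1; split.
- rewrite [leRHS](_ : _ = (b 0 k - zeta) / (1 - zeta)).
    by apply: divr_ge0; [rewrite subr_ge0|exact: ltW].
  have -> : b 0 k = 1 - b 0 (succ3 k) - b 0 (succ3 (succ3 k)) by rewrite -b1; ring.
  by field; rewrite gt_eqF.
- by rewrite divr_ge0 ?b0// ltW.
- by rewrite divr_ge0 ?b0// ltW.
- by ring.
rewrite (ptj_base j k hb.2) !euE !evE.
apply/rowP => c; rewrite !mxE; field; rewrite gt_eqF//.
Qed.

Lemma Omega_hat i (x : pt) : surf X x -> zeta < hat i x -> Omega zeta i x.
Proof.
move=> hx hz; split; first by apply: star_hat => //; exact: ltW.
have [|r r0 H] := hat_cont TD i (e := hat i x - zeta) hx; first by rewrite subr_gt0.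
apply/nbhs_ballP; exists r => // y hy sy; apply: star_hat => //.
by have := H y sy hy; rewrite ltr_norml => /andP[]; lra.
Qed.

(** Unfolding a face is a rotation and a scaling of its flat coordinate, so the constant in front of
    the power collects the length of an edge and the starting angle [al]. *)
Lemma chartE : exists kap : 'I_(nF X) -> 'I_3 -> R[i], (forall j k, kap j k != 0) /\
  forall j k b, isb b -> b 0 k < 1 -> Omega zeta (F j k) (ptj j b) ->
    phi (F j k) (ptj j b) = kap j k * cpow (gamma (F j k)) (zt j k b).
Proof.
have hal i := (CH i).1; have [al hal'] := choice hal.
exists (fun j k => polarC (enorm (eu j k) `^ gamma (F j k)) (gamma (F j k) * al (F j k) j)).
split=> [j k|j k b hb bk hO].
  by apply: polarC_neq0; apply: powR_gt0; exact: eu_gt0.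
have hc : cface j (ptj j b) by apply/cfaceP => //; exists b.
rewrite (hal' (F j k) j k (ptj j b) erefl hO hc).
have [e1 e2] := edot_zt TD j k hb.2.
have u0 := eu_gt0 j k.
have x0 : 0 < complex.Re (zt j k b) by exact: Re_zt_gt0.
have c0 : 0 < cn (zt j k b) by rewrite (lt_le_trans x0)// (le_trans (ler_norm _) (cn_Re _)).
have en : enorm (ptj j b - P (F j k)) = enorm (eu j k) * cn (zt j k b).
  rewrite /enorm e2 sqrtrM ?edot_ge0// sqrtr_sqr ger0_norm// ltW//.
rewrite -cpow_polar//; last exact: Im_zt_ge0.
rewrite -polarCM -powRM ?(ltW u0) ?(ltW c0)// -en -mulrDr.
congr (polarC _ (_ * (_ + _))); rewrite /eangle; congr acos.
rewrite e1 en -/(eu j k) -enorm2; field; rewrite !gt_eqF//.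
Qed.
End Charts.

Section OneSidedDerivative.
Variables (R : realType) (d : nat) (X : TriSurf R d).
Local Notation P := (@pos _ _ X).
Local Notation F := (@face _ _ X).
Local Notation pt := 'rV[R]_d.
Implicit Types (j : 'I_(nF X)) (k m : 'I_3) (v w i : 'I_(nV X)) (b : 'rV[R]_3).
Variables (v1 v2 v3 : 'I_(nV X)) (zeta : R) (phi : 'I_(nV X) -> pt -> R[i]^o).
Variables (Psi : pt -> R[i]^o) (Psiinv : R[i]^o -> pt).
Hypotheses (TD : triangulated_disk X) (zeta0 : 0 < zeta) (zeta1 : zeta < 4^-1).
Hypothesis SA : standing_assumption X v1 v2 v3.
Hypothesis CH : forall i, is_chart X v1 v2 v3 zeta i (phi i).
Hypothesis PS : is_Psi X v1 v2 v3 zeta phi Psi Psiinv.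
Local Notation gamma := (gam v1 v2 v3).

Lemma conformal_cder i (x : pt) : Omega zeta i x -> ~ bdsurf X x ->
  exists (g : R[i] -> R[i]) (D : R[i]), [/\ D != 0, cder g (phi i x) D &
    forall y, Omega zeta i y -> ~ bdsurf X y -> Psi y = g (phi i y)].
Proof.
move=> hO nb; case: PS => _ _ _ _ /(_ i)[g [U [[oU dg] HU Hg]]].
have [h1 h2] := dg _ (HU x hO nb).
by exists g, ('D_1 (g : R[i]^o -> R[i]^o) (phi i x)); split=> //; exact: derivable_cder.
Qed.

Definition psz j k (z : R[i]) : R[i] := Psi (ptj j (bz j k z)).
Lemma pszE j k (z : R[i]) : psz j k z = Psi (ptj j (bz j k z)). Proof. by []. Qed.

(** In the chart of a suitable vertex [m], [Psi] is a composition of an affine map, a power, a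
    constant factor and a conformal map. The derivative is taken within the face, so at a point of
    an interior edge it is one-sided. *)
Lemma psz_der j k (z0 : R[i]) : isb (bz j k z0) -> 0 < bz j k z0 0 k ->
  0 < bz j k z0 0 (succ3 k) ->
  (0 < bz j k z0 0 (succ3 (succ3 k)) \/ ~~ bedge (F j k) (F j (succ3 k))) ->
  exists2 D, D != 0 & forall e : R, 0 < e -> exists2 r : R, 0 < r &
    forall z, isb (bz j k z) -> cn (z - z0) < r ->
      cn (psz j k z - psz j k z0 - D * (z - z0)) <= e * cn (z - z0).
Proof.
set b0 := bz j k z0 => hb0 p0 p1 p2.
(* As [zeta < 4^-1], the three coordinates cannot all be at most [zeta]; the domain of the chart of
   the vertex found contains the nearby points of the face. *)
have [m hm] : exists m, zeta < b0 0 m.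
  apply: contrapT => /forallNP h.
  have := hb0.2; have h' n : b0 0 n <= zeta by rewrite leNgt; apply/negP; exact: h.
  rewrite (sum3 k); have := h' k; have := h' (succ3 k); have := h' (succ3 (succ3 k)).
  by move: zeta1; lra.
have m1 : b0 0 m < 1.
  have := hb0.2; rewrite (sum3 k); have := hb0.1 (succ3 (succ3 k)).
  by case: (ord3_cases k m) => ->; lra.
have [C C0 HC] := bz_lip TD.
have nearb : exists2 r : R, 0 < r & forall z, cn (z - z0) < r ->
   [/\ 0 < bz j k z 0 k, 0 < bz j k z 0 (succ3 k), zeta < bz j k z 0 m, bz j k z 0 m < 1 &
    0 < b0 0 (succ3 (succ3 k)) -> 0 < bz j k z 0 (succ3 (succ3 k))].
  pose e := Num.min (Num.min (b0 0 k) (b0 0 (succ3 k))) (Num.min (Num.min (b0 0 m - zeta) (1 - b0 0 m))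
     (if 0 < b0 0 (succ3 (succ3 k)) then b0 0 (succ3 (succ3 k)) else 1)).
  have e0 : 0 < e by rewrite !lt_min p0 p1 !subr_gt0 hm m1 /=; case: ifP.
  exists (e / C); first exact: divr_gt0.
  move=> z; rewrite ltr_pdivlMr// mulrC => hz.
  have H n : `|bz j k z 0 n - b0 0 n| < e by exact: le_lt_trans (HC j k n z z0) hz.
  have H1 n : b0 0 n - e < bz j k z 0 n < b0 0 n + e.
    by have := H n; rewrite ltr_norml => /andP[? ?]; apply/andP; split; lra.
  have e1 : e <= b0 0 k by rewrite !ge_min lexx.
  have e2 : e <= b0 0 (succ3 k) by rewrite !ge_min lexx orbT.
  have e3 : e <= b0 0 m - zeta by rewrite !ge_min lexx !orbT.
  have e4 : e <= 1 - b0 0 m by rewrite !ge_min lexx !orbT.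
  have e5 : 0 < b0 0 (succ3 (succ3 k)) -> e <= b0 0 (succ3 (succ3 k)).
    by move=> h; rewrite !ge_min h lexx !orbT.
  have /andP[a1 a1'] := H1 k; have /andP[a2 a2'] := H1 (succ3 k); have /andP[a3 a3'] := H1 m.
  have /andP[a4 a4'] := H1 (succ3 (succ3 k)).
  split; [lra|lra|lra|lra|by move=> /e5; lra].
have [r r0 Hr] := nearb.
have [kap [kap0 Hkap]] := chartE TD SA CH.
have [p [q [q0 Hpq]]] := zt_base TD j k m.
have ztm z : zt j m (bz j k z) = p + q * z by rewrite Hpq ?bz_sum ?zt_bz.
have good z : isb (bz j k z) -> cn (z - z0) < r ->
    [/\ Omega zeta (F j m) (ptj j (bz j k z)), ~ bdsurf X (ptj j (bz j k z)) &
     phi (F j m) (ptj j (bz j k z)) = kap j m * cpow (gamma (F j m)) (p + q * z)].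
  move=> hb hz; have [a1 a2 a3 a4 a5] := Hr z hz.
  have hO : Omega zeta (F j m) (ptj j (bz j k z)).
    apply: (Omega_hat TD zeta0 zeta1); first by apply: (proj2 (surfP TD _)); exists j; exists (bz j k z).
    by rewrite hat_pt.
  split=> //; last by rewrite (Hkap j m)// ztm.
  move=> /(bdsurf_face TD hb a1 a2)[e1 e2]; case: p2 => [/a5|/negP//].
  by rewrite e1 ltxx.
have hz0 : cn (z0 - z0) < r by rewrite subrr cn0.
have [hO0 nb0 ph0] := good z0 hb0 hz0.
have [g [D [D0 dg Hg]]] := conformal_cder hO0 nb0.
have w0 : 0 < complex.Re (p + q * z0) by rewrite -ztm; apply: (Re_zt_gt0 TD SA).
have d1 := cder_comp (cder_affine p q z0) (cder_cpow (gamma (F j m)) w0).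
have d2 := cder_comp d1 (cder_affine 0 (kap j m) (cpow (gamma (F j m)) (p + q * z0))).
rewrite ph0 in dg.
have d3 := @cder_comp R _ g z0 _ D d2.
have {}d3 := d3 (ltac:(rewrite add0r; exact: dg)).
eexists; last first.
  move=> e e0; have [s s0 Hs] := d3 e e0.
  exists (Num.min r s); first by rewrite lt_min r0.
  move=> z hb; rewrite lt_min => /andP[zr zs].
  have [hO nb ph] := good z hb zr.
  have := Hs z zs; rewrite /psz !Hg// ph ph0 !add0r; exact.
have wn0 : p + q * z0 != 0.
  by rewrite -cn_gt0 (lt_le_trans w0)// (le_trans (ler_norm _) (cn_Re _)).
rewrite !mulf_neq0 ?kap0 ?cpow_neq0 ?invr_eq0// -cn_gt0 cnR normr_gt0 gt_eqF//.
exact: gam_gt0.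
Qed.

Lemma psz_cder j k (z0 : R[i]) : (forall m, 0 < bz j k z0 0 m) ->
  exists D, cder (psz j k) z0 D.
Proof.
move=> h; have hb : isb (bz j k z0) by split; [move=> m; exact: ltW|exact: bz_sum].
have [D _ HD] := psz_der hb (h _) (h _) (or_introl (h _)).
have [C C0 HC] := bz_lip TD.
have [e e0 He] : exists2 e : R, 0 < e & forall m, e <= bz j k z0 0 m.
  by apply: fin_delta => [m|m e e' _ h1 h2]; [exists (bz j k z0 0 m)|exact: le_trans h2].
exists D => s s0; have [r r0 Hr] := HD s s0.
exists (Num.min r (e / C)); first by rewrite lt_min r0 divr_gt0.
move=> w; rewrite lt_min => /andP[w1 w2]; apply: Hr => //.
split; last exact: bz_sum.
move=> m; have := HC j k m w z0; rewrite ltr_pdivlMr// mulrC in w2.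
move=> /le_lt_trans/(_ w2); rewrite ltr_norml => /andP[]; have := He m; lra.
Qed.
End OneSidedDerivative.

(** * The target triangle and the boundary correspondence *)

Section TriangleT.
Variable R : realType.
Implicit Types (w z h : R[i]) (c m : 'I_3).

Definition crs (u v : R[i]) : R := complex.Re u * complex.Im v - complex.Im u * complex.Re v.
Definition tc c : R[i] := tcorner R c.
Definition kapT : R := crs (tc 1 - tc 0) (tc 2 - tc 0).
(** The barycentric coordinate of [w] at the corner [c], as a quotient of oriented areas; [muL] is
    its linear part. *)
Definition mu c w : R := crs (tc (succ3 c) - w) (tc (succ3 (succ3 c)) - w) / kapT.
Definition muL c h : R := crs (tc (succ3 (succ3 c)) - tc (succ3 c)) h / kapT.


Lemma kapT_gt0 : 0 < kapT.
Proof.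
have pi0 := pi_gt0 R.
pose a : R := 2 * pi / 3.
have t0 : tc 0 = 1 +i* 0 by rewrite /tc /tcorner /polarC (_ : (0%R : 'I_3)%:R = 0 :> R)// mul0r cos0 sin0 mulr1 mulr0.
have t1 : tc 1 = cos a +i* sin a by rewrite /tc /tcorner /polarC (_ : (1%R : 'I_3)%:R = 1 :> R)// !mul1r.
have t2 : tc 2 = cos (a + a) +i* sin (a + a).
  by rewrite /tc /tcorner /polarC (_ : (2%R : 'I_3)%:R = 1 + 1 :> R)// mulrDl !mul1r.
rewrite /kapT t0 t1 t2 /crs !ReD !ImD !ReN !ImN /=.
have sa : 0 < sin a by apply: sin_gt0_pi; rewrite /a; apply/andP; split; lra.
have s2 : sin (a + a) < 0.
  have -> : a + a = pi / 3 + pi by rewrite /a; field.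
  rewrite sinDpi oppr_lt0; apply: sin_gt0_pi; apply/andP; split; lra.
have E : sin (a + a - a) = sin (a + a) * cos a - cos (a + a) * sin a by rewrite sinB.
rewrite addrK in E; move: E s2 sa; nra.
Qed.

Lemma mu_sum w : \sum_(c < 3) mu c w = 1.
Proof.
have k0 := kapT_gt0; rewrite (sum3 0) !succ3E /mu !succ3E -!mulrDl.
apply: (mulIf (lt0r_neq0 k0)); rewrite divfK ?mul1r ?gt_eqF// /kapT /crs.
by rewrite !(ReD, ImD, ReN, ImN); ring.
Qed.
Lemma mu_sub c w z : mu c w - mu c z = muL c (w - z).
Proof. by rewrite /mu /muL -mulrBl /crs !(ReD, ImD, ReN, ImN); congr (_ / _); ring. Qed.
Lemma mulD c w z : muL c (w + z) = muL c w + muL c z.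
Proof. by rewrite /muL /crs ReD ImD -mulrDl; congr (_ / _); ring. Qed.
Lemma mulZ c (t : R) z : muL c (t%:C * z) = t * muL c z.
Proof. by rewrite /muL /crs ReRM ImRM; ring. Qed.
Lemma mulN c z : muL c (- z) = - muL c z.
Proof. by rewrite /muL /crs ReN ImN; ring. Qed.
Lemma muD c w h : mu c (w + h) = mu c w + muL c h.
Proof. by rewrite -[h in RHS](addrK w) -(addrC w) -mu_sub; ring. Qed.
Lemma mu_tc c m : mu c (tc m) = (c == m)%:R.
Proof.
have k0 := kapT_gt0.
case: (ord3_cases c m) => ->.
- rewrite eqxx; apply: (mulIf (lt0r_neq0 k0)); rewrite divfK ?mul1r ?gt_eqF// /kapT /crs.
  case: (ord3P c) => ->; rewrite !succ3E !(ReD, ImD, ReN, ImN); ring.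
- by rewrite eq_sym succ3_neq /mu subrr /crs /= !mul0r subrr mul0r.
- by rewrite eq_sym succ3_neq2 /mu subrr /crs /= !mulr0 subrr mul0r.
Qed.
Lemma mul_recover h : h = \sum_(c < 3) (muL c h)%:C * tc c.
Proof.
have k0 := kapT_gt0; rewrite (sum3 0) !succ3E.
apply: ReIm_eq; rewrite !(ReD, ImD, ReRM, ImRM) /muL !succ3E.
  transitivity ((crs (tc 2 - tc 1) h * complex.Re (tc 0) + crs (tc 0 - tc 2) h * complex.Re (tc 1) +
     crs (tc 1 - tc 0) h * complex.Re (tc 2)) / kapT); last by field; rewrite gt_eqF.
  apply: (mulIf (lt0r_neq0 k0)); rewrite divfK ?gt_eqF//.
  rewrite /kapT /crs !(ReD, ImD, ReN, ImN); ring.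
transitivity ((crs (tc 2 - tc 1) h * complex.Im (tc 0) + crs (tc 0 - tc 2) h * complex.Im (tc 1) +
   crs (tc 1 - tc 0) h * complex.Im (tc 2)) / kapT); last by field; rewrite gt_eqF.
apply: (mulIf (lt0r_neq0 k0)); rewrite divfK ?gt_eqF//.
rewrite /kapT /crs !(ReD, ImD, ReN, ImN); ring.
Qed.
Lemma mu_recover w : w = \sum_(c < 3) (mu c w)%:C * tc c.
Proof.
have h := mul_recover (w - tc 0).
rewrite -[LHS](subrK (tc 0)) h !(sum3 0) !succ3E -!mu_sub !mu_tc /= subr0 subr0 rmorphB /=.
by rewrite mulr1n; ring.
Qed.
Lemma cn_tc c : cn (tc c) = 1.
Proof. by rewrite /tc /tcorner /polarC cnE /= !mul1r cos2Dsin2 sqrtr1. Qed.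
Lemma cn_mul h : cn h <= \sum_(c < 3) `|muL c h|.
Proof.
rewrite {1}[h]mul_recover !(sum3 0); apply: (le_trans (cnD _ _)).
apply: lerD; last by rewrite cnM cnR cn_tc mulr1.
by apply: (le_trans (cnD _ _)); rewrite !cnM !cnR !cn_tc !mulr1.
Qed.
Lemma mul_cn : exists2 C : R, 0 < C & forall c h, `|muL c h| <= C * cn h.
Proof.
have k0 := kapT_gt0; exists (4 / kapT); first exact: divr_gt0.
move=> c h; rewrite /muL normrM normrV ?unitfE ?gt_eqF// (gtr0_norm k0) mulrAC.
rewrite ler_pM2r ?invr_gt0//.
set t := _ - _; have t2 : cn t <= 2 by apply: (le_trans (cnB _ _)); rewrite !cn_tc.
rewrite /crs; apply: (le_trans (ler_normB _ _)); rewrite !normrM.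
have := cn_Re t; have := cn_Im t; have := cn_Re h; have := cn_Im h; have := cn_ge0 h.
move: (cn_ge0 t) t2; move: (cn t) (cn h) => a b a0 a2 b0 h1 h2 h3 h4.
have e1 : `|complex.Re t| * `|complex.Im h| <= 2 * b by apply: ler_pM => //; exact: le_trans h4 a2.
have e2 : `|complex.Im t| * `|complex.Re h| <= 2 * b by apply: ler_pM => //; exact: le_trans h3 a2.
by apply: (le_trans (lerD e1 e2)); lra.
Qed.

Lemma mu_comb3 (l : 'I_3 -> R) c : \sum_(i < 3) l i = 1 -> mu c (\sum_(i < 3) (l i)%:C * tc i) = l c.
Proof.
move=> hl; have E : mu c (\sum_(i < 3) (l i)%:C * tc i) = \sum_(i < 3) l i * mu c (tc i).
  have -> : \sum_(i < 3) (l i)%:C * tc i = tc 0 + \sum_(i < 3) (l i)%:C * (tc i - tc 0).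
    rewrite !(sum3 0) !succ3E; have -> : l 0 = 1 - l 1 - l 2 by rewrite -hl (sum3 0) !succ3E; ring.
    by rewrite !rmorphB /=; ring.
  rewrite muD !(sum3 0) !mulD !mulZ -!mu_sub !succ3E.
  have -> : l 0 = 1 - l 1 - l 2 by rewrite -hl (sum3 0) !succ3E; ring.
  ring.
rewrite E (bigD1 c)//= mu_tc eqxx mulr1 big1 ?addr0// => i ic.
by rewrite mu_tc eq_sym (negbTE ic) mulr0.
Qed.

Lemma TriP w : Tri w <-> forall c, 0 <= mu c w.
Proof.
split=> [[l1 [l2 [l3 [h1 h2 h3 h4 ->]]]] c|h].
  pose l (i : 'I_3) := if i == 0 then l1 else if i == 1 then l2 else l3.
  have hl : \sum_(i < 3) l i = 1 by rewrite (sum3 0) !succ3E.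
  have := mu_comb3 c hl; rewrite (sum3 0) !succ3E /= => ->.
  by rewrite /l; case: ifP => _ //; case: ifP.
exists (mu 0 w), (mu 1 w), (mu 2 w); split=> //.
  by rewrite -(mu_sum w) (sum3 0) !succ3E.
by rewrite {1}[w]mu_recover (sum3 0) !succ3E.
Qed.

Lemma bdTriP w : bdTri w <-> (forall c, 0 <= mu c w) /\ exists c, mu c w = 0.
Proof.
split=> [|[h [c hc]]].
  have H c (l1 l2 : R) : 0 <= l1 -> 0 <= l2 -> l1 + l2 = 1 ->
     (forall m, 0 <= mu m (l1%:C * tc c + l2%:C * tc (succ3 c))) /\
     exists m, mu m (l1%:C * tc c + l2%:C * tc (succ3 c)) = 0.
    move=> h1 h2 h3.
    pose l (i : 'I_3) := if i == c then l1 else if i == succ3 c then l2 else 0.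
    have hl : \sum_(i < 3) l i = 1.
      by rewrite (sum3 c) /l eqxx succ3_neq eqxx succ3_neq2 succ3_neq addr0.
    have E : l1%:C * tc c + l2%:C * tc (succ3 c) = \sum_(i < 3) (l i)%:C * tc i.
      by rewrite (sum3 c) /l eqxx succ3_neq eqxx succ3_neq2 succ3_neq mul0r addr0.
    rewrite E; split=> [m|]; first by rewrite mu_comb3// /l; case: ifP => _ //; case: ifP.
    by exists (succ3 (succ3 c)); rewrite mu_comb3// /l succ3_neq2 succ3_neq.
  case=> [[|]|] [l1 [l2 [h1 h2 h3 ->]]].
  - by have := H 0 l1 l2 h1 h2 h3; rewrite succ3_0.
  - by have := H 1 l1 l2 h1 h2 h3; rewrite succ3_1.
  - by have := H 2 l1 l2 h1 h2 h3; rewrite succ3_2.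
have hs := mu_sum w; have hr := mu_recover w.
rewrite (sum3 c) hc add0r in hs; rewrite (sum3 c) hc mul0r add0r in hr.
have E : conv2C (tc (succ3 c)) (tc (succ3 (succ3 c))) w.
  by exists (mu (succ3 c) w), (mu (succ3 (succ3 c)) w); split.
case: (ord3P c) E => ->; rewrite !succ3E => E; by [left; right|right|left; left].
Qed.

Lemma mu_corner c w : mu (succ3 c) w = 0 -> mu (succ3 (succ3 c)) w = 0 -> w = tc c.
Proof.
move=> h1 h2; have hs := mu_sum w; rewrite (sum3 c) h1 h2 !addr0 in hs.
by rewrite [LHS]mu_recover (sum3 c) h1 h2 hs !mul0r !addr0 mul1r.
Qed.
Lemma mu_inj2 c w z : mu c w = mu c z -> mu (succ3 c) w = mu (succ3 c) z -> w = z.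
Proof.
move=> h1 h2; have := mu_sum w; rewrite -(mu_sum z) !(sum3 c) h1 h2 => /addrI h3.
by rewrite [LHS]mu_recover [RHS]mu_recover !(sum3 c) h1 h2 h3.
Qed.
Lemma mu_seg c w z (t : R) : mu c ((1 - t)%:C * w + t%:C * z) = (1 - t) * mu c w + t * mu c z.
Proof.
have -> : (1 - t)%:C * w + t%:C * z = w + t%:C * (z - w) by rewrite rmorphB /=; ring.
by rewrite muD mulZ -mu_sub; ring.
Qed.
End TriangleT.
Arguments tc : simpl never.
Arguments mu : simpl never.
Arguments muL : simpl never.
Arguments crs : simpl never.

(** * Paths over the unit interval *)

Section Paths.
Variable R : realType.

Definition in01 (t : R) : bool := 0 <= t <= 1.
Definition pcont (h : R -> R) := forall t, in01 t -> forall e : R, 0 < e ->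
  exists2 r : R, 0 < r & forall s, in01 s -> `|s - t| < r -> `|h s - h t| < e.

Lemma pcontB (f g : R -> R) : pcont f -> pcont g -> pcont (fun t => f t - g t).
Proof.
move=> cf cg t ht e e0; have e2 : 0 < e / 2 by rewrite divr_gt0.
have [r r0 H] := cf t ht _ e2; have [r' r'0 H'] := cg t ht _ e2.
exists (Num.min r r'); first by rewrite lt_min r0.
move=> s hs; rewrite lt_min => /andP[/(H s hs) h /(H' s hs) h'].
rewrite (_ : _ - _ - _ = (f s - f t) - (g s - g t)); last by ring.
by apply: (le_lt_trans (ler_normB _ _)); lra.
Qed.
Lemma pcont_min (f g : R -> R) : pcont f -> pcont g -> pcont (fun t => Num.min (f t) (g t)).
Proof.
move=> cf cg t ht e e0.
have [r r0 H] := cf t ht _ e0; have [r' r'0 H'] := cg t ht _ e0.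
exists (Num.min r r'); first by rewrite lt_min r0.
move=> s hs; rewrite lt_min => /andP[/(H s hs) h /(H' s hs) h'].
move: h h'; rewrite !ltr_norml => /andP[h1 h2] /andP[h3 h4].
by case: (leP (f s) (g s)); case: (leP (f t) (g t)) => *; apply/andP; split; lra.
Qed.
Lemma pcont_rescale (h : R -> R) (a b : R) : pcont h -> in01 a -> in01 b ->
  pcont (fun t => h (a + t * (b - a))).
Proof.
move=> ch /andP[a0 a1] /andP[b0 b1].
have I t : in01 t -> in01 (a + t * (b - a)).
  move=> /andP[t0 t1]; have -> : a + t * (b - a) = (1 - t) * a + t * b by ring.
  apply/andP; split; first by rewrite addr_ge0// mulr_ge0// subr_ge0.
  apply: (@le_trans _ _ ((1 - t) * 1 + t * 1)); last by rewrite !mulr1 subrK.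
  by apply: lerD; apply: ler_wpM2l => //; rewrite subr_ge0.
move=> t ht e e0; have [r r0 H] := ch _ (I t ht) e e0.
exists r => // s hs hst; apply: H; first exact: I.
rewrite (_ : _ - _ = (s - t) * (b - a)); last by ring.
apply: (le_lt_trans _ hst); rewrite normrM ler_piMr// ler_norml; apply/andP; split; lra.
Qed.

Lemma ivt01 (h : R -> R) : pcont h -> h 0 <= 0 -> 0 <= h 1 -> exists2 t, in01 t & h t = 0.
Proof.
(* The path is extended to the real line by clamping its parameter. *)
move=> ch h0 h1; pose cl (t : R) : R := Num.max 0 (Num.min 1 t).
have cl_in t : in01 (cl t).
  by rewrite /in01 /cl le_max lexx /= ge_max ler01 ge_min lexx.
have cl_id t : in01 t -> cl t = t.
  by move=> /andP[t0 t1]; rewrite /cl min_r// max_r.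
have cl_lip s t : `|cl s - cl t| <= `|s - t|.
  have H (u v : R) : u <= v -> 0 <= cl v - cl u <= v - u.
    have C x : [\/ x <= 0 /\ cl x = 0, in01 x /\ cl x = x | 1 <= x /\ cl x = 1].
      have [x0|x0] := leP x 0.
        by apply: Or31; split=> //; rewrite /cl min_r ?max_l// (le_trans x0).
      have [x1|x1] := leP x 1.
        by apply: Or32; have hx : in01 x by [rewrite /in01 x1 ltW]; split=> //; exact: cl_id.
      by apply: Or33; rewrite /cl min_l ?max_r ?ltW.
    rewrite /in01 in C; case: (C u) => -[hu ->]; case: (C v) => -[hv ->] uv; apply/andP; split; lra.
  have [st|st] := leP s t.
    by rewrite distrC [leRHS]distrC; have /andP[a1 a2] := H _ _ st; rewrite !ger0_norm// (le_trans a1).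
  by have /andP[a1 a2] := H _ _ (ltW st); rewrite !ger0_norm// (le_trans a1).
have cc : continuous (h \o cl).
  move=> t; apply/cvgrPdist_lt => /= e e0; have [r r0 H] := ch (cl t) (cl_in t) e e0.
  apply/nbhs_ballP; exists r => //= s; rewrite /ball /= => hs.
  rewrite distrC; apply: H; first exact: cl_in.
  by apply: (le_lt_trans (cl_lip _ _)); rewrite distrC.
have i0 : in01 0 by rewrite /in01 lexx ler01.
have i1 : in01 1 by rewrite /in01 lexx ler01.
have [] := @IVT R (h \o cl) 0 1 0 ler01.
- exact: continuous_subspaceT.
- by rewrite /= !cl_id// ge_min h0 le_max h1 orbT.
move=> t ht /= hE; exists t; first by rewrite /in01; move: ht; rewrite in_itv.
by rewrite -hE cl_id// /in01; move: ht; rewrite in_itv.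
Qed.

(* f lists the barycentric coordinates of a path in the boundary of a triangle;
   the last hypothesis says that it avoids the corners other than m. *)
Lemma boundary_path (f : 'I_3 -> R -> R) (m : 'I_3) :
  (forall c, pcont (f c)) -> (forall c t, in01 t -> 0 <= f c t) ->
  (forall t, in01 t -> exists c, f c t = 0) ->
  0 < f m 0 ->
  (forall c t, in01 t -> c != m -> f m t = 0 -> f c t != 0) ->
  forall t, in01 t -> 0 < f m t.
Proof.
move=> cf f0 fz fm nc t0 ht0; rewrite lt_def f0// andbT; apply/negP => /eqP ft.
have in0 : in01 0 by rewrite /in01 lexx ler01.
(* At a zero of [g] the coordinate at [m] equals the smaller of the other two; since one of the
   three is zero, both are, and the path is at a corner other than [m]. *)
pose g t := Num.min (f (succ3 m) t) (f (succ3 (succ3 m)) t) - f m t.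
have cg : pcont g by apply: pcontB => //; exact: pcont_min.
have [|||t1 ht1] := @ivt01 (fun t => g (0 + t * (t0 - 0))).
- exact: (@pcont_rescale g 0 t0).
- rewrite mul0r addr0 /g subr_le0; have [c hc] := fz 0 in0.
  rewrite ge_min; case: (ord3_cases m c) hc => -> hc; rewrite hc ?f0 ?orbT//.
  by rewrite hc ltxx in fm.
- rewrite mul1r add0r subr0 /g ft subr0 le_min !f0//.
rewrite add0r subr0; set t2 := t1 * t0.
have ht2 : in01 t2.
  move: ht1 ht0 => /andP[a1 a2] /andP[a3 a4]; apply/andP; split; first exact: mulr_ge0.
  by rewrite /t2 mulr_ile1.
move/eqP; rewrite subr_eq0 => /eqP E.
have n1 : succ3 m != m by rewrite succ3_neq.
have n2 : succ3 (succ3 m) != m by rewrite succ3_neq2.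
have Fm : f m t2 = 0.
  have [c hc] := fz t2 ht2; case: (ord3_cases m c) hc => -> hc //.
    by rewrite -E hc min_l// f0.
  by rewrite -E hc min_r// f0.
have := nc _ _ ht2 n1 Fm; have := nc _ _ ht2 n2 Fm.
move: E; rewrite Fm; case: leP => _ ->; by rewrite eqxx.
Qed.

(** Pigeonhole: each obstruction excludes at most one parameter, and one parameter more than there
    are obstructions is tried. *)
Lemma avoid (I : finType) (B : I -> R -> Prop) (r : R) : 0 < r ->
  (forall i s s', B i s -> B i s' -> s = s') -> exists s, 0 < s < r /\ forall i, ~ B i s.
Proof.
move=> r0 Bu; apply: contrapT => /forallNP H.
have {}H (n : 'I_(#|I|.+1)) : exists i, B i (r / n.+2%:R).
  have /not_andP[h|/existsNP[i /contrapT h]] := H (r / n.+2%:R); last by exists i.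
  by exfalso; apply: h; rewrite divr_gt0//= ltr_pdivrMr// ltr_pMr// ltr1n.
have [g hg] := choice H.
have gi : injective g.
  move=> n m nm; have := hg n; rewrite nm => /(Bu _ _ _ (hg m)) /(mulfI (lt0r_neq0 r0)).
  by move=> /invr_inj /eqP; rewrite eqr_nat => /eqP[] /esym h; apply/val_inj.
by have := leq_card g gi; rewrite card_ord ltnn.
Qed.
End Paths.

Section SurfaceContinuity.
Variables (R : realType) (d : nat) (X : TriSurf R d).
Local Notation P := (@pos _ _ X).
Local Notation F := (@face _ _ X).
Local Notation pt := 'rV[R]_d.
Implicit Types (j : 'I_(nF X)) (k m c : 'I_3) (v : 'I_(nV X)) (b : 'rV[R]_3) (x y : pt).
Hypothesis TD : triangulated_disk X.

Lemma ball_rV x y (r : R) : 0 < r -> (forall i, `|x 0 i - y 0 i| < r) -> ball x r y.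
Proof. by move=> r0 H; split=> // i i'; rewrite ord1; exact: H. Qed.

Definition scont (h : pt -> R) := forall x, surf X x -> forall e : R, 0 < e ->
  exists2 r : R, 0 < r & forall y, surf X y -> ball x r y -> `|h y - h x| < e.

Lemma scont_hat v : scont (hat v).
Proof. by move=> x hx e e0; exact: hat_cont. Qed.

Lemma ptj_sub j b b' i : ptj (X := X) j b 0 i - ptj j b' 0 i = \sum_(k < 3) (b - b') 0 k * P (F j k) 0 i.
Proof. by rewrite /ptj !(sum3 0) !mxE; ring. Qed.

Lemma ptj_ball (r : R) : 0 < r -> exists2 e : R, 0 < e &
  forall j b b', bnorm (b - b') < e -> ball (ptj (X := X) j b) r (ptj j b').
Proof.
move=> r0; pose M := \sum_v \sum_i `|P v 0 i| + 1.
have M0 : 0 < M by rewrite ltr_wpDl// sumr_ge0// => v _; apply: sumr_ge0.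
have hM v i : `|P v 0 i| <= M.
  rewrite /M (bigD1 v)//= (bigD1 i)//= -!addrA lerDl !addr_ge0// ?sumr_ge0// => w _.
  exact: sumr_ge0.
exists (r / M); first exact: divr_gt0.
move=> j b b' hb; apply: ball_rV => // i; rewrite ptj_sub.
rewrite ltr_pdivlMr// in hb; apply: (le_lt_trans _ hb).
apply: (le_trans (ler_norm_sum _ _ _)); rewrite /bnorm mulr_suml; apply: ler_sum => k _.
by rewrite normrM ler_wpM2l.
Qed.

Lemma surf_ptj j b : isb b -> surf X (ptj j b).
Proof. by move=> hb; apply: (proj2 (surfP TD _)); exists j, b. Qed.

Lemma pcont_face (h : pt -> R) j b b' : scont h -> isb b -> isb b' ->
  pcont (fun t => h (ptj j ((1 - t) *: b + t *: b'))).
Proof.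
move=> ch [hb hb1] [hb' hb1'] t ht e e0.
have I s : in01 s -> isb ((1 - s) *: b + s *: b').
  move=> /andP[s0 s1]; split=> [k|].
    by rewrite !mxE addr_ge0// mulr_ge0// subr_ge0.
  rewrite (eq_bigr (fun k => (1 - s) * b 0 k + s * b' 0 k)); last by move=> k _; rewrite !mxE.
  by rewrite big_split /= -!mulr_sumr hb1 hb1'; ring.
have [r r0 H] := ch _ (surf_ptj j (I t ht)) e e0.
have [e1 e10 H1] := ptj_ball r0.
pose K := bnorm (b' - b) + 1; have K0 : 0 < K by rewrite ltr_wpDl// sumr_ge0.
exists (e1 / K); first exact: divr_gt0.
move=> s hs; rewrite ltr_pdivlMr// => hst; apply: H; first exact/surf_ptj/I.
apply: H1; apply: (le_lt_trans _ hst).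
have -> : (1 - t) *: b + t *: b' - ((1 - s) *: b + s *: b') = (t - s) *: (b' - b).
  by apply/rowP => i; rewrite !mxE; ring.
rewrite distrC /K mulrDr mulr1; apply: ler_wpDr => //.
by rewrite /bnorm mulr_sumr; apply: ler_sum => k _; rewrite mxE normrM.
Qed.

Section Homeo.
Variables (f : pt -> R[i]^o) (g : R[i]^o -> pt).
Hypothesis H : homeo_sets (surf X) (@Tri R) f g.

Lemma homeo_T x : surf X x -> Tri (f x). Proof. by case: H => h _ _ _ _ /h. Qed.
Lemma homeo_S w : Tri w -> surf X (g w). Proof. by case: H => _ h _ _ _ /h. Qed.
Lemma homeo_K x : surf X x -> g (f x) = x. Proof. by case: H => _ _ [h _] _ _ /h. Qed.
Lemma homeo_Ki w : Tri w -> f (g w) = w. Proof. by case: H => _ _ [_ h] _ _ /h. Qed.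
Lemma homeo_mu x c : surf X x -> 0 <= mu c (f x).
Proof. by move=> /homeo_T /TriP. Qed.

Lemma homeo_cont x (e : R) : surf X x -> 0 < e -> exists2 r : R, 0 < r &
  forall y, surf X y -> ball x r y -> cn (f y - f x) < e.
Proof.
move=> hx e0; case: H => _ _ _ /subspace_continuousP/(_ x hx)/cvgrPdist_lt/(_ e%:C) + _.
rewrite ltcR => /(_ e0); rewrite near_withinE => /nbhs_ballP[r /= r0 Hr].
by exists r => // y hy hb; rewrite cnC -ltC_cn; apply: Hr.
Qed.
Lemma homeo_icont w (r : R) : Tri w -> 0 < r -> exists2 e : R, 0 < e &
  forall z, Tri z -> cn (z - w) < e -> ball (g w) r (g z).
Proof.
move=> hw r0; case: H => _ _ _ _ /subspace_continuousP/(_ w hw)/cvg_ballP/(_ r r0).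
rewrite near_withinE => /nbhs_cn[e e0 He].
by exists e => // z hz hzw; apply: He.
Qed.
Lemma scont_mu c : scont (fun x => mu c (f x)).
Proof.
move=> x hx e e0; have [C C0 HC] := mul_cn R.
have [|r r0 Hr] := @homeo_cont x (e / C) hx; first exact: divr_gt0.
exists r => // y hy /(Hr y hy); rewrite ltr_pdivlMr// mulrC => h.
by rewrite mu_sub; exact: le_lt_trans h.
Qed.

Definition segC (w z : R[i]) (t : R) : R[i] := (1 - t)%:C * w + t%:C * z.
Lemma Tri_seg w z t : Tri w -> Tri z -> in01 t -> Tri (segC w z t).
Proof.
move=> /TriP hw /TriP hz /andP[t0 t1]; apply/TriP => c; rewrite mu_seg.
by rewrite addr_ge0// mulr_ge0// subr_ge0.
Qed.
Lemma pcont_seg (h : pt -> R) w z : scont h -> Tri w -> Tri z ->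
  pcont (fun t => h (g (segC w z t))).
Proof.
move=> ch hw hz t ht e e0.
have ht' := Tri_seg hw hz ht.
have [r r0 Hr] := ch _ (homeo_S ht') e e0.
have [e1 e10 He] := homeo_icont ht' r0.
pose K := cn (z - w) + 1; have K0 : 0 < K by rewrite ltr_wpDl// cn_ge0.
exists (e1 / K); first exact: divr_gt0.
move=> s hs; rewrite ltr_pdivlMr// => hst.
have hs' := Tri_seg hw hz hs; apply: Hr; first exact: homeo_S.
apply: He => //; apply: (le_lt_trans _ hst).
have -> : segC w z s - segC w z t = (s - t)%:C * (z - w).
  by rewrite /segC !rmorphB /=; ring.
by rewrite cnM cnR /K mulrDr mulr1 lerDl.
Qed.
End Homeo.
End SurfaceContinuity.

Section InteriorPoints.
Variables (R : realType) (d : nat) (X : TriSurf R d).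
Local Notation P := (@pos _ _ X).
Local Notation F := (@face _ _ X).
Local Notation pt := 'rV[R]_d.
Implicit Types (j : 'I_(nF X)) (k m c : 'I_3) (v w i : 'I_(nV X)) (b : 'rV[R]_3).
Variables (v1 v2 v3 : 'I_(nV X)) (zeta : R) (phi : 'I_(nV X) -> pt -> R[i]^o).
Variables (Psi : pt -> R[i]^o) (Psiinv : R[i]^o -> pt).
Hypotheses (TD : triangulated_disk X) (zeta0 : 0 < zeta) (zeta1 : zeta < 4^-1).
Hypothesis SA : standing_assumption X v1 v2 v3.
Hypothesis CH : forall i, is_chart X v1 v2 v3 zeta i (phi i).
Hypothesis PS : is_Psi X v1 v2 v3 zeta phi Psi Psiinv.
Local Notation psz := (@psz R d X Psi).

Lemma Psi_homeo : homeo_sets (surf X) (@Tri R) Psi Psiinv.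
Proof. by case: PS. Qed.

(* If a barycentric coordinate of G vanished at z0, where G is open, moving in the
   direction that decreases it would leave T. *)
Lemma push_out (G : R[i] -> R[i]) (A : R[i] -> Prop) (z0 D : R[i]) c : D != 0 ->
  (forall e : R, 0 < e -> exists2 r : R, 0 < r & forall z, A z -> cn (z - z0) < r ->
     cn (G z - G z0 - D * (z - z0)) <= e * cn (z - z0)) ->
  mu c (G z0) = 0 -> (forall z, A z -> 0 <= mu c (G z)) ->
  (exists2 s0 : R, 0 < s0 & forall s : R, 0 < s -> s < s0 ->
     A (z0 + s%:C * (- (tc R c - tc R (succ3 c)) / D))) -> False.
Proof.
move=> D0 hD hz hA [s0 s00 Hs].
set h := - (tc R c - tc R (succ3 c)) / D.
have mh : muL c (D * h) = -1.
  rewrite (_ : D * h = - (tc R c - tc R (succ3 c))); last by rewrite /h; field.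
  by rewrite mulN -mu_sub !mu_tc eqxx eq_sym succ3_neq subr0.
have [C C0 HC] := mul_cn R.
pose K := cn h + 1; have K0 : 0 < K by rewrite ltr_wpDl// cn_ge0.
have [|r r0 Hr] := hD (1 / (2 * C * K)); first by rewrite divr_gt0// !mulr_gt0.
pose s := Num.min s0 (r / K) / 2.
have m0 : 0 < Num.min s0 (r / K) by rewrite lt_min s00 divr_gt0.
have sp : 0 < s by rewrite divr_gt0.
have sm : s < Num.min s0 (r / K) by rewrite /s ltr_pdivrMr// ltr_pMr// ltr1n.
have [ss0 ssr] : s < s0 /\ s < r / K by move: sm; rewrite lt_min => /andP[].
have As := Hs s sp ss0; rewrite -/h in As.
have E : z0 + s%:C * h - z0 = s%:C * h by ring.
have cs : cn (z0 + s%:C * h - z0) = s * cn h by rewrite E cnM cnR gtr0_norm.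
have := Hr _ As; rewrite cs => H1.
have {}H1 : cn (G (z0 + s%:C * h) - G z0 - D * (z0 + s%:C * h - z0)) <= 1 / (2 * C * K) * (s * cn h).
  apply: H1; rewrite ltr_pdivlMr// in ssr; apply: (le_lt_trans _ ssr).
  by apply: ler_wpM2l; [exact: ltW|rewrite lerDl].
have := hA _ As; apply/negP; rewrite -ltNge.
set err := G _ - _ - _ in H1.
rewrite (_ : G (z0 + s%:C * h) = G z0 + (s%:C * (D * h) + err)); last by rewrite /err; ring.
rewrite muD hz add0r mulD mulZ mh.
have := HC c err => /(le_trans (ler_norm _)) h2.
have h3 : C * cn err <= s / 2.
  apply: (le_trans (ler_wpM2l (ltW C0) H1)).
  rewrite (_ : C * (1 / (2 * C * K) * (s * cn h)) = s / 2 * (cn h / K)); last by field; rewrite !gt_eqF.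
  by rewrite ler_piMr// ?ler_pdivrMr ?mul1r ?lerDl// ltW// divr_gt0.
by move: h2 h3 sp; lra.
Qed.

Lemma isb_near j k (z0 h : R[i]) : isb (bz j k z0) -> 0 < bz j k z0 0 k ->
  0 < bz j k z0 0 (succ3 k) ->
  (0 < bz j k z0 0 (succ3 (succ3 k)) \/ 0 <= complex.Im h) ->
  exists2 s0 : R, 0 < s0 & forall s : R, 0 < s -> s < s0 -> isb (bz j k (z0 + s%:C * h)).
Proof.
move=> hb p0 p1 p2; have [C C0 HC] := bz_lip TD.
pose e := Num.min (Num.min (bz j k z0 0 k) (bz j k z0 0 (succ3 k)))
  (if 0 < bz j k z0 0 (succ3 (succ3 k)) then bz j k z0 0 (succ3 (succ3 k)) else 1).
have e0 : 0 < e by rewrite !lt_min p0 p1 /=; case: ifP.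
pose K := C * cn h + 1; have K0 : 0 < K by rewrite ltr_wpDl// mulr_ge0 ?cn_ge0 ?ltW.
exists (e / K); first exact: divr_gt0.
move=> s sp; rewrite ltr_pdivlMr// => hs; split; last exact: bz_sum.
have H n : `|bz j k (z0 + s%:C * h) 0 n - bz j k z0 0 n| < e.
  apply: (le_lt_trans (HC j k n _ _)); apply: (le_lt_trans _ hs).
  have -> : z0 + s%:C * h - z0 = s%:C * h by ring.
  by rewrite cnM cnR gtr0_norm// mulrCA ler_pM2l// lerDl.
have {}H n : bz j k z0 0 n - e < bz j k (z0 + s%:C * h) 0 n.
  by have := H n; rewrite ltr_norml => /andP[? ?]; lra.
have e1 : e <= bz j k z0 0 k by rewrite !ge_min lexx.
have e2 : e <= bz j k z0 0 (succ3 k) by rewrite !ge_min lexx orbT.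
move=> m; case: (ord3_cases k m) => ->.
- by have := H k; lra.
- by have := H (succ3 k); lra.
have [q|q] := ltP 0 (bz j k z0 0 (succ3 (succ3 k))).
  have e3 : e <= bz j k z0 0 (succ3 (succ3 k)) by rewrite !ge_min q lexx !orbT.
  by have := H (succ3 (succ3 k)); lra.
case: p2 => [|hi]; first by rewrite ltNge q.
have z2 := hb.1 (succ3 (succ3 k)); rewrite bz2 in z2.
rewrite bz2 ImD ImRM mulrDl; apply: addr_ge0 => //; apply: divr_ge0.
  by apply: mulr_ge0 => //; exact: ltW.
by apply/ltW; exact: tau_im_gt0.
Qed.

(** Adjacent faces traverse their common edge in opposite directions, which exchanges 0 and 1 in the
    flat coordinates. *)
Lemma edge_match j k j' k' (z : R[i]) : F j' k' = F j (succ3 k) -> F j' (succ3 k') = F j k ->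
  complex.Im z = 0 -> ptj j (bz j k z) = ptj j' (bz j' k' (1 - z)).
Proof.
move=> e1 e2 iz.
rewrite /ptj (sum3 k) (sum3 k') e1 e2 !bz0 !bz1 !bz2 ReD ImD ReN ImN iz.
rewrite [complex.Im 1]/= [complex.Re 1]/= subrr !mul0r !scale0r !addr0 !subr0.
by rewrite opprB addrC subrKC addrC.
Qed.

(** By [push_out], a vanishing coordinate could be made negative by moving in a certain direction.
    On an interior edge this direction may leave the face; it then enters the neighbour, because the
    derivative there, in its own coordinate, is the opposite one. *)
Lemma int_psi j k b c : isb b -> 0 < b 0 k -> 0 < b 0 (succ3 k) ->
  (0 < b 0 (succ3 (succ3 k)) \/ ~~ bedge (F j k) (F j (succ3 k))) ->
  0 < mu c (Psi (ptj j b)).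
Proof.
move=> hb p0 p1 p2.
have T0 j' b' : isb b' -> 0 <= mu c (Psi (ptj j' b')).
  by move=> hb'; apply: (homeo_mu Psi_homeo); exact: surf_ptj.
rewrite lt_def T0// andbT; apply/negP => /eqP hz.
pose z0 := zt j k b; have zb0 : bz j k z0 = b by apply: bz_zt => //; case: hb.
have ib0 : isb (bz j k z0) by rewrite zb0.
have q0 : 0 < bz j k z0 0 k by rewrite zb0.
have q1 : 0 < bz j k z0 0 (succ3 k) by rewrite zb0.
have q2 : 0 < bz j k z0 0 (succ3 (succ3 k)) \/ ~~ bedge (F j k) (F j (succ3 k)) by rewrite zb0.
have [D D0 hD] := psz_der TD zeta0 zeta1 SA CH PS ib0 q0 q1 q2.
have hz0 : mu c (psz j k z0) = 0 by rewrite !pszE zb0.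
have step1 : (0 < b 0 (succ3 (succ3 k)) \/ 0 <= complex.Im (- (tc R c - tc R (succ3 c)) / D)) -> False.
  move=> hh; apply: (push_out D0 hD hz0).
    by move=> z hzz; exact: T0.
  by apply: isb_near => //; rewrite zb0.
have [p2'|p2'] := ltP 0 (b 0 (succ3 (succ3 k))); first by apply: step1; left.
case: p2 => [|nb]; first by rewrite ltNge p2'.
have hI : complex.Im z0 = 0.
  by rewrite /z0 Im_zt (_ : b 0 _ = 0) ?mulr0//; apply/le_anti; rewrite p2' hb.1.
have oe : oedge (F j k) (F j (succ3 k)) by apply/oedgeP; exists j, k.
move: nb; rewrite /bedge oe /= negbK => /oedgeP[j' [k' [e1 e2]]].
pose z1 : R[i] := 1 - z0.
have E0 : ptj j (bz j k z0) = ptj j' (bz j' k' z1) by exact: edge_match.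
have B1 : bz j' k' z1 0 k' = b 0 (succ3 k) /\ bz j' k' z1 0 (succ3 k') = b 0 k /\
    bz j' k' z1 0 (succ3 (succ3 k')) = 0.
  rewrite !bz0 !bz1 !bz2 /z1 ReD ImD ReN ImN hI [complex.Im 1]/= [complex.Re 1]/= subrr !mul0r !subr0.
  have := bz1 j k z0; have := bz0 j k z0; rewrite zb0 hI !mul0r !subr0 => -> ->.
  by split; [ring|split].
have [B1a [B1b B1c]] := B1.
have ib1 : isb (bz j' k' z1).
  split; last exact: bz_sum.
  by move=> m; case: (ord3_cases k' m) => ->; rewrite ?B1a ?B1b ?B1c// hb.1.
have nb1 : ~~ bedge (F j' k') (F j' (succ3 k')) by rewrite /bedge negb_and e1 e2 oe orbT.
have r0 : 0 < bz j' k' z1 0 k' by rewrite B1a.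
have r1 : 0 < bz j' k' z1 0 (succ3 k') by rewrite B1b.
have [D' D'0 hD'] := psz_der TD zeta0 zeta1 SA CH PS ib1 r0 r1 (or_intror nb1).
have hz1 : mu c (psz j' k' z1) = 0 by rewrite pszE -E0 -pszE.
(* Both expansions hold along the common edge, where they describe the same values; the sign comes
   from the change of coordinate [1 - z]. *)
have DD : D' = - D.
  apply/eqP; rewrite -subr_eq0 opprK -cn_eq0; apply/eqP/le_anti; rewrite cn_ge0 andbT.
  apply/ler_addgt0Pr => /= e e_gt0; rewrite add0r.
  have e2_gt0 : 0 < e / 2 by rewrite divr_gt0.
  have [r r_gt0 Hr] := hD _ e2_gt0; have [r' r'_gt0 Hr'] := hD' _ e2_gt0.
  have [|s0 s00 Hs] := @isb_near j k z0 1 ib0 q0 q1 _; first by right.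
  have [|s0' s0'0 Hs'] := @isb_near j' k' z1 (-1) ib1 r0 r1 _.
    by right; rewrite ImN [complex.Im 1]/= oppr0.
  pose mm := Num.min (Num.min r r') (Num.min s0 s0').
  have mm0 : 0 < mm by rewrite !lt_min r_gt0 r'_gt0 s00 s0'0.
  have sm : mm / 2 < mm by rewrite ltr_pdivrMr// ltr_pMr// ltr1n.
  have sp : 0 < mm / 2 by rewrite divr_gt0.
  move: sm; set s := mm / 2 in sp *; rewrite !lt_min => /andP[/andP[sr sr'] /andP[ss ss']].
  have A := Hs s sp ss; have A' := Hs' s sp ss'.
  have cs : z0 + s%:C * 1 - z0 = s%:C by ring.
  have cs' : z1 + s%:C * -1 - z1 = - s%:C by ring.
  have h1 := Hr _ A; rewrite cs cnR gtr0_norm// in h1; have {}h1 := h1 sr.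
  have h2 := Hr' _ A'; rewrite cs' cnN cnR gtr0_norm// in h2; have {}h2 := h2 sr'.
  have EE : psz j k (z0 + s%:C * 1) = psz j' k' (z1 + s%:C * -1).
    rewrite !pszE (@edge_match j k j' k')//; last by rewrite ImD ImRM hI [complex.Im 1]/= mulr0 addr0.
    by congr (Psi (ptj _ (bz _ _ _))); rewrite /z1; ring.
  have EE0 : psz j k z0 = psz j' k' z1 by rewrite !pszE E0.
  rewrite EE EE0 in h1.
  rewrite -(ler_pM2r sp) -{1}(gtr0_norm sp) -cnR -cnM.
  set Q := psz _ _ _ in h1 h2; set Q0 := psz j' k' z1 in h1 h2.
  rewrite (_ : (D' + D) * s%:C = (Q - Q0 - D' * - s%:C) - (Q - Q0 - D * s%:C)); last by ring.
  by apply: (le_trans (cnB _ _)); lra.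
have [hi|hi] := leP 0 (complex.Im (- (tc R c - tc R (succ3 c)) / D)); first by apply: step1; right.
apply: (push_out D'0 hD' hz1).
  by move=> z hzz; exact: T0.
apply: isb_near => //; right.
by rewrite DD invrN mulrN ImN oppr_ge0 ltW.
Qed.
End InteriorPoints.

(** * Correspondence of boundary edges and sides of T *)

Section BoundaryCorrespondence.
Variables (R : realType) (d : nat) (X : TriSurf R d).
Local Notation P := (@pos _ _ X).
Local Notation F := (@face _ _ X).
Local Notation pt := 'rV[R]_d.
Implicit Types (j : 'I_(nF X)) (k m c : 'I_3) (v w i : 'I_(nV X)) (b : 'rV[R]_3) (x : pt).
Variables (v1 v2 v3 : 'I_(nV X)) (zeta : R) (phi : 'I_(nV X) -> pt -> R[i]^o).
Variables (Psi : pt -> R[i]^o) (Psiinv : R[i]^o -> pt).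
Hypotheses (TD : triangulated_disk X) (zeta0 : 0 < zeta) (zeta1 : zeta < 4^-1).
Hypothesis SA : standing_assumption X v1 v2 v3.
Hypothesis CH : forall i, is_chart X v1 v2 v3 zeta i (phi i).
Hypothesis PS : is_Psi X v1 v2 v3 zeta phi Psi Psiinv.
Let HPsi := Psi_homeo PS.

Definition mv c : 'I_(nV X) := if c == 0 then v1 else if c == 1 then v2 else v3.

Lemma Psi_mv c : Psi (P (mv c)) = tc R c.
Proof. by case: PS => _ h1 h2 h3 _; case: (ord3P c) => ->. Qed.

Lemma surf_vertex v : exists j k, v = F j k /\ P v = ptj j (edgeb k 0).
Proof.
case: TD => _ [hc _ _] _ _; have [j /mem_faceset[k ->]] := hc v.
by exists j, k; rewrite ptj_edgeb subr0 scale1r scale0r addr0.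
Qed.
Lemma edgeb01 k : isb (edgeb k 0 : 'rV[R]_3).
Proof. by apply: edgeb_isb; rewrite lexx ler01. Qed.
Lemma surfV v : surf X (P v).
Proof. by have [j [k [_ ->]]] := surf_vertex v; apply: surf_ptj => //; exact: edgeb01. Qed.
Lemma hat_vertex v w : hat w (P v) = (w == v)%:R.
Proof.
have [j [k [-> ->]]] := surf_vertex v; have [/mem_faceset[m ->]|h] := boolP (w \in faceset j).
  rewrite hat_pt//; last exact: edgeb01.
  rewrite (inj_eq (face_inj TD (j := j))) mxE subr0.
  by case: eqP => // _; case: ifP.
rewrite hat_pt0//; last exact: edgeb01.
by case: eqP h => // -> /mem_faceset[]; exists k.
Qed.

(** Any two of three coordinates are cyclically consecutive, so a point without a consecutive
    positive pair has a single positive coordinate. *)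
Lemma vertex_or_edge x : surf X x -> (exists v, x = P v) \/
  exists j k b, [/\ isb b, x = ptj j b, 0 < b 0 k & 0 < b 0 (succ3 k)].
Proof.
move=> /(surfP TD)[j [b hb ->]].
have [[k [h1 h2]]|hn] := pselect (exists k, 0 < b 0 k /\ 0 < b 0 (succ3 k)).
  by right; exists j, k, b.
left; have [m hm] : exists m, 0 < b 0 m.
  apply: contrapT => /forallNP h; have := hb.2; rewrite big1 => [|k _].
    by move/eqP; rewrite eq_sym oner_eq0.
  by apply/le_anti; rewrite hb.1 leNgt; apply/andP; split=> //; apply/negP; exact: h.
have z n : (0 < b 0 n -> False) -> b 0 n = 0.
  by move=> h; apply/le_anti; rewrite hb.1 leNgt; apply/andP; split=> //; apply/negP.
have b1 : b 0 (succ3 m) = 0 by apply: z => h; apply: hn; exists m.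
have b2 : b 0 (succ3 (succ3 m)) = 0.
  by apply: z => h; apply: hn; exists (succ3 (succ3 m)); rewrite succ3K.
have := hb.2; rewrite (sum3 m) b1 b2 !addr0 => bm.
by exists (F j m); rewrite /ptj (sum3 m) b1 b2 bm !scale0r !addr0 scale1r.
Qed.

Lemma conv2_bd v w x : bedge v w -> conv2 (P v) (P w) x -> bdsurf X x.
Proof. by move=> h1 h2; exists v, w. Qed.

(** Preimages that are not vertices are handled by [int_psi]. A vertex is approached along the side
    by boundary points that are no vertices; close to it its hat function is positive on them, so it
    is an end of a boundary edge. *)
Lemma psi_bd (w : R[i]) c : Tri w -> mu c w = 0 -> bdsurf X (Psiinv w).
Proof.
have nonv (z : R[i]) : Tri z -> mu c z = 0 -> (forall v, Psiinv z <> P v) -> bdsurf X (Psiinv z).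
  move=> hz mz nv; have sx := homeo_S HPsi hz.
  have [[v hv]|[j [k [b [hb xE p0 p1]]]]] := vertex_or_edge sx; first by case: (nv v).
  have nint : ~ (0 < b 0 (succ3 (succ3 k)) \/ ~~ bedge (F j k) (F j (succ3 k))).
    move=> h; have := int_psi TD zeta0 zeta1 SA CH PS c hb p0 p1 h.
    by rewrite -xE (homeo_Ki HPsi hz) mz ltxx.
  have /not_orP[h1 /negP/negPn h2] := nint.
  have b2 : b 0 (succ3 (succ3 k)) = 0.
    by apply/le_anti; rewrite hb.1 leNgt andbT; exact/negP.
  apply: (conv2_bd h2); have := hb.2; rewrite (sum3 k) b2 addr0 => bs.
  exists (b 0 k), (b 0 (succ3 k)); split=> //; try exact: ltW.
  by rewrite xE /ptj (sum3 k) b2 scale0r addr0.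
move=> hw mw; have sx := homeo_S HPsi hw.
have [[v hv]|nv] := pselect (exists v, Psiinv w = P v); last first.
  by apply: nonv => // v h; apply: nv; exists v.
have [|r r0 Hr] := scont_hat TD v sx (e := 2^-1); first by rewrite invr_gt0.
have [e e0 He] := homeo_icont HPsi hw r0.
(* A corner of the same side other than [w]: the segment towards it stays in the side. *)
have [m [mc wm]] : exists m, mu c (tc R m) = 0 /\ w <> tc R m.
  have [h|h] := pselect (w = tc R (succ3 c)).
    exists (succ3 (succ3 c)); rewrite mu_tc eq_sym succ3_neq2; split=> // h'.
    have := mu_tc R (succ3 c) (succ3 c); rewrite -h h' mu_tc eqxx.
    by rewrite eq_sym succ3_neq => /eqP; rewrite eq_sym oner_eq0.
  by exists (succ3 c); rewrite mu_tc eq_sym succ3_neq; split.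
have Tm : Tri (tc R m) by apply/TriP => n; rewrite mu_tc ler0n.
have n0 : 0 < cn (tc R m - w) by rewrite cn_gt0 subr_eq0; apply/eqP => h; apply: wm.
pose B v' s := in01 s /\ Psiinv (segC w (tc R m) s) = P v'.
have [|v' s s' [hs h1] [hs' h2]|s [/andP[s0 s1] hs]] := @avoid R 'I_(nV X) B (Num.min 1 (e / cn (tc R m - w))).
- by rewrite lt_min ltr01 divr_gt0.
- have := homeo_Ki HPsi (Tri_seg hw Tm hs'); rewrite h2 -h1 (homeo_Ki HPsi (Tri_seg hw Tm hs)).
  move=> /eqP; rewrite -subr_eq0 /segC.
  rewrite (_ : _ - _ = (s - s')%:C * (tc R m - w)); last by rewrite !rmorphB /=; ring.
  rewrite mulf_eq0 => /orP[/eqP|].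
    by move=> /(congr1 (@complex.Re R)) /= /eqP; rewrite subr_eq0 => /eqP.
  by rewrite -cn_eq0 gt_eqF.
move: s1; rewrite lt_min => /andP[s1]; rewrite ltr_pdivlMr// => se.
have is01 : in01 s by rewrite /in01 !ltW.
have hws := Tri_seg hw Tm is01.
have mws : mu c (segC w (tc R m) s) = 0 by rewrite /segC mu_seg mw mc !mulr0 addr0.
have bs : bdsurf X (Psiinv (segC w (tc R m) s)).
  by apply: nonv => // v' h; apply: (hs v'); split.
have nb : ball (Psiinv w) r (Psiinv (segC w (tc R m) s)).
  apply: He => //; rewrite (_ : _ - _ = s%:C * (tc R m - w)); last by rewrite /segC !rmorphB /=; ring.
  by rewrite cnM cnR gtr0_norm.
have := Hr _ (homeo_S HPsi hws) nb; rewrite {1}hv hat_vertex eqxx ltr_norml => /andP[h1 _].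
case: bs => p [q [pq hx]]; have /andP[opq _] := pq.
have hv0 : 0 < hat v (Psiinv (segC w (tc R m) s)) by move: h1; rewrite mulr1n; lra.
rewrite hv; exists p, q; split=> //.
have [->|->] := conv2_hat TD opq hx hv0.
  by exists 1, 0; rewrite lexx ler01 addr0 scale1r scale0r addr0.
by exists 0, 1; rewrite lexx ler01 add0r scale1r scale0r add0r.
Qed.

Section Phi.
Variables (Phi : pt -> R[i]^o) (g : R[i]^o -> pt).
Hypotheses (HPhi : homeo_sets (surf X) (@Tri R) Phi g).
Hypothesis (Phi_bd : Phi @` bdsurf X = @bdTri R).
Hypothesis (Phi_mv : forall c, Phi (P (mv c)) = tc R c).

Let side c (t : R) : R[i] := segC (tc R (succ3 c)) (tc R (succ3 (succ3 c))) t.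
Let Ttc c : Tri (tc R c). Proof. by apply/TriP => m; rewrite mu_tc ler0n. Qed.
Let Tside c t : in01 t -> Tri (side c t). Proof. exact: Tri_seg. Qed.
Let mu_side c t : [/\ mu c (side c t) = 0, mu (succ3 c) (side c t) = 1 - t &
  mu (succ3 (succ3 c)) (side c t) = t].
Proof.
rewrite /side /segC !mu_seg !mu_tc !eqxx.
have e1 : (c == succ3 c) = false by rewrite eq_sym succ3_neq.
have e2 : (c == succ3 (succ3 c)) = false by rewrite eq_sym succ3_neq2.
have e3 : (succ3 c == succ3 (succ3 c)) = false by rewrite eq_sym succ3_neq.
by rewrite e1 e2 e3 succ3_neq; split; rewrite /= ?mulr1n ?mulr0n; ring.
Qed.

(** The transition map from [Psi] to [Phi], restricted to the side [c] of [T]. *)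
Let Fs c t := Phi (Psiinv (side c t)).
Let Fs_cont c m : pcont (fun t => mu m (Fs c t)).
Proof. exact: (pcont_seg HPsi (scont_mu HPhi m) (Ttc _) (Ttc _)). Qed.
Let Fs_ge0 c m t : in01 t -> 0 <= mu m (Fs c t).
Proof. by move=> /(Tside c) /(homeo_S HPsi) h; apply: (homeo_mu HPhi). Qed.
Let Fs_bd c t : in01 t -> exists m, mu m (Fs c t) = 0.
Proof.
move=> ht; have [h _ _] := mu_side c t; have hb := psi_bd (Tside c ht) h.
have : bdTri (Fs c t) by rewrite -Phi_bd; exists (Psiinv (side c t)).
by move=> /bdTriP[].
Qed.
Let Fs_corner c t m m' : in01 t -> m' != m -> mu m (Fs c t) = 0 -> mu m' (Fs c t) = 0 ->
  exists2 m0, m0 != m & side c t = tc R m0.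
Proof.
move=> ht mm h1 h2.
have [m0 [n0 E]] : exists m0, m0 != m /\ Fs c t = tc R m0.
  case: (ord3_cases m m') mm h2 => -> mm h2.
  - by rewrite eqxx in mm.
  - exists (succ3 (succ3 m)); split; first by rewrite succ3_neq2.
    by apply: mu_corner; rewrite succ3K.
  - exists (succ3 m); split; first by rewrite succ3_neq.
    by apply: mu_corner; rewrite ?succ3K.
exists m0 => //; have hs := homeo_S HPsi (Tside c ht).
have : Psiinv (side c t) = P (mv m0).
  by rewrite -(homeo_K HPhi hs) -(homeo_K HPhi (surfV (mv m0))) Phi_mv -E.
by move=> h; rewrite -(homeo_Ki HPsi (Tside c ht)) h Psi_mv.
Qed.

Let i0 : in01 (0 : R). Proof. by rewrite /in01 lexx ler01. Qed.
Let i1 : in01 (1 : R). Proof. by rewrite /in01 lexx ler01. Qed.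
Let side0 c : side c 0 = tc R (succ3 c).
Proof. by rewrite /side /segC subr0 mul1r mul0r addr0. Qed.
Let side1 c : side c 1 = tc R (succ3 (succ3 c)).
Proof. by rewrite /side /segC subrr mul1r mul0r add0r. Qed.
Let Fs_tc c t m : side c t = tc R m -> Fs c t = tc R m.
Proof. by move=> h; rewrite /Fs h -(Psi_mv m) (homeo_K HPsi (surfV (mv m))) Phi_mv Psi_mv. Qed.

Let rescale (a b s : R) : in01 a -> in01 b -> in01 s -> in01 (a + s * (b - a)).
Proof.
move=> /andP[a0 a1] /andP[b0 b1] /andP[s0 s1].
have -> : a + s * (b - a) = (1 - s) * a + s * b by ring.
apply/andP; split; first by rewrite addr_ge0// mulr_ge0// subr_ge0.
apply: (@le_trans _ _ ((1 - s) * 1 + s * 1)); last by rewrite !mulr1 subrK.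
by apply: lerD; apply: ler_wpM2l => //; rewrite subr_ge0.
Qed.

(** The image of the part before [t] is a boundary path that starts at one end of the side and
    misses the other two corners, so the coordinate of that end stays positive; likewise from the
    other end. The vanishing coordinate can only be the one at [c]. *)
Lemma side_to_side c t : in01 t -> mu c (Fs c t) = 0.
Proof.
move=> ht; have /andP[t0 t1] := ht.
have [->|tn0] := eqVneq t 0; first by rewrite (Fs_tc (side0 c)) mu_tc eq_sym succ3_neq.
have [->|tn1] := eqVneq t 1; first by rewrite (Fs_tc (side1 c)) mu_tc eq_sym succ3_neq2.
have {}t0 : 0 < t by rewrite lt_def tn0.
have {}t1 : t < 1 by rewrite lt_def eq_sym tn1.
have A1 : 0 < mu (succ3 c) (Fs c (0 + 1 * (t - 0))).
  apply: (@boundary_path R (fun m s => mu m (Fs c (0 + s * (t - 0)))) (succ3 c)) => //.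
  - by move=> m; apply: (@pcont_rescale R (fun s => mu m (Fs c s))).
  - by move=> m s hs; apply: Fs_ge0; exact: rescale.
  - by move=> s hs; apply: Fs_bd; exact: rescale.
  - by rewrite mul0r addr0 (Fs_tc (side0 c)) mu_tc eqxx.
  - move=> m s hs hm h; apply/eqP => h'.
    have [m0 m0n hm0] := Fs_corner (rescale i0 ht hs) hm h h'.
    have [_ + _] := mu_side c (0 + s * (t - 0)); rewrite hm0 mu_tc eq_sym (negbTE m0n) /=.
    by have /andP[s0 s1] := hs; rewrite mulr0n; nra.
have A2 : 0 < mu (succ3 (succ3 c)) (Fs c (1 + 1 * (t - 1))).
  apply: (@boundary_path R (fun m s => mu m (Fs c (1 + s * (t - 1)))) (succ3 (succ3 c))) => //.
  - by move=> m; apply: (@pcont_rescale R (fun s => mu m (Fs c s))).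
  - by move=> m s hs; apply: Fs_ge0; exact: rescale.
  - by move=> s hs; apply: Fs_bd; exact: rescale.
  - by rewrite mul0r addr0 (Fs_tc (side1 c)) mu_tc eqxx.
  - move=> m s hs hm h; apply/eqP => h'.
    have [m0 m0n hm0] := Fs_corner (rescale i1 ht hs) hm h h'.
    have [_ _] := mu_side c (1 + s * (t - 1)); rewrite hm0 mu_tc eq_sym (negbTE m0n) /=.
    by have /andP[s0 s1] := hs; rewrite mulr0n; nra.
rewrite mul1r subr0 add0r in A1; rewrite mul1r subrKC in A2.
have [m hm] := Fs_bd c ht; case: (ord3_cases c m) hm => -> hm //.
  by rewrite hm ltxx in A1.
by rewrite hm ltxx in A2.
Qed.

Lemma mu_le1 c (w : R[i]) : Tri w -> mu c w <= 1.
Proof.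
move=> /TriP h; have := mu_sum w; rewrite (sum3 c) => <-.
by rewrite -addrA lerDl addr_ge0.
Qed.

(** The transition map fixes the two ends of a side, hence by the intermediate value theorem maps
    the side onto itself. *)
Lemma same_side x c : surf X x -> (mu c (Phi x) = 0 <-> mu c (Psi x) = 0).
Proof.
move=> hx; split=> h.
  have cf := @Fs_cont c (succ3 (succ3 c)).
  have cc (k : R) : pcont (fun=> k) by move=> t _ e e0; exists 1 => // s _ _; rewrite subrr normr0.
  have [||t ht /eqP] := ivt01 (pcontB cf (cc (mu (succ3 (succ3 c)) (Phi x)))).
  - rewrite (Fs_tc (side0 c)) mu_tc succ3_neq sub0r oppr_le0; exact: (homeo_mu HPhi).
  - rewrite (Fs_tc (side1 c)) mu_tc eqxx subr_ge0; apply: mu_le1; exact: (homeo_T HPhi).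
  rewrite subr_eq0 => /eqP hE.
  have E : Fs c t = Phi x by apply: (@mu_inj2 R (succ3 (succ3 c))); rewrite // succ3K h side_to_side.
  have hs := homeo_S HPsi (Tside c ht).
  have : Psiinv (side c t) = x by rewrite -(homeo_K HPhi hs) -(homeo_K HPhi hx) -E.
  by move=> <-; rewrite (homeo_Ki HPsi (Tside c ht)); case: (mu_side c t).
pose t := mu (succ3 (succ3 c)) (Psi x).
have ht : in01 t by rewrite /in01 (homeo_mu HPsi)//= mu_le1//; exact: (homeo_T HPsi).
have E : Psi x = side c t.
  have [e1 _ e3] := mu_side c t.
  by apply: (@mu_inj2 R (succ3 (succ3 c))); rewrite ?succ3K ?h ?e1 ?e3.
by rewrite -(homeo_K HPsi hx) E; exact: side_to_side.
Qed.

(** That boundary points go to the boundary of [T] is given for [Phi], and [same_side] transfers it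
    to [Psi]. The open edge contains no vertex, so its image contains no corner and cannot pass from
    one side to another; the ends follow by continuity. *)
Lemma edge_side j k : bedge (F j k) (F j (succ3 k)) ->
  exists c, forall t, in01 t -> mu c (Psi (ptj j (edgeb k t))) = 0.
Proof.
move=> be; pose G m t := mu m (Psi (ptj j (edgeb k t))).
have sx t : in01 t -> surf X (ptj j (edgeb k t)) by move=> ht; apply: surf_ptj => //; exact: edgeb_isb.
have cG m : pcont (G m).
  have E : (fun t : R => mu m (Psi (ptj j ((1 - t) *: edgeb k 0 + t *: edgeb k 1)))) = G m.
    apply/funext => t; rewrite /G; congr (mu _ (Psi (ptj _ _))).
    by apply/rowP => i; rewrite !mxE; case: ifP => _; [ring|case: ifP => _; ring].
  have := @pcont_face R d X TD _ j _ _ (scont_mu HPsi m) (edgeb_isb k (ltac:(rewrite lexx ler01) : 0 <= 0 <= 1))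
     (edgeb_isb k (ltac:(rewrite lexx ler01) : 0 <= 1 <= 1)).
  by move=> h; rewrite -E; exact: h.
have G0 m t : in01 t -> 0 <= G m t by move=> /sx h; exact: (homeo_mu HPsi).
have Gz t : in01 t -> exists m, G m t = 0.
  move=> ht; have : bdTri (Phi (ptj j (edgeb k t))).
    rewrite -Phi_bd; exists (ptj j (edgeb k t)) => //; apply: (conv2_bd be).
    have /andP[t0 t1] := ht; exists (1 - t), t; rewrite subr_ge0 t0 t1 subrK ptj_edgeb; split=> //.
  by move=> /bdTriP[_ [m hm]]; exists m; apply/(same_side m (sx t ht)).
have nc t m m' : 0 < t < 1 -> m' != m -> G m t = 0 -> G m' t <> 0.
  move=> /andP[t0 t1] mm h1 h2; have ht : in01 t by rewrite /in01 !ltW.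
  have [m0 E] : exists m0, Psi (ptj j (edgeb k t)) = tc R m0.
    case: (ord3_cases m m') mm h2 => -> mm h2.
    - by rewrite eqxx in mm.
    - by exists (succ3 (succ3 m)); apply: mu_corner; rewrite succ3K.
    - by exists (succ3 m); apply: mu_corner; rewrite ?succ3K.
  have EE : ptj j (edgeb k t) = P (mv m0).
    by rewrite -(homeo_K HPsi (sx t ht)) -(homeo_K HPsi (surfV (mv m0))) Psi_mv E.
  have ib := edgeb_isb k ht.
  have := hat_vertex (mv m0) (mv m0); rewrite -EE eqxx.
  have [/mem_faceset[n ->]|hn] := boolP (mv m0 \in faceset j); last first.
    by rewrite hat_pt0// => /eqP; rewrite eq_sym oner_eq0.
  rewrite hat_pt// mxE mulr1n; case: ifP => _; first lra.
  by case: ifP => _; lra.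
have h2 : 0 < (2^-1 : R) < 1 by apply/andP; split; lra.
have i2 : in01 (2^-1 : R) by move/andP: h2 => [? ?]; rewrite /in01 !ltW.
have [c hc] := Gz _ i2; exists c.
have pos m t : m != c -> 0 < t < 1 -> 0 < G m t.
  move=> mc tt; have ht : in01 t by move/andP: tt => [? ?]; rewrite /in01 !ltW.
  have inn s : in01 s -> 0 < 2^-1 + s * (t - 2^-1) < 1.
    move=> /andP[s0 s1]; have /andP[t0 t1] := tt.
    have -> : 2^-1 + s * (t - 2^-1) = (1 - s) * 2^-1 + s * t by ring.
    by apply/andP; split; nra.
  have : 0 < G m (2^-1 + 1 * (t - 2^-1)); last by rewrite mul1r subrKC.
  apply: (@boundary_path R (fun m s => G m (2^-1 + s * (t - 2^-1))) m) => //.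
  - by move=> n; apply: (@pcont_rescale R (G n)).
  - by move=> n s hs; apply: G0; exact: rescale.
  - by move=> s hs; apply: Gz; exact: rescale.
  - rewrite mul0r addr0 lt_def G0// andbT; apply/eqP => h.
    by apply: (nc _ _ _ h2 mc hc h).
  - by move=> n s hs nm h; apply/eqP; apply: (nc _ _ _ (inn s hs) nm h).
have mid t : 0 < t < 1 -> G c t = 0.
  move=> tt; have ht : in01 t by move/andP: tt => [? ?]; rewrite /in01 !ltW.
  have [m hm] := Gz t ht; have [<-//|mc] := eqVneq m c.
  by have := pos m t mc tt; rewrite hm ltxx.
have ends a : in01 a -> G c a = 0.
  move=> ha; apply/eqP/negPn/negP => hn.
  have g0 : 0 < G c a by rewrite lt_def hn G0.
  have [r r0 Hr] := cG c a ha _ g0.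
  pose r' := Num.min r 2^-1; have r'0 : 0 < r' by rewrite lt_min r0 invr_gt0 ltr0n.
  have [r'r r'2] : r' <= r /\ r' <= 2^-1 by rewrite /r' !ge_min !lexx orbT.
  have [s [s0 sa]] : exists s, 0 < s < 1 /\ `|s - a| < r.
    have /andP[a0 a1] := ha; have [h|h] := leP a 2^-1.
      exists (a + r' / 2); split; first by apply/andP; split; lra.
      by rewrite addrC addKr ger0_norm; lra.
    exists (a - r' / 2); split; first by apply/andP; split; lra.
    by rewrite addrC addKr normrN ger0_norm; lra.
  have is0 : in01 s by move: s0 => /andP[? ?]; rewrite /in01 !ltW.
  by have := Hr s is0 sa; rewrite (mid s s0) sub0r normrN gtr0_norm// ltxx.
by move=> t ht; exact: ends.
Qed.

(** A point of the open side that is not the image of a vertex comes from a boundary edge, and its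
    other two coordinates, being positive, exclude the other sides. *)
Lemma side_has_edge c : exists j k, bedge (F j k) (F j (succ3 k)) /\
  forall t, in01 t -> mu c (Psi (ptj j (edgeb k t))) = 0.
Proof.
pose B v s := in01 s /\ Psiinv (side c s) = P v.
have [v s s' [hs h1] [hs' h2]|s [/andP[s0 s1] hs]] := @avoid R 'I_(nV X) B 1 ltr01.
  have := homeo_Ki HPsi (Tside c hs'); rewrite h2 -h1 (homeo_Ki HPsi (Tside c hs)) => E.
  by have [_ _ <-] := mu_side c s; have [_ _ <-] := mu_side c s'; rewrite E.
have is01 : in01 s by rewrite /in01 !ltW.
have [m0 m1 m2] := mu_side c s.
have hx := homeo_S HPsi (Tside c is01).
have [[v hv]|[j [k [b [hb xE p0 p1]]]]] := vertex_or_edge hx; first by case: (hs v); split.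
have bx := psi_bd (Tside c is01) m0; rewrite xE in bx.
have [b2 be] := bdsurf_face TD hb p0 p1 bx.
exists j, k; split=> //; have [c' hc'] := edge_side be.
suff -> : c = c' by [].
have bE : b = edgeb k (b 0 (succ3 k)).
  have := hb.2; rewrite (sum3 k) b2 addr0 => bs.
  apply/rowP => m; rewrite mxE; case: (ord3_cases k m) => ->.
  - by rewrite eqxx -bs addrK.
  - by rewrite succ3_neq eqxx.
  - by rewrite succ3_neq2 succ3_neq b2.
have i01 : in01 (b 0 (succ3 k)) by rewrite /in01 hb.1 isb_le1.
have := hc' _ i01; rewrite -bE -xE (homeo_Ki HPsi (Tside c is01)) => h.
case: (ord3_cases c c') h => -> //; first by rewrite m1 => ?; exfalso; lra.
by rewrite m2 => ?; exfalso; lra.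
Qed.
End Phi.
End BoundaryCorrespondence.

(** * Cauchy estimates on the surface *)

Section Gluing.
Variable R : realType.
Implicit Types (z w a p k D : R[i]) (e r M : R).

Definition cj z : R[i] := complex.Re z -i* complex.Im z.
Lemma cjK z : cj (cj z) = z. Proof. by case: z => x y; rewrite /cj /= opprK. Qed.
Lemma cjD z w : cj (z + w) = cj z + cj w.
Proof. by apply: ReIm_eq; rewrite /cj !(ReD, ImD) //= opprD. Qed.
Lemma cjN z : cj (- z) = - cj z.
Proof. by apply: ReIm_eq; rewrite /cj !(ReN, ImN). Qed.
Lemma cjB z w : cj (z - w) = cj z - cj w. Proof. by rewrite cjD cjN. Qed.
Lemma cjM z w : cj (z * w) = cj z * cj w.
Proof. by apply: ReIm_eq; rewrite /cj !(ReMc, ImMc) /=; ring. Qed.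
Lemma cn_cj z : cn (cj z) = cn z.
Proof. by rewrite !cnE /cj /= sqrrN. Qed.

Lemma cder_cj (G : R[i] -> R[i]) z D k p : cn k = 1 -> cder G (cj z) D ->
  cder (fun w => p + k * cj (G (cj w))) z (k * cj D).
Proof.
move=> k1 hG e e0; have [d d0 Hd] := hG e e0; exists d => // w hw.
have hw' : cn (cj w - cj z) < d by rewrite -cjB cn_cj.
have := Hd _ hw'; rewrite -cjB (cn_cj (w - z)).
have -> : p + k * cj (G (cj w)) - (p + k * cj (G (cj z))) - k * cj D * (w - z) =
  k * cj (G (cj w) - G (cj z) - D * cj (w - z)).
  by rewrite !(cjB, cjM, cjK); ring.
by rewrite cnM k1 mul1r cn_cj.
Qed.

Definition upper z := 0 <= complex.Im z.
Definition lower z := complex.Im z <= 0.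

(** The function equal to [G] above and to [H] below the real axis is continuous and can fail to be
    differentiable only on the axis, which is the line that [cauchy_estimate] allows. *)
Lemma glue_estimate (G H : R[i] -> R[i]) a r M : 0 < r -> upper a ->
  (forall z, near_sq a r z -> upper z -> forall e, 0 < e -> exists2 d : R, 0 < d &
     forall w, near_sq a r w -> upper w -> cn (w - z) < d -> cn (G w - G z) < e) ->
  (forall z, near_sq a r z -> lower z -> forall e, 0 < e -> exists2 d : R, 0 < d &
     forall w, near_sq a r w -> lower w -> cn (w - z) < d -> cn (H w - H z) < e) ->
  (forall z, near_sq a r z -> complex.Im z = 0 -> G z = H z) ->
  (forall z, near_sq a r z -> 0 < complex.Im z -> exists D, cder G z D) ->
  (forall z, near_sq a r z -> complex.Im z < 0 -> exists D, cder H z D) ->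
  (forall z, near_sq a r z -> upper z -> cn (G z - G a) <= M) ->
  (forall z, near_sq a r z -> lower z -> cn (H z - G a) <= M) ->
  exists D, forall z, upper z -> cn (z - a) <= r / 32 ->
    cn (G z - G a) <= 64 * M / r * cn (z - a) /\
    cn (G z - G a - D * (z - a)) <= 32 * (32 * 32) * M / r ^+ 2 * cn (z - a) ^+ 2.
Proof.
move=> r0 ua cG cH GH dG dH bG bH.
pose f z := if 0 <= complex.Im z then G z else H z.
have fu z : upper z -> f z = G z by rewrite /f /upper => ->.
have fl z : near_sq a r z -> lower z -> f z = H z.
  move=> hz; rewrite /lower le_eqVlt => /orP[/eqP h|h]; last by rewrite /f leNgt h.
  by rewrite /f h lexx GH.
have cder_loc (F1 F2 : R[i] -> R[i]) z D (d : R) : 0 < d ->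
    (forall w, cn (w - z) < d -> F2 w = F1 w) -> cder F1 z D -> cder F2 z D.
  move=> d0 E hF e e0; have [d1 d10 H1] := hF e e0.
  exists (Num.min d d1); first by rewrite lt_min d0.
  move=> w; rewrite lt_min => /andP[h1 h2].
  by rewrite !E ?subrr ?cn0//; exact: H1.
have [|||D HD] := @cauchy_estimate R f a r 0 M r0.
- move=> z hz e e0; have [uz|lz] := leP 0 (complex.Im z).
    have [d1 d10 H1] := cG z hz uz e e0.
    move: uz; rewrite le_eqVlt => /orP[/eqP zz|zp].
      have lz : lower z by rewrite /lower -zz.
      have uz : upper z by rewrite /upper -zz.
      have [d2 d20 H2] := cH z hz lz e e0.
      exists (Num.min d1 d2); first by rewrite lt_min d10.
      move=> w hw; rewrite lt_min => /andP[h1 h2].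
      have [uw|/ltW lw] := leP 0 (complex.Im w); first by rewrite !fu//; exact: H1.
      by rewrite !fl//; exact: H2.
    exists (Num.min d1 (complex.Im z)); first by rewrite lt_min d10.
    move=> w hw; rewrite lt_min => /andP[h1 h2].
    have uw : upper w.
      by rewrite /upper; have := le_lt_trans (cn_Im (w - z)) h2; rewrite ImD ImN ltr_norml => /andP[? ?]; lra.
    by rewrite !fu ?/upper ?(ltW zp)//; apply: H1 => //.
  have [d1 d10 H1] := cH z hz (ltW lz) e e0.
  exists (Num.min d1 (- complex.Im z)); first by rewrite lt_min d10 oppr_gt0.
  move=> w hw; rewrite lt_min => /andP[h1 h2].
  have lw : lower w.
    by rewrite /lower; have := le_lt_trans (cn_Im (w - z)) h2; rewrite ImD ImN ltr_norml => /andP[? ?]; lra.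
  by rewrite !fl//; [exact: H1|exact: ltW].
- move=> z h1 h2 h3; have hz : near_sq a r z by split; exact: ltW.
  have [zp|zn|/esym zz] := ltgtP 0 (complex.Im z); last by rewrite zz eqxx in h3.
    have [D hD] := dG z hz zp; exists D; apply: (cder_loc G f z D _ zp) => // w hw.
    apply: fu; rewrite /upper; have := le_lt_trans (cn_Im (w - z)) hw.
    by rewrite ImD ImN ltr_norml => /andP[? ?]; lra.
  have [D hD] := dH z hz zn; exists D; apply: (cder_loc H f z D (- complex.Im z)) => //.
    by rewrite oppr_gt0.
  move=> w hw; rewrite /f leNgt; have := le_lt_trans (cn_Im (w - z)) hw.
  rewrite ImD ImN ltr_norml => /andP[? ?]; suff -> : complex.Im w < 0 by []; lra.
- move=> z hz; rewrite (fu a ua); have [uz|/ltW lz] := leP 0 (complex.Im z).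
    by rewrite fu//; exact: bG.
  by rewrite fl//; exact: bH.
by exists D => z uz hz; have := HD z hz; rewrite !fu.
Qed.
End Gluing.

Section Reflection.
Variable R : realType.
Implicit Types (z w : R[i]) (c : 'I_3).

Let dir c : R[i] := tc R (succ3 (succ3 c)) - tc R (succ3 c).
(** Reflection in the line through the side [c]: the unit factor turns conjugation in the real axis
    into conjugation in the direction of the side. *)
Definition reflT c w : R[i] := tc R (succ3 c) + dir c / cj (dir c) * cj (w - tc R (succ3 c)).

Lemma dir_neq0 c : dir c != 0.
Proof.
apply/eqP => h; have := mu_sub (succ3 c) (tc R (succ3 (succ3 c))) (tc R (succ3 c)).
rewrite -/(dir c) h !mu_tc eqxx eq_sym succ3_neq /muL /crs /= !mulr0 subrr mul0r mulr0n mulr1n.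
by move=> /eqP; rewrite sub0r oppr_eq0 oner_eq0.
Qed.
Lemma cj_dir_neq0 c : cj (dir c) != 0.
Proof. by rewrite -cn_eq0 cn_cj cn_eq0 dir_neq0. Qed.
Lemma cn_dir c : cn (dir c / cj (dir c)) = 1.
Proof. by rewrite cnM cnV cn_cj divff// cn_eq0 dir_neq0. Qed.

Lemma reflT_fix c w : mu c w = 0 -> reflT c w = w.
Proof.
rewrite /mu => /eqP; rewrite mulf_eq0 invr_eq0 (gt_eqF (kapT_gt0 R)) orbF => /eqP h.
suff E : dir c * cj (w - tc R (succ3 c)) = (w - tc R (succ3 c)) * cj (dir c).
  by rewrite /reflT mulrAC E mulfK ?cj_dir_neq0// subrKC.
move: h; rewrite /crs /dir; move: (tc R (succ3 c)) (tc R (succ3 (succ3 c))) => p q.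
rewrite !(ReD, ImD, ReN, ImN) => h; apply: ReIm_eq; rewrite !(ReMc, ImMc) /cj !ReD !ImD !ReN !ImN /=; first by ring.
apply/eqP; rewrite -subr_eq0; apply/eqP.
rewrite -[RHS](mulr0 (-2)) -h; ring.
Qed.
Lemma reflT_iso c w z : cn (reflT c w - reflT c z) = cn (w - z).
Proof.
rewrite /reflT (_ : _ - _ = dir c / cj (dir c) * cj (w - z)); first by rewrite cnM cn_dir mul1r cn_cj.
by rewrite !cjB; ring.
Qed.
Lemma reflT_cder c (G : R[i] -> R[i]) z D : cder G (cj z) D ->
  exists D', cder (fun w => reflT c (G (cj w))) z D'.
Proof.
move=> h; exists (dir c / cj (dir c) * cj D).
have := cder_cj (tc R (succ3 c) - dir c / cj (dir c) * cj (tc R (succ3 c))) (cn_dir c) h.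
suff -> : (fun w => reflT c (G (cj w))) = (fun w => tc R (succ3 c) -
   dir c / cj (dir c) * cj (tc R (succ3 c)) + dir c / cj (dir c) * cj (G (cj w))) by [].
by apply/funext => w; rewrite /reflT cjB; ring.
Qed.
End Reflection.

Section SurfaceEstimate.
Variables (R : realType) (d : nat) (X : TriSurf R d).
Local Notation P := (@pos _ _ X).
Local Notation F := (@face _ _ X).
Local Notation pt := 'rV[R]_d.
Implicit Types (j : 'I_(nF X)) (k m c : 'I_3) (v i : 'I_(nV X)) (b : 'rV[R]_3) (x : pt).
Variables (v1 v2 v3 : 'I_(nV X)) (zeta : R) (phi : 'I_(nV X) -> pt -> R[i]^o).
Variables (Psi : pt -> R[i]^o) (Psiinv : R[i]^o -> pt).
Hypotheses (TD : triangulated_disk X) (zeta0 : 0 < zeta) (zeta1 : zeta < 4^-1).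
Hypothesis SA : standing_assumption X v1 v2 v3.
Hypothesis CH : forall i, is_chart X v1 v2 v3 zeta i (phi i).
Hypothesis PS : is_Psi X v1 v2 v3 zeta phi Psi Psiinv.
Hypothesis ES : forall j k, bedge (F j k) (F j (succ3 k)) ->
  exists c, forall t : R, in01 t -> mu c (Psi (ptj j (edgeb k t))) = 0.
Local Notation psz := (@psz R d X Psi).
Let HPsi := Psi_homeo PS.

Lemma psz_cont j k (z : R[i]) (e : R) : isb (bz j k z) -> 0 < e -> exists2 r : R, 0 < r &
  forall w : R[i], isb (bz j k w) -> cn (w - z) < r -> cn (psz j k w - psz j k z) < e.
Proof.
move=> hz e0; have [r r0 Hr] := homeo_cont HPsi (surf_ptj TD j hz) e0.
have [e1 e10 He] := @ptj_ball R d X r r0; have [C C0 HC] := bz_lip TD.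
exists (e1 / (4 * C)) => [|w hw]; first by rewrite divr_gt0// mulr_gt0.
rewrite ltr_pdivlMr ?mulr_gt0// => h; rewrite !pszE; apply: Hr; first exact: surf_ptj.
apply: He; rewrite /bnorm (sum3 0).
have B m : `|(bz j k z - bz j k w) 0 m| <= C * cn (w - z).
  by rewrite !mxE cnC; have := HC j k m z w; rewrite !mxE.
have := B 0; have := B (succ3 0); have := B (succ3 (succ3 0)).
have := cn_ge0 (w - z); move: h C0; move: (`|_|) (`|_|) (`|_|) (cn _) => p q s t h C0 t0 h1 h2 h3.
have : 0 <= C * t by apply: mulr_ge0 => //; exact: ltW.
nra.
Qed.

Lemma isb_bz j k (z : R[i]) : 0 <= bz j k z 0 k -> 0 <= bz j k z 0 (succ3 k) ->
  0 <= complex.Im z -> isb (bz j k z).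
Proof.
move=> h1 h2 h3; split; last exact: bz_sum.
move=> m; case: (ord3_cases k m) => -> //; rewrite bz2.
by apply: divr_ge0 => //; apply/ltW; exact: tau_im_gt0.
Qed.

(* Across the edge k, Psi is continued by the neighbouring face, or by reflection in
   a side of T for a boundary edge. The vertex m localises the bound M. *)
Lemma surface_estimate : exists2 C : R, 0 < C & forall j k m b (eta M : R),
  0 < eta -> isb b -> eta <= b 0 k -> eta <= b 0 (succ3 k) -> (m = k \/ m = succ3 k) ->
  (forall x, surf X x -> hat (F j m) (ptj j b) - eta <= hat (F j m) x ->
     cn (Psi x - Psi (ptj j b)) <= M) ->
  exists D, forall b', isb b' -> cn (zt j k b' - zt j k b) <= eta / C ->
    cn (Psi (ptj j b') - Psi (ptj j b)) <= C * M / eta * cn (zt j k b' - zt j k b) /\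
    cn (Psi (ptj j b') - Psi (ptj j b) - D * (zt j k b' - zt j k b)) <=
      C * M / eta ^+ 2 * cn (zt j k b' - zt j k b) ^+ 2.
Proof.
have [B B0 HB] := bz_lip TD.
(* In a square of half side [eta / K] the barycentric coordinates change by at most [eta / 2]. [C]
   dominates the constants of the radius and of the two bounds, where the factor 3 is the price of
   reflection. *)
pose K : R := 4 * B; have K0 : 0 < K by rewrite mulr_gt0.
pose C := 32 * K + 64 * 3 * K + 32 * (32 * 32) * 3 * K ^+ 2.
have K2 : 0 < K ^+ 2 by rewrite exprn_gt0.
have C0 : 0 < C by rewrite /C; lra.
exists C => // j k m b eta M eta0 hb bk bk1 hm HM.
have M0 : 0 <= M.
  apply: le_trans (cn_ge0 _) (HM _ (surf_ptj TD j hb) _).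
  by rewrite lerBlDr lerDl ltW.
have [a aE] : exists a, a = zt j k b by exists (zt j k b).
have bE : bz j k a = b by rewrite aE; apply: (bz_zt TD); exact: hb.2.
have ua : upper a by rewrite /upper aE Im_zt; apply: mulr_ge0; [apply/ltW; exact: tau_im_gt0|exact: hb.1].
pose r := eta / K; have r0 : 0 < r by rewrite divr_gt0.
have rK : K * r = eta by rewrite /r mulrC divfK ?gt_eqF.
have near_cn z : near_sq a r z -> cn (z - a) <= 2 * r.
  move=> [h1 h2]; apply: le_trans (cn_le _) _; lra.
have near_b z n : near_sq a r z -> `|bz j k z 0 n - b 0 n| <= eta / 2.
  move=> /near_cn h; rewrite -bE; apply: le_trans (HB _ _ _ _ _) _.
  have : B * cn (z - a) <= B * (2 * r) by apply: ler_wpM2l => //; exact: ltW.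
  by move: rK; rewrite /K; lra.
have near_pos z : near_sq a r z -> eta / 2 <= bz j k z 0 k /\ eta / 2 <= bz j k z 0 (succ3 k).
  move=> h; have := near_b z k h; have := near_b z (succ3 k) h.
  by rewrite !ler_norml => /andP[? ?] /andP[? ?]; split; lra.
have near_isb z : near_sq a r z -> upper z -> isb (bz j k z).
  by move=> h hz; have [? ?] := near_pos z h; apply: isb_bz => //; lra.
have near_hat z : near_sq a r z -> upper z -> hat (F j m) (ptj j b) - eta <= hat (F j m) (ptj j (bz j k z)).
  move=> h hz; rewrite !hat_pt//; last exact: near_isb.
  by have := near_b z m h; rewrite ler_norml => /andP[? ?]; lra.
have psa : psz j k a = Psi (ptj j b) by rewrite pszE bE.
have bG z : near_sq a r z -> upper z -> cn (psz j k z - psz j k a) <= M.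
  move=> h hz; rewrite psa; apply: HM; last exact: near_hat.
  by apply: surf_ptj => //; exact: near_isb.
have cG z : near_sq a r z -> upper z -> forall e : R, 0 < e -> exists2 d : R, 0 < d &
     forall w, near_sq a r w -> upper w -> cn (w - z) < d -> cn (psz j k w - psz j k z) < e.
  move=> h hz e e0; have [d1 d10 Hd] := psz_cont (near_isb z h hz) e0.
  by exists d1 => // w hw uw; apply: Hd; exact: near_isb.
have dG z : near_sq a r z -> 0 < complex.Im z -> exists D, cder (psz j k) z D.
  move=> h hz; apply: (psz_cder TD zeta0 zeta1 SA CH PS) => n.
  have [? ?] := near_pos z h; case: (ord3_cases k n) => ->; [lra|lra|].
  by rewrite bz2 divr_gt0//; exact: tau_im_gt0.
suff [H [cH GH dH bH]] : exists H : R[i] -> R[i],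
   [/\ (forall z, near_sq a r z -> lower z -> forall e : R, 0 < e -> exists2 d : R, 0 < d &
     forall w, near_sq a r w -> lower w -> cn (w - z) < d -> cn (H w - H z) < e),
   (forall z, near_sq a r z -> complex.Im z = 0 -> psz j k z = H z),
   (forall z, near_sq a r z -> complex.Im z < 0 -> exists D, cder H z D) &
   (forall z, near_sq a r z -> lower z -> cn (H z - psz j k a) <= 3 * M)].
  have bG3 z : near_sq a r z -> upper z -> cn (psz j k z - psz j k a) <= 3 * M.
    by move=> h hz; apply: le_trans (bG z h hz) _; lra.
  have [D HD] := glue_estimate r0 ua cG cH GH dG dH bG3 bH.
  exists D => b' hb'; rewrite -aE => hc.
  have uz : upper (zt j k b').
    by rewrite /upper Im_zt; apply: mulr_ge0; [apply/ltW; exact: tau_im_gt0|exact: hb'.1].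
  have [|h1 h2] := HD _ uz.
    apply: le_trans hc _; rewrite /r -mulrA -invfM; apply: ler_wpM2l; first exact: ltW.
    rewrite lef_pV2 ?posrE//; last by rewrite mulr_gt0.
    by rewrite /C; lra.
  have eb : psz j k (zt j k b') = Psi (ptj j b') by rewrite pszE bz_zt//; exact: hb'.2.
  move: h1 h2; rewrite eb psa => h1 h2; split.
    apply: le_trans h1 _; apply: ler_wpM2r; first exact: cn_ge0.
    have -> : 64 * (3 * M) / r = 64 * 3 * K * (M / eta) by rewrite /r; field; rewrite !gt_eqF.
    rewrite -[leRHS]mulrA; apply: ler_wpM2r; first by apply: divr_ge0 => //; exact: ltW.
    by rewrite /C; lra.
  apply: le_trans h2 _; apply: ler_wpM2r; first exact: exprn_ge0 (cn_ge0 _).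
  have -> : 32 * (32 * 32) * (3 * M) / r ^+ 2 = 32 * (32 * 32) * 3 * K ^+ 2 * (M / eta ^+ 2).
    by rewrite /r; field; rewrite !gt_eqF.
  rewrite -[leRHS]mulrA; apply: ler_wpM2r; first by apply: divr_ge0 => //; exact: exprn_ge0 (ltW eta0).
  by rewrite /C; lra.
have real_near z : near_sq a r z -> lower z -> near_sq a r (complex.Re z)%:C.
  rewrite /near_sq /lower !ReD !ReN !ImD !ImN /= => -[h1 h2] lz; split=> //.
  move: h2 ua; rewrite /upper sub0r normrN !ler_norml => /andP[h2 h3] ua.
  by apply/andP; split; lra.
have im_small z : near_sq a r z -> lower z -> `|complex.Im z| <= r.
  rewrite /near_sq /lower !ImD !ImN /= => -[_ h2] lz.
  move: h2 ua; rewrite /upper !ler_norml => /andP[h2 h3] ua.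
  by apply/andP; split; lra.
have [be|nbe] := boolP (bedge (F j k) (F j (succ3 k))); last first.
  have [j' [k' [e1 e2]]] : exists j' k', F j' k' = F j (succ3 k) /\ F j' (succ3 k') = F j k.
    move: nbe; rewrite /bedge negb_and negbK => /orP[|/oedgeP[j' [k' [? ?]]]]; last by exists j', k'.
    by move=> /negP[]; apply/oedgeP; exists j, k.
  have near_pos' z : near_sq a r z -> lower z ->
     [/\ `|bz j' k' (1 - z) 0 k' - bz j k (complex.Re z)%:C 0 (succ3 k)| <= eta / 4 &
      `|bz j' k' (1 - z) 0 (succ3 k') - bz j k (complex.Re z)%:C 0 k| <= eta / 4].
    move=> h lz; have E n : `|bz j' k' (1 - z) 0 n - bz j' k' (1 - (complex.Re z)%:C) 0 n| <= eta / 4.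
      apply: le_trans (HB _ _ _ _ _) _.
      have -> : 1 - z - (1 - (complex.Re z)%:C) = 'i * (- complex.Im z)%:C.
        by rewrite {1}(ReIm z) rmorphN /=; ring.
      rewrite cnM cni mul1r cnR normrN.
      have : B * `|complex.Im z| <= B * r by apply: ler_wpM2l; [exact: ltW|exact: im_small].
      by move: rK; rewrite /K; lra.
    have A1 : bz j' k' (1 - (complex.Re z)%:C) 0 k' = bz j k (complex.Re z)%:C 0 (succ3 k).
      by rewrite bz0 bz1 !ReD !ImD !ReN !ImN /= !(mul0r, oppr0, addr0, subr0); ring.
    have A2 : bz j' k' (1 - (complex.Re z)%:C) 0 (succ3 k') = bz j k (complex.Re z)%:C 0 k.
      by rewrite bz0 bz1 !ReD !ImD !ReN !ImN /= !(mul0r, oppr0, addr0, subr0); ring.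
    by rewrite -A1 -A2.
  have isb' z : near_sq a r z -> lower z -> isb (bz j' k' (1 - z)).
    move=> h lz; have [p1 p2] := near_pos _ (real_near z h lz).
    have [h1 h2] := near_pos' z h lz.
    move: h1 h2; rewrite !ler_norml => /andP[h1 _] /andP[h2 _].
    apply: isb_bz; [lra|lra|].
    by rewrite ImD ImN /= add0r oppr_ge0.
  exists (fun z => psz j' k' (1 - z)); split.
  - move=> z h lz e e0; have [d1 d10 Hd] := psz_cont (isb' z h lz) e0.
    exists d1 => // w hw lw hwz; apply: Hd; first exact: isb'.
    by rewrite (_ : _ - _ = z - w); [rewrite cnC|ring].
  - by move=> z h zz; rewrite pszE (edge_match e1 e2 zz).
  - move=> z h lz.
    have [D hD] : exists D, cder (psz j' k') (1 - z) D.
      apply: (psz_cder TD zeta0 zeta1 SA CH PS) => n.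
      have [p1 p2] := near_pos _ (real_near z h (ltW lz)).
      have [h1 h2] := near_pos' z h (ltW lz).
      move: h1 h2; rewrite !ler_norml => /andP[h1 _] /andP[h2 _].
      case: (ord3_cases k' n) => ->; [lra|lra|].
      by rewrite bz2 divr_gt0//; [rewrite ImD ImN /= add0r oppr_gt0|exact: tau_im_gt0].
    exists (- D) => e e0; have [d1 d10 Hd] := hD e e0; exists d1 => // w hw.
    have E : 1 - w - (1 - z) = - (w - z) by ring.
    have := Hd (1 - w); rewrite E cnN => /(_ hw).
    by rewrite mulrN mulNr.
  - move=> z h lz; rewrite psa; apply: le_trans (HM _ _ _) _; last lra.
      by apply: surf_ptj => //; exact: isb'.
    have [h1 h2] := near_pos' z h lz.
    have n1 := near_b _ k (real_near z h lz); have n2 := near_b _ (succ3 k) (real_near z h lz).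
    move: h1 h2 n1 n2; rewrite !ler_norml => /andP[h1 _] /andP[h2 _] /andP[n1 _] /andP[n2 _].
    case: hm => ->; rewrite hat_pt// -?e1 -?e2 hat_pt//; try exact: isb'; lra.
have [c hc] := ES be.
have cjnear z : near_sq a r z -> lower z -> near_sq a r (cj z).
  rewrite /near_sq /lower /cj !ReD !ReN !ImD !ImN /= => -[h1 h2] lz; split=> //.
  move: h2 ua; rewrite /upper !ler_norml => /andP[h2 h3] ua.
  by apply/andP; split; lra.
have cjup (z : R[i]) : lower z -> upper (cj z) by rewrite /lower /upper /cj /= oppr_ge0.
have line z : near_sq a r z -> complex.Im z = 0 -> mu c (psz j k z) = 0.
  move=> h zz; have uz : upper z by rewrite /upper zz.
  have hbz := near_isb z h uz.
  have E : bz j k z = edgeb k (complex.Re z).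
    apply/rowP => n; rewrite [RHS]mxE; case: (ord3_cases k n) => ->.
    - by rewrite eqxx bz0 zz mul0r mul0r !subr0.
    - by rewrite succ3_neq eqxx bz1 zz !mul0r subr0.
    - by rewrite succ3_neq2 succ3_neq bz2 zz mul0r.
  rewrite pszE E; apply: hc; move: hbz; rewrite E => hbz.
  have := hbz.1 k; have := hbz.1 (succ3 k); rewrite !mxE eqxx succ3_neq eqxx /in01.
  by move=> ? ?; apply/andP; split; lra.
exists (fun z => reflT c (psz j k (cj z))); split.
- move=> z h lz e e0; have [d1 d10 Hd] := cG _ (cjnear z h lz) (cjup z lz) e e0.
  exists d1 => // w hw lw hwz; rewrite reflT_iso; apply: Hd; [exact: cjnear|exact: cjup|].
  by rewrite -cjB cn_cj.
- move=> z h zz; have -> : cj z = z by apply: ReIm_eq; rewrite /cj /= ?zz ?oppr0.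
  by rewrite reflT_fix//; exact: line.
- move=> z h lz; have [||D hD] := dG (cj z); first by apply: cjnear => //; exact: ltW.
    by rewrite /cj /= oppr_gt0.
  exact: reflT_cder hD.
- move=> z h lz; have hr := real_near z h lz.
  have zz : complex.Im (complex.Re z)%:C = 0 by [].
  have ur : upper (complex.Re z)%:C by rewrite /upper zz.
  (* The reflection fixes the image of the foot [complex.Re z], so the distance to it is that of the
     mirror point; comparing all points with the centre [a] gives [3 * M]. *)
  apply: le_trans (cn_tri (psz j k (complex.Re z)%:C) _ _) _.
  rewrite -{1}(reflT_fix (line _ hr zz)) reflT_iso.
  apply: (@le_trans _ _ (M + M + M)); last by lra.
  apply: lerD; last exact: bG.
  apply: le_trans (cn_tri (psz j k a) _ _) _; apply: lerD; first by apply: bG; [exact: cjnear|exact: cjup].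
  by rewrite cnC; apply: bG.
Qed.
End SurfaceEstimate.

(** * Subdivision and edge sums *)

Section Subdivision.
Variable R : realType.
Implicit Types (b : 'rV[R]_3) (c : 'I_4) (k l m : 'I_3) (p : seq 'I_4).

Definition bv k : 'rV[R]_3 := \row_l (l == k)%:R.
Definition cc k : 'I_4 := lift (ord_max : 'I_4) k.
(** Coordinates in the parent of a point given in the child [c]: a corner child shrinks towards its
    vertex, and the middle child, [ord_max], is also turned by a half turn. *)
Definition sub c b : 'rV[R]_3 :=
  if unlift (ord_max : 'I_4) c is Some k then 2^-1 *: (b + bv k) else 2^-1 *: (const_mx 1 - b).

Lemma ord4P c : (exists k, c = cc k) \/ c = ord_max.
Proof. by case: (unliftP (ord_max : 'I_4) c) => [k ->|->]; [left; exists k|right]. Qed.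
Lemma sub_cc k b : sub (cc k) b = 2^-1 *: (b + bv k).
Proof. by rewrite /sub /cc liftK. Qed.
Lemma sub_max b : sub ord_max b = 2^-1 *: (const_mx 1 - b).
Proof. by rewrite /sub unlift_none. Qed.
Lemma sub_ccE k b l : sub (cc k) b 0 l = (b 0 l + (l == k)%:R) / 2.
Proof. by rewrite sub_cc !mxE mulrC. Qed.
Lemma sub_maxE b l : sub ord_max b 0 l = (1 - b 0 l) / 2.
Proof. by rewrite sub_max !mxE mulrC. Qed.
Lemma cc_inj : injective cc. Proof. exact: lift_inj. Qed.

Lemma bv_isb k : isb (bv k).
Proof.
split=> [l|]; first by rewrite mxE ler0n.
by rewrite (sum3 k) !mxE eqxx succ3_neq succ3_neq2 !addr0.
Qed.
Lemma sub_isb c b : isb b -> isb (sub c b).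
Proof.
move=> hb; have [h1 h2] := hb; case: (ord4P c) => [[k ->]|->]; split=> [l|].
- by rewrite sub_ccE divr_ge0// addr_ge0.
- move: h2; rewrite !(sum3 k) !sub_ccE eqxx succ3_neq succ3_neq2 /= => h2; lra.
- by rewrite sub_maxE divr_ge0// subr_ge0; exact: isb_le1.
- by move: h2; rewrite !(sum3 0) !sub_maxE => h2; lra.
Qed.

Lemma sub_aff c b m : \sum_(k < 3) b 0 k = 1 ->
  sub c b 0 m = \sum_(k < 3) b 0 k * sub c (bv k) 0 m.
Proof.
have e1 : (m == succ3 m) = false by rewrite eq_sym succ3_neq.
have e2 : (m == succ3 (succ3 m)) = false by rewrite eq_sym succ3_neq2.
rewrite !(sum3 m) => h; case: (ord4P c) => [[l ->]|->].
  rewrite !sub_ccE !mxE eqxx e1 e2 /= mulr0n mulr1n; move: ((m == l)%:R : R) => q.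
  transitivity ((b 0 m + (b 0 m + b 0 (succ3 m) + b 0 (succ3 (succ3 m))) * q) / 2); last by ring.
  by rewrite h mul1r.
rewrite !sub_maxE !mxE eqxx e1 e2 /=.
transitivity ((b 0 m + b 0 (succ3 m) + b 0 (succ3 (succ3 m)) - b 0 m) / 2); first by rewrite h.
ring.
Qed.

(** The corners of the small triangle with address [p], in coordinates of the face; the head of [p]
    is the outermost subdivision, as in [subface]. *)
Fixpoint tri p k : 'rV[R]_3 := if p is c :: p' then sub c (tri p' k) else bv k.
Lemma tri_isb p k : isb (tri p k).
Proof. by elim: p => [|c p IH] /=; [exact: bv_isb|exact: sub_isb]. Qed.

Definition lin d (Q : 'I_3 -> 'rV[R]_d) b : 'rV[R]_d := \sum_(k < 3) b 0 k *: Q k.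

Lemma lin_bv d (Q : 'I_3 -> 'rV[R]_d) k : lin Q (bv k) = Q k.
Proof.
by rewrite /lin (sum3 k) !mxE eqxx succ3_neq succ3_neq2 scale1r !scale0r !addr0.
Qed.

Lemma lin_sub d (Q : 'I_3 -> 'rV[R]_d) c b : \sum_(k < 3) b 0 k = 1 ->
  lin (fun k => lin Q (sub c (bv k))) b = lin Q (sub c b).
Proof.
move=> h; rewrite /lin; under eq_bigr do rewrite scaler_sumr.
rewrite exchange_big /=; apply: eq_bigr => m _; rewrite (sub_aff c m h) scaler_suml.
by apply: eq_bigr => k _; rewrite scalerA.
Qed.

Lemma child_lin d (Q : 'I_3 -> 'rV[R]_d) c : child (Q 0, Q 1, Q 2) c =
  (lin Q (sub c (bv 0)), lin Q (sub c (bv 1)), lin Q (sub c (bv 2))).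
Proof.
have E b : lin Q b = b 0 0 *: Q 0 + b 0 1 *: Q 1 + b 0 2 *: Q 2.
  by rewrite /lin (sum3 0) !succ3E.
have e k l : bv k 0 l = (l == k)%:R by rewrite mxE.
case: (ord4P c) => [[k ->]|->]; rewrite !E ?sub_ccE ?sub_maxE !e.
  by case: (ord3P k) => ->; rewrite /child /=; congr (_, _, _); apply/rowP => i;
    rewrite /midp !mxE /= ?(mulr0n, mulr1n); field.
rewrite /child /=; congr (_, _, _); apply/rowP => i; rewrite /midp !mxE /= ?(mulr0n, mulr1n); ring.
Qed.

Lemma foldl_child d p (Q : 'I_3 -> 'rV[R]_d) : foldl (@child R d) (Q 0, Q 1, Q 2) p =
  (lin Q (tri p 0), lin Q (tri p 1), lin Q (tri p 2)).
Proof.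
elim: p Q => [|c p IH] Q; first by rewrite /= !lin_bv.
change (foldl (@child R d) (child (Q 0, Q 1, Q 2) c) p =
  (lin Q (sub c (tri p 0)), lin Q (sub c (tri p 1)), lin Q (sub c (tri p 2)))).
rewrite child_lin (IH (fun k => lin Q (sub c (bv k)))).
by rewrite !lin_sub//; apply: (proj2 (tri_isb _ _)).
Qed.

Lemma subfaceE d (X : TriSurf R d) (j : 'I_(nF X)) p :
  subface j p = (ptj j (tri p 0), ptj j (tri p 1), ptj j (tri p 2)).
Proof. exact: (foldl_child p (fun k => pos (face j k))). Qed.

Fixpoint paths (n : nat) : seq (seq 'I_4) :=
  if n is n'.+1 then [seq c :: p | c <- enum 'I_4, p <- paths n'] else [:: [::]].

Lemma mem_paths n p : (p \in paths n) = (size p == n).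
Proof.
elim: n p => [|n IH] [|c p] //=.
  by apply/negbTE/allpairsP => -[[c p] /= [_ _]].
rewrite eqSS -IH; apply/allpairsP/idP => [[[c' p'] /= [_ h [_ ->]]]//|h].
by exists (c, p); rewrite mem_enum.
Qed.
Lemma uniq_paths n : uniq (paths n).
Proof.
elim: n => //= n IH; apply: allpairs_uniq => //; first exact: enum_uniq.
by move=> [c p] [c' p'] _ _ /= [-> ->].
Qed.
Lemma sum_pathsS n (f : seq 'I_4 -> R) :
  \sum_(p <- paths n.+1) f p = \sum_(k < 3) \sum_(p <- paths n) f (cc k :: p)
    + \sum_(p <- paths n) f (ord_max :: p).
Proof.
rewrite big_allpairs_dep big_enum /= big_ord_recr /=; congr (_ + _).
by apply: eq_bigr => k _; apply: eq_bigr => p _; congr (f (_ :: _)); apply/val_inj; rewrite /= /bump leqNgt ltn_ord.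
Qed.

Definition lrp (a b : 'rV[R]_3) (t : R) := a + t *: (b - a).
Lemma sub_lrp c a b t : sub c (lrp a b t) = lrp (sub c a) (sub c b) t.
Proof.
by apply/rowP => l; case: (ord4P c) => [[k ->]|->]; rewrite /lrp ?sub_cc ?sub_max !mxE; ring.
Qed.

(** A discrete line integral of the form [h]; [circ] is the corresponding circulation around a small
    triangle. *)
Definition ledge n (h : 'rV[R]_3 -> 'rV[R]_3 -> R) a b : R :=
  \sum_(i < 2 ^ n) h (lrp a b (i%:R / (2 ^ n)%:R)) (lrp a b (i.+1%:R / (2 ^ n)%:R)).
Definition antisym (T : Type) (h : T -> T -> R) := forall x y, h y x = - h x y.
Definition circ (h : 'rV[R]_3 -> 'rV[R]_3 -> R) p := \sum_(k < 3) h (tri p k) (tri p (succ3 k)).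
Definition mid (a b : 'rV[R]_3) := 2^-1 *: (a + b).
Lemma midC a b : mid a b = mid b a. Proof. by rewrite /mid addrC. Qed.

Lemma pow2_neq0 n : (2 ^ n)%:R != 0 :> R.
Proof. by rewrite pnatr_eq0 expn_eq0. Qed.

Lemma ledge_split n h a b : ledge n.+1 h a b = ledge n h a (mid a b) + ledge n h (mid a b) b.
Proof.
have n0 := pow2_neq0 n.
have e1 (i : nat) : lrp a b (i%:R / (2 ^ n.+1)%:R) = lrp a (mid a b) (i%:R / (2 ^ n)%:R).
  by apply/rowP => l; rewrite /lrp /mid !mxE expnS natrM; field.
have e2 (i : nat) : lrp a b ((2 ^ n + i)%:R / (2 ^ n.+1)%:R) = lrp (mid a b) b (i%:R / (2 ^ n)%:R).
  by apply/rowP => l; rewrite /lrp /mid !mxE expnS natrM natrD; field.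
rewrite /ledge; set f := (fun i : nat => h (lrp a b (i%:R / (2 ^ n.+1)%:R)) (lrp a b (i.+1%:R / (2 ^ n.+1)%:R))).
rewrite (_ : \sum_(i < 2 ^ n.+1) _ = \sum_(i < 2 ^ n + 2 ^ n) f i); last first.
  by rewrite -(big_mkord xpredT f) -(big_mkord xpredT f) expnS mul2n addnn.
rewrite big_split_ord /=; congr (_ + _); apply: eq_bigr => i _; rewrite /f; first by rewrite !e1.
by rewrite -addnS !e2.
Qed.

Lemma ledge_rev n h a b : antisym h -> ledge n h b a = - ledge n h a b.
Proof.
move=> H; have n0 := pow2_neq0 n.
rewrite /ledge (reindex_inj rev_ord_inj) /= -sumrN; apply: eq_bigr => i _.
have e t : lrp b a (1 - t) = lrp a b t by apply/rowP => l; rewrite /lrp !mxE; ring.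
rewrite H; congr (- h _ _).
  by rewrite -e; congr lrp; rewrite subnSK// natrB ?(ltnW (ltn_ord i))//; field.
by rewrite -e; congr lrp; rewrite natrB//; field.
Qed.

Lemma ledge_sub n h c a b :
  ledge n (fun x y => h (sub c x) (sub c y)) a b = ledge n h (sub c a) (sub c b).
Proof. by apply: eq_bigr => i _; rewrite !sub_lrp. Qed.

Lemma sub_cc_bv k l : sub (cc k) (bv l) = mid (bv k) (bv l).
Proof. by rewrite sub_cc midC. Qed.
Lemma mid_id a : mid a a = a.
Proof. by apply/rowP => l; rewrite !mxE; field. Qed.
Lemma sub_max_bv k : sub ord_max (bv k) = mid (bv (succ3 k)) (bv (succ3 (succ3 k))).
Proof.
apply/rowP => l; rewrite sub_maxE !mxE; case: (ord3_cases k l) => ->.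
- by rewrite eqxx (eq_sym k) succ3_neq (eq_sym k) succ3_neq2 /=; lra.
- by rewrite eqxx succ3_neq (eq_sym (succ3 k)) succ3_neq /=; lra.
- by rewrite eqxx !succ3_neq succ3_neq2 /=; lra.
Qed.

(** Discrete Stokes theorem: the circulations of the four children cancel along the sides of the
    middle one, and the halves of each outer side join. *)
Lemma telescope_tri n h : antisym h ->
  \sum_(p <- paths n) circ h p = \sum_(k < 3) ledge n h (bv k) (bv (succ3 k)).
Proof.
elim: n h => [|n IH] h H.
  rewrite big_seq1; apply: eq_bigr => k _; rewrite /ledge big_ord1 /= /lrp.
  by rewrite mul0r scale0r addr0 divr1 scale1r subrKC.
have Hs c : antisym (fun x y => h (sub c x) (sub c y)) by move=> x y; exact: H.
have E c : \sum_(p <- paths n) circ h (c :: p) =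
    \sum_(k < 3) ledge n h (sub c (bv k)) (sub c (bv (succ3 k))).
  rewrite -[LHS]/(\sum_(p <- paths n) circ (fun x y => h (sub c x) (sub c y)) p) IH//.
  by apply: eq_bigr => k _; rewrite ledge_sub.
rewrite sum_pathsS E; under eq_bigr do rewrite E.
rewrite !(sum3 0) !succ3E !sub_cc_bv !sub_max_bv !succ3E !ledge_split !mid_id.
rewrite (midC (bv 1) (bv 0)) (midC (bv 2) (bv 0)) (midC (bv 2) (bv 1)).
have r := fun a b => ledge_rev n a b H.
rewrite (r (mid (bv 0) (bv 1)) (mid (bv 0) (bv 2))) (r (mid (bv 1) (bv 2)) (mid (bv 0) (bv 1))).
rewrite (r (mid (bv 0) (bv 2)) (mid (bv 1) (bv 2))).
ring.
Qed.

(** The homothety that maps the face onto its corner triangle of generation [H] at the vertex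
    [k]. *)
Definition cor (H : nat) k b := bv k + (2 ^- H) *: (b - bv k).
Lemma corS H k b : sub (cc k) (cor H k b) = cor H.+1 k b.
Proof. by rewrite sub_cc /cor; apply/rowP => l; rewrite !mxE exprS invfM; field. Qed.
Lemma tri_corner H k p l : tri (nseq H (cc k) ++ p) l = cor H k (tri p l).
Proof.
elim: H => [|H IH] /=; first by rewrite /cor expr0 invr1 scale1r subrKC.
by rewrite IH corS.
Qed.
Lemma cor_lrp H k a b t : cor H k (lrp a b t) = lrp (cor H k a) (cor H k b) t.
Proof. by apply/rowP => l; rewrite /cor /lrp !mxE; ring. Qed.

Lemma telescope_corner H k n h : antisym h ->
  \sum_(p <- paths n) circ h (nseq H (cc k) ++ p) =
  \sum_(l < 3) ledge n h (cor H k (bv l)) (cor H k (bv (succ3 l))).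
Proof.
move=> Ha; transitivity (\sum_(p <- paths n) circ (fun x y => h (cor H k x) (cor H k y)) p).
  by apply: eq_bigr => p _; apply: eq_bigr => l _; rewrite !tri_corner.
rewrite telescope_tri; last by move=> x y; exact: Ha.
by apply: eq_bigr => l _; apply: eq_bigr => i _; rewrite !cor_lrp.
Qed.

Definition ncor (H : nat) p : bool := [forall k, take H p != nseq H (cc k)].

(** With [0 < H] the first letter of an address tells the three corners apart; for [H = 0] each
    corner would be the whole face. *)
Lemma sum_split_corners H n (f : seq 'I_4 -> R) : (0 < H)%N ->
  \sum_(p <- paths (H + n)) f p = \sum_(p <- paths (H + n) | ncor H p) f p +
    \sum_(k < 3) \sum_(p <- paths n) f (nseq H (cc k) ++ p).
Proof.
move=> H0; rewrite (bigID (ncor H)) /=; congr (_ + _).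
transitivity (\sum_(k < 3) \sum_(p <- paths (H + n) | take H p == nseq H (cc k)) f p).
  under [RHS]eq_bigr do rewrite big_mkcond /=.
  rewrite exchange_big /= big_mkcond /=; apply: eq_bigr => p _.
  case: ifP => [/forallPn[k]|/negbFE/forallP h]; last first.
    by rewrite big1// => k _; rewrite (negbTE (h k)).
  rewrite negbK => /eqP E; rewrite (bigD1 k)//= E eqxx big1 ?addr0// => l lk.
  case: eqP => // h; case/eqP: lk; apply: cc_inj.
  by move: h; case: (H) H0 => // H' _ h'; exact: esym (congr1 (head (cc k)) h').
apply: eq_bigr => k _; rewrite -[LHS]big_filter.
transitivity (\sum_(p <- [seq nseq H (cc k) ++ p | p <- paths n]) f p); last by rewrite big_map.
apply: perm_big; apply: uniq_perm.
- by rewrite filter_uniq// uniq_paths.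
- by rewrite map_inj_uniq ?uniq_paths// => p p' /eqP; rewrite eqseq_cat// eqxx => /eqP.
move=> p; rewrite mem_filter mem_paths; apply/andP/mapP => [[/eqP h1 /eqP h2]|[p' hp ->]].
  exists (drop H p); last by rewrite -h1 cat_take_drop.
  by rewrite mem_paths size_drop h2 addKn.
by rewrite take_size_cat ?size_nseq// eqxx size_cat size_nseq; move: hp; rewrite mem_paths => /eqP ->.
Qed.

Lemma ncor_le H p k l : (H <= size p)%N -> ncor H p -> tri p l 0 k <= 1 - 2 ^- H.
Proof.
move=> hs /forallP/(_ k); elim: H p hs => [|H IH] p; first by rewrite take0 eqxx.
case: p => // c p; rewrite ltnS => hs /=.
have lpow : 2 ^- H.+1 <= 2^-1 :> R.
  by rewrite exprS invfM ler_piMr// invf_le1 ?exprn_gt0// exprn_ege1// ler1n.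
have [h1 h2] := tri_isb p l; have := isb_le1 k (tri_isb p l).
case: (ord4P c) => [[m ->]|-> _ _]; last first.
  by rewrite sub_maxE; have := h1 k; lra.
rewrite sub_ccE; have [->|mk] := eqVneq m k => t1.
  rewrite eqseq_cons eqxx /= => h; have := IH p hs h; rewrite mulr1n exprS invfM; lra.
by move=> _; rewrite /= mulr0n; lra.
Qed.

Definition latp (n : nat) (x : 'I_3 -> nat) : 'rV[R]_3 := \row_l ((x l)%:R / n%:R).

(* The small triangles with the orientation of the face, then the reversed ones; the
   induction removes the outermost subdivision. *)
Lemma lat_tri n (x : 'I_3 -> nat) :
  ((\sum_(k < 3) x k).+1 = 2 ^ n -> exists2 p, size p = n &
     forall k, tri p k = latp (2 ^ n) (fun l => x l + (l == k))%N)%N /\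
  ((\sum_(k < 3) x k).+2 = 2 ^ n -> exists2 p, size p = n &
     forall k, tri p k = latp (2 ^ n) (fun l => x l + (l != k))%N)%N.
Proof.
elim: n x => [|n IH] x.
  split; last by case: (\sum_(k < 3) _)%N.
  move=> [/eqP]; rewrite sum_nat_eq0 => /forallP x0; exists [::] => // k.
  by apply/rowP => l; rewrite !mxE /= divr1 (eqP (x0 l)).
have n0 := pow2_neq0 n.
have up (y : 'I_3 -> nat) k : (2 ^ n <= x k)%N -> exists x' : 'I_3 -> nat,
    (\sum_(k < 3) x k = \sum_(k < 3) x' k + 2 ^ n)%N /\ forall l, x l = (x' l + (l == k) * 2 ^ n)%N.
  move=> h; exists (fun l => x l - (l == k) * 2 ^ n)%N; split.
    by rewrite !(sum3 k) eqxx succ3_neq succ3_neq2 /= !mul0n !subn0 mul1n; lia.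
  by move=> l; rewrite subnK//; case: eqP => [->|//]; rewrite mul1n.
have [/existsP[k hk]|] := boolP [exists k, (2 ^ n <= x k)%N].
  have [x' [E1 E2]] := up x k hk; rewrite E1 expnS; have [IH1 IH2] := IH x'.
  split=> h; [have [|p ps hp] := IH1|have [|p ps hp] := IH2]; try lia.
    exists (cc k :: p); rewrite /= ?ps// => m; apply/rowP => l.
    by rewrite sub_ccE hp !mxE E2 natrM !natrD natrM; case: (l == k); rewrite ?mulr0n ?mulr1n; field.
  exists (cc k :: p); rewrite /= ?ps// => m; apply/rowP => l.
  by rewrite sub_ccE hp !mxE E2 natrM !natrD natrM; case: (l == k); rewrite ?mulr0n ?mulr1n; field.
rewrite negb_exists => /forallP hx.
have {}hx k : (x k < 2 ^ n)%N by rewrite ltnNge.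
(* No coordinate reaches one half, so the triangle lies in the middle child. There the lattice is
   reversed, which exchanges the two orientations and hence the two halves of the induction
   hypothesis. *)
pose x' l := (2 ^ n - 1 - x l)%N.
have [IH1 IH2] := IH x'.
have S : (\sum_(k < 3) x' k + \sum_(k < 3) x k + 3 = 3 * 2 ^ n)%N.
  by rewrite !(sum3 0) /x'; have := hx 0; have := hx (succ3 0); have := hx (succ3 (succ3 0)); lia.
have D m (l : 'I_3) (b : bool) : (1 - (x' l + b)%:R / (2 ^ n)%:R) / 2 = ((x l + ~~ b)%:R) / (2 * 2 ^ n)%:R :> R.
  have e : (x' l + b + (x l + ~~ b) = 2 ^ n)%N by rewrite /x'; have := hx l; case: b => /=; lia.
  have E' : (2 ^ n)%:R = (x' l + b)%:R + (x l + ~~ b)%:R :> R by rewrite -natrD e.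
  have -> : (x l + ~~ b)%:R = (2 ^ n)%:R - (x' l + b)%:R :> R by rewrite E' addrAC subrr add0r.
  by rewrite natrM; field.
rewrite expnS; split=> h.
  have [|p ps hp] := IH2; first lia.
  exists (ord_max :: p); rewrite /= ?ps// => m; apply/rowP => l.
  by rewrite sub_maxE hp !mxE D// negbK.
have [|p ps hp] := IH1; first lia.
exists (ord_max :: p); rewrite /= ?ps// => m; apply/rowP => l.
by rewrite sub_maxE hp !mxE D.
Qed.

Lemma sum_map_le (I : eqType) (T : eqType) (s : seq I) (t : seq T) (g : I -> T) (f : T -> R) :
  uniq s -> {in s &, injective g} -> (forall i, i \in s -> g i \in t) -> uniq t ->
  (forall x, x \in t -> 0 <= f x) -> \sum_(i <- s) f (g i) <= \sum_(x <- t) f x.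
Proof.
move=> us gi gt ut f0; rewrite -(big_map g xpredT f).
rewrite [leRHS](bigID (mem [seq g i | i <- s])) /=.
have -> : \sum_(x <- t | x \in [seq g i | i <- s]) f x = \sum_(x <- [seq g i | i <- s]) f x.
  rewrite -big_filter; apply: perm_big; apply: uniq_perm; first exact: filter_uniq.
    by rewrite map_inj_in_uniq.
  move=> x; rewrite mem_filter; apply/andb_idr => /mapP[i hi ->]; exact: gt.
by rewrite lerDl big_seq_cond; apply: sumr_ge0 => x /andP[hx _]; exact: f0.
Qed.
End Subdivision.

Section GlobalCancel.
Variables (R : realType) (d : nat) (X : TriSurf R d).
Local Notation F := (@face _ _ X).
Hypothesis TD : triangulated_disk X.

(** Coherent orientation: an oriented edge belongs to at most one face, and an interior edge occurs
    in both directions, with opposite contributions. *)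
Lemma global_cancel (h : 'I_(nV X) -> 'I_(nV X) -> R) : antisym h ->
  (forall v w, bedge v w -> h v w = 0) ->
  \sum_j \sum_(k < 3) h (F j k) (F j (succ3 k)) = 0.
Proof.
move=> Ha Hb; rewrite pair_bigA /=.
pose e (jk : 'I_(nF X) * 'I_3) := (F jk.1 jk.2, F jk.1 (succ3 jk.2)).
have ei : injective e.
  move=> [j k] [j' k'] [h1 h2]; case: TD => _ _ hc _; have jj := hc _ _ _ _ h1 h2; subst j'.
  by case: TD => -[_ hi _] _ _ _; rewrite (hi _ _ _ h1).
have -> : \sum_(p : 'I_(nF X) * 'I_3) h (F p.1 p.2) (F p.1 (succ3 p.2)) =
   \sum_(vw in [set e p | p in [set: 'I_(nF X) * 'I_3]]%SET) h vw.1 vw.2.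
  rewrite big_imset /=; last by move=> x y _ _; exact: ei.
  by apply: eq_bigl => p; rewrite inE.
have E vw : (vw \in [set e p | p in [set: 'I_(nF X) * 'I_3]]%SET) = oedge vw.1 vw.2.
  case: vw => v w /=; apply/imsetP/existsP => [[[j k] _ [-> ->]]|[j /existsP[k /andP[/eqP <- /eqP <-]]]].
    by exists j; apply/existsP; exists k; rewrite !eqxx.
  by exists (j, k); rewrite ?inE.
rewrite (eq_bigl _ _ E).
have -> : \sum_(vw | oedge vw.1 vw.2) h vw.1 vw.2 =
  \sum_(vw | oedge vw.1 vw.2 && oedge vw.2 vw.1) h vw.1 vw.2.
  rewrite (bigID (fun vw => oedge vw.2 vw.1)) /= [X in _ + X]big1 ?addr0// => vw bd.
  exact: Hb.
set S := \sum_(_ | _) _; suff : S = - S by lra.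
have si : injective (fun vw : 'I_(nV X) * 'I_(nV X) => (vw.2, vw.1)) by move=> [? ?] [? ?] [-> ->].
rewrite {1}/S (reindex_inj si) /= -sumrN.
by apply: eq_big => [vw|vw _]; [rewrite andbC|exact: Ha].
Qed.
End GlobalCancel.

(** * Distortion and energy *)

Section Distortion.
Variable R : realType.
Implicit Types (u v w z t : R[i]) (K : R).

Lemma crsDl u v w : crs (u + v) w = crs u w + crs v w.
Proof. by rewrite /crs ReD ImD; ring. Qed.
Lemma crsDr u v w : crs w (u + v) = crs w u + crs w v.
Proof. by rewrite /crs ReD ImD; ring. Qed.
Lemma crs_cj u v : crs u v = complex.Im (cj u * v).
Proof. by rewrite ImMc /crs /cj /=; ring. Qed.
Lemma crs_le u v : `|crs u v| <= cn u * cn v.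
Proof. by rewrite crs_cj; apply: le_trans (cn_Im _) _; rewrite cnM cn_cj. Qed.
Lemma crsM t u v : crs (t * u) (t * v) = cn t ^+ 2 * crs u v.
Proof. by rewrite cn2E /crs !ReMc !ImMc; ring. Qed.

Lemma eigen2 (M : 'M[R]_2) (x : R) : x ^+ 2 - \tr M * x + \det M = 0 -> eigenvalue M x.
Proof.
move=> h; rewrite eigenvalue_root_char; apply/eqP; rewrite horner_coef size_char_poly.
rewrite !big_ord_recr big_ord0 /= char_poly_det.
have -> : (char_poly M)`_1 = - \tr M by exact: char_poly_trace.
have -> : (char_poly M)`_2 = 1.
  by have := char_poly_monic M; rewrite monicE lead_coefE size_char_poly => /eqP.
by rewrite -[RHS]h; ring.
Qed.

Lemma det2 (M : 'M[R]_2) : \det M = M 0 0 * M 1 1 - M 0 1 * M 1 0.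
Proof.
rewrite (expand_det_row _ 0) !big_ord_recl big_ord0 addr0 /cofactor !det_mx11 !mxE /=.
have -> : lift (0 : 'I_2) (0 : 'I_1) = 1 by apply/val_inj.
have -> : lift (1 : 'I_2) (0 : 'I_1) = 0 by apply/val_inj.
rewrite addn0 expr0 expr1; ring.
Qed.

(** Written as [al * z + be * cj z], the linear map has the singular values [cn al + cn be] and
    [cn al - cn be]. The two expressions of the conclusion are [be] and [al] times one factor built
    from the edges of the source triangle. *)
Lemma dcd_distortion K (z1 z2 z3 w1 w2 w3 : R[i]) : DCD_le K z1 z2 z3 w1 w2 w3 ->
  0 < crs (z2 - z1) (z3 - z1) -> 0 < crs (w2 - w1) (w3 - w1) ->
  1 <= K /\ (K + 1) * cn ((w3 - w1) * (z2 - z1) - (w2 - w1) * (z3 - z1)) <=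
  (K - 1) * cn ((w2 - w1) * cj (z3 - z1) - (w3 - w1) * cj (z2 - z1)).
Proof.
case=> L; move: (z2 - z1) (z3 - z1) (w2 - w1) (w3 - w1) => o1 o2 U1 U2 [h1 h2 hs] po pU.
pose a := L 0 0; pose b := L 0 1; pose c := L 1 0; pose e := L 1 1.
have comp (o U : R[i]) : c2v o *m L = c2v U ->
    complex.Re U = complex.Re o * a + complex.Im o * c /\
    complex.Im U = complex.Re o * b + complex.Im o * e.
  move=> h; split.
    by have := congr1 (fun M : 'rV[R]_2 => M 0 0) h; rewrite !mxE !big_ord_recl big_ord0 addr0 !mxE /= => <-;
       congr (_ + _ * L _ _); apply/val_inj.
  by have := congr1 (fun M : 'rV[R]_2 => M 0 1) h; rewrite !mxE !big_ord_recl big_ord0 addr0 !mxE /= => <-;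
     congr (_ + _ * L _ _); apply/val_inj.
have [r1 i1] := comp _ _ h1; have [r2 i2] := comp _ _ h2.
have dU : crs U1 U2 = (a * e - b * c) * crs o1 o2 by rewrite /crs r1 r2 i1 i2; ring.
have d0 : 0 < a * e - b * c by move: pU; rewrite dU pmulr_lgt0.
pose al : R[i] := ((a + e) / 2) +i* ((b - c) / 2).
pose be : R[i] := ((a - e) / 2) +i* ((b + c) / 2).
have UE (o U : R[i]) : complex.Re U = complex.Re o * a + complex.Im o * c ->
    complex.Im U = complex.Re o * b + complex.Im o * e -> U = al * o + be * cj o.
  by move=> hr hi; apply: ReIm_eq; rewrite ?ReD ?ImD ?ReMc ?ImMc /cj /= ?hr ?hi; field.
have nab : cn al ^+ 2 - cn be ^+ 2 = a * e - b * c by rewrite !cn2E /=; field.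
have nab2 : 2 * (cn al ^+ 2 + cn be ^+ 2) = a ^+ 2 + b ^+ 2 + c ^+ 2 + e ^+ 2 by rewrite !cn2E /=; field.
have ba : cn be < cn al.
  rewrite -(@ltr_pXn2r _ 2) ?nnegrE ?cn_ge0// -subr_gt0 nab //.
have tr : \tr (L^T *m L) = 2 * (cn al ^+ 2 + cn be ^+ 2).
  rewrite nab2 /mxtrace !big_ord_recl big_ord0 addr0 !mxE !big_ord_recl !big_ord0 !addr0 !mxE /=.
  have -> : lift (0 : 'I_2) (0 : 'I_1) = 1 by apply/val_inj.
  by rewrite -/a -/b -/c -/e; ring.
have de : \det (L^T *m L) = (cn al ^+ 2 - cn be ^+ 2) ^+ 2.
  by rewrite nab det_mulmx det_tr det2 -/a -/b -/c -/e; ring.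
have sv (s : R) : 0 <= s -> s ^+ 2 ^+ 2 - 2 * (cn al ^+ 2 + cn be ^+ 2) * s ^+ 2 + (cn al ^+ 2 - cn be ^+ 2) ^+ 2 = 0 ->
    singular_value L s.
  by move=> s0 h; split=> //; apply: eigen2; rewrite tr de.
have S := hs (cn al + cn be) (cn al - cn be).
have {}S : cn al + cn be <= K * (cn al - cn be).
  apply: S; apply: sv; first by apply: addr_ge0; exact: cn_ge0.
  - ring.
  - by rewrite subr_ge0 ltW.
  - ring.
split.
  have := cn_ge0 be; move: S ba; move: (cn al) (cn be) => p q S ba q0; nra.
rewrite (UE _ _ r1 i1) (UE _ _ r2 i2).
have -> : (al * o2 + be * cj o2) * o1 - (al * o1 + be * cj o1) * o2 = be * (cj o2 * o1 - cj o1 * o2) by ring.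
have -> : (al * o1 + be * cj o1) * cj o2 - (al * o2 + be * cj o2) * cj o1 =
   al * (cj o2 * o1 - cj o1 * o2) by ring.
rewrite !cnM !mulrA; apply: ler_wpM2r; first exact: cn_ge0.
by move: S; lra.
Qed.

(* When U1 and U2 are the values at 1 and t of alpha z + beta z^*, dbar and dz are
   beta and alpha multiplied by -2i Im t. *)
Definition dbar t (U1 U2 : R[i]) : R[i] := U2 - t * U1.
Definition dz t (U1 U2 : R[i]) : R[i] := U1 * cj t - U2.

Lemma dz_dbar t (U1 U2 : R[i]) : cn (dz t U1 U2) ^+ 2 - cn (dbar t U1 U2) ^+ 2 =
  4 * complex.Im t * crs U1 U2.
Proof.
by rewrite !cn2E /dz /dbar /crs !(ReD, ImD, ReN, ImN, ReMc, ImMc) /cj /=; ring.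
Qed.
Lemma recover_cn t (U1 U2 : R[i]) : cn U1 * (2 * `|complex.Im t|) <= cn (dz t U1 U2) + cn (dbar t U1 U2) /\
  cn U2 * (2 * `|complex.Im t|) <= cn t * (cn (dz t U1 U2) + cn (dbar t U1 U2)).
Proof.
have e : cn (cj t - t) = 2 * `|complex.Im t|.
  have -> : cj t - t = 'i * (- 2 * complex.Im t)%:C.
    by apply: ReIm_eq; rewrite ?ReD ?ImD ?ReN ?ImN ?ReMc ?ImMc /cj /=; ring.
  by rewrite cnM cni mul1r cnR normrM normrN normr_nat.
rewrite -e -!cnM; split.
  have -> : U1 * (cj t - t) = dz t U1 U2 + dbar t U1 U2 by rewrite /dz /dbar; ring.
  exact: cnD.
have -> : U2 * (cj t - t) = t * dz t U1 U2 + cj t * dbar t U1 U2 by rewrite /dz /dbar; ring.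
by apply: le_trans (cnD _ _) _; rewrite !cnM cn_cj mulrDr.
Qed.

(** The chart triangle is only nearly similar to the flat one. Replacing its edges by [th] and
    [th * t] costs [de * cn th] times the edges of the image, which [recover_cn] bounds by [dz] and
    [dbar]; then [dz_dbar] trades [dz] for area. *)
Lemma dcd_flat t : 0 < complex.Im t -> forall e : R, 0 < e -> exists2 de : R, 0 < de &
  forall K (th : R[i]) (z1 z2 z3 w1 w2 w3 : R[i]), th != 0 -> K - 1 <= de ->
  DCD_le K z1 z2 z3 w1 w2 w3 -> 0 < crs (w2 - w1) (w3 - w1) ->
  cn (z2 - z1 - th) <= de * cn th -> cn (z3 - z1 - th * t) <= de * cn th ->
  cn (dbar t (w2 - w1) (w3 - w1)) ^+ 2 <= e * crs (w2 - w1) (w3 - w1).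
Proof.
move=> t0 e e0; set X := complex.Im t; pose l : R := (1 + cn t) / (2 * X).
have l0 : 0 < l by rewrite /l divr_gt0 ?mulr_gt0// ltr_pwDl// cn_ge0.
pose ep : R := Num.min 4^-1 (e / (22 * X)).
have ep0 : 0 < ep by rewrite /ep lt_min invr_gt0 ltr0n divr_gt0// mulr_gt0.
have ep4 : ep <= 4^-1 by rewrite /ep ge_min lexx.
have epe : ep <= e / (22 * X) by rewrite /ep ge_min lexx orbT.
(* [l] is the constant of [recover_cn]. The bound by [X] keeps the chart triangle positively
   oriented; the one by [ep] lets the error terms be absorbed. *)
pose m1 := Num.min 1 (ep / (1 + 4 * l)); pose de := Num.min m1 (X / (4 * (1 + cn t))).
have l4 : 0 < 1 + 4 * l by lra.
have t1 : 0 < 1 + cn t by have := cn_ge0 t; lra.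
have m10 : 0 < m1 by rewrite /m1 lt_min ltr01 divr_gt0.
have de0 : 0 < de by rewrite /de lt_min m10 divr_gt0// mulr_gt0.
have de1 : de <= 1 by rewrite /de /m1 !ge_min lexx.
have de2 : de * (1 + 4 * l) <= ep.
  by rewrite -ler_pdivlMr// /de /m1 !ge_min lexx orbT.
have de3 : de * (4 * (1 + cn t)) <= X.
  by rewrite -ler_pdivlMr ?mulr_gt0// /de !ge_min lexx orbT.
exists de => // K th z1 z2 z3 w1 w2 w3 th0 Kd DCD cU.
set U1 := w2 - w1; set U2 := w3 - w1; set r1 := z2 - z1 - th; set r2 := z3 - z1 - th * t => hr1 hr2.
have o1E : z2 - z1 = th + r1 by rewrite /r1; ring.
have o2E : z3 - z1 = th * t + r2 by rewrite /r2; ring.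
clearbody r1 r2.
have T0 : 0 < cn th by rewrite cn_gt0.
have po : 0 < crs (z2 - z1) (z3 - z1).
  rewrite o1E o2E !crsDl !crsDr.
  have -> : crs th (th * t) = cn th ^+ 2 * X by rewrite -{1}(mulr1 th) crsM /crs /=; rewrite /X; ring.
  have b1 : `|crs th r2| <= cn th * (de * cn th).
    by apply: le_trans (crs_le _ _) _; apply: ler_wpM2l => //; exact: cn_ge0.
  have b2 : `|crs r1 (th * t)| <= (de * cn th) * (cn th * cn t).
    by apply: le_trans (crs_le _ _) _; rewrite cnM; apply: ler_wpM2r => //; apply: mulr_ge0; exact: cn_ge0.
  have b3 : `|crs r1 r2| <= (de * cn th) * (1 * cn th).
    apply: le_trans (crs_le _ _) _; apply: ler_pM => //; try exact: cn_ge0.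
    by apply: le_trans hr2 _; apply: ler_wpM2r; [exact: cn_ge0|].
  have h : cn th ^+ 2 * (de * (4 * (1 + cn t))) <= cn th ^+ 2 * X by apply: ler_wpM2l => //; apply: exprn_ge0 (cn_ge0 _).
  have h' : 0 < cn th ^+ 2 * (de * (1 + cn t)) by apply: mulr_gt0; [exact: exprn_gt0|exact: mulr_gt0].
  have h2 : 0 <= cn th ^+ 2 * de * cn t by apply: mulr_ge0; [apply: mulr_ge0; [exact: exprn_ge0 (cn_ge0 _)|exact: ltW]|exact: cn_ge0].
  move: b1 b2 b3; rewrite !ler_norml => /andP[b1 _] /andP[b2 _] /andP[b3 _].
  by move: b1 b2 b3 h h' h2; clear; lra.
have [K1 DD] := dcd_distortion DCD po cU; move: DD; rewrite -/U1 -/U2 o1E o2E.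
have -> : U2 * (th + r1) - U1 * (th * t + r2) = th * dbar t U1 U2 + (U2 * r1 - U1 * r2).
  by rewrite /dbar; ring.
have -> : U1 * cj (th * t + r2) - U2 * cj (th + r1) =
    cj th * dz t U1 U2 + (U1 * cj r2 - U2 * cj r1).
  by rewrite /dz !cjD cjM; ring.
set bc := th * _ + _; set ac := cj th * _ + _ => DD.
have [ru1 ru2] := recover_cn t U1 U2; rewrite (gtr0_norm t0) -/X in ru1 ru2.
have hA : cn ac <= cn th * cn (dz t U1 U2) + de * cn th * (cn U1 + cn U2).
  apply: le_trans (cnD _ _) _; rewrite (cnM (cj th)) cn_cj lerD2l.
  apply: le_trans (cnB _ _) _; rewrite !cnM !cn_cj mulrDr; apply: lerD.
    by rewrite mulrC; apply: ler_wpM2r => //; exact: cn_ge0.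
  by rewrite mulrC; apply: ler_wpM2r => //; exact: cn_ge0.
have hB : cn th * cn (dbar t U1 U2) <= cn bc + de * cn th * (cn U1 + cn U2).
  rewrite -cnM; have -> : th * dbar t U1 U2 = bc - (U2 * r1 - U1 * r2) by rewrite /bc; ring.
  apply: le_trans (cnB _ _) _; rewrite lerD2l.
  apply: le_trans (cnB _ _) _; rewrite !cnM mulrDr [leRHS]addrC; apply: lerD.
    by rewrite mulrC; apply: ler_wpM2r => //; exact: cn_ge0.
  by rewrite mulrC; apply: ler_wpM2r => //; exact: cn_ge0.
have hs : cn U1 + cn U2 <= l * (cn (dz t U1 U2) + cn (dbar t U1 U2)).
  by rewrite /l mulrAC ler_pdivlMr ?mulr_gt0//; move: ru1 ru2; lra.
have := dz_dbar t U1 U2; rewrite -/X.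
have bc0 := cn_ge0 bc; have ac0 := cn_ge0 ac.
have hc : cn bc <= de * cn ac.
  have : 2 * cn bc <= (K + 1) * cn bc by apply: ler_wpM2r => //; lra.
  have : (K - 1) * cn ac <= de * cn ac by apply: ler_wpM2r.
  by move: DD; lra.
have s0 : 0 <= cn U1 + cn U2 by apply: addr_ge0; exact: cn_ge0.
have A0 := cn_ge0 (dz t U1 U2); have B0 := cn_ge0 (dbar t U1 U2).
move: cU; rewrite -/U1 -/U2.
move: hA hB hs hc s0 A0 B0 bc0 ac0; move: (cn U1 + cn U2) (cn ac) (cn bc) (cn (dz _ _ _)) (cn (dbar _ _ _)) (crs U1 U2).
move=> s a b A B c hA hB hs hc s0 A0 B0 b0 a0 c0 id.
have h1 : B <= de * (A + de * s) + de * s.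
  have : de * a <= de * (cn th * A + de * cn th * s) by apply: ler_wpM2l => //; exact: ltW.
  move=> h; rewrite -(ler_pM2l T0); apply: le_trans hB _; lra.
have h2 : de * (de * s) <= de * s.
  by apply: ler_wpM2l; [exact: ltW|rewrite ler_piMl].
have h3 : de * s <= de * (l * (A + B)) by apply: ler_wpM2l => //; exact: ltW.
have h4 : de * (1 + 4 * l) * (A + B) <= ep * (A + B) by apply: ler_wpM2r => //; exact: addr_ge0.
have h5 : B <= ep * (A + B).
  have : 0 <= de * B by apply: mulr_ge0 => //; exact: ltW.
  have : 0 <= de * (l * (A + B)) by apply: mulr_ge0; [exact: ltW|apply: mulr_ge0; [exact: ltW|exact: addr_ge0]].
  move: h1 h2 h3 h4; lra.
have h6 : ep * B <= 4^-1 * B by apply: ler_wpM2r.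
have h7 : B * (3 / 4) <= ep * A by move: h5 h6; lra.
have h8 : (B * (3 / 4)) ^+ 2 <= (ep * A) ^+ 2.
  by rewrite ler_pXn2r ?nnegrE//; apply: mulr_ge0 => //; exact: ltW.
have h9 : ep ^+ 2 * A ^+ 2 = ep ^+ 2 * B ^+ 2 + ep ^+ 2 * (4 * X * c).
  by rewrite -mulrDr; congr (_ * _); move: id; lra.
have ep2 : ep ^+ 2 <= 4^-1 * ep by rewrite expr2; apply: ler_wpM2r => //; exact: ltW.
have h10 : ep ^+ 2 * B ^+ 2 <= 16^-1 * B ^+ 2.
  apply: ler_wpM2r; first exact: exprn_ge0.
  by move: ep2; lra.
have Xc : 0 < X * c by exact: mulr_gt0.
have h11 : ep ^+ 2 * (4 * X * c) <= ep * (X * c).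
  rewrite (_ : ep ^+ 2 * _ = (4 * ep ^+ 2) * (X * c)); last by ring.
  by apply: ler_wpM2r; [exact: ltW|lra].
have h12 : ep * (X * c) <= e / 22 * c.
  rewrite mulrA; apply: ler_wpM2r; first exact: ltW.
  by rewrite -ler_pdivlMr// -mulrA -invfM.
have ec : 0 < e * c by exact: mulr_gt0.
move: h8; rewrite !exprMn h9; move: h10 h11 h12 ec; lra.
Qed.
End Distortion.

Section PowerExpansion.
Variable R : realType.

Lemma cn_cpow (g : R) (z : R[i]) : cn (cpow g z) = expR (g * ln (cn z)).
Proof. by rewrite /cpow cn_cexp ReRM. Qed.

(** The square of half side [rho / 2] around [a] stays in the right half-plane, so one Cauchy
    estimate serves all base points. Its [D] is the derivative of the power, whose modulus is
    explicit and bounded below. *)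
Lemma cpow_local (g rho B : R) : 0 < g -> 0 < rho -> exists C c : R, [/\ 0 < C, 0 < c &
  forall a : R[i], rho <= complex.Re a -> cn a <= B -> exists D, c <= cn D /\
    forall z : R[i], cn (z - a) <= rho / 64 ->
      cn (cpow g z - cpow g a - D * (z - a)) <= C * cn (z - a) ^+ 2].
Proof.
move=> g0 r0; pose r := rho / 2; have r20 : 0 < r by rewrite divr_gt0.
pose M := expR (g * ln (B + rho)) + expR (g * ln (B + rho)).
have M0 : 0 < M by rewrite addr_gt0// expR_gt0.
pose C := 32 * (32 * 32) * M / r ^+ 2.
have C0 : 0 < C by rewrite /C divr_gt0 ?exprn_gt0// !mulr_gt0.
pose c := expR (g * ln rho) * (g / Num.max B rho).
have mB : 0 < Num.max B rho by rewrite lt_max r0 orbT.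
exists C, c; split=> //; first by rewrite mulr_gt0 ?expR_gt0// divr_gt0.
move=> a ha aB; have a0 : 0 < complex.Re a by exact: lt_le_trans ha.
have rca : rho <= cn a by apply: le_trans (le_trans _ (cn_Re a)); first exact: ha; exact: ler_norm.
have ca : 0 < cn a by exact: lt_le_trans rca.
have pz z : near_sq a r z -> 0 < complex.Re z /\ cn z <= B + rho.
  move=> [h1 h2]; split.
    move: h1; rewrite ReD ReN ler_norml /r => /andP[h1 _]; lra.
  have -> : z = a + (z - a) by ring.
  apply: le_trans (cnD _ _) _; apply: lerD => //.
  apply: le_trans (cn_le _) _; move: h1 h2; rewrite /r; lra.
have bz z : near_sq a r z -> cn (cpow g z) <= expR (g * ln (B + rho)).
  move=> /pz[h1 h2]; have cz : 0 < cn z by apply: lt_le_trans h1 (le_trans (ler_norm _) (cn_Re z)).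
  rewrite cn_cpow ler_expR; apply: ler_wpM2l; first exact: ltW.
  by rewrite ler_ln ?posrE//; exact: lt_le_trans h2.
have na : near_sq a r a by split; rewrite subrr normr0 ltW.
have [|||D HD] := @cauchy_estimate R (cpow g) a r 0 M r20.
- move=> z /pz[h1 _] e e0; have [d d0 Hd] := cder_cont (cder_cpow g h1) e0.
  by exists d => // w _; exact: Hd.
- move=> z h1 h2 _; have [|h _] := pz z; first by split; exact: ltW.
  by eexists; exact: cder_cpow.
- by move=> z hz; apply: le_trans (cnB _ _) _; apply: lerD; exact: bz.
have r32 : rho / 64 = r / 32 by rewrite /r; field.
exists D; split; last by move=> z; rewrite r32 => /HD[_].
have dD : cder (cpow g) a D.
  move=> e e0; exists (Num.min (r / 32) (e / C)); first by rewrite lt_min; apply/andP; split; exact: divr_gt0.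
  move=> w; rewrite lt_min => /andP[h1 h2]; have [_ h3] := HD w (ltW h1).
  apply: le_trans h3 _; rewrite -/C [cn (w - a) ^+ 2]expr2 mulrA; apply: ler_wpM2r; first exact: cn_ge0.
  by rewrite -ler_pdivlMl// mulrC ltW.
rewrite (cder_uniq dD (cder_cpow g a0)) cnM cn_cpow cnM cnV cnR (gtr0_norm g0).
apply: ler_pM.
- exact: expR_ge0.
- by apply: divr_ge0; exact: ltW.
- rewrite ler_expR; apply: ler_wpM2l; first exact: ltW.
  by rewrite ler_ln ?posrE.
apply: ler_wpM2l; first exact: ltW.
rewrite lef_pV2 ?posrE//; apply: le_trans aB _; by rewrite le_max lexx.
Qed.
End PowerExpansion.

Section TriangleEdges.
Variable R : realType.
Implicit Types (b : 'rV[R]_3) (k l : 'I_3) (p : seq 'I_4).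

(** The ratio [s] is negative when the address contains an odd number of middle children. *)
Lemma tri_edge p : exists s : R, `|s| = 2 ^- size p /\
  forall k l, tri R p k - tri R p l = s *: (bv R k - bv R l).
Proof.
elim: p => [|c p [s [s1 hs]]].
  by exists 1; rewrite normr1 expr0 invr1; split=> // k l; rewrite scale1r.
case: (ord4P c) => [[m ->]|->].
  exists (2^-1 * s); split=> [|k l].
    by rewrite normrM s1 ger0_norm ?invr_ge0// /= exprS invfM.
  by rewrite /= !sub_cc -scalerBr opprD addrACA subrr addr0 hs scalerA.
exists (- 2^-1 * s); split=> [|k l].
  by rewrite normrM normrN s1 ger0_norm ?invr_ge0// /= exprS invfM.
apply/rowP => n; have := congr1 (fun M : 'rV[R]_3 => M 0 n) (hs k l).
rewrite /= !sub_max !mxE => h.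
transitivity (- 2^-1 * (tri R p k 0 n - tri R p l 0 n)); first by ring.
by rewrite h; ring.
Qed.

(** Any two coordinates are cyclically consecutive, and a single coordinate reaching [eta] would
    exceed [1 - 2 * eta]. *)
Lemma two_coords b (eta : R) : isb b -> (forall k, b 0 k <= 1 - 2 * eta) ->
  exists k, eta <= b 0 k /\ eta <= b 0 (succ3 k).
Proof.
move=> hb h; apply: contrapT => /forallNP H.
have hs := hb.2; rewrite (sum3 0) in hs.
have g k : eta <= b 0 k \/ b 0 k < eta by case: (leP eta (b 0 k)); [left|right].
have N k : b 0 k < eta \/ b 0 (succ3 k) < eta.
  case: (g k) => h1; last by left.
  by case: (g (succ3 k)) => h2; [case: (H k)|right].
have := h 0; have := h (succ3 0); have := h (succ3 (succ3 0)).
have := N 0; have := N (succ3 0); have := N (succ3 (succ3 0)); rewrite succ3K.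
by move=> [?|?] [?|?] [?|?] ? ? ?; lra.
Qed.
End TriangleEdges.

Section LocalEstimates.
Variables (R : realType) (d : nat) (X : TriSurf R d).
Local Notation P := (@pos _ _ X).
Local Notation F := (@face _ _ X).
Local Notation pt := 'rV[R]_d.
Implicit Types (j : 'I_(nF X)) (k m c l : 'I_3) (v i : 'I_(nV X)) (b : 'rV[R]_3) (x : pt) (p : seq 'I_4).
Hypothesis TD : triangulated_disk X.

Lemma zt_diff j k b b' : zt j k b - zt j k b' =
  ((b - b') 0 (succ3 k))%:C + tau j k * ((b - b') 0 (succ3 (succ3 k)))%:C.
Proof. by rewrite /zt !mxE !rmorphB /=; ring. Qed.

Lemma zt_tri j p : exists s : R, [/\ `|s| = 2 ^- size p,
  zt j 0 (tri R p 1) - zt j 0 (tri R p 0) = s%:C &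
  zt j 0 (tri R p 2) - zt j 0 (tri R p 0) = s%:C * tau j 0].
Proof.
have [s [s1 hs]] := tri_edge R p; exists s; split=> //; rewrite zt_diff hs !mxE !succ3E /=.
  by rewrite !(subr0, subrr, mulr1, mulr0, rmorph0, addr0).
by rewrite !(subr0, subrr, mulr1, mulr0, rmorph0, addr0, add0r) mulrC.
Qed.

Lemma zt_base_diff : exists2 C : R, 0 < C & forall j k, exists q : R[i], [/\ q != 0, cn q <= C &
  forall b b', isb b -> isb b' -> zt j k b - zt j k b' = q * (zt j 0 b - zt j 0 b')].
Proof.
have [C C0 HC] := @fin_bound R ('I_(nF X) * 'I_3)%type (fun jk C => exists q : R[i], [/\ q != 0, cn q <= C &
  forall b b', isb b -> isb b' -> zt jk.1 jk.2 b - zt jk.1 jk.2 b' = q * (zt jk.1 0 b - zt jk.1 0 b')])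
  ltac:(move=> [j k] /=; have [s [q [q0 h]]] := zt_base TD j 0 k; exists (cn q), q; split=> // b b' hb hb';
    rewrite !h ?hb.2 ?hb'.2//; ring)
  ltac:(by move=> jk C C' CC [q [q0 h1 h2]]; exists q; split=> //; exact: le_trans CC).
by exists C => // j k; exact: (HC (j, k)).
Qed.

Lemma tau_bound : exists2 C : R, 0 < C & forall j k, cn (tau j k) <= C.
Proof.
have [C C0 HC] := @fin_bound R ('I_(nF X) * 'I_3)%type (fun jk C => cn (tau jk.1 jk.2) <= C)
  ltac:(by move=> [j k]; exists (cn (tau j k))) ltac:(by move=> jk C C' CC h; exact: le_trans CC).
by exists C => // j k; exact: (HC (j, k)).
Qed.

Lemma Tri_cn (w : R[i]) : Tri w -> cn w <= 1.
Proof.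
move=> /TriP h; have e c : cn ((mu c w)%:C * tc R c) = mu c w by rewrite cnM cn_tc cnR mulr1 ger0_norm.
have := mu_sum w; rewrite (sum3 0) => S; rewrite (congr1 (@cn R) (mu_recover w)) (sum3 0).
have := cnD ((mu 0 w)%:C * tc R 0 + (mu (succ3 0) w)%:C * tc R (succ3 0)) ((mu (succ3 (succ3 0)) w)%:C * tc R (succ3 (succ3 0))).
have := cnD ((mu 0 w)%:C * tc R 0) ((mu (succ3 0) w)%:C * tc R (succ3 0)).
by move: S; rewrite !e; lra.
Qed.

Section Psi.
Variables (v1 v2 v3 : 'I_(nV X)) (zeta : R) (phi : 'I_(nV X) -> pt -> R[i]^o).
Variables (Psi : pt -> R[i]^o) (Psiinv : R[i]^o -> pt).
Hypotheses (zeta0 : 0 < zeta) (zeta1 : zeta < 4^-1).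
Hypothesis SA : standing_assumption X v1 v2 v3.
Hypothesis CH : forall i, is_chart X v1 v2 v3 zeta i (phi i).
Hypothesis PS : is_Psi X v1 v2 v3 zeta phi Psi Psiinv.
Hypothesis ES : forall j k, bedge (F j k) (F j (succ3 k)) ->
  exists c, forall t : R, in01 t -> mu c (Psi (ptj j (edgeb k t))) = 0.

Definition dbarF j (f : pt -> R[i]) p := dbar (tau j 0)
  (f (ptj j (tri R p 1)) - f (ptj j (tri R p 0))) (f (ptj j (tri R p 2)) - f (ptj j (tri R p 0))).

(** In the flat coordinate the edges are [s] and [s * tau], so [dbar] kills the linear term of the
    expansion and leaves the quadratic remainder. The constant depends on [H], which keeps the
    triangle away from the vertices. *)
Lemma psi_dbar H : exists C : R, exists N, forall j p, (N <= size p)%N -> ncor H p ->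
  cn (dbarF j Psi p) <= C * (2 ^- size p) ^+ 2.
Proof.
have [C1 C10 HC1] := surface_estimate TD zeta0 zeta1 SA CH PS ES.
have [Cq Cq0 Hq] := zt_base_diff; have [Ct Ct0 Ht] := tau_bound.
pose eta : R := 2 ^- H.+1; have eta0 : 0 < eta by rewrite invr_gt0 exprn_gt0.
have e2 : 2 * eta = 2 ^- H by rewrite /eta exprS invfM mulrA divff ?mul1r// pnatr_eq0.
pose L := Cq * (1 + Ct); have L0 : 0 < L by rewrite mulr_gt0// ltr_wpDl// ltW.
pose E := C1 * (1 + 1) / eta ^+ 2 * L ^+ 2.
have [N HN] := small_pow L (divr_gt0 eta0 C10).
exists ((1 + Ct) * E), (N + H)%N => j p hs hc; have hs1 : (N <= size p)%N := leq_trans (leq_addr H N) hs.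
have hs2 : (H <= size p)%N := leq_trans (leq_addl N H) hs.
have [k [hk hk']] := two_coords (tri_isb R p 0) (fun k => ltac:(rewrite e2; exact: ncor_le) : tri R p 0 0 k <= 1 - 2 * eta).
(* Two points of [T] are at distance at most 2, which serves as the bound [M]. *)
have hM x : surf X x -> hat (F j k) (ptj j (tri R p 0)) - eta <= hat (F j k) x ->
    cn (Psi x - Psi (ptj j (tri R p 0))) <= 1 + 1.
  move=> hx _; apply: le_trans (cnB _ _) _; apply: lerD; apply: Tri_cn;
    apply: (homeo_T (Psi_homeo PS)) => //; apply: surf_ptj => //; exact: tri_isb.
have [D HD] := HC1 j k k _ _ _ eta0 (tri_isb R p 0) hk hk' (or_introl erefl) hM.
have [q [q0 qC hq]] := Hq j k; have [s [s1 t1 t2]] := zt_tri j p.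
set n := size p in hs hs1 hs2 s1 *.
have E1 := hq _ _ (tri_isb R p 1) (tri_isb R p 0); rewrite t1 in E1.
have E2 := hq _ _ (tri_isb R p 2) (tri_isb R p 0); rewrite t2 in E2.
have n0 : 0 <= 2 ^- n :> R by rewrite invr_ge0 exprn_ge0.
have L1 : cn (q * s%:C) <= L * 2 ^- n.
  rewrite cnM cnR s1; apply: ler_wpM2r => //; apply: le_trans qC _.
  by rewrite /L ler_pMr// lerDl ltW.
have L2 : cn (q * (s%:C * tau j 0)) <= L * 2 ^- n.
  rewrite !cnM cnR s1 mulrCA mulrC; apply: ler_wpM2r => //; apply: ler_pM; try exact: cn_ge0.
    exact: qC.
  by apply: le_trans (Ht _ _) _; rewrite lerDr ler01.
have sm : L * 2 ^- n <= eta / C1 by apply/ltW/HN.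
have [|_ h1] := HD _ (tri_isb R p 1); first by rewrite E1; exact: le_trans sm.
have [|_ h2] := HD _ (tri_isb R p 2); first by rewrite E2; exact: le_trans sm.
rewrite E1 in h1; rewrite E2 in h2.
have K0 : 0 <= C1 * (1 + 1) / eta ^+ 2.
  by apply: divr_ge0; [apply: mulr_ge0; [exact: ltW|lra]|exact: exprn_ge0 (ltW eta0)].
have b1 (z w : R[i]) : cn w <= L * 2 ^- n -> cn z <= C1 * (1 + 1) / eta ^+ 2 * cn w ^+ 2 ->
    cn z <= E * (2 ^- n) ^+ 2.
  move=> hw hz; apply: le_trans hz _; rewrite /E -[leRHS]mulrA -exprMn; apply: ler_wpM2l => //.
  rewrite ler_pXn2r ?nnegrE ?cn_ge0//; apply: mulr_ge0 => //; exact: ltW.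
have r1 := b1 _ _ L1 h1; have r2 := b1 _ _ L2 h2.
rewrite /dbarF /dbar.
set u1 := _ - _ - _ in r1; set u2 := _ - _ - _ in r2.
rewrite (_ : _ - _ = u2 - tau j 0 * u1); last by rewrite /u1 /u2; ring.
apply: le_trans (cnB _ _) _; rewrite cnM.
have : cn (tau j 0) * cn u1 <= Ct * (E * (2 ^- n) ^+ 2) by apply: ler_pM => //; exact: cn_ge0.
by move: r2; lra.
Qed.

(** Outside the corners the power acts on small triangles as multiplication by its derivative, up to
    a quadratic error; the lower bound on [th] makes this error relatively small. *)
Lemma chart_local j k H : exists C c : R, exists N, [/\ 0 < C, 0 < c & forall p, (N <= size p)%N ->
  ncor H p -> (forall l, Omega zeta (F j k) (ptj j (tri R p l))) -> exists th : R[i],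
  [/\ c * 2 ^- size p <= cn th,
     cn (phi (F j k) (ptj j (tri R p 1)) - phi (F j k) (ptj j (tri R p 0)) - th) <= C * (2 ^- size p) ^+ 2 &
     cn (phi (F j k) (ptj j (tri R p 2)) - phi (F j k) (ptj j (tri R p 0)) - th * tau j 0) <=
       C * (2 ^- size p) ^+ 2]].
Proof.
have [kap [kap0 hkap]] := chartE TD SA CH.
pose rho := Num.min 1 (complex.Re (tau j k)) * 2 ^- H.
have tr := tau_re_gt0 TD SA j k.
have m0 : 0 < Num.min 1 (complex.Re (tau j k)) by rewrite lt_min ltr01.
have pH : 0 < 2 ^- H :> R by rewrite invr_gt0 exprn_gt0.
have rho0 : 0 < rho by rewrite mulr_gt0.
have g0 : 0 < gam v1 v2 v3 (F j k) by exact: gam_gt0.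
have [C1 [c1 [C10 c10 HC]]] := cpow_local (1 + cn (tau j k)) g0 rho0.
have [Cq Cq0 Hq] := zt_base_diff; have [q [q0 qC hq]] := Hq j k.
have [Ct Ct0 Ht] := tau_bound.
pose L := Cq * (1 + Ct); have L0 : 0 < L by rewrite mulr_gt0// ltr_wpDl// ltW.
have kp : 0 < cn (kap j k) by rewrite cn_gt0.
have qp : 0 < cn q by rewrite cn_gt0.
have [N HN] := @small_pow R L (rho / 64) ltac:(by rewrite divr_gt0).
exists (cn (kap j k) * (C1 * L ^+ 2)), (cn (kap j k) * (c1 * cn q)), (N + H)%N.
have L20 : 0 < L ^+ 2 by exact: exprn_gt0.
split; [by apply: mulr_gt0 => //; apply: mulr_gt0|by apply: mulr_gt0 => //; apply: mulr_gt0|].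
move=> p hs hc hO; have hs2 : (H <= size p)%N := leq_trans (leq_addl N H) hs.
have hs1 : (N <= size p)%N := leq_trans (leq_addr H N) hs.
have b1 l : tri R p l 0 k <= 1 - 2 ^- H by exact: ncor_le.
have pE l : phi (F j k) (ptj j (tri R p l)) = kap j k * cpow (gam v1 v2 v3 (F j k)) (zt j k (tri R p l)).
  apply: hkap => //; first exact: tri_isb.
  by apply: le_lt_trans (b1 l) _; rewrite ltrBlDr ltrDl.
have hb := tri_isb R p 0; have hb1 := hb.1.
have [||D [Dc HD]] := HC (zt j k (tri R p 0)).
- rewrite Re_zt; have := hb.2; rewrite (sum3 k) => hs'; have := b1 0.
  have := hb1 (succ3 k); have := hb1 (succ3 (succ3 k)).
  move: (tri R p 0 0 k) (tri R p 0 0 (succ3 k)) (tri R p 0 0 (succ3 (succ3 k))) hs' => x0 x1 x2 hs' h2 h1 h0.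
  have l1 : Num.min 1 (complex.Re (tau j k)) <= 1 by rewrite ge_min lexx.
  have l2 : Num.min 1 (complex.Re (tau j k)) <= complex.Re (tau j k) by rewrite ge_min lexx orbT.
  have a1 : Num.min 1 (complex.Re (tau j k)) * x1 <= 1 * x1 by apply: ler_wpM2r.
  have a2 : Num.min 1 (complex.Re (tau j k)) * x2 <= complex.Re (tau j k) * x2 by apply: ler_wpM2r.
  have a3 : rho <= Num.min 1 (complex.Re (tau j k)) * (x1 + x2).
    by apply: ler_wpM2l; [exact: ltW|lra].
  lra.
- rewrite /zt; apply: le_trans (cnD _ _) _; rewrite cnM !cnR !ger0_norm//.
  apply: lerD; first exact: isb_le1.
  by rewrite ler_piMr ?cn_ge0//; exact: isb_le1.
have [s [s1 t1 t2]] := zt_tri j p.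
set n := size p in hs hs1 hs2 s1 *.
have E1 := hq _ _ (tri_isb R p 1) (tri_isb R p 0); rewrite t1 in E1.
have E2 := hq _ _ (tri_isb R p 2) (tri_isb R p 0); rewrite t2 in E2.
have n0 : 0 <= 2 ^- n :> R by rewrite invr_ge0 exprn_ge0.
have L1 : cn (q * s%:C) <= L * 2 ^- n.
  rewrite cnM cnR s1; apply: ler_wpM2r => //; apply: le_trans qC _.
  by rewrite /L ler_pMr// lerDl ltW.
have L2 : cn (q * (s%:C * tau j 0)) <= L * 2 ^- n.
  rewrite !cnM cnR s1 mulrCA mulrC; apply: ler_wpM2r => //; apply: ler_pM; try exact: cn_ge0.
    exact: qC.
  by apply: le_trans (Ht _ _) _; rewrite lerDr ler01.
have sm : L * 2 ^- n <= rho / 64 by apply/ltW/HN.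
exists (kap j k * (D * (q * s%:C))); split.
- rewrite !cnM cnR s1 -!mulrA; apply: ler_wpM2l; first exact: ltW.
  apply: ler_wpM2r => //; by apply: mulr_ge0 => //; exact: ltW.
- have h1 := HD (zt j k (tri R p 1)); rewrite E1 in h1; have {}h1 := h1 (le_trans L1 sm).
  rewrite !pE -mulrBr -mulrBr cnM -mulrA; apply: ler_wpM2l; first exact: ltW.
  apply: le_trans h1 _; rewrite -[leRHS]mulrA -exprMn; apply: ler_wpM2l; first exact: ltW.
  by rewrite ler_pXn2r ?nnegrE ?cn_ge0//; apply: mulr_ge0 => //; exact: ltW.
- have h1 := HD (zt j k (tri R p 2)); rewrite E2 in h1; have {}h1 := h1 (le_trans L2 sm).
  rewrite !pE (_ : _ - _ = kap j k * (cpow (gam v1 v2 v3 (F j k)) (zt j k (tri R p 2)) -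
     cpow (gam v1 v2 v3 (F j k)) (zt j k (tri R p 0)) - D * (q * (s%:C * tau j 0)))); last by ring.
  rewrite cnM -mulrA; apply: ler_wpM2l; first exact: ltW.
  apply: le_trans h1 _; rewrite -[leRHS]mulrA -exprMn; apply: ler_wpM2l; first exact: ltW.
  by rewrite ler_pXn2r ?nnegrE ?cn_ge0//; apply: mulr_ge0 => //; exact: ltW.
Qed.

(** The distortion is measured in the chart of the ancestor of generation 2, whose triangle lies in
    [Omega], so the expansion of that chart applies. One [N] serves as threshold for the level and
    for [K - 1]. *)
Lemma phi_dbar (chart : 'I_(nF X) -> seq 'I_4 -> 'I_(nV X)) H (e : R) :
  chart_assignment X zeta chart -> 0 < e -> exists N, forall (q : nat) (K : R) (Phi : pt -> R[i]^o),
  (N <= q)%N -> K - 1 <= N.+1%:R^-1 -> (2 <= q)%N -> in_FK X v1 v2 v3 phi chart K q Phi ->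
  forall j p, size p = q -> ncor H p -> cn (dbarF j Phi p) ^+ 2 <= e *
    crs (Phi (ptj j (tri R p 1)) - Phi (ptj j (tri R p 0))) (Phi (ptj j (tri R p 2)) - Phi (ptj j (tri R p 0))).
Proof.
move=> CA e0; have [|jk n m nm h|N HN] := @fin_nat ('I_(nF X) * 'I_3)%type (fun jk N =>
  forall (K : R) (Phi : pt -> R[i]^o) p, (N <= size p)%N -> K - 1 <= N.+1%:R^-1 -> ncor H p ->
  (forall l, Omega zeta (F jk.1 jk.2) (ptj jk.1 (tri R p l))) ->
  DCD_le K (phi (F jk.1 jk.2) (ptj jk.1 (tri R p 0))) (phi (F jk.1 jk.2) (ptj jk.1 (tri R p 1)))
    (phi (F jk.1 jk.2) (ptj jk.1 (tri R p 2)))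
    (Phi (ptj jk.1 (tri R p 0))) (Phi (ptj jk.1 (tri R p 1))) (Phi (ptj jk.1 (tri R p 2))) ->
  0 < crs (Phi (ptj jk.1 (tri R p 1)) - Phi (ptj jk.1 (tri R p 0))) (Phi (ptj jk.1 (tri R p 2)) - Phi (ptj jk.1 (tri R p 0))) ->
  cn (dbarF jk.1 Phi p) ^+ 2 <= e *
    crs (Phi (ptj jk.1 (tri R p 1)) - Phi (ptj jk.1 (tri R p 0))) (Phi (ptj jk.1 (tri R p 2)) - Phi (ptj jk.1 (tri R p 0)))).
- move=> [j k] /=; have [de de0 Hd] := dcd_flat (tau_im_gt0 TD j 0) e0.
  have [C [c [N [C0 c0 HC]]]] := chart_local j k H.
  have [N1 HN1] := @small_pow R C (de * c) ltac:(by rewrite mulr_gt0).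
  have [N2 HN2] : exists N2 : nat, N2.+1%:R^-1 <= de.
    exists (Num.trunc (de^-1)); rewrite invf_ple ?posrE//; apply/ltW; exact: truncnS_gt.
  exists (N + N1 + N2)%N => K Phi p hs hK hc hO DCD cr.
  have hs1 : (N <= size p)%N by apply: leq_trans hs; rewrite -addnA leq_addr.
  have hs2 : (N1 <= size p)%N by apply: leq_trans hs; rewrite -addnA addnCA leq_addr.
  have [th [h1 h2 h3]] := HC p hs1 hc hO.
  have n0 : 0 < 2 ^- size p :> R by rewrite invr_gt0 exprn_gt0.
  have th0 : 0 < cn th by apply: lt_le_trans h1; exact: mulr_gt0.
  have small : C * (2 ^- size p) ^+ 2 <= de * cn th.
    have : C / 2 ^+ size p <= de * c by apply/ltW/HN1.
    move=> /(ler_wpM2r (ltW n0)) h; rewrite expr2 mulrA; apply: le_trans h _.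
    by rewrite -mulrA; apply: ler_wpM2l; [exact: ltW|].
  apply: (Hd K th _ _ _ _ _ _ _ _ DCD cr).
  - by rewrite -cn_gt0.
  - by apply: le_trans hK _; apply: le_trans HN2; rewrite lef_pV2 ?posrE ?ltr0n// ler_nat ltnS leq_addl.
  - by apply: le_trans small; exact: h2.
  - by apply: le_trans small; exact: h3.
- move=> K Phi p hs hK; apply: h; first exact: leq_trans hs.
  by apply: le_trans hK _; rewrite lef_pV2 ?posrE ?ltr0n// ler_nat ltnS.
exists N => q K Phi Nq hK q2 [_ _ hcr _ hd] j p hp hc.
have hs2 : size (take 2 p) = 2%N by rewrite size_takel// hp.
have [[k hk] hO] := CA j (take 2 p) hs2.
have := hcr j p hp; have := hd j p hp; rewrite subfaceE /= -hk => DCD cr.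
apply: (HN (j, k) K Phi p _ hK hc _ DCD cr) => /=; first by rewrite hp.
move=> l; rewrite hk; apply: hO.
rewrite subfaceE /=; have -> : tri R p l = tri R (take 2 p ++ drop 2 p) l by rewrite cat_take_drop.
(* Concatenating addresses composes affine maps, so a small triangle lies in its ancestor. *)
have hT (p1 p2 : seq 'I_4) (l' : 'I_3) : tri R (p1 ++ p2) l' = lin (tri R p1) (tri R p2 l').
  elim: p1 => [|a p1 IH] /=.
    apply/rowP => n; rewrite /lin summxE (sum3 n) !mxE eqxx.
    by rewrite (eq_sym n) succ3_neq (eq_sym n) succ3_neq2 /= mulr1 !mulr0 !addr0.
  rewrite IH; apply/rowP => n; rewrite (sub_aff a n); last first.
    rewrite /lin; under eq_bigr do rewrite summxE; rewrite exchange_big /=.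
    rewrite -[RHS](proj2 (tri_isb R p2 l')); apply: eq_bigr => m _.
    under eq_bigr do rewrite mxE; by rewrite -mulr_sumr (proj2 (tri_isb R p1 m)) mulr1.
  rewrite /lin; under eq_bigr do rewrite summxE mulr_suml.
  rewrite exchange_big summxE /=; apply: eq_bigr => m _; rewrite !mxE.
  rewrite (sub_aff a n (proj2 (tri_isb R p1 m))) mulr_sumr; apply: eq_bigr => r _.
  by rewrite mxE mulrA.
rewrite hT; have [hb1 hb2] := tri_isb R (drop 2 p) l.
move: (tri R (drop 2 p) l) hb1 hb2 => b hb1 hb2.
exists (b 0 0), (b 0 1), (b 0 2); split=> //; first by move: hb2; rewrite (sum3 0) !succ3E.
rewrite /ptj /lin; under eq_bigr do rewrite summxE scaler_suml.
rewrite exchange_big /= (sum3 0) !succ3E.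
by congr (_ + _ + _); rewrite scaler_sumr; apply: eq_bigr => r _; rewrite mxE scalerA.
Qed.
End Psi.
End LocalEstimates.

(** * Discrete area sums over the surface *)

Section EdgeSums.
Variable R : realType.

Definition edge_sum (T : Type) n (h : T -> T -> R) (c : R -> T) : R :=
  \sum_(i < 2 ^ n) h (c (i%:R / (2 ^ n)%:R)) (c (i.+1%:R / (2 ^ n)%:R)).

Lemma edge_sum_rev (T : Type) n (h : T -> T -> R) (c : R -> T) : antisym h ->
  edge_sum n h (fun t => c (1 - t)) = - edge_sum n h c.
Proof.
move=> H; have n0 := pow2_neq0 R n.
rewrite /edge_sum (reindex_inj rev_ord_inj) /= -sumrN; apply: eq_bigr => i _.
rewrite H; congr (- h (c _) (c _)).
  by rewrite subnSK// natrB ?(ltnW (ltn_ord i))//; field.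
by rewrite natrB//; field.
Qed.

Lemma lat01 n (i : 'I_(2 ^ n)) : in01 (i%:R / (2 ^ n)%:R : R) /\ in01 (i.+1%:R / (2 ^ n)%:R : R).
Proof.
have n0 : 0 < (2 ^ n)%:R :> R by rewrite ltr0n expn_gt0.
rewrite /in01 !divr_ge0 ?ler0n//= !ler_pdivrMr// !mul1r !ler_nat.
by rewrite ltn_ord ltnW.
Qed.

Lemma crsC (a b : R[i]) : crs b a = - crs a b.
Proof. by rewrite /crs; ring. Qed.
Lemma crsNl (a b : R[i]) : crs (- a) b = - crs a b.
Proof. by rewrite /crs ReN ImN; ring. Qed.
Lemma crsNr (a b : R[i]) : crs a (- b) = - crs a b.
Proof. by rewrite /crs ReN ImN; ring. Qed.

Lemma muL_crs c (a b : R[i]) : muL c a = 0 -> muL c b = 0 -> crs a b = 0.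
Proof.
move=> ha hb; have hs (z : R[i]) : \sum_(m < 3) muL m z = 0.
  transitivity (\sum_(m < 3) (mu m z - mu m 0)); last by rewrite sumrB !mu_sum subrr.
  by apply: eq_bigr => m _; rewrite mu_sub subr0.
have E (z : R[i]) : muL c z = 0 -> z = (muL (succ3 c) z)%:C * (tc R (succ3 c) - tc R (succ3 (succ3 c))).
  move=> h; have := hs z; rewrite (sum3 c) h add0r => /eqP; rewrite addrC addr_eq0 => /eqP e.
  by rewrite {1}(mul_recover z) (sum3 c) h e rmorphN /= rmorph0; ring.
rewrite (E a ha) (E b hb) /crs !ReMc !ImMc /=; ring.
Qed.

(** On a line the area swept from the origin is additive in whatever order the points come, so only
    the ends count. *)
Lemma line_sum (f : nat -> R[i]) c n : (forall i, (i <= n)%N -> mu c (f i) = 0) ->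
  \sum_(i < n) crs (f i) (f i.+1) = crs (f 0%N) (f n).
Proof.
elim: n => [|n IH] h; first by rewrite big_ord0 /crs; ring.
rewrite big_ord_recr /= IH => [|i hi]; last by apply: h; exact: leqW.
have : crs (f n - f 0%N) (f n.+1 - f 0%N) = 0.
  by apply: (@muL_crs c); rewrite -mu_sub !h ?subrr// ltnW.
by rewrite !crsDl !crsDr !crsNl !crsNr (crsC (f n.+1)) (crsC (f n)) => e;
   rewrite (crsC (f n) (f 0%N)) /crs in e *; lra.
Qed.
End EdgeSums.

Section SurfaceSums.
Variables (R : realType) (d : nat) (X : TriSurf R d).
Local Notation P := (@pos _ _ X).
Local Notation F := (@face _ _ X).
Local Notation pt := 'rV[R]_d.
Implicit Types (j : 'I_(nF X)) (k m c l : 'I_3) (v w i : 'I_(nV X)) (b : 'rV[R]_3) (x : pt) (p : seq 'I_4).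
Hypothesis TD : triangulated_disk X.

(** The edge is parametrised by its vertices alone, so that both faces containing it refer to the
    same points. *)
Definition vlrp v w (t : R) : pt := (1 - t) *: P v + t *: P w.
Definition hj j (h : pt -> pt -> R) b b' : R := h (ptj j b) (ptj j b').

Lemma ptj_lrp j b b' (t : R) : ptj j (lrp b b' t) = (1 - t) *: ptj j b + t *: ptj j b'.
Proof.
rewrite /ptj !scaler_sumr -big_split /=; apply: eq_bigr => k _.
by rewrite !scalerA -scalerDl /lrp !mxE; congr (_ *: _); ring.
Qed.
Lemma ptj_bv j k : ptj j (bv R k) = P (F j k).
Proof. exact: lin_bv. Qed.
Lemma vlrp_rev v w (t : R) : vlrp w v t = vlrp v w (1 - t).
Proof. by rewrite /vlrp subKr addrC. Qed.
Lemma bedge_face v w : bedge v w -> exists j k, [/\ F j k = v, F j (succ3 k) = w &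
  forall t, vlrp v w t = ptj j (edgeb k t)].
Proof.
move=> /andP[/oedgeP[j [k [<- <-]]] _]; exists j, k; split=> // t.
by rewrite ptj_edgeb.
Qed.

Lemma sum_all n (h : pt -> pt -> R) : antisym h ->
  \sum_j \sum_(p <- paths n) circ (hj j h) p =
  \sum_j \sum_(k < 3) edge_sum n h (vlrp (F j k) (F j (succ3 k))).
Proof.
move=> H; apply: eq_bigr => j _; rewrite telescope_tri; last by move=> b b'; exact: H.
by apply: eq_bigr => k _; apply: eq_bigr => i _; rewrite /hj !ptj_lrp !ptj_bv.
Qed.

Lemma sum_all0 n (h : pt -> pt -> R) : antisym h ->
  (forall v w, bedge v w -> edge_sum n h (vlrp v w) = 0) ->
  \sum_j \sum_(p <- paths n) circ (hj j h) p = 0.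
Proof.
move=> H H0; rewrite sum_all// (global_cancel TD (h := fun v w => edge_sum n h (vlrp v w)))//.
by move=> v w; rewrite -edge_sum_rev//; congr edge_sum; apply/funext => t; exact: vlrp_rev.
Qed.

(** The circulation around a corner consists of the chord opposite to the vertex and two radial
    pieces. The radial pieces cancel between neighbouring faces, which use the same form at a common
    vertex, and vanish on the boundary by assumption. *)
Lemma sum_corners H n (h : 'I_(nV X) -> pt -> pt -> R) : (forall v, antisym (h v)) ->
  (forall v w, bedge v w -> forall u, u = v \/ u = w -> forall s t, in01 s -> in01 t ->
     h u (vlrp v w s) (vlrp v w t) = 0) ->
  \sum_j \sum_(k < 3) \sum_(p <- paths n) circ (hj j (h (F j k))) (nseq H (cc k) ++ p) =
  \sum_j \sum_(k < 3) ledge n (hj j (h (F j k))) (cor H k (bv R (succ3 k))) (cor H k (bv R (succ3 (succ3 k)))).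
Proof.
move=> Ha H0; pose r v w := edge_sum n (h v) (fun t => vlrp v w (t * 2 ^- H)).
have hl (t : R) : 0 <= t <= 1 -> in01 (t * 2 ^- H).
  move=> /andP[t0 t1]; have : 0 <= (2 ^- H : R) <= 1.
    by rewrite invr_ge0 exprn_ge0//= invf_le1 ?exprn_gt0// exprn_ege1// ler1n.
  move=> /andP[e0 e1]; rewrite /in01 mulr_ge0//=.
  by apply: le_trans e1; rewrite ler_piMl.
have E j k : \sum_(p <- paths n) circ (hj j (h (F j k))) (nseq H (cc k) ++ p) =
    r (F j k) (F j (succ3 k)) - r (F j k) (F j (succ3 (succ3 k))) +
    ledge n (hj j (h (F j k))) (cor H k (bv R (succ3 k))) (cor H k (bv R (succ3 (succ3 k)))).
  have Hj : antisym (hj j (h (F j k))) by move=> b b'; exact: Ha.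
  rewrite telescope_corner// (sum3 k) succ3K.
  have ck : cor H k (bv R k) = bv R k by rewrite /cor subrr scaler0 addr0.
  have e m : ledge n (hj j (h (F j k))) (bv R k) (cor H k (bv R m)) = r (F j k) (F j m).
    apply: eq_bigr => i _; rewrite /hj !ptj_lrp !ptj_bv.
    by congr (h _ _ _); rewrite /vlrp scalerDr !scalerA addrA -scalerDl; congr (_ *: _ + _ *: _); ring.
  by rewrite ck (ledge_rev n (bv R k)) // !e; ring.
have -> : \sum_j \sum_(k < 3) \sum_(p <- paths n) circ (hj j (h (F j k))) (nseq H (cc k) ++ p) =
   \sum_j \sum_(k < 3) (r (F j k) (F j (succ3 k)) - r (F j (succ3 k)) (F j k)) +
  \sum_j \sum_(k < 3) ledge n (hj j (h (F j k))) (cor H k (bv R (succ3 k))) (cor H k (bv R (succ3 (succ3 k)))).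
  rewrite -big_split /=; apply: eq_bigr => j _.
  under eq_bigr do rewrite E.
  rewrite big_split /=; congr (_ + _); rewrite !sumrB; congr (_ - _).
  by rewrite (reindex_inj succ3_inj) /=; apply: eq_bigr => k _; rewrite succ3K.
rewrite (global_cancel TD (h := fun v w => r v w - r w v)) ?add0r//; first by move=> v w; rewrite opprB.
move=> v w vw; rewrite /r /edge_sum !big1 ?subrr// => i _; have [h1 h2] := lat01 R i.
  by rewrite !(vlrp_rev v w); apply: (H0 v w vw w (or_intror erefl));
    rewrite /in01 subr_ge0 lerBlDr lerDl andbC; exact: hl.
by apply: (H0 v w vw v (or_introl erefl)); exact: hl.
Qed.
End SurfaceSums.

Section Energy.
Variables (R : realType) (d : nat) (X : TriSurf R d).
Local Notation P := (@pos _ _ X).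
Local Notation F := (@face _ _ X).
Local Notation pt := 'rV[R]_d.
Implicit Types (j : 'I_(nF X)) (k m c l : 'I_3) (v w i : 'I_(nV X)) (b : 'rV[R]_3) (x : pt) (p : seq 'I_4).
Hypothesis TD : triangulated_disk X.
Variables (v1 v2 v3 : 'I_(nV X)) (zeta : R) (phi : 'I_(nV X) -> pt -> R[i]^o).
Variables (Psi : pt -> R[i]^o) (Psiinv : R[i]^o -> pt).
Hypotheses (zeta0 : 0 < zeta) (zeta1 : zeta < 4^-1).
Hypothesis SA : standing_assumption X v1 v2 v3.
Hypothesis CH : forall i, is_chart X v1 v2 v3 zeta i (phi i).
Hypothesis PS : is_Psi X v1 v2 v3 zeta phi Psi Psiinv.
Hypothesis ES : forall j k, bedge (F j k) (F j (succ3 k)) ->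
  exists c, forall t : R, in01 t -> mu c (Psi (ptj j (edgeb k t))) = 0.

Lemma psi_osc (e : R) : 0 < e -> exists H, forall v x, surf X x ->
  1 - 2 ^- H <= hat v x -> cn (Psi x - Psi (P v)) <= e.
Proof.
move=> e0; apply: fin_nat => [v|v n m nm h x hx hm]; last first.
  apply: h => //; apply: le_trans hm; rewrite lerD2l lerN2 lef_pV2 ?posrE ?exprn_gt0//.
  by rewrite ler_weXn2l// ler1n.
have [r r0 Hr] := homeo_cont (Psi_homeo PS) (surfV TD v) e0.
have [e1 e10 He] := @ptj_ball R d X r r0.
have [N HN] := @small_pow R 1 (Num.min 1 (e1 / 2)) ltac:(by rewrite lt_min ltr01 divr_gt0).
exists N => x hx hm; apply/ltW/Hr => //.
have [j [b hb xE]] := proj1 (surfP TD x) hx.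
have := HN N (leqnn N); rewrite div1r lt_min => /andP[n1 n2].
have [/mem_faceset[k vE]|hv] := boolP (v \in faceset j); last first.
  by move: hm; rewrite xE hat_pt0//; lra.
rewrite xE vE -ptj_bv; apply: He; rewrite /bnorm (sum3 k) !mxE eqxx succ3_neq succ3_neq2 /=.
move: hm; rewrite xE vE hat_pt// => hm; have [b0 bs] := hb; rewrite (sum3 k) in bs.
have := isb_le1 k hb; have := b0 (succ3 k); have := b0 (succ3 (succ3 k)) => h2 h1 hk.
by rewrite !sub0r !normrN mulr1n !ger0_norm ?subr_ge0//; lra.
Qed.

(* Since Phi - Psi (P v) = u + (Psi - Psi (P v)), this is the area form of
   Phi - Psi (P v) minus the area form of u. *)
Definition star_form (u : pt -> R[i]) v x y : R :=
  crs (Psi x - Psi (P v)) (Psi y - Psi (P v)) +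
  (crs (u x) (Psi y - Psi (P v)) + crs (Psi x - Psi (P v)) (u y)).

Lemma star_form_anti u v : antisym (star_form u v).
Proof. by move=> x y; rewrite /star_form crsC (crsC (u x)) (crsC _ (u y)); ring. Qed.

Lemma cor_coord H k (t : R) : let b := lrp (cor H k (bv R (succ3 k))) (cor H k (bv R (succ3 (succ3 k)))) t in
  [/\ b 0 k = 1 - 2 ^- H, b 0 (succ3 k) = 2 ^- H * (1 - t) & b 0 (succ3 (succ3 k)) = 2 ^- H * t].
Proof.
rewrite /= /lrp /cor !mxE !eqxx (eq_sym k (succ3 k)) (eq_sym k (succ3 (succ3 k))) !succ3_neq !succ3_neq2.
by rewrite (eq_sym (succ3 k) (succ3 (succ3 k))) succ3_neq /=; split; ring.
Qed.
Lemma cor_isb H k (t : R) : in01 t ->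
  isb (lrp (cor H k (bv R (succ3 k))) (cor H k (bv R (succ3 (succ3 k)))) t).
Proof.
move=> /andP[t0 t1]; have [e1 e2 e3] := cor_coord H k t.
have p0 : 0 <= 2 ^- H :> R by rewrite invr_ge0 exprn_ge0.
have p1 : 2 ^- H <= 1 :> R by rewrite invf_le1 ?exprn_gt0// exprn_ege1// ler1n.
split=> [m|]; last by rewrite (sum3 k) e1 e2 e3; ring.
case: (ord3_cases k m) => ->; rewrite ?e1 ?e2 ?e3; first by rewrite subr_ge0.
  by rewrite mulr_ge0// subr_ge0.
by rewrite mulr_ge0.
Qed.

(** [C] is independent of [H]: the chord is at a distance of order [2 ^- H] from the vertex and its
    steps have length of order [2 ^- H * 2 ^- n], so the scale cancels in the first-order bound of
    [surface_estimate]. *)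
Lemma chord_step : exists2 C : R, 0 < C & exists N, forall H n (M : R) j k, (0 < H)%N -> (N <= n)%N ->
  (forall x, surf X x -> 1 - 2 * 2 ^- H <= hat (F j k) x -> cn (Psi x - Psi (P (F j k))) <= M) ->
  forall t s : R, in01 t -> in01 s -> `|s - t| <= 2 ^- n ->
   cn (Psi (ptj j (lrp (cor H k (bv R (succ3 k))) (cor H k (bv R (succ3 (succ3 k)))) s)) -
       Psi (ptj j (lrp (cor H k (bv R (succ3 k))) (cor H k (bv R (succ3 (succ3 k)))) t))) <= C * M * 2 ^- n.
Proof.
have [C1 C10 HC1] := surface_estimate TD zeta0 zeta1 SA CH PS ES.
have [Cz Cz0 Hz] := @zt_lip R d X.
have [N HN] := @small_pow R (4 * Cz * C1) 1 ltr01.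
exists (8 * C1 * Cz); first by rewrite !mulr_gt0.
exists N => H n M j k H0 hn hM t s ht hs st.
set B := lrp _ _; have ib := cor_isb H k ht; have ib' := cor_isb H k hs.
rewrite -/B in ib ib'; have [e1 e2 e3] := cor_coord H k t; rewrite -/B /= in e1 e2 e3.
pose eta : R := 2 ^- H / 2; have pH : 0 < 2 ^- H :> R by rewrite invr_gt0 exprn_gt0.
have eta0 : 0 < eta by rewrite divr_gt0.
have pH2 : 2 ^- H <= 2^-1 :> R.
  by rewrite lef_pV2 ?posrE ?exprn_gt0// -[leLHS]expr1 ler_weXn2l// ler1n.
have hk : eta <= B t 0 k by rewrite e1 /eta; lra.
have hat_lo x : surf X x -> hat (F j k) (ptj j (B t)) - eta <= hat (F j k) x ->
    cn (Psi x - Psi (ptj j (B t))) <= M + M.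
  move=> hx hx2; apply: le_trans (cn_tri (Psi (P (F j k))) _ _) _; apply: lerD.
    by apply: hM => //; apply: le_trans hx2; rewrite hat_pt// e1 /eta; lra.
  rewrite cnC; apply: hM; first exact: surf_ptj.
  by rewrite hat_pt// e1; lra.
have dist m : cn (zt j m (B s) - zt j m (B t)) <= 2 * Cz * 2 ^- H * 2 ^- n.
  apply: le_trans (Hz _ _ _ _) _.
  have -> : bnorm (B s - B t) = 2 * 2 ^- H * `|s - t|.
    have [f1 f2 f3] := cor_coord H k s; rewrite -/B /= in f1 f2 f3.
    have e m' : (B s - B t) 0 m' = B s 0 m' - B t 0 m' by rewrite mxE [X in _ + X]mxE.
    rewrite /bnorm (sum3 k) !e e1 e2 e3 f1 f2 f3 subrr normr0 add0r -!mulrBr.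
    rewrite !normrM (ger0_norm (ltW pH)); have -> : 1 - s - (1 - t) = - (s - t) by ring.
    by rewrite normrN; ring.
  rewrite (_ : 2 * Cz * 2 ^- H * 2 ^- n = Cz * (2 * 2 ^- H * 2 ^- n)); last by ring.
  apply: ler_wpM2l; first exact: ltW.
  by apply: ler_wpM2l => //; apply: mulr_ge0 => //; exact: ltW.
have n0 : 0 < 2 ^- n :> R by rewrite invr_gt0 exprn_gt0.
have small : 2 * Cz * 2 ^- H * 2 ^- n <= eta / C1.
  rewrite ler_pdivlMr//; have := ltW (HN n hn).
  move=> /(ler_wpM2r (ltW eta0)); rewrite /eta mul1r; apply: le_trans.
  by rewrite le_eqVlt; apply/orP; left; apply/eqP; field; rewrite !expf_neq0// pnatr_eq0.
(* Of the two edges at the vertex, the one towards which the point leans is used; both its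
   coordinates are at least [eta]. *)
have [k0 [m0 [h1 h2 h3 h4]]] : exists k0 m0, [/\ F j m0 = F j k, m0 = k0 \/ m0 = succ3 k0, eta <= B t 0 k0 & eta <= B t 0 (succ3 k0)].
  have [h|h] := leP t 2^-1.
    exists k, k; split=> //; first by left.
    by rewrite e2 /eta; apply: ler_wpM2l; [exact: ltW|lra].
  exists (succ3 (succ3 k)), k; split=> //; first by right; rewrite succ3K.
    by rewrite e3 /eta; apply: ler_wpM2l; exact: ltW.
  by rewrite succ3K.
have [|D HD] := HC1 j k0 m0 (B t) eta (M + M) eta0 ib h3 h4 h2; first by rewrite h1.
have [|+ _] := HD (B s) ib'; first exact: le_trans (dist _) small.
move=> h; apply: le_trans h _.
have M0 : 0 <= M + M.
  apply: le_trans (cn_ge0 _) (hat_lo (ptj j (B t)) _ _); first exact: surf_ptj.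
  by rewrite lerBlDr lerDl ltW.
apply: (@le_trans _ _ (C1 * (M + M) / eta * (2 * Cz * 2 ^- H * 2 ^- n))).
  apply: ler_wpM2l; last exact: dist.
  by apply: divr_ge0; [apply: mulr_ge0 => //; exact: ltW|exact: ltW].
rewrite le_eqVlt; apply/orP; left; apply/eqP; rewrite /eta; field.
by rewrite !expf_neq0// pnatr_eq0.
Qed.

(** The increments of [u] are not under control. Summation by parts moves them to [Psi]: with
    [g i = crs (u (x i)) (W i)], the form is [g i - g i.+1] plus terms containing an increment of
    [W]. *)
Lemma chord_bound : exists2 C : R, 0 < C & exists N, forall H n (M : R) (u : pt -> R[i]) j k, (0 < H)%N -> (N <= n)%N ->
  0 <= M -> M <= 2 -> (forall x, surf X x -> cn (u x) <= 2) ->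
  (forall x, surf X x -> 1 - 2 * 2 ^- H <= hat (F j k) x -> cn (Psi x - Psi (P (F j k))) <= M) ->
  `|ledge n (hj j (star_form u (F j k))) (cor H k (bv R (succ3 k))) (cor H k (bv R (succ3 (succ3 k))))| <= C * M.
Proof.
have [C C0 [N HC]] := chord_step.
exists (4 + 6 * C); first by rewrite addr_gt0// mulr_gt0.
exists N => H n M u j k H0 hn M0 M2 hu hM.
have step := HC H n M j k H0 hn hM.
set B := lrp (cor H k (bv R (succ3 k))) (cor H k (bv R (succ3 (succ3 k)))) in step *.
have n0 : 0 < (2 ^ n)%:R :> R by rewrite ltr0n expn_gt0.
pose x (i : nat) := ptj j (B (i%:R / (2 ^ n)%:R)).
pose W (i : nat) := Psi (x i) - Psi (P (F j k)).
pose g (i : nat) := crs (u (x i)) (W i).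
have sx (i : nat) : (i <= 2 ^ n)%N -> surf X (x i).
  move=> hi; apply: surf_ptj => //; apply: cor_isb.
  by rewrite /in01 divr_ge0 ?ler0n//= ler_pdivrMr// mul1r ler_nat.
have i01 (i : nat) : (i <= 2 ^ n)%N -> in01 (i%:R / (2 ^ n)%:R : R).
  by move=> hi; rewrite /in01 divr_ge0 ?ler0n//= ler_pdivrMr// mul1r ler_nat.
have hW (i : nat) : (i <= 2 ^ n)%N -> cn (W i) <= M.
  move=> hi; apply: hM; first exact: sx.
  rewrite hat_pt//; last by apply: cor_isb; exact: i01.
  have [e1 _ _] := cor_coord H k (i%:R / (2 ^ n)%:R); rewrite /= in e1; rewrite /B e1.
  by have : 0 < 2 ^- H :> R; [rewrite invr_gt0 exprn_gt0|lra].
have hg (i : nat) : (i <= 2 ^ n)%N -> `|g i| <= 2 * M.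
  move=> hi; apply: le_trans (crs_le _ _) _; apply: ler_pM; try exact: cn_ge0.
    by apply: hu; exact: sx.
  exact: hW.
have dW (i : nat) : (i < 2 ^ n)%N -> cn (W i.+1 - W i) <= C * M * 2 ^- n.
  move=> hi; have -> : W i.+1 - W i = Psi (x i.+1) - Psi (x i) by rewrite /W; ring.
  apply: step; [exact: i01 (ltnW hi)|exact: i01|].
  by rewrite -mulrBl -natrB// subSnn mul1r ger0_norm ?invr_ge0 ?ler0n// natrX.
have err (i : nat) : (i < 2 ^ n)%N ->
    `|hj j (star_form u (F j k)) (B (i%:R / (2 ^ n)%:R)) (B (i.+1%:R / (2 ^ n)%:R)) - (g i - g i.+1)| <= 6 * (C * M * 2 ^- n).
  move=> hi; have -> : hj j (star_form u (F j k)) (B (i%:R / (2 ^ n)%:R)) (B (i.+1%:R / (2 ^ n)%:R)) - (g i - g i.+1) =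
      crs (W i) (W i.+1 - W i) + (crs (u (x i)) (W i.+1 - W i) + crs (u (x i.+1)) (W i.+1 - W i)).
    by rewrite /hj /star_form /g /W /x /crs !(ReD, ImD, ReN, ImN); ring.
  have D0 := dW i hi; have c0 := cn_ge0 (W i.+1 - W i).
  have D1 : `|crs (W i) (W i.+1 - W i)| <= 2 * (C * M * 2 ^- n).
    apply: le_trans (crs_le _ _) _; apply: ler_pM => //; first exact: cn_ge0.
    exact: le_trans (hW i (ltnW hi)) M2.
  have D2 (i' : nat) : (i' <= 2 ^ n)%N -> `|crs (u (x i')) (W i.+1 - W i)| <= 2 * (C * M * 2 ^- n).
    move=> hi'; apply: le_trans (crs_le _ _) _; apply: ler_pM => //; first exact: cn_ge0.
    by apply: hu; exact: sx.
  have := D2 i (ltnW hi); have := D2 i.+1 hi => D3 D4.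
  apply: le_trans (ler_normD _ _) _.
  have := ler_normD (crs (u (x i)) (W i.+1 - W i)) (crs (u (x i.+1)) (W i.+1 - W i)).
  by move: D1 D3 D4; lra.
rewrite /ledge -/B.
rewrite (_ : \sum_(i < 2 ^ n) _ = \sum_(i < 2 ^ n) (hj j (star_form u (F j k)) (B (i%:R / (2 ^ n)%:R)) (B (i.+1%:R / (2 ^ n)%:R)) - (g i - g i.+1))
  + (g 0%N - g (2 ^ n)%N)); last first.
  rewrite sumrB (_ : \sum_(i < 2 ^ n) (g i - g i.+1) = g 0%N - g (2 ^ n)%N) ?subrK//.
  rewrite -(big_mkord xpredT (fun i : nat => g i - g i.+1)) -[RHS]opprB -telescope_sumr// -sumrN.
  by apply: eq_bigr => i _; rewrite opprB.
apply: le_trans (ler_normD _ _) _.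
have g2 : `|g 0%N - g (2 ^ n)%N| <= 4 * M.
  apply: le_trans (ler_normB _ _) _; have := hg 0%N (leq0n _); have := hg _ (leqnn (2 ^ n)); lra.
have : `|\sum_(i < 2 ^ n) (hj j (star_form u (F j k)) (B (i%:R / (2 ^ n)%:R)) (B (i.+1%:R / (2 ^ n)%:R)) - (g i - g i.+1))| <=
   6 * (C * M).
  apply: le_trans (ler_norm_sum _ _ _) _.
  apply: (@le_trans _ _ (\sum_(i < 2 ^ n) 6 * (C * M * 2 ^- n))).
    by apply: ler_sum => i _; exact: err.
  rewrite sumr_const card_ord -[_ *+ (2 ^ n)]mulr_natr natrX le_eqVlt; apply/orP; left; apply/eqP; field.
  by rewrite expf_neq0// pnatr_eq0.
by move: g2; lra.
Qed.
End Energy.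

Section EnergyBound.
Variables (R : realType) (d : nat) (X : TriSurf R d).
Local Notation P := (@pos _ _ X).
Local Notation F := (@face _ _ X).
Local Notation pt := 'rV[R]_d.
Implicit Types (j : 'I_(nF X)) (k m c l : 'I_3) (v w i : 'I_(nV X)) (b : 'rV[R]_3) (x : pt) (p : seq 'I_4).
Hypothesis TD : triangulated_disk X.

Definition inc1 j (f : pt -> R[i]) p := f (ptj j (tri R p 1)) - f (ptj j (tri R p 0)).
Definition inc2 j (f : pt -> R[i]) p := f (ptj j (tri R p 2)) - f (ptj j (tri R p 0)).
Definition ener j (f : pt -> R[i]) p := cn (inc1 j f p) ^+ 2 + cn (inc2 j f p) ^+ 2.

Lemma circ_crs j (f : pt -> R[i]) p :
  circ (hj j (fun x y => crs (f x) (f y))) p = crs (inc1 j f p) (inc2 j f p).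
Proof. by rewrite /circ (sum3 0) !succ3E /hj /inc1 /inc2 /crs !(ReD, ImD, ReN, ImN); ring. Qed.

Lemma size_paths n : size (paths n) = (4 ^ n)%N.
Proof. by elim: n => //= n IH; rewrite size_allpairs IH size_enum_ord expnS. Qed.

(** [recover_cn] bounds the energy by [dz] and [dbar], and [dz_dbar] trades [dz] for area. The area
    carries the same factor [G] on all faces because only the unweighted areas of [u] cancel over
    the surface. *)
Lemma ener_bound : exists G K : R, [/\ 0 < G, 0 < K & forall j (f : pt -> R[i]) p,
  ener j f p <= G * (K * cn (dbarF j f p) ^+ 2 + crs (inc1 j f p) (inc2 j f p))].
Proof.
have [Ct Ct0 Ht] := @tau_bound R d X.
have [|j a a' _ ba h|y y0 Hy] := @fin_delta R 'I_(nF X) (fun j y => y <= complex.Im (tau j 0)).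
- by move=> j; exists (complex.Im (tau j 0)) => //; exact: tau_im_gt0.
- exact: le_trans ba h.
pose L := (1 + Ct ^+ 2) / (2 * y ^+ 2).
have Ct2 : 0 < Ct ^+ 2 by exact: exprn_gt0.
have y2 : 0 < y ^+ 2 by exact: exprn_gt0.
have L0 : 0 < L by apply: divr_gt0; [exact: addr_gt0|exact: mulr_gt0].
exists (4 * Ct * L), (1 / (2 * y)); split.
- by apply: mulr_gt0 => //; exact: mulr_gt0.
- by apply: divr_gt0 => //; exact: mulr_gt0.
move=> j f p; rewrite /ener; have [r1 r2] := recover_cn (tau j 0) (inc1 j f p) (inc2 j f p).
have := dz_dbar (tau j 0) (inc1 j f p) (inc2 j f p).
have X0 := tau_im_gt0 TD j 0; have yX := Hy j.
have XC : complex.Im (tau j 0) <= Ct.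
  by apply: le_trans (Ht j 0); apply: le_trans (cn_Im _); exact: ler_norm.
have tC := Ht j 0; have t0 := cn_ge0 (tau j 0).
rewrite (gtr0_norm X0) in r1 r2.
rewrite -[dbarF j f p]/(dbar (tau j 0) (inc1 j f p) (inc2 j f p)).
have := cn_ge0 (dz (tau j 0) (inc1 j f p) (inc2 j f p)); have := cn_ge0 (dbar (tau j 0) (inc1 j f p) (inc2 j f p)).
have := cn_ge0 (inc1 j f p); have := cn_ge0 (inc2 j f p).
move: r1 r2 X0 yX XC tC t0; move: (cn (dz _ _ _)) (cn (dbar _ _ _)) (cn (inc1 _ _ _)) (cn (inc2 _ _ _)) (crs _ _) (cn (tau _ _)) (complex.Im _).
move=> A B U1 U2 c t Y r1 r2 Y0 yY YC tC t0 U20 U10 B0 A0 id.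
pose s := A ^+ 2 + B ^+ 2; have s0 : 0 <= s by apply: addr_ge0; exact: sqr_ge0.
have AB : (A + B) ^+ 2 <= 2 * s by have := sqr_ge0 (A - B); rewrite /s !expr2; lra.
have y2Y : y ^+ 2 <= Y ^+ 2 by rewrite ler_pXn2r ?nnegrE// ltW.
have u1 : U1 ^+ 2 * (2 * y ^+ 2) <= s.
  have : (U1 * (2 * Y)) ^+ 2 <= (A + B) ^+ 2.
    rewrite ler_pXn2r ?nnegrE//; [|exact: addr_ge0].
    by apply: mulr_ge0 => //; apply: mulr_ge0 => //; exact: ltW.
  have : U1 ^+ 2 * y ^+ 2 <= U1 ^+ 2 * Y ^+ 2 by apply: ler_wpM2l => //; exact: sqr_ge0.
  by move: AB; rewrite !exprMn; lra.
have u2 : U2 ^+ 2 * (2 * y ^+ 2) <= Ct ^+ 2 * s.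
  have h : (U2 * (2 * Y)) ^+ 2 <= (t * (A + B)) ^+ 2.
    rewrite ler_pXn2r ?nnegrE//; last by apply: mulr_ge0 => //; exact: addr_ge0.
    by apply: mulr_ge0 => //; apply: mulr_ge0 => //; exact: ltW.
  have h1 : U2 ^+ 2 * y ^+ 2 <= U2 ^+ 2 * Y ^+ 2 by apply: ler_wpM2l => //; exact: sqr_ge0.
  have h2 : t ^+ 2 * (A + B) ^+ 2 <= Ct ^+ 2 * (2 * s).
    apply: ler_pM => //; try exact: sqr_ge0.
    by rewrite ler_pXn2r ?nnegrE// ltW.
  by move: h h1 h2; rewrite !exprMn; lra.
have E1 : U1 ^+ 2 + U2 ^+ 2 <= L * s.
  by rewrite /L mulrAC ler_pdivlMr ?mulr_gt0//; move: u1 u2; lra.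
apply: le_trans E1 _; rewrite (mulrC (4 * Ct)) -[leRHS]mulrA; apply: ler_wpM2l; first exact: ltW.
have sE : s = 2 * B ^+ 2 + 4 * Y * c by rewrite /s; move: id; lra.
(* Enlarging [s] by [Ct / Y], which is at least 1, turns the factor [4 * Y] of the area, dependent
   on the face, into [4 * Ct]. *)
have a1 : s <= Ct / Y * s.
  by rewrite ler_peMl// ler_pdivlMr// mul1r.
have a2 : Ct / Y * B ^+ 2 <= Ct / y * B ^+ 2.
  apply: ler_wpM2r; first exact: sqr_ge0.
  by apply: ler_wpM2l; [exact: ltW|rewrite lef_pV2 ?posrE].
have a3 : 4 * Ct * c = Ct / Y * s - 2 * (Ct / Y * B ^+ 2).
  by rewrite sE; field; exact: lt0r_neq0.
have a4 : 4 * Ct * (1 / (2 * y) * B ^+ 2) = 2 * (Ct / y * B ^+ 2) by field; exact: lt0r_neq0.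
by rewrite mulrDr a3 a4; move: a1 a2; lra.
Qed.

Variables (v1 v2 v3 : 'I_(nV X)) (zeta : R) (phi : 'I_(nV X) -> pt -> R[i]^o).
Variables (Psi : pt -> R[i]^o) (Psiinv : R[i]^o -> pt).
Hypotheses (zeta0 : 0 < zeta) (zeta1 : zeta < 4^-1).
Hypothesis SA : standing_assumption X v1 v2 v3.
Hypothesis CH : forall i, is_chart X v1 v2 v3 zeta i (phi i).
Hypothesis PS : is_Psi X v1 v2 v3 zeta phi Psi Psiinv.
Hypothesis ES : forall j k, bedge (F j k) (F j (succ3 k)) ->
  exists c, forall t : R, in01 t -> mu c (Psi (ptj j (edgeb k t))) = 0.
Variable chart : 'I_(nF X) -> seq 'I_4 -> 'I_(nV X).
Hypothesis CA : chart_assignment X zeta chart.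

Definition sides (Phi : pt -> R[i]^o) := forall v w, bedge v w -> exists c, forall t : R, in01 t ->
  mu c (Psi (vlrp v w t)) = 0 /\ mu c (Phi (vlrp v w t)) = 0.

Section Fix.
Variables (Phi : pt -> R[i]^o) (q : nat) (K : R).
Hypotheses (FK : in_FK X v1 v2 v3 phi chart K q Phi) (SP : sides Phi).
Let u x : R[i] := Phi x - Psi x.

Lemma fk_pos j p : size p = q -> 0 < crs (inc1 j Phi p) (inc2 j Phi p).
Proof. by move=> hp; case: FK => _ _ h _ _; have := h j p hp; rewrite subfaceE. Qed.
Lemma fk_T x : surf X x -> Tri (Phi x).
Proof. by case: FK => _ [g hg] _ _ _; exact: (homeo_T hg). Qed.

(** On a boundary edge the image stays on a line, so by [line_sum] the edge sum is the cross product
    of its end values. The difference of the two therefore cancels over the surface, and what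
    remains involves original vertices only, whence a bound independent of [q]. *)
Lemma area_bound : \sum_(j < nF X) \sum_(p <- paths q) crs (inc1 j Phi p) (inc2 j Phi p) <= (nF X)%:R * 3.
Proof.
pose h x y := crs (Phi x) (Phi y).
have ha : antisym h by move=> x y; exact: crsC.
have -> : \sum_(j < nF X) \sum_(p <- paths q) crs (inc1 j Phi p) (inc2 j Phi p) =
    \sum_(j < nF X) \sum_(p <- paths q) circ (hj j h) p.
  by apply: eq_bigr => j _; apply: eq_bigr => p _; rewrite circ_crs.
rewrite (@sum_all R d X q h ha).
pose g v w := edge_sum q h (vlrp v w) - crs (Phi (P v)) (Phi (P w)).
have ga : antisym g.
  move=> v w; have e1 : edge_sum q h (vlrp w v) = - edge_sum q h (vlrp v w).
    by rewrite -edge_sum_rev//; congr edge_sum; apply/funext => t; exact: vlrp_rev.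
  have e2 : crs (Phi (P w)) (Phi (P v)) = - crs (Phi (P v)) (Phi (P w)) := crsC _ _.
  by rewrite /g e1 e2; ring.
have g0 v w : bedge v w -> g v w = 0.
  move=> vw; have [c hc] := SP vw; apply/eqP; rewrite /g subr_eq0; apply/eqP.
  have n0 : 0 < (2 ^ q)%:R :> R by rewrite ltr0n expn_gt0.
  rewrite /edge_sum /h (@line_sum R (fun i : nat => Phi (vlrp v w (i%:R / (2 ^ q)%:R))) c).
    by rewrite mul0r divff ?gt_eqF// /vlrp subr0 subrr !scale1r !scale0r addr0 add0r.
  by move=> i hi; apply: (proj2 (hc _ _)); rewrite /in01 divr_ge0 ?ler0n//= ler_pdivrMr// mul1r ler_nat.
have := global_cancel TD ga g0; rewrite /g.
under eq_bigr do rewrite sumrB.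
rewrite sumrB => /eqP; rewrite subr_eq0 => /eqP ->.
apply: (@le_trans _ _ (\sum_(j < nF X) 3)); last by rewrite sumr_const card_ord -[_ *+ nF X]mulr_natl.
apply: ler_sum => j _; apply: (@le_trans _ _ (\sum_(k < 3) 1)).
  apply: ler_sum => k _; apply: le_trans (ler_norm _) _; apply: le_trans (crs_le _ _) _.
  by rewrite -[leRHS]mulr1; apply: ler_pM; try exact: cn_ge0; apply: Tri_cn; apply: fk_T; exact: surfV.
by rewrite sumr_const card_ord.
Qed.

(* The areas of u cancel over the whole surface, and inside the stars the area of
   Phi is positive. *)
Lemma cross_bound H n (B : R) : q = (H + n)%N -> (0 < H)%N ->
  (forall j k, `|ledge n (hj j (star_form Psi u (F j k))) (cor H k (bv R (succ3 k))) (cor H k (bv R (succ3 (succ3 k))))| <= B) ->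
  \sum_(j < nF X) \sum_(p <- paths q | ncor H p) crs (inc1 j u p) (inc2 j u p) <= (nF X)%:R * (3 * B).
Proof.
move=> qE H0 hB; pose h x y := crs (u x) (u y).
have ha : antisym h by move=> x y; exact: crsC.
have uline v w c : (forall t : R, in01 t -> mu c (Psi (vlrp v w t)) = 0 /\ mu c (Phi (vlrp v w t)) = 0) ->
    forall t, in01 t -> muL c (u (vlrp v w t)) = 0.
  by move=> hc t ht; have [e1 e2] := hc t ht; rewrite /u -mu_sub e1 e2 subrr.
have S0 : \sum_(j < nF X) \sum_(p <- paths q) circ (hj j h) p = 0.
  apply: (@sum_all0 R d X TD q h ha) => v w vw; have [c hc] := SP vw.
  rewrite /edge_sum; apply: big1 => i _; have [h1 h2] := lat01 R i.
  by apply: (@muL_crs R c); exact: (uline v w).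
have hcE j k p : size p = q -> - circ (hj j h) p <= circ (hj j (star_form Psi u (F j k))) p.
  move=> hp; rewrite -subr_ge0 opprK.
  have -> : circ (hj j (star_form Psi u (F j k))) p + circ (hj j h) p = circ (hj j (fun x y =>
     crs (Phi x - Psi (P (F j k))) (Phi y - Psi (P (F j k))))) p.
    rewrite /circ -big_split; apply: eq_bigr => l _; rewrite /hj /star_form /h /u /crs.
    by rewrite !(ReD, ImD, ReN, ImN) /=; ring.
  rewrite (circ_crs j (fun x => Phi x - Psi (P (F j k)))) /inc1 /inc2.
  by rewrite !opprB !addrA !subrK; apply: ltW; exact: (fk_pos j hp).
have e j : \sum_(p <- paths q | ncor H p) crs (inc1 j u p) (inc2 j u p) =
   \sum_(p <- paths q) circ (hj j h) p - \sum_(k < 3) \sum_(p <- paths n) circ (hj j h) (nseq H (cc k) ++ p).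
  rewrite qE (sum_split_corners n (fun p => circ (hj j h) p) H0) addrK.
  by apply: eq_bigr => p _; rewrite circ_crs.
under eq_bigr do rewrite e.
rewrite sumrB S0 sub0r.
apply: (@le_trans _ _ (\sum_(j < nF X) \sum_(k < 3) \sum_(p <- paths n) circ (hj j (star_form Psi u (F j k))) (nseq H (cc k) ++ p))).
  rewrite -sumrN; apply: ler_sum => j _; rewrite -sumrN; apply: ler_sum => k _; rewrite -sumrN.
  rewrite big_seq [leRHS]big_seq; apply: ler_sum => p; rewrite mem_paths => /eqP hp.
  by apply: hcE; rewrite size_cat size_nseq hp qE.
rewrite (sum_corners TD H n (h := fun v => star_form Psi u v)).
- apply: (@le_trans _ _ (\sum_(j < nF X) (3 * B))); last by rewrite sumr_const card_ord -[_ *+ nF X]mulr_natl.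
  apply: ler_sum => j _; apply: (@le_trans _ _ (\sum_(k < 3) B)).
    by apply: ler_sum => k _; apply: le_trans (ler_norm _) _; exact: hB.
  by rewrite sumr_const card_ord -[B *+ 3]mulr_natl.
- by move=> v; exact: star_form_anti.
move=> v w vw a av s t hs ht; have [c hc] := SP vw.
have cW r : in01 r -> muL c (Psi (vlrp v w r) - Psi (P a)) = 0.
  move=> hr; rewrite -mu_sub (proj1 (hc _ hr)) sub0r; apply/eqP; rewrite oppr_eq0; apply/eqP.
  case: av => ->.
    by have [] := hc 0; rewrite ?/in01 ?lexx ?ler01// /vlrp subr0 scale1r scale0r addr0.
  by have [] := hc 1; rewrite ?/in01 ?lexx ?ler01// /vlrp subrr scale1r scale0r add0r.
have cu := uline v w c hc.
by rewrite /star_form !(@muL_crs R c) ?addr0//; first [exact: cW|exact: cu].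
Qed.
End Fix.

(** The areas of [u], [dbar] of [Phi] and [dbar] of [Psi] contribute [e / 3] each. The oscillation
    of [Psi] fixes [H], and [N] is chosen afterwards. *)
Lemma energy_small (e : R) H0 : 0 < e -> exists H, (H0 <= H)%N /\ exists N, forall q (K : R) (Phi : pt -> R[i]^o),
  (N <= q)%N -> K - 1 <= N.+1%:R^-1 -> (2 <= q)%N -> in_FK X v1 v2 v3 phi chart K q Phi -> sides Phi ->
  \sum_(j < nF X) \sum_(p <- paths q | ncor H p) ener j (fun x => Phi x - Psi x) p <= e.
Proof.
move=> e0; have [G [KK [G0 K0 HG]]] := ener_bound.
have [C C0 [N1 HC]] := chord_bound TD zeta0 zeta1 SA CH PS ES.
pose f : R := (nF X).+1%:R; have f0 : 0 < f by rewrite ltr0n.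
have nf : (nF X)%:R <= f by rewrite ler_nat.
pose e1 := e / (3 * G); have e10 : 0 < e1 by apply: divr_gt0 => //; exact: mulr_gt0.
pose M := Num.min 2 (e1 / (f * (3 * C))).
have f3C : 0 < f * (3 * C) by apply: mulr_gt0 => //; exact: mulr_gt0.
have M0 : 0 < M by rewrite lt_min ltr0n divr_gt0.
have M2 : M <= 2 by rewrite ge_min lexx.
have MC : f * (3 * (C * M)) <= e1.
  rewrite (_ : f * (3 * (C * M)) = M * (f * (3 * C))); last by ring.
  by rewrite -ler_pdivlMr// ge_min lexx orbT.
have [H1 HM] := psi_osc TD PS M0.
(* The strict inequality pays for the factor 2 in [chord_bound], which asks for the oscillation on a
   star twice as large. *)
have [H [hH0 hH1]] : exists H, (H0 <= H)%N /\ (H1 < H)%N.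
  by exists (H0 + H1.+1)%N; rewrite leq_addr leq_addl.
exists H; split => //.
pose e2 := e1 / (2 * KK * (f * 3)).
have f3 : 0 < f * 3 by exact: mulr_gt0.
have e20 : 0 < e2 by apply: divr_gt0 => //; apply: mulr_gt0 => //; exact: mulr_gt0.
have [N2 HN2] := phi_dbar TD SA CH H CA e20.
have [C3 [N3 HN3]] := psi_dbar TD zeta0 zeta1 SA CH PS ES H.
have [N4 HN4] := small_pow (2 * KK * (f * C3 ^+ 2)) e10.
exists (H + N1 + N2 + N3 + N4)%N => q K Phi hq hK q2 FK SP.
have [l1 l2 l3 l4] : [/\ (H + N1 <= q)%N, (N2 <= q)%N, (N3 <= q)%N & (N4 <= q)%N].
  by move: hq; clear; split; lia.
have {}hK : K - 1 <= N2.+1%:R^-1.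
  apply: le_trans hK _; rewrite lef_pV2 ?posrE ?ltr0n// ler_nat.
  by clear; lia.
have qE : q = (H + (q - H))%N by rewrite subnKC//; apply: leq_trans l1; exact: leq_addr.
have Hp : (0 < H)%N := leq_ltn_trans (leq0n _) hH1.
pose u x : R[i] := Phi x - Psi x.
have S1 : \sum_(j < nF X) \sum_(p <- paths q | ncor H p) crs (inc1 j u p) (inc2 j u p) <= e1.
  apply: le_trans (cross_bound FK SP qE Hp (B := C * M) _) _.
    move=> j k; apply: HC => //; first by rewrite leq_subRL// (leq_trans (leq_addr N1 H) l1).
    - exact: ltW.
    - move=> x hx; apply: le_trans (cnB _ _) _; rewrite -[leRHS]/(1 + 1 : R); apply: lerD; apply: Tri_cn.
        exact: (fk_T FK).
      exact: (homeo_T (Psi_homeo PS)).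
    move=> x hx hh; apply: HM => //; apply: le_trans hh; rewrite lerD2l lerN2.
    apply: (@le_trans _ _ (2 * 2 ^- H1.+1)); last by rewrite exprS invfM mulrA divff ?pnatr_eq0// mul1r.
    by apply: ler_wpM2l => //; rewrite lef_pV2 ?posrE ?exprn_gt0// ler_weXn2l ?ler1n.
  apply: le_trans MC; apply: ler_wpM2r => //.
  by apply: mulr_ge0 => //; apply: mulr_ge0; exact: ltW.
have S2 : \sum_(j < nF X) \sum_(p <- paths q | ncor H p) cn (dbarF j Phi p) ^+ 2 <= e1 / (2 * KK).
  apply: (@le_trans _ _ (\sum_(j < nF X) \sum_(p <- paths q) e2 * crs (inc1 j Phi p) (inc2 j Phi p))).
    apply: ler_sum => j _; rewrite big_mkcond big_seq [leRHS]big_seq /=; apply: ler_sum => p.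
    rewrite mem_paths => /eqP hp; case: ifP => hc; first exact: (HN2 q K Phi).
    by apply: mulr_ge0; apply: ltW => //; exact: (fk_pos FK).
  under eq_bigr do rewrite -mulr_sumr.
  rewrite -mulr_sumr; apply: (@le_trans _ _ (e2 * (f * 3))).
    apply: ler_wpM2l; first exact: ltW.
    by apply: le_trans (area_bound FK SP) _; apply: ler_wpM2r.
  by rewrite /e2 le_eqVlt; apply/orP; left; apply/eqP; field; rewrite !gt_eqF.
have S3 : \sum_(j < nF X) \sum_(p <- paths q | ncor H p) cn (dbarF j Psi p) ^+ 2 <= e1 / (2 * KK).
  have a0 : 0 <= (C3 * (2 ^- q) ^+ 2) ^+ 2 :> R by exact: sqr_ge0.
  apply: (@le_trans _ _ (\sum_(j < nF X) \sum_(p <- paths q) (C3 * (2 ^- q) ^+ 2) ^+ 2)).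
    apply: ler_sum => j _; rewrite big_mkcond big_seq [leRHS]big_seq /=; apply: ler_sum => p.
    rewrite mem_paths => /eqP hp; case: ifP => hc //.
    have h : cn (dbarF j Psi p) <= C3 * (2 ^- q) ^+ 2 by rewrite -hp; apply: HN3 => //; rewrite hp.
    by rewrite ler_pXn2r ?nnegrE ?cn_ge0//; apply: le_trans h; exact: cn_ge0.
  rewrite sumr_const card_ord big_const_seq count_predT size_paths iter_addr_0.
  rewrite -[_ *+ nF X]mulr_natl -[_ *+ (4 ^ q)]mulr_natl.
  (* There are [4 ^ q] triangles in a face, and each contributes at most [C3 ^+ 2] divided by
     [16 ^ q]. *)
  have E : (4 ^ q)%:R * (C3 * (2 ^- q) ^+ 2) ^+ 2 = C3 ^+ 2 / 2 ^+ q / 2 ^+ q.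
    rewrite natrX -[4%:R]/((2 * 2)%:R) natrM exprMn; field.
    by rewrite expf_neq0// pnatr_eq0.
  rewrite E.
  have b1 : 0 <= C3 ^+ 2 / 2 ^+ q by apply: divr_ge0; [exact: sqr_ge0|exact: exprn_ge0].
  apply: (@le_trans _ _ (f * (C3 ^+ 2 / 2 ^+ q))).
    apply: ler_pM => //; first by apply: divr_ge0 => //; exact: exprn_ge0.
    by rewrite ler_pdivrMr ?exprn_gt0// ler_peMr// exprn_ege1// ler1n.
  rewrite ler_pdivlMr ?mulr_gt0//; have := ltW (HN4 q l4); apply: le_trans.
  by rewrite le_eqVlt; apply/orP; left; apply/eqP; field; rewrite expf_neq0// pnatr_eq0.
have D j p : dbarF j u p = dbarF j Phi p - dbarF j Psi p by rewrite /dbarF /dbar /u; ring.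
apply: (@le_trans _ _ (\sum_(j < nF X) \sum_(p <- paths q | ncor H p)
   (G * (2 * KK) * cn (dbarF j Phi p) ^+ 2 + G * (2 * KK) * cn (dbarF j Psi p) ^+ 2 + G * crs (inc1 j u p) (inc2 j u p)))).
  apply: ler_sum => j _; apply: ler_sum => p _; apply: le_trans (HG j _ p) _.
  have h : cn (dbarF j u p) ^+ 2 <= 2 * cn (dbarF j Phi p) ^+ 2 + 2 * cn (dbarF j Psi p) ^+ 2.
    rewrite D; have h1 := cnB (dbarF j Phi p) (dbarF j Psi p).
    have h0 := cn_ge0 (dbarF j Phi p - dbarF j Psi p).
    have : cn (dbarF j Phi p - dbarF j Psi p) ^+ 2 <= (cn (dbarF j Phi p) + cn (dbarF j Psi p)) ^+ 2.
      by rewrite ler_pXn2r ?nnegrE//; apply: le_trans h1.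
    have := sqr_ge0 (cn (dbarF j Phi p) - cn (dbarF j Psi p)); rewrite !expr2; lra.
  have {}h : G * (KK * cn (dbarF j u p) ^+ 2) <= G * (KK * (2 * cn (dbarF j Phi p) ^+ 2 + 2 * cn (dbarF j Psi p) ^+ 2)).
    by apply: ler_wpM2l; [exact: ltW|apply: ler_wpM2l => //; exact: ltW].
  by rewrite mulrDr -/u; move: h; lra.
under eq_bigr do rewrite !big_split /= -!mulr_sumr.
rewrite !big_split /= -!mulr_sumr.
have GK : 0 < G * (2 * KK) by apply: mulr_gt0 => //; exact: mulr_gt0.
have r1 := ler_wpM2l (ltW GK) S2; have r2 := ler_wpM2l (ltW GK) S3; have r3 := ler_wpM2l (ltW G0) S1.
have E1 : G * (2 * KK) * (e1 / (2 * KK)) = e / 3 by rewrite /e1; field; rewrite !gt_eqF.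
have E2 : G * e1 = e / 3 by rewrite /e1; field; rewrite !gt_eqF.
by rewrite E1 in r1 r2; rewrite E2 in r3; move: r1 r2 r3; lra.
Qed.
End EnergyBound.

(** * Good chords and convergence *)

Section Rows.
Variables (R : realType) (d : nat) (X : TriSurf R d).
Local Notation P := (@pos _ _ X).
Local Notation F := (@face _ _ X).
Local Notation pt := 'rV[R]_d.
Implicit Types (j : 'I_(nF X)) (k m c : 'I_3) (v w : 'I_(nV X)) (b : 'rV[R]_3) (x : pt) (p : seq 'I_4).
Hypothesis TD : triangulated_disk X.

(** The lattice points of a chord on which the coordinate at [k] is constant; [l] counts from the
    edge between [k] and [succ3 k]. *)
Definition rowx (n : nat) k (i l : nat) m : nat :=
  if m == k then i else if m == succ3 k then (n - i - l)%N else l.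
Definition rowb q k (i l : nat) : 'rV[R]_3 := latp R (2 ^ q) (rowx (2 ^ q) k i l).

Lemma rowb_coord q k i l : [/\ rowb q k i l 0 k = i%:R / (2 ^ q)%:R,
  rowb q k i l 0 (succ3 k) = (2 ^ q - i - l)%:R / (2 ^ q)%:R &
  rowb q k i l 0 (succ3 (succ3 k)) = l%:R / (2 ^ q)%:R].
Proof.
by rewrite !mxE /rowx eqxx succ3_neq eqxx succ3_neq2 succ3_neq.
Qed.

Lemma rowb_isb q k i l : (i + l <= 2 ^ q)%N -> isb (rowb q k i l).
Proof.
move=> h; have [e1 e2 e3] := rowb_coord q k i l; split=> [m|].
  by rewrite mxE divr_ge0.
rewrite (sum3 k) e1 e2 e3 -!mulrDl -!natrD.
have -> : (i + (2 ^ q - i - l) + l = 2 ^ q)%N by lia.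
by rewrite divff// pow2_neq0.
Qed.

Lemma row_edge q k i l : (i + l < 2 ^ q)%N -> exists2 p, size p = q &
  tri R p (succ3 k) = rowb q k i l /\ tri R p (succ3 (succ3 k)) = rowb q k i l.+1.
Proof.
move=> h; pose x m := if m == k then i else if m == succ3 k then (2 ^ q - i - l.+1)%N else l.
have [|p ps hp] := (lat_tri R q x).1.
  by rewrite (sum3 k) /x eqxx succ3_neq eqxx succ3_neq2 succ3_neq; lia.
exists p => //; rewrite !hp; split; apply/rowP => m; rewrite !mxE; congr (_%:R / _); rewrite /x /rowx.
  case: (ord3_cases k m) => ->.
  - by rewrite eqxx (eq_sym k) succ3_neq addn0.
  - by rewrite succ3_neq eqxx; lia.
  - by rewrite succ3_neq2 succ3_neq addn0.
case: (ord3_cases k m) => ->.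
- by rewrite eqxx (eq_sym k) succ3_neq2 addn0.
- by rewrite succ3_neq eqxx (eq_sym (succ3 k)) succ3_neq addn0; lia.
- by rewrite succ3_neq2 succ3_neq eqxx addn1.
Qed.

Lemma ener_pair j (f : pt -> R[i]) p k :
  cn (f (ptj j (tri R p (succ3 (succ3 k)))) - f (ptj j (tri R p (succ3 k)))) ^+ 2 <= 2 * ener j f p.
Proof.
rewrite /ener; set A := inc1 j f p; set B := inc2 j f p.
have hA := sqr_ge0 (cn A); have hB := sqr_ge0 (cn B).
case: (ord3P k) => ->; rewrite !succ3E.
- have -> : f (ptj j (tri R p 2)) - f (ptj j (tri R p 1)) = B - A by rewrite /A /B /inc1 /inc2; ring.
  have h1 := cnB B A; have h0 := cn_ge0 (B - A).
  have : cn (B - A) ^+ 2 <= (cn B + cn A) ^+ 2 by rewrite ler_pXn2r ?nnegrE//; exact: le_trans h1.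
  by have := sqr_ge0 (cn A - cn B); rewrite !expr2; lra.
- by rewrite cnC -/B; lra.
- by rewrite -/A; lra.
Qed.

Lemma ncorPn H p : ~~ ncor H p -> exists k, forall l, 1 - 2 ^- H <= tri R p l 0 k.
Proof.
move=> /forallPn[k]; rewrite negbK => /eqP E; exists k => l.
rewrite -(cat_take_drop H p) E tri_corner /cor !mxE eqxx.
have : 0 <= 2 ^- H * tri R (drop H p) l 0 k.
  by apply: mulr_ge0; [rewrite invr_ge0 exprn_ge0|exact: (tri_isb R (drop H p) l).1].
by rewrite mulr1n; lra.
Qed.

Definition rowE q j k (f : pt -> R[i]) (i : nat) : R :=
  \sum_(l < 2 ^ q | (i + l < 2 ^ q)%N)
    cn (f (ptj j (rowb q k i l.+1)) - f (ptj j (rowb q k i l))) ^+ 2.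

(** Each step of a row is a side of a small triangle oriented like the face, distinct steps give
    distinct triangles, and rows between [r] and [1 - r] avoid the corners. *)
Lemma rows_energy q j k (f : pt -> R[i]) H (r : R) (a m : nat) : 2 ^- H < r ->
  (forall t, (t < m)%N -> r <= (a + t)%:R / (2 ^ q)%:R <= 1 - r) ->
  \sum_(t < m) rowE q j k f (a + t) <= 2 * \sum_(p <- paths q | ncor H p) ener j f p.
Proof.
move=> Hr hw; have n0 : 0 < (2 ^ q)%:R :> R by rewrite ltr0n expn_gt0.
have ex (tl : 'I_m * 'I_(2 ^ q)) : exists p, (a + tl.1 + tl.2 < 2 ^ q)%N -> [/\ size p = q,
    tri R p (succ3 k) = rowb q k (a + tl.1) tl.2 &
    tri R p (succ3 (succ3 k)) = rowb q k (a + tl.1) tl.2.+1].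
  have [h|h] := ltnP (a + tl.1 + tl.2) (2 ^ q); last by exists [::].
  by have [p h1 [h2 h3]] := row_edge k h; exists p.
have [pf hpf] := choice ex.
pose s := [seq tl : 'I_m * 'I_(2 ^ q) <- enum {: 'I_m * 'I_(2 ^ q)} | (a + tl.1 + tl.2 < 2 ^ q)%N].
pose g p : R := if ncor H p then ener j f p else 0.
have sP (tl : 'I_m * 'I_(2 ^ q)) : tl \in s -> (a + tl.1 + tl.2 < 2 ^ q)%N by rewrite mem_filter => /andP[].
(* In the corner of [c] the coordinate at [c] exceeds [1 - r]. The one at [k] lies between [r] and
   [1 - r], which rules out [c = k] and leaves too little for any other [c]. *)
have nc (tl : 'I_m * 'I_(2 ^ q)) : tl \in s -> ncor H (pf tl).
  move=> /sP h; apply/negPn/negP => /ncorPn[c hc].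
  have [_ e1 _] := hpf _ h; have := hc (succ3 k); rewrite e1.
  have /andP[w1 w2] := hw tl.1 (ltn_ord _).
  have [c1 c2 c3] := rowb_coord q k (a + tl.1) tl.2.
  have [hb hs] := @rowb_isb q k (a + tl.1) tl.2 (ltnW h); rewrite (sum3 k) in hs.
  have := hb (succ3 k); have := hb (succ3 (succ3 k)).
  by case: (ord3_cases k c) => ->; move: hs w1 w2 Hr; rewrite -c1; lra.
have -> : \sum_(t < m) rowE q j k f (a + t) = \sum_(tl <- s)
    cn (f (ptj j (rowb q k (a + tl.1) tl.2.+1)) - f (ptj j (rowb q k (a + tl.1) tl.2))) ^+ 2.
  rewrite /rowE pair_big_dep /s big_filter big_enum_cond /=.
  by apply: eq_bigl => -[t l] //=; rewrite ?inE ?andbT.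
apply: (@le_trans _ _ (\sum_(tl <- s) 2 * g (pf tl))).
  rewrite big_seq [leRHS]big_seq; apply: ler_sum => tl hs; have [_ e1 e2] := hpf _ (sP _ hs).
  by rewrite /g nc// -e1 -e2; exact: ener_pair.
rewrite -mulr_sumr; apply: ler_wpM2l => //.
rewrite [leRHS]big_mkcond /=; apply: (sum_map_le (f := g)).
- by rewrite filter_uniq// enum_uniq.
- move=> [t l] [t' l'] h h' E; have [_ e1 _] := hpf _ (sP _ h); have [_ e1' _] := hpf _ (sP _ h').
  have EE : rowb q k (a + t) l = rowb q k (a + t') l' by rewrite /= in e1 e1'; rewrite -e1 -e1' E.
  have [c1 _ c3] := rowb_coord q k (a + t) l; have [c1' _ c3'] := rowb_coord q k (a + t') l'.
  move: c1 c3; rewrite EE c1' c3' => /(divIf (lt0r_neq0 n0)) /eqP; rewrite eqr_nat eqn_add2l => /eqP h1.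
  move=> /(divIf (lt0r_neq0 n0)) /eqP; rewrite eqr_nat => /eqP h2.
  by congr (_, _); apply/val_inj.
- by move=> tl hs; rewrite mem_paths; have [-> _ _] := hpf _ (sP _ hs).
- exact: uniq_paths.
- by move=> p _; rewrite /g /ener; case: ifP => // _; apply: addr_ge0; exact: sqr_ge0.
Qed.

(** The Cauchy-Schwarz inequality over at most [2 ^ q] steps, in the form [d <= tau + d ^+ 2 / tau]
    with [tau] proportional to [2 ^- q]. *)
Lemma row_osc q j k (f : pt -> R[i]) i (e : R) : 0 < e -> (2 ^ q)%:R * rowE q j k f i <= e ^+ 2 / 4 ->
  forall l, (i + l <= 2 ^ q)%N -> cn (f (ptj j (rowb q k i l)) - f (ptj j (rowb q k i 0))) <= e.
Proof.
move=> e0 hE l hl; have n0 : 0 < (2 ^ q)%:R :> R by rewrite ltr0n expn_gt0.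
pose dl (t : nat) := cn (f (ptj j (rowb q k i t.+1)) - f (ptj j (rowb q k i t))).
have tele t : cn (f (ptj j (rowb q k i t)) - f (ptj j (rowb q k i 0))) <= \sum_(s < t) dl s.
  elim: t => [|t IH]; first by rewrite subrr cn0 big_ord0.
  rewrite big_ord_recr /= addrC; apply: le_trans (cn_tri (f (ptj j (rowb q k i t))) _ _) _.
  by apply: lerD.
apply: le_trans (tele l) _.
pose tau := e / (2 * (2 ^ q)%:R); have tau0 : 0 < tau by apply: divr_gt0 => //; exact: mulr_gt0.
have pt1 t : dl t <= tau + dl t ^+ 2 / tau.
  have d0 : 0 <= dl t := cn_ge0 _.
  have [h|h] := leP (dl t) tau; first by apply: le_trans h _; rewrite lerDl divr_ge0 ?sqr_ge0// ltW.
  apply: (@le_trans _ _ (dl t ^+ 2 / tau)); last by rewrite lerDr ltW.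
  by rewrite ler_pdivlMr// expr2; apply: ler_wpM2l => //; exact: ltW.
apply: (@le_trans _ _ (\sum_(s < l) (tau + dl s ^+ 2 / tau))); first by apply: ler_sum => s _; exact: pt1.
rewrite big_split /= sumr_const card_ord -mulr_suml.
have h1 : tau *+ l <= e / 2.
  rewrite -[_ *+ l]mulr_natl (_ : e / 2 = (2 ^ q)%:R * tau); last by rewrite /tau; field; exact: lt0r_neq0.
  by apply: ler_wpM2r; [exact: ltW|rewrite ler_nat; lia].
have h2 : \sum_(s < l) dl s ^+ 2 <= rowE q j k f i.
  have hl' : (l <= 2 ^ q)%N by lia.
  rewrite /rowE (big_ord_widen_cond (2 ^ q) xpredT (fun s : nat => dl s ^+ 2) hl') /=.
  rewrite big_mkcond [leRHS]big_mkcond /=; apply: ler_sum => s _.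
  case: ifP => h; case: ifP => h' //; first by move: h h'; lia.
  exact: sqr_ge0.
have h3 : rowE q j k f i / tau <= e / 2.
  rewrite ler_pdivrMr// /tau.
  have -> : e / 2 * (e / (2 * (2 ^ q)%:R)) = e ^+ 2 / 4 / (2 ^ q)%:R by field; exact: lt0r_neq0.
  by rewrite ler_pdivlMr// mulrC.
have h4 : (\sum_(s < l) dl s ^+ 2) / tau <= rowE q j k f i / tau.
  by apply: ler_wpM2r => //; rewrite invr_ge0 ltW.
by move: h1 h3 h4; lra.
Qed.

Lemma good_row q (f : pt -> R[i]) H (r s e : R) v : 0 < r -> 2 ^- H < r -> 4 <= r * (2 ^ q)%:R ->
  r <= s -> s <= 1 - 2 * r -> 0 < e ->
  \sum_(j < nF X) \sum_(p <- paths q | ncor H p) ener j f p <= e ^+ 2 * r / 96 ->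
  exists i : nat, s <= i%:R / (2 ^ q)%:R <= s + r /\ forall j k, F j k = v ->
    forall l, (i + l <= 2 ^ q)%N -> cn (f (ptj j (rowb q k i l)) - f (ptj j (rowb q k i 0))) <= e.
Proof.
move=> r0 Hr hq rs s1 e0 hE; have n0 : 0 < (2 ^ q)%:R :> R by rewrite ltr0n expn_gt0.
set n : R := (2 ^ q)%:R in hq n0 *.
pose a := (Num.trunc (s * n)).+1; pose m := Num.trunc (r * n / 2).
have sn0 : 0 <= s * n by apply: mulr_ge0; [lra|exact: ltW].
have rn0 : 0 <= r * n / 2 by lra.
have a1 : s * n <= a%:R by apply/ltW; exact: truncnS_gt.
have a2 : a%:R <= s * n + 1 by rewrite /a -natr1 lerD2r truncn_le.
have m1 : m%:R <= r * n / 2 by rewrite truncn_le.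
have m2 : r * n / 4 <= m%:R.
  have : r * n / 2 < m.+1%:R by exact: truncnS_gt.
  by rewrite -[m.+1%:R]natr1; lra.
have m0 : 0 < m%:R :> R by lra.
have win t : (t < m)%N -> s <= (a + t)%:R / n <= s + r.
  move=> tm; have tm' : t%:R + 1 <= m%:R :> R by rewrite natr1 ler_nat.
  have t0 : 0 <= t%:R :> R by rewrite ler0n.
  by rewrite ler_pdivlMr// ler_pdivrMr// natrD; apply/andP; split; lra.
pose RE (t : nat) := \sum_(j < nF X) \sum_(k < 3 | F j k == v) rowE q j k f (a + t).
have RE0 j k t : 0 <= rowE q j k f t by apply: sumr_ge0 => l _; exact: sqr_ge0.
have tot : \sum_(t < m) RE t <= 6 * (e ^+ 2 * r / 96).
  apply: (@le_trans _ _ (\sum_(j < nF X) \sum_(k < 3) \sum_(t < m) rowE q j k f (a + t))).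
    rewrite /RE exchange_big /=; apply: ler_sum => j _.
    rewrite exchange_big big_mkcond /=; apply: ler_sum => k _; case: ifP => // _.
    by apply: sumr_ge0.
  apply: (@le_trans _ _ (\sum_(j < nF X) 6 * \sum_(p <- paths q | ncor H p) ener j f p)); last first.
    by rewrite -mulr_sumr; apply: ler_wpM2l.
  apply: ler_sum => j _.
  have : \sum_(k < 3) \sum_(t < m) rowE q j k f (a + t) <= \sum_(k < 3) 2 * \sum_(p <- paths q | ncor H p) ener j f p.
    apply: ler_sum => k _; apply: (@rows_energy q j k f H r a m Hr) => t /win /andP[w1 w2].
    by apply/andP; split; lra.
  by rewrite (sum3 0 (fun=> 2 * _)); lra.
have [t ht] : exists t : 'I_m, m%:R * RE t <= 6 * (e ^+ 2 * r / 96).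
  apply: contrapT => /forallNP h; move: tot; apply/negP; rewrite -ltNge.
  have mpos : (0 < m)%N by rewrite -(ltr0n R).
  rewrite -(ltr_pM2l m0) mulr_sumr.
  apply: (@le_lt_trans _ _ (\sum_(t < m) 6 * (e ^+ 2 * r / 96))); first by rewrite le_eqVlt sumr_const card_ord; apply/orP; left; apply/eqP; exact: mulr_natl.
  apply: ltr_sum; first by apply/hasP; exists (Ordinal mpos) => //; rewrite mem_index_enum.
  by move=> t _; rewrite ltNge; apply/negP; exact: h.
exists (a + t)%N; split; first exact: win.
move=> j k jk l hl; apply: row_osc => //.
have le1 : rowE q j k f (a + t) <= RE t.
  rewrite /RE (bigD1 j)//= (bigD1 k) ?jk//= -addrA lerDl; apply: addr_ge0.
    by apply: sumr_ge0 => ? _.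
  by apply: sumr_ge0 => ? _; apply: sumr_ge0 => ? _.
have h1 : r * n / 4 * RE t <= m%:R * RE t.
  by apply: ler_wpM2r => //; apply: le_trans le1.
have h2 : n * rowE q j k f (a + t) <= n * RE t by apply: ler_wpM2l => //; exact: ltW.
rewrite -/n; apply: le_trans h2 _; rewrite -(ler_pM2l (_ : 0 < r / 4)); last by rewrite divr_gt0.
by move: h1 ht; lra.
Qed.
End Rows.

(** * Connectedness of the dual graph *)

Section DualGraph.
Variables (R : realType) (d : nat) (X : TriSurf R d).
Local Notation P := (@pos _ _ X).
Local Notation F := (@face _ _ X).
Local Notation pt := 'rV[R]_d.
Implicit Types (j : 'I_(nF X)) (k m c : 'I_3) (v w : 'I_(nV X)) (x : pt).
Hypothesis TD : triangulated_disk X.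
Variables (v1 v2 v3 : 'I_(nV X)) (zeta : R) (phi : 'I_(nV X) -> pt -> R[i]^o).
Variables (Psi : pt -> R[i]^o) (Psiinv : R[i]^o -> pt).
Hypotheses (zeta0 : 0 < zeta) (zeta1 : zeta < 4^-1).
Hypothesis SA : standing_assumption X v1 v2 v3.
Hypothesis CH : forall i, is_chart X v1 v2 v3 zeta i (phi i).
Hypothesis PS : is_Psi X v1 v2 v3 zeta phi Psi Psiinv.
Let HPsi := Psi_homeo PS.

Lemma scontD (f g : pt -> R) : scont X f -> scont X g -> scont X (fun x => f x + g x).
Proof.
move=> hf hg x sx e e0; have e2 : 0 < e / 2 by rewrite divr_gt0.
have [r1 r10 H1] := hf x sx _ e2; have [r2 r20 H2] := hg x sx _ e2.
exists (Num.min r1 r2); first by rewrite lt_min r10.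
move=> y sy hy.
have b1 : ball x r1 y by apply: le_ball hy; rewrite ge_min lexx.
have b2 : ball x r2 y by apply: le_ball hy; rewrite ge_min lexx orbT.
have := H1 y sy b1; have := H2 y sy b2 => h2 h1.
rewrite (_ : _ - _ = (f y - f x) + (g y - g x)); last by ring.
by apply: le_lt_trans (ler_normD _ _) _; lra.
Qed.
Lemma scontN (f : pt -> R) : scont X f -> scont X (fun x => - f x).
Proof.
move=> hf x sx e e0; have [r r0 H] := hf x sx e e0; exists r => // y sy hy.
by rewrite -opprD normrN; exact: H.
Qed.
Lemma scont_sum (I : Type) (s : seq I) (Q : pred I) (f : I -> pt -> R) : (forall i, scont X (f i)) ->
  scont X (fun x => \sum_(i <- s | Q i) f i x).
Proof.
move=> hf; elim: s => [|i s IH].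
  move=> x sx e e0; exists 1 => // y _ _; by rewrite !big_nil subrr normr0.
have h : scont X (fun x => (if Q i then f i x else 0) + \sum_(i <- s | Q i) f i x).
  apply: scontD => //; case: (Q i); first exact: hf.
  by move=> x sx e e0; exists 1 => // y _ _; rewrite subrr normr0.
by move=> x sx e e0; have [r r0 H] := h x sx e e0; exists r => // y sy hy;
   rewrite !big_cons; have := H y sy hy; case: (Q i) => //; rewrite !add0r.
Qed.
Lemma scont_hat2 v w : scont X (fun x => hat v x * hat w x).
Proof.
move=> x sx e e0; have e2 : 0 < e / 2 by rewrite divr_gt0.
have [r1 r10 H1] := scont_hat TD v sx e2; have [r2 r20 H2] := scont_hat TD w sx e2.
exists (Num.min r1 r2); first by rewrite lt_min r10.
move=> y sy hy.
have b1 : ball x r1 y by apply: le_ball hy; rewrite ge_min lexx.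
have b2 : ball x r2 y by apply: le_ball hy; rewrite ge_min lexx orbT.
have := H1 y sy b1; have := H2 y sy b2 => h2 h1.
rewrite (_ : _ - _ = (hat v y - hat v x) * hat w y + hat v x * (hat w y - hat w x)); last by ring.
apply: le_lt_trans (ler_normD _ _) _; rewrite !normrM.
have l1 : `|hat w y| <= 1 by rewrite ger0_norm ?hat_le1//; exact: hat_ge0.
have l2 : `|hat v x| <= 1 by rewrite ger0_norm ?hat_le1//; exact: hat_ge0.
have := ler_wpM2l (normr_ge0 (hat v y - hat v x)) l1; have := ler_wpM2r (normr_ge0 (hat w y - hat w x)) l2.
lra.
Qed.

Definition adj j j' : bool := [exists a, exists b, [&& a != b, F j a \in faceset j' & F j b \in faceset j']].
Lemma adjP j j' : adj j j' -> exists a b a' b', [/\ a != b, a' != b', F j a = F j' a' & F j b = F j' b'].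
Proof.
move=> /existsP[a /existsP[b /and3P[ab /mem_faceset[a' ha] /mem_faceset[b' hb]]]].
exists a, b, a', b'; split=> //; apply: contra ab => /eqP E.
by apply/eqP; apply: (face_inj TD (j := j)); rewrite ha hb E.
Qed.
Lemma adj_sym j j' : adj j j' -> adj j' j.
Proof.
move=> /adjP[a [b [a' [b' [ab ab' ha hb]]]]]; apply/existsP; exists a'; apply/existsP; exists b'.
by rewrite ab' -ha -hb; apply/andP; split=> //; apply/andP; split; apply/mem_faceset; [exists a|exists b].
Qed.

Lemma dual_connected j j' : connect adj j j'.
Proof.
apply/negPn/negP => nj.
(* gsum A is positive at the non-vertex points of the faces in A and vanishes on the
   faces that share no edge with them: a path in T that avoids the images of the
   vertices contradicts the intermediate value theorem. *)
pose gsum (A : pred 'I_(nF X)) x := \sum_(i | A i) \sum_(k < 3) hat (F i k) x * hat (F i (succ3 k)) x.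
have gsc A : scont X (gsum A).
  by apply: scont_sum => i; apply: scont_sum => k; exact: scont_hat2.
have gs0 A x : surf X x -> 0 <= gsum A x.
  by move=> sx; apply: sumr_ge0 => i _; apply: sumr_ge0 => k _; apply: mulr_ge0; exact: hat_ge0.
pose A i := connect adj j i; pose B i := ~~ connect adj j i.
have AB i i' : A i -> B i' -> ~~ adj i i'.
  by move=> hi; apply: contra => h; apply: connect_trans hi (connect1 h).
have vanish (Q : pred 'I_(nF X)) i b : (forall i', Q i' -> ~~ adj i' i) -> isb b -> gsum Q (ptj i b) = 0.
  move=> hQ hb; rewrite /gsum big1// => i' /hQ ni; rewrite big1// => k _.
  have [h1|h1] := boolP (F i' k \in faceset i); last by rewrite hat_pt0// mul0r.
  have [h2|h2] := boolP (F i' (succ3 k) \in faceset i); last by rewrite [X in _ * X]hat_pt0// mulr0.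
  case/negP: ni; apply/existsP; exists k; apply/existsP; exists (succ3 k).
  by rewrite eq_sym succ3_neq h1 h2.
have posi (Q : pred 'I_(nF X)) i b k : Q i -> isb b -> 0 < b 0 k -> 0 < b 0 (succ3 k) -> 0 < gsum Q (ptj i b).
  move=> hQ hb b1 b2; rewrite /gsum (bigD1 i)//= (bigD1 k)//= !hat_pt//.
  have sx := surf_ptj TD i hb.
  apply: ltr_pwDl; last by apply: sumr_ge0 => i' _; apply: sumr_ge0 => k' _; apply: mulr_ge0; exact: hat_ge0.
  apply: ltr_pwDl; first exact: mulr_gt0.
  by apply: sumr_ge0 => k' _; apply: mulr_ge0; exact: hat_ge0.
pose G x := gsum A x - gsum B x.
have Gc : scont X G by apply: scontD => //; apply: scontN.
have GA i b k : A i -> isb b -> 0 < b 0 k -> 0 < b 0 (succ3 k) -> 0 < G (ptj i b).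
  move=> hA hb h1 h2; rewrite /G (vanish B) ?subr0//; first exact: posi h1 h2.
  by move=> i' hB; apply: contra (AB _ _ hA hB) => /adj_sym.
have GB i b k : B i -> isb b -> 0 < b 0 k -> 0 < b 0 (succ3 k) -> G (ptj i b) < 0.
  move=> hB hb h1 h2; rewrite /G (vanish A) ?sub0r ?oppr_lt0//; first exact: posi h1 h2.
  by move=> i' hA; exact: AB.
have Gz x : surf X x -> G x = 0 -> exists v, x = P v.
  move=> sx; have [//|[i [k [b [hb -> h1 h2]]]]] := vertex_or_edge TD sx.
  have [hA|hB] := boolP (A i); first by have := GA i b k hA hb h1 h2 => + e; rewrite e ltxx.
  by have := GB i b k hB hb h1 h2 => + e; rewrite e ltxx.
pose b0 : 'rV[R]_3 := \row__ 3^-1.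
have e0 k : b0 0 k = 3^-1 by rewrite mxE.
have p3 : 0 < 3^-1 :> R by rewrite invr_gt0.
have hb0 : isb b0 by split=> [k|]; [rewrite e0 ltW|rewrite (sum3 0) !e0; lra].
pose w (t : bool) := Psi (ptj (if t then j else j') b0).
have sw t : surf X (ptj (if t then j else j') b0) by exact: surf_ptj.
have Tw t : Tri (w t) by exact: (homeo_T HPsi).
have mw t c : 0 < mu c (w t).
  by apply: (@int_psi R d X v1 v2 v3 zeta phi Psi Psiinv TD zeta0 zeta1 SA CH PS _ 0); rewrite ?e0//; left.
(* The images of both barycentres are joined to one point of a side of [T], which is moved along the
   side until neither segment meets the image of a vertex. *)
pose ms s := segC (tc R 1) (tc R 2) s.
have Tt c : Tri (tc R c) by apply/TriP => m; rewrite mu_tc ler0n.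
have Tms s : in01 s -> Tri (ms s) by exact: Tri_seg.
have m0 s : mu 0 (ms s) = 0 by rewrite /ms mu_seg !mu_tc /=; ring.
have m2 s : mu 2 (ms s) = s by rewrite /ms mu_seg !mu_tc /=; ring.
have wv t v : w t <> Psi (P v).
  move=> h; have := homeo_K HPsi (sw t); rewrite -/(w t) h (homeo_K HPsi (surfV TD v)) => E.
  have := hat_vertex TD v v; rewrite eqxx E; set i := if t then j else j'.
  have [/mem_faceset[k ->]|hv] := boolP (v \in faceset i).
    by rewrite hat_pt// e0 mulr1n; lra.
  by rewrite hat_pt0// => /eqP; rewrite eq_sym oner_eq0.
pose Bad (tv : bool * 'I_(nV X)) s := in01 s /\ exists2 t, in01 t & segC (w tv.1) (ms s) t = Psi (P tv.2).
have [[tb v] s s' [hs [t ht e1]] [hs' [t' ht' e2]]|s [/andP[s0 s1] hs]] := @avoid R (bool * 'I_(nV X))%type Bad 1 ltr01.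
  (* [mu 0], which vanishes on the side, determines the parameter on the segment; then [mu 2]
     determines the point of the side. *)
  have q1 : (1 - t) * mu 0 (w tb) = (1 - t') * mu 0 (w tb).
    by have := congr1 (mu 0) (etrans e1 (esym e2)); rewrite /= /segC !(mu_seg 0 (w tb)) !m0 !mulr0 !addr0.
  have tt : t = t' by have := mulIf (lt0r_neq0 (mw tb 0)) q1; lra.
  have q2 : t * s = t * s'.
    by have := congr1 (mu 2) (etrans e1 (esym e2)); rewrite /= /segC !(mu_seg 2 (w tb)) !m2 -tt; lra.
  have [tz|tn] := eqVneq t 0; last exact: mulfI q2.
  by case: (wv tb v); rewrite -e1 tz /segC subr0 mul1r mul0r addr0.
have is01 : in01 s by rewrite /in01 !ltW.
have nz tb t : in01 t -> G (Psiinv (segC (w tb) (ms s) t)) <> 0.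
  move=> ht hz; have hT := Tri_seg (Tw tb) (Tms s is01) ht.
  have [v hv] := Gz _ (homeo_S HPsi hT) hz; apply: (hs (tb, v)); split=> //; exists t => //=.
  by rewrite -hv (homeo_Ki HPsi hT).
have pc tb := pcont_seg HPsi Gc (Tw tb) (Tms s is01).
have pcn tb := pcont_seg HPsi (scontN Gc) (Tw tb) (Tms s is01).
have at0 tb : Psiinv (segC (w tb) (ms s) 0) = ptj (if tb then j else j') b0.
  by rewrite /segC subr0 mul1r mul0r addr0 (homeo_K HPsi (sw tb)).
have at1 tb : segC (w tb) (ms s) 1 = ms s by rewrite /segC subrr mul0r mul1r add0r.
have Gj : 0 < G (ptj j b0) by apply: (GA j b0 0); rewrite ?e0// /A connect0.
have Gj' : G (ptj j' b0) < 0 by apply: (GB j' b0 0); rewrite ?e0.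
have [h|h] := leP (G (Psiinv (ms s))) 0.
  have [||t ht /eqP] := ivt01 (pcn true).
  - by rewrite at0 oppr_le0 ltW.
  - by rewrite at1 oppr_ge0.
  by rewrite oppr_eq0 => /eqP; exact: nz.
have [||t ht] := ivt01 (pc false).
- by rewrite at0 ltW.
- by rewrite at1 ltW.
exact: nz.
Qed.
End DualGraph.

Section Hubs.
Variables (R : realType) (d : nat) (X : TriSurf R d).
Local Notation P := (@pos _ _ X).
Local Notation F := (@face _ _ X).
Local Notation pt := 'rV[R]_d.
Implicit Types (j : 'I_(nF X)) (k m c : 'I_3) (v w : 'I_(nV X)) (x : pt).

(** The crossing point has the heights [i] and [i'] as two of its coordinates; the third is what
    they leave of [2 ^ q]. *)
Lemma rowb_cross q k m i i' : k != m -> (i + i' <= 2 ^ q)%N -> exists l l',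
  [/\ (i + l <= 2 ^ q)%N, (i' + l' <= 2 ^ q)%N & rowb R q k i l = rowb R q m i' l'].
Proof.
move=> km h; have E a b l l' : (forall r, rowx (2 ^ q) k a l r = rowx (2 ^ q) m b l' r) ->
    rowb R q k a l = rowb R q m b l'.
  by move=> e; apply/rowP => r; rewrite !mxE e.
case: (ord3_cases k m) km E => -> km E; first by rewrite eqxx in km.
  exists (2 ^ q - i - i')%N, i; split; [lia|lia|]; apply: E => r; rewrite /rowx.
  case: (ord3_cases k r) => ->; rewrite ?eqxx ?succ3_neq ?succ3_neq2 ?(eq_sym k) ?(eq_sym (succ3 k)) ?succ3_neq ?succ3_neq2 ?eqxx //; lia.
exists i', (2 ^ q - i' - i)%N; split; [lia|lia|]; apply: E => r; rewrite /rowx succ3K.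
case: (ord3_cases k r) => ->; rewrite ?eqxx ?succ3_neq ?succ3_neq2 ?(eq_sym k) ?(eq_sym (succ3 k)) ?succ3_neq ?succ3_neq2 ?eqxx //; lia.
Qed.

Lemma rowb_edge q j a b i : a != b -> (i <= 2 ^ q)%N -> exists l, (i + l <= 2 ^ q)%N /\
  ptj j (rowb R q a i l) = (i%:R / (2 ^ q)%:R) *: P (F j a) + ((2 ^ q - i)%:R / (2 ^ q)%:R) *: P (F j b).
Proof.
move=> ab h; case: (ord3_cases a b) ab => -> ab; first by rewrite eqxx in ab.
  exists 0%N; rewrite addn0; split=> //; have [e1 e2 e3] := rowb_coord R q a i 0.
  by rewrite /ptj (sum3 a) e1 e2 e3 mul0r scale0r addr0 subn0.
exists (2 ^ q - i)%N; rewrite subnKC//; split=> //; have [e1 e2 e3] := rowb_coord R q a i (2 ^ q - i).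
by rewrite /ptj (sum3 a) e1 e2 e3 subnn mul0r scale0r addr0.
Qed.

(** Hub rows of one face cross, and hub rows at a common vertex of adjacent faces meet on their
    common edge. A simple path in the dual graph has at most [nF X] steps, so the values on all hub
    rows are close to each other; since each [muL c] of [u] vanishes somewhere on them, they are
    close to 0. *)
Lemma hub_bound : exists2 B : R, 0 < B & forall q (u : pt -> R[i]) (de : R) (hub : 'I_(nV X) -> nat),
  triangulated_disk X -> (forall j j', connect (@adj R d X) j j') -> 0 <= de ->
  (forall j k l, (hub (F j k) + l <= 2 ^ q)%N -> cn (u (ptj j (rowb R q k (hub (F j k)) l)) - u (ptj j (rowb R q k (hub (F j k)) 0))) <= de) ->
  (forall v w, (hub v + hub w <= 2 ^ q)%N) ->
  (forall c, exists j k, forall t, in01 t -> muL c (u (ptj j (edgeb k t))) = 0) ->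
  forall j k l, (hub (F j k) + l <= 2 ^ q)%N -> cn (u (ptj j (rowb R q k (hub (F j k)) l))) <= B * de.
Proof.
have [C C0 HC] := mul_cn R; pose n : R := (nF X)%:R.
have n0 : 0 <= n by rewrite ler0n.
have B0 : 0 <= C * (3 + 6 * n) by apply: mulr_ge0; [exact: ltW|lra].
exists (3 + 3 * (C * (3 + 6 * n))); first by lra.
move=> q u de hub TD conn de0 osc hh sd.
pose r j k l := u (ptj j (rowb R q k (hub (F j k)) l)).
have osc2 j k l l' : (hub (F j k) + l <= 2 ^ q)%N -> (hub (F j k) + l' <= 2 ^ q)%N -> cn (r j k l - r j k l') <= 2 * de.
  move=> h h'; apply: le_trans (cn_tri (r j k 0%N) _ _) _; rewrite (cnC (r j k 0%N)).
  have h1 : cn (r j k l - r j k 0%N) <= de := osc j k l h.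
  have h2 : cn (r j k l' - r j k 0%N) <= de := osc j k l' h'.
  by lra.
pose ka j := r j 0 0%N.
have near j k l : (hub (F j k) + l <= 2 ^ q)%N -> cn (r j k l - ka j) <= 3 * de.
  have [->|k0] := eqVneq k 0.
    by move=> h; have h1 : cn (r j 0 l - r j 0 0%N) <= de := osc j 0 l h; rewrite /ka; lra.
  move=> h; have k0' : (0 : 'I_3) != k by rewrite eq_sym.
  have [l0 [l1 [h0 h1 E]]] := rowb_cross k0' (hh (F j 0) (F j k)).
  apply: le_trans (cn_tri (r j k l1) _ _) _.
  have a1 := osc2 j k l l1 h h1.
  have a2 : cn (r j 0 l0 - r j 0 0%N) <= de := osc j 0 l0 h0.
  have E' : r j k l1 = r j 0 l0 by rewrite /r E.
  by rewrite {2}E' /ka; lra.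
have hub_le v : (hub v <= 2 ^ q)%N by apply: leq_trans (hh v v); exact: leq_addr.
have step j j' : adj j j' -> cn (ka j - ka j') <= 6 * de.
  move=> /(adjP TD)[a [b [a' [b' [ab ab' ha hb]]]]].
  have [l [h1 e1]] := rowb_edge j ab (hub_le (F j a)).
  have [l' [h2 e2]] := rowb_edge j' ab' (hub_le (F j' a')).
  have E : r j a l = r j' a' l' by rewrite /r e1 e2 ha hb.
  apply: le_trans (cn_tri (r j a l) _ _) _; have := near j a l h1; have := near j' a' l' h2.
  by rewrite -E (cnC (ka j)); lra.
have chain p j : path (@adj R d X) j p -> cn (ka j - ka (last j p)) <= 6 * de * (size p)%:R.
  elim: p j => [|j1 p IH] j /=; first by rewrite subrr cn0 mulr0.
  move=> /andP[/step h1 /IH h2]; apply: le_trans (cn_tri (ka j1) _ _) _.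
  by rewrite -[(size p).+1%:R]natr1; lra.
have far j j' : cn (ka j - ka j') <= 6 * n * de.
  have /connectP[p hp ->] := conn j j'; case/shortenP: hp => p' hp' up _.
  apply: le_trans (chain _ _ hp') _; rewrite mulrAC; apply: ler_wpM2r => //.
  apply: ler_wpM2l => //; rewrite /n ler_nat.
  have : (size (j :: p') <= #|'I_(nF X)|)%N by rewrite -(card_uniqP up); exact: max_card.
  by rewrite card_ord /=; apply: leq_trans.
(* The hub row at the first vertex of an edge on the side [c] starts on that edge, where [muL c] of
   [u] is 0. *)
have kaL c j : `|muL c (ka j)| <= C * (3 + 6 * n) * de.
  have [j1 [k1 h1]] := sd c.
  pose i := hub (F j1 k1); pose t : R := (2 ^ q - i)%:R / (2 ^ q)%:R.
  have p0 : 0 < (2 ^ q)%:R :> R by rewrite ltr0n expn_gt0.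
  have [e1 e2 e3] := rowb_coord R q k1 i 0.
  have tE : i%:R / (2 ^ q)%:R = 1 - t.
    by rewrite /t natrB ?hub_le//; field; exact: lt0r_neq0.
  have E : rowb R q k1 i 0 = edgeb k1 t.
    apply/rowP => m; rewrite [RHS]mxE; case: (ord3_cases k1 m) => ->.
    - by rewrite eqxx e1 tE.
    - by rewrite succ3_neq eqxx e2 subn0.
    - by rewrite succ3_neq2 succ3_neq e3 mul0r.
  have t01 : in01 t.
    by rewrite /in01 /t divr_ge0 ?ler0n//= ler_pdivrMr// mul1r ler_nat leq_subr.
  have z : muL c (r j1 k1 0%N) = 0 by rewrite /r E; exact: h1.
  have hl : (hub (F j1 k1) + 0 <= 2 ^ q)%N by rewrite addn0.
  have -> : ka j = ka j - r j1 k1 0%N + r j1 k1 0%N by rewrite subrK.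
  rewrite mulD z addr0; apply: le_trans (HC _ _) _; rewrite -mulrA; apply: ler_wpM2l; first exact: ltW.
  apply: le_trans (cn_tri (ka j1) _ _) _; have := far j j1; have := near j1 k1 0%N hl.
  by rewrite (cnC (ka j1)); lra.
move=> j k l h; have -> : u (ptj j (rowb R q k (hub (F j k)) l)) = (r j k l - ka j) + ka j by rewrite subrK.
apply: le_trans (cnD _ _) _; have := near j k l h; have := cn_mul (ka j).
have := kaL 0 j; have := kaL (succ3 0) j; have := kaL (succ3 (succ3 0)) j; rewrite (sum3 0); lra.
Qed.
End Hubs.

Lemma row_weights_le (R : realType) (x y z r s : R) : x + y + z = 1 -> 0 <= y -> 0 <= z ->
  r <= s -> s <= x -> x <= s + r -> s <= 1 - 2 * r -> [/\ x <= 1 - r, y <= 1 - r & z <= 1 - r].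
Proof. by move=> *; split; lra. Qed.

Lemma conv_le (R : realType) (t a b e : R) : 0 <= t -> 0 <= 1 - t -> a <= e -> b <= e ->
  (1 - t) * a + t * b <= e.
Proof.
move=> t0 t1 ae be; apply: le_trans (lerD (ler_wpM2l t1 ae) (ler_wpM2l t0 be)) _.
by rewrite -mulrDl subrK mul1r.
Qed.

Section GoodChords.
Variables (R : realType) (d : nat) (X : TriSurf R d).
Local Notation P := (@pos _ _ X).
Local Notation F := (@face _ _ X).
Local Notation pt := 'rV[R]_d.
Implicit Types (j : 'I_(nF X)) (k m c : 'I_3) (v w i : 'I_(nV X)) (b : 'rV[R]_3) (x : pt) (p : seq 'I_4).
Hypothesis TD : triangulated_disk X.
Variables (v1 v2 v3 : 'I_(nV X)) (zeta : R) (phi : 'I_(nV X) -> pt -> R[i]^o).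
Variables (Psi : pt -> R[i]^o) (Psiinv : R[i]^o -> pt).
Hypotheses (zeta0 : 0 < zeta) (zeta1 : zeta < 4^-1).
Hypothesis SA : standing_assumption X v1 v2 v3.
Hypothesis CH : forall i, is_chart X v1 v2 v3 zeta i (phi i).
Hypothesis PS : is_Psi X v1 v2 v3 zeta phi Psi Psiinv.
Hypothesis ES : forall j k, bedge (F j k) (F j (succ3 k)) ->
  exists c, forall t : R, in01 t -> mu c (Psi (ptj j (edgeb k t))) = 0.
Variable chart : 'I_(nF X) -> seq 'I_4 -> 'I_(nV X).
Hypothesis CA : chart_assignment X zeta chart.

Lemma psi_lip (r e : R) : 0 < r -> 0 < e -> exists2 de : R, 0 < de & forall j b b', isb b -> isb b' ->
  (forall k, b 0 k <= 1 - r) -> bnorm (b' - b) <= de -> cn (Psi (ptj j b') - Psi (ptj j b)) <= e.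
Proof.
move=> r0 e0; have [C C0 HC] := surface_estimate TD zeta0 zeta1 SA CH PS ES.
have [Cz Cz0 Hz] := @zt_lip R d X.
pose eta := r / 2; have eta0 : 0 < eta by rewrite divr_gt0.
pose de := Num.min (eta / C / Cz) (e / (C * (1 + 1) / eta) / Cz).
have K0 : 0 < C * (1 + 1) / eta by apply: divr_gt0 => //; apply: mulr_gt0.
have de0 : 0 < de.
  by rewrite lt_min; apply/andP; split; apply: divr_gt0 => //; apply: divr_gt0.
exists de => // j b b' hb hb' hr hd.
have [k [h1 h2]] := two_coords hb (fun k => ltac:(by have := hr k; rewrite /eta; lra) : b 0 k <= 1 - 2 * eta).
have hM x : surf X x -> hat (F j k) (ptj j b) - eta <= hat (F j k) x -> cn (Psi x - Psi (ptj j b)) <= 1 + 1.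
  move=> hx _; apply: le_trans (cnB _ _) _; apply: lerD; apply: Tri_cn;
    apply: (homeo_T (Psi_homeo PS)) => //; exact: surf_ptj.
have [D HD] := HC j k k b eta (1 + 1) eta0 hb h1 h2 (or_introl erefl) hM.
have dz : cn (zt j k b' - zt j k b) <= Cz * de.
  by apply: le_trans (Hz _ _ _ _) _; apply: ler_wpM2l => //; exact: ltW.
have d1 : Cz * de <= eta / C by rewrite mulrC -ler_pdivlMr// ge_min lexx.
have d2 : Cz * de <= e / (C * (1 + 1) / eta) by rewrite mulrC -ler_pdivlMr// ge_min lexx orbT.
have [h _] := HD b' hb' (le_trans dz d1).
apply: le_trans h _; rewrite mulrC -ler_pdivlMr//; exact: le_trans dz d2.
Qed.

Definition side_edges (Phi : pt -> R[i]^o) := forall c, exists j k, forall t : R, in01 t ->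
  mu c (Psi (ptj j (edgeb k t))) = 0 /\ mu c (Phi (ptj j (edgeb k t))) = 0.

Lemma fk_affine (Phi : pt -> R[i]^o) q (K : R) j p k (t : R) : in_FK X v1 v2 v3 phi chart K q Phi -> size p = q -> in01 t ->
  Phi (ptj j ((1 - t) *: tri R p (succ3 k) + t *: tri R p (succ3 (succ3 k)))) =
  (1 - t)%:C * Phi (ptj j (tri R p (succ3 k))) + t%:C * Phi (ptj j (tri R p (succ3 (succ3 k)))).
Proof.
move=> [hA _ _ _ _] hp /andP[t0 t1]; have := hA j p hp; rewrite subfaceE => h.
have t1' : 0 <= 1 - t by rewrite subr_ge0.
have E a b : ptj j ((1 - t) *: a + t *: b) = (1 - t) *: ptj j a + t *: ptj j b.
  rewrite (_ : _ *: a + _ = lrp a b t) ?ptj_lrp//.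
  by apply/rowP => n; rewrite /lrp !mxE; ring.
have s1 : 0 + (1 - t) + t = 1 by ring. have s2 : (1 - t) + t + 0 = 1 by ring.
have s3 : t + 0 + (1 - t) = 1 by ring.
rewrite E; case: (ord3P k) => ->; rewrite !succ3E.
- have := h 0 (1 - t) t (lexx _) t1' t0 s1.
  by rewrite scale0r add0r rmorph0 mul0r add0r.
- have := h t 0 (1 - t) t0 (lexx _) t1' s3.
  by rewrite scale0r addr0 rmorph0 mul0r addr0 addrC => ->; rewrite addrC.
- have := h (1 - t) t 0 t1' t0 (lexx _) s2.
  by rewrite scale0r addr0 rmorph0 mul0r addr0.
Qed.

(** A row of small oscillation crosses a hub row, on which [u] is small. Between lattice points
    [Phi] is affine and [Psi] varies little, so the bound extends to the whole chord. *)
Lemma good_chord (r e : R) : 0 < r -> r <= 4^-1 -> 0 < e -> exists N, forall q (K : R) (Phi : pt -> R[i]^o),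
  (N <= q)%N -> K - 1 <= N.+1%:R^-1 -> (2 <= q)%N -> in_FK X v1 v2 v3 phi chart K q Phi -> @sides R d X Psi Phi ->
  side_edges Phi -> forall v (s : R), r <= s -> s <= 1 - 2 * r ->
  exists c : R, s <= c <= s + r /\ forall x, surf X x -> hat v x = c -> cn (Phi x - Psi x) <= e.
Proof.
move=> r0 r4 e0; have [B B0 HB] := @hub_bound R d X.
(* Two oscillations of the row and the bound [B * de] on the hub rows make [e / 2]; the other half
   is spent between lattice points. *)
pose de := e / (2 * (B + 2)); have B2 : 0 < 2 * (B + 2) by lra.
have de0 : 0 < de by exact: divr_gt0.
have deE : B * de + 2 * de = e / 2 by rewrite /de; field; apply: lt0r_neq0; lra.
pose rh := r / 2; have rh0 : 0 < rh by exact: divr_gt0.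
have rhr : rh <= r by rewrite /rh; lra.
have en0 : 0 < de ^+ 2 * rh / 96 by apply: divr_gt0 => //; apply: mulr_gt0 => //; exact: exprn_gt0.
have [H0 hH0] := @small_pow R 1 rh rh0.
have [H [hH [N1 HN1]]] := energy_small TD zeta0 zeta1 SA CH PS ES CA H0 en0.
have Hrh : 2 ^- H < rh by have := hH0 H hH; rewrite div1r.
have e20 : 0 < e / 2 by exact: divr_gt0.
have [dl dl0 Hdl] := psi_lip r0 e20.
have [N2 HN2] := @small_pow R 4 rh rh0.
have [N3 HN3] := @small_pow R 2 dl dl0.
exists (N1 + N2 + N3)%N => q K Phi hq hK q2 FK SP SE.
have [l1 [l2 l3]] : (N1 <= q)%N /\ (N2 <= q)%N /\ (N3 <= q)%N by clear - hq; lia.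
have {}hK : K - 1 <= N1.+1%:R^-1.
  apply: le_trans hK _; rewrite lef_pV2 ?posrE ?ltr0n// ler_nat; clear; lia.
pose u x : R[i] := Phi x - Psi x.
have EN := HN1 q K Phi l1 hK q2 FK SP.
have n0 : 0 < (2 ^ q)%:R :> R by rewrite ltr0n expn_gt0.
have q4 : 4 <= rh * (2 ^ q)%:R by rewrite natrX -ler_pdivrMr ?exprn_gt0//; apply/ltW/HN2.
(* Rows close to the opposite edges meet all the other rows. *)
have ex v : exists i : nat, rh <= i%:R / (2 ^ q)%:R <= rh + rh /\ forall j k, F j k = v -> forall l, (i + l <= 2 ^ q)%N ->
      cn (u (ptj j (rowb R q k i l)) - u (ptj j (rowb R q k i 0))) <= de.
  by apply: (@good_row R d X q u H rh rh de v) => //; rewrite /rh; lra.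
have [hub hubP] := choice ex.
have hub_lo v : (hub v)%:R <= r * (2 ^ q)%:R.
  have [/andP[_ h] _] := hubP v; move: h; rewrite ler_pdivrMr//.
  by have -> : rh + rh = r by rewrite /rh; lra.
have hh v w : (hub v + hub w <= 2 ^ q)%N.
  rewrite -(ler_nat R) natrD; have := hub_lo v; have := hub_lo w.
  have : r * (2 ^ q)%:R <= 4^-1 * (2 ^ q)%:R by apply: ler_wpM2r => //; exact: ltW.
  by move: n0; lra.
have sd c : exists j k, forall t, in01 t -> muL c (u (ptj j (edgeb k t))) = 0.
  have [j [k h]] := SE c; exists j, k => t ht; have [h1 h2] := h t ht.
  by rewrite /u -mu_sub h1 h2 subrr.
have conn j j' : connect (@adj R d X) j j' by exact: (dual_connected TD zeta0 zeta1 SA CH PS).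
have HH := HB q u de hub TD conn (ltW de0) (fun j k => (hubP (F j k)).2 j k erefl) hh sd.
move=> v s rs s1.
have [i [/andP[i1 i2] hi]] : exists i : nat, s <= i%:R / (2 ^ q)%:R <= s + r /\ forall j k, F j k = v ->
    forall l, (i + l <= 2 ^ q)%N -> cn (u (ptj j (rowb R q k i l)) - u (ptj j (rowb R q k i 0))) <= de.
  apply: (@good_row R d X q u H r s de v) => //.
  - exact: lt_le_trans Hrh rhr.
  - by apply: le_trans q4 _; apply: ler_wpM2r => //; exact: ltW.
  apply: le_trans EN _; apply: ler_wpM2r; first by rewrite invr_ge0.
  by apply: ler_wpM2l => //; exact: sqr_ge0.
have ihub w : (i + hub w <= 2 ^ q)%N.
  rewrite -(ler_nat R) natrD; have := hub_lo w; move: i2; rewrite ler_pdivrMr// => i2.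
  have : (s + r) * (2 ^ q)%:R <= (1 - r) * (2 ^ q)%:R by apply: ler_wpM2r; [exact: ltW|lra].
  by move: i2; lra.
have row j k l : F j k = v -> (i + l <= 2 ^ q)%N -> cn (u (ptj j (rowb R q k i l))) <= e / 2.
  move=> jk hl; have kk : k != succ3 k by rewrite eq_sym succ3_neq.
  have [l0 [l' [h0 h' E]]] := rowb_cross R kk (ihub (F j (succ3 k))).
  have a1 := hi j k jk l hl; have a2 := hi j k jk l0 h0.
  have a3 := HH j (succ3 k) l' h'; rewrite -E in a3.
  have -> : u (ptj j (rowb R q k i l)) = (u (ptj j (rowb R q k i l)) - u (ptj j (rowb R q k i 0))) -
     (u (ptj j (rowb R q k i l0)) - u (ptj j (rowb R q k i 0))) + u (ptj j (rowb R q k i l0)) by ring.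
  apply: le_trans (cnD _ _) _; have := cnB (u (ptj j (rowb R q k i l)) - u (ptj j (rowb R q k i 0)))
     (u (ptj j (rowb R q k i l0)) - u (ptj j (rowb R q k i 0))).
  by move: a1 a2 a3 deE; lra.
exists (i%:R / (2 ^ q)%:R); rewrite i1 i2; split=> // x sx hx.
have [j [b hb xE]] := proj1 (surfP TD x) sx.
have c0 : 0 < i%:R / (2 ^ q)%:R :> R by apply: lt_le_trans i1; apply: lt_le_trans rs.
have [/mem_faceset[k vE]|hv] := boolP (v \in faceset j); last first.
  by move: hx c0; rewrite xE hat_pt0// => <-; rewrite ltxx.
have bk : b 0 k = i%:R / (2 ^ q)%:R by rewrite -hx xE vE hat_pt.
have [hb0 hbs] := hb; rewrite (sum3 k) in hbs.
pose y := b 0 (succ3 (succ3 k)) * (2 ^ q)%:R; have y0 : 0 <= y by apply: mulr_ge0 => //; exact: ltW.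
pose l := Num.trunc y; have ly : l%:R <= y by rewrite truncn_le.
have yl : y < l.+1%:R by exact: truncnS_gt.
have bkn : b 0 k * (2 ^ q)%:R = i%:R by rewrite bk divfK// lt0r_neq0.
have b1n : b 0 (succ3 k) * (2 ^ q)%:R = (2 ^ q)%:R - i%:R - y.
  have e1 : b 0 (succ3 k) = 1 - b 0 k - b 0 (succ3 (succ3 k)) by rewrite -hbs; ring.
  by rewrite -bkn /y e1; ring.
have b1p : 0 <= (2 ^ q)%:R - i%:R - y by rewrite -b1n; apply: mulr_ge0 => //; exact: ltW.
have il : (i + l <= 2 ^ q)%N by rewrite -(ler_nat R) natrD; move: b1p ly; lra.
have iq : (i <= 2 ^ q)%N by apply: leq_trans il; exact: leq_addr.
have bE : b = \row_m (if m == k then i%:R / (2 ^ q)%:R else if m == succ3 k then ((2 ^ q)%:R - i%:R - y) / (2 ^ q)%:R else y / (2 ^ q)%:R).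
  apply/rowP => m; rewrite mxE; case: (ord3_cases k m) => ->.
  - by rewrite eqxx bk.
  - by rewrite succ3_neq eqxx -b1n mulfK// lt0r_neq0.
  - by rewrite succ3_neq2 succ3_neq /y mulfK// lt0r_neq0.
have rE l' : (i + l' <= 2 ^ q)%N -> rowb R q k i l' = \row_m (if m == k then i%:R / (2 ^ q)%:R else if m == succ3 k then ((2 ^ q)%:R - i%:R - l'%:R) / (2 ^ q)%:R else l'%:R / (2 ^ q)%:R).
  move=> h; apply/rowP => m; rewrite !mxE /rowx; case: ifP => _ //; case: ifP => _ //.
  by rewrite !natrB//; clear - h; lia.
have [yE|yne] := eqVneq y l%:R.
  have -> : x = ptj j (rowb R q k i l) by rewrite xE bE rE// yE.
  by apply: le_trans (row j k l (esym vE) il) _; rewrite ler_pdivrMr// ler_peMr ?ltW// ltr1n.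
have {}ly : l%:R < y by rewrite lt_def yne.
have il1 : (i + l < 2 ^ q)%N by rewrite -(ltr_nat R) natrD; move: b1p ly; lra.
have il1' : (i + l.+1 <= 2 ^ q)%N by rewrite addnS.
have [p hp [pr1 pr2]] := row_edge R k il1.
pose t := y - l%:R; have t01 : in01 t.
  by rewrite /in01 /t subr_ge0 (ltW ly) /= lerBlDl natr1 ltW.
have /andP[t0 t1] := t01.
have xT : x = ptj j ((1 - t) *: tri R p (succ3 k) + t *: tri R p (succ3 (succ3 k))).
  rewrite xE pr1 pr2 (rE l (ltnW il1)) (rE l.+1 il1'); congr (ptj j _); rewrite bE; apply/rowP => m; rewrite !mxE.
  by case: ifP => _; [ring|case: ifP => _; rewrite /t -[l.+1%:R]natr1; ring].
have b1r m : b 0 m <= 1 - r.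
  rewrite -bk in i1 i2.
  have [? ? ?] := row_weights_le hbs (hb0 (succ3 k)) (hb0 (succ3 (succ3 k))) rs i1 i2 s1.
  by case: (ord3_cases k m) => ->.
have lip l' : (i + l' <= 2 ^ q)%N -> `|y - l'%:R| <= 1 -> cn (Psi (ptj j (rowb R q k i l')) - Psi x) <= e / 2.
  move=> hl' hy; rewrite xE; apply: Hdl => //; first exact: rowb_isb.
  apply: (@le_trans _ _ (2 / 2 ^+ q)); last exact/ltW/HN3.
  rewrite rE// {1}bE /bnorm (sum3 k) !mxE !eqxx !succ3_neq !succ3_neq2 subrr normr0 add0r.
  rewrite -!mulrBl !normrM (_ : (2 ^ q)%:R - i%:R - l'%:R - ((2 ^ q)%:R - i%:R - y) = y - l'%:R); last by ring.
  have nn : `|(2 ^ q)%:R^-1| = (2 ^+ q)^-1 :> R by rewrite natrX ger0_norm ?invr_ge0 ?exprn_ge0.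
  rewrite (distrC l'%:R) -mulrDl nn; apply: ler_wpM2r; last by rewrite -[leRHS]/(1 + 1); exact: lerD.
  by rewrite invr_ge0 exprn_ge0.
have aff := fk_affine j k FK hp t01; rewrite -xT pr1 pr2 in aff.
rewrite aff (_ : _ - _ = (1 - t)%:C * (u (ptj j (rowb R q k i l)) + (Psi (ptj j (rowb R q k i l)) - Psi x)) +
  t%:C * (u (ptj j (rowb R q k i l.+1)) + (Psi (ptj j (rowb R q k i l.+1)) - Psi x))); last first.
  by rewrite /u rmorphB /=; ring.
have A l' : (i + l' <= 2 ^ q)%N -> `|y - l'%:R| <= 1 ->
    cn (u (ptj j (rowb R q k i l')) + (Psi (ptj j (rowb R q k i l')) - Psi x)) <= e.
  move=> h1 h2; apply: le_trans (cnD _ _) _; rewrite [leRHS]splitr; apply: lerD; [exact: row|exact: lip].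
have A1 : `|y - l%:R| <= 1 by rewrite -/t ger0_norm.
have A2 : `|y - l.+1%:R| <= 1.
  by rewrite -[l.+1%:R]natr1 opprD addrA -/t ler0_norm ?subr_le0// opprB lerBlDr lerDl.
apply: le_trans (cnD _ _) _; rewrite !cnM !cnR (ger0_norm t0) ger0_norm ?subr_ge0//.
by apply: (conv_le t0 _ (A _ (ltnW il1) A1) (A _ il1' A2)); rewrite subr_ge0.
Qed.
End GoodChords.

Section IvtMin.
Variable R : realType.

(** The minimum of the family changes sign; at a zero of it no member is negative and one vanishes.
    The value 1 at the empty list keeps the minimum positive at the start and is never the zero. *)
Lemma ivt_min (T : eqType) (s : seq T) (f : T -> R -> R) : (forall v, v \in s -> pcont (f v)) ->
  (forall v, v \in s -> 0 < f v 0) -> (exists2 v, v \in s & f v 1 < 0) ->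
  exists2 t, in01 t & (exists2 v, v \in s & f v t = 0) /\ forall v, v \in s -> 0 <= f v t.
Proof.
move=> fc f0 [w ws fw]; pose g := foldr (fun v h t => Num.min (f v t) (h t)) (fun=> 1 : R) s.
have gle v t : v \in s -> g t <= f v t.
  rewrite /g; elim: (s) => //= a r IH; rewrite inE => /orP[/eqP ->|/IH h]; rewrite ge_min ?lexx//.
  by rewrite h orbT.
have gc : pcont g.
  have h0 : pcont (fun=> 1 : R) by move=> t _ e e0; exists 1 => // r _ _; rewrite subrr normr0.
  rewrite /g; elim: (s) fc => //= a r IH fc; apply: (@pcont_min R (f a)); first by apply: fc; rewrite inE eqxx.
  by apply: IH => v vr; apply: fc; rewrite inE vr orbT.
have gor t : g t = 1 \/ exists2 v, v \in s & g t = f v t.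
  rewrite /g; elim: (s) => [|a r IH] /=; first by left.
  case: (leP (f a t) _) => _; first by right; exists a => //; rewrite inE eqxx.
  by case: IH => [->|[v vr ->]]; [left|right; exists v => //; rewrite inE vr orbT].
have g0 : 0 < g 0 by case: (gor 0) => [->//|[v vs ->]]; exact: f0.
have cc : pcont (fun=> 0 : R) by move=> t _ e e0; exists 1 => // r _ _; rewrite subrr normr0.
have [||t ht] := ivt01 (pcontB cc gc).
- by rewrite sub0r oppr_le0 ltW.
- by rewrite sub0r oppr_ge0; apply: le_trans (gle w 1 ws) (ltW fw).
rewrite sub0r => /eqP; rewrite oppr_eq0 => /eqP gt; exists t => //; split; last by move=> v vs; rewrite -gt; exact: gle.
case: (gor t) => [h|[v vs h]]; first by move: gt; rewrite h => /eqP; rewrite oner_eq0.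
by exists v => //; rewrite -h.
Qed.
End IvtMin.

Lemma norm3_le (R : realType) (a b c e : R) : 0 < e -> a + b + c = 0 -> a <= e -> b <= e -> c <= e ->
  `|a| + `|b| + `|c| <= 6 * e.
Proof.
move=> e0 s0 ae be ce; have B t : - (2 * e) <= t -> t <= e -> `|t| <= 2 * e.
  by move=> *; rewrite ler_norml; apply/andP; split; lra.
by have := B a; have := B b; have := B c; lra.
Qed.

(** * From good chords to convergence *)

Section Convergence.
Variables (R : realType) (d : nat) (X : TriSurf R d).
Local Notation P := (@pos _ _ X).
Local Notation F := (@face _ _ X).
Local Notation pt := 'rV[R]_d.
Implicit Types (j : 'I_(nF X)) (k m c : 'I_3) (v w i : 'I_(nV X)) (x : pt).
Hypothesis TD : triangulated_disk X.
Variables (v1 v2 v3 : 'I_(nV X)) (zeta : R) (phi : 'I_(nV X) -> pt -> R[i]^o).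
Variables (Psi : pt -> R[i]^o) (Psiinv : R[i]^o -> pt).
Hypotheses (zeta0 : 0 < zeta) (zeta1 : zeta < 4^-1).
Hypothesis SA : standing_assumption X v1 v2 v3.
Hypothesis CH : forall i, is_chart X v1 v2 v3 zeta i (phi i).
Hypothesis PS : is_Psi X v1 v2 v3 zeta phi Psi Psiinv.
Variable chart : 'I_(nF X) -> seq 'I_4 -> 'I_(nV X).
Hypothesis CA : chart_assignment X zeta chart.
Let HPsi := Psi_homeo PS.
Local Notation FK := (in_FK X v1 v2 v3 phi chart).

Section FK.
Variables (K : R) (q : nat) (Phi : pt -> R[i]^o).
Hypothesis HF : FK K q Phi.
Lemma fk_mv c : Phi (P (mv v1 v2 v3 c)) = tc R c.
Proof. by case: HF => _ _ _ [_ h1 h2 h3] _; case: (ord3P c) => ->. Qed.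

Lemma fk_edge_side j k : bedge (F j k) (F j (succ3 k)) ->
  exists c, forall t : R, in01 t -> mu c (Psi (ptj j (edgeb k t))) = 0.
Proof.
case: HF => _ [g hg] _ [hb _ _ _] _.
exact: (edge_side TD zeta0 zeta1 SA CH PS hg hb fk_mv).
Qed.

Lemma fk_same x c : surf X x -> mu c (Psi x) = 0 -> mu c (Phi x) = 0.
Proof.
case: HF => _ [g hg] _ [hb _ _ _] _ hx h.
exact: (proj2 (same_side TD zeta0 zeta1 SA CH PS hg hb fk_mv c hx)).
Qed.

Lemma fk_sides : @sides R d X Psi Phi.
Proof.
move=> v w vw0; have [j [k [hv hw E]]] := bedge_face vw0.
have vw : bedge (F j k) (F j (succ3 k)) by rewrite hv hw.
have [c hc] := fk_edge_side vw; exists c => t ht; rewrite E; split; first exact: hc.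
by apply: fk_same; [apply: surf_ptj => //; exact: edgeb_isb|exact: hc].
Qed.

Lemma fk_side_edges : @side_edges R d X Psi Phi.
Proof.
move=> c; have [g hg] : exists g, homeo_sets (surf X) (@Tri R) Phi g by case: HF.
have hb : Phi @` bdsurf X = @bdTri R by case: HF => _ _ _ [].
have [j [k [be h]]] := side_has_edge TD zeta0 zeta1 SA CH PS hg hb fk_mv c.
exists j, k => t ht; split; first exact: h.
by apply: fk_same; [apply: surf_ptj => //; exact: edgeb_isb|exact: h].
Qed.
End FK.

Hypothesis ES : forall j k, bedge (F j k) (F j (succ3 k)) ->
  exists c, forall t : R, in01 t -> mu c (Psi (ptj j (edgeb k t))) = 0.

(** A point is the combination of the vertices with its hat values as weights, so close hat values
    mean close points. *)
Lemma hat_near x (e : R) : surf X x -> 0 < e -> exists2 r : R, 0 < r & forall z, surf X z ->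
  (forall v, `|hat v z - hat v x| <= r) -> cn (Psi z - Psi x) <= e.
Proof.
move=> sx e0; have [r r0 Hr] := homeo_cont HPsi sx e0.
have [vk|vk C C' CC h|C C0 HC] := @fin_bound R ('I_(nV X) * 'I_d)%type (fun vk C => `|P vk.1 0 vk.2| <= C).
- by exists `|P vk.1 0 vk.2|.
- exact: le_trans CC.
pose n : R := (nV X)%:R + 1; have n0 : 0 < n by rewrite /n ltr_wpDl.
exists (r / (n * C) / 2); first by rewrite !divr_gt0// mulr_gt0.
move=> z sz hz; apply/ltW/Hr => //; apply: ball_rV => // k.
rewrite {1}(hat_sum TD sx) {1}(hat_sum TD sz) !summxE -sumrB.
apply: le_lt_trans (ler_norm_sum _ _ _) _.
apply: (@le_lt_trans _ _ (\sum_(v < nV X) r / (n * C) / 2 * C)).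
  apply: ler_sum => v _; rewrite !mxE -mulrBl normrM; apply: ler_pM => //.
    by rewrite distrC.
  exact: (HC (v, k)).
rewrite sumr_const card_ord -[_ *+ nV X]mulr_natl.
rewrite (_ : _ * _ = (nV X)%:R / n * (r / 2)); last by field; rewrite !gt_eqF.
have : (nV X)%:R / n <= 1 by rewrite ler_pdivrMr// mul1r /n lerDl.
by move=> h; have := ler_wpM2r (ltW (divr_gt0 r0 (ltr0Sn R 1))) h; lra.
Qed.

(** The cell around [Psiinv y0] is bounded by chords whose hat values are off by [2 * r] to [3 * r],
    while nearby points are off by less than [r] and so lie inside. In [e1], 18 is three errors per
    coordinate times the 6 of [norm3_le]. *)
Lemma local_convergence (y0 : R[i]) (e : R) : 0 < e -> Tri y0 -> (forall c, y0 <> tc R c) ->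
  exists2 de : R, 0 < de & exists N, forall q (K : R) (Phi : pt -> R[i]^o),
  (N <= q)%N -> K - 1 <= N.+1%:R^-1 -> (2 <= q)%N -> FK K q Phi ->
  forall y, Tri y -> cn (y - y0) < de -> cn (Phi (Psiinv y) - y) <= e.
Proof.
move=> e0 Ty0 y0c; have [C C0 HC] := mul_cn R.
pose e1 := e / (18 * C); have e10 : 0 < e1 by rewrite divr_gt0// mulr_gt0.
pose x0 := Psiinv y0; have sx0 : surf X x0 by exact: (homeo_S HPsi).
have Px0 : Psi x0 = y0 by exact: (homeo_Ki HPsi).
pose h v := hat v x0.
have h0 v : 0 <= h v by exact: hat_ge0.
have h1 v : h v <= 1 by exact: hat_le1.
have [r1 r10 Hr1] := hat_near sx0 e10; rewrite Px0 in Hr1.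
(* At x0 every hat function is 0, 1 or in [4 r, 1 - 4 r], so that there are good
   chords on both sides of x0 wherever they are needed. *)
have [|v a a' a0 aa [p1 p2]|r2 r20 Hr2] := @fin_delta R 'I_(nV X) (fun v r => (0 < h v -> 4 * r <= h v) /\ (h v < 1 -> h v <= 1 - 4 * r)).
- move=> v; pose a := if 0 < h v then h v / 4 else 1; pose b := if h v < 1 then (1 - h v) / 4 else 1.
  have a0 : 0 < a by rewrite /a; case: ifP => // ?; rewrite divr_gt0.
  have b0 : 0 < b by rewrite /b; case: ifP => // ?; rewrite divr_gt0// subr_gt0.
  exists (Num.min a b); first by rewrite lt_min a0.
  have ma : Num.min a b <= a by rewrite ge_min lexx.
  have mb : Num.min a b <= b by rewrite ge_min lexx orbT.
  by split=> hh; [move: ma; rewrite /a hh|move: mb; rewrite /b hh]; lra.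
- by split=> hh; [have := p1 hh|have := p2 hh]; lra.
pose r := Num.min (r1 / 3) (Num.min r2 8^-1).
have r0 : 0 < r by rewrite !lt_min divr_gt0// r20 invr_gt0 ltr0n.
have rr0 : r <= r1 / 3 by rewrite ge_min lexx.
have rr1 : 3 * r <= r1 by lra.
have rr2 : r <= r2 by rewrite !ge_min lexx orbT.
have rr8 : r <= 8^-1 by rewrite !ge_min lexx !orbT.
have r4 : r <= 4^-1 by lra.
have hlo v : 0 < h v -> 4 * r <= h v by move=> hv; have := (Hr2 v).1 hv; lra.
have hhi v : h v < 1 -> h v <= 1 - 4 * r by move=> hv; have := (Hr2 v).2 hv; lra.
have [N HN] := good_chord TD zeta0 zeta1 SA CH PS ES CA r0 r4 e10.
(* As [y0] is not a corner, each marked vertex lies beyond the upper chord of its own hat function,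
   so a path to it leaves the cell. *)
have hmv c : h (mv v1 v2 v3 c) < 1.
  rewrite lt_def h1 andbT; apply/eqP => E.
  have [j [b hb xE]] := proj1 (surfP TD x0) sx0.
  have := E; rewrite /h xE; set v := mv v1 v2 v3 c.
  have [/mem_faceset[k vE]|hv] := boolP (v \in faceset j); last first.
    by rewrite hat_pt0// => /eqP; rewrite oner_eq0.
  rewrite vE hat_pt// => b1; have [hb0 hbs] := hb; rewrite (sum3 k) -b1 in hbs.
  have z1 : b 0 (succ3 k) = 0 by apply/le_anti; rewrite hb0 andbT; have := hb0 (succ3 (succ3 k)); move: hbs; rewrite b1; lra.
  have z2 : b 0 (succ3 (succ3 k)) = 0 by move: hbs; rewrite z1 b1; lra.
  have xv : x0 = P v by rewrite xE vE /ptj (sum3 k) z1 z2 -b1 !scale0r !addr0 scale1r.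
  by apply: (y0c c); rewrite -Px0 xv (Psi_mv PS).
have [r3 r30 Hr3] : exists2 r3 : R, 0 < r3 & forall z, surf X z -> ball x0 r3 z -> forall v, `|hat v z - h v| < r.
  have [|v a a' a0 aa H|r3 r30 H] := @fin_delta R 'I_(nV X) (fun v r3 => forall z, surf X z -> ball x0 r3 z -> `|hat v z - h v| < r).
  - by move=> v; exact: (scont_hat TD v sx0 r0).
  - by move=> z sz hz; apply: H => //; exact: le_ball hz.
  by exists r3 => // z sz hz v; exact: H.
have [d1 d10 Hd1] := homeo_icont HPsi Ty0 r30.
exists (Num.min d1 e1); first by rewrite lt_min d10.
exists N => q K Phi hq hK q2 HF y Ty; rewrite lt_min => /andP[yd ye].
pose x := Psiinv y; have sx : surf X x by exact: (homeo_S HPsi).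
have hx v : `|hat v x - h v| < r by apply: Hr3 => //; exact: Hd1.
have HG := HN q K Phi hq hK q2 HF (fk_sides HF) (fk_side_edges HF).
have [g hg] : exists g, homeo_sets (surf X) (@Tri R) Phi g by case: HF.
have exl v : exists c : R, 0 < h v -> h v - 3 * r <= c <= h v - 2 * r /\ forall x', surf X x' -> hat v x' = c -> cn (Phi x' - Psi x') <= e1.
  have [hv|hv] := ltP 0 (h v); last by exists 0.
  have [||c [c1 c2]] := HG v (h v - 3 * r).
  - by have := hlo v hv; lra.
  - by have := h1 v; lra.
  by exists c => _; split=> //; move: c1; rewrite (_ : h v - 3 * r + r = h v - 2 * r)//; ring.
have exu v : exists c : R, h v < 1 -> h v + 2 * r <= c <= h v + 3 * r /\ forall x', surf X x' -> hat v x' = c -> cn (Phi x' - Psi x') <= e1.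
  have [hv|hv] := ltP (h v) 1; last by exists 0.
  have [||c [c1 c2]] := HG v (h v + 2 * r).
  - by have := h0 v; lra.
  - by have := hhi v hv; lra.
  by exists c => _; split=> //; move: c1; rewrite (_ : h v + 2 * r + r = h v + 3 * r)//; ring.
have [cl hcl] := choice exl; have [cu hcu] := choice exu.
have TPx : Tri (Phi x) by exact: (homeo_T hg).
have Ttc c : Tri (tc R c) by apply/TriP => m; rewrite mu_tc ler0n.
have key c : mu c (Phi x) <= mu c y + 3 * C * e1.
  pose xs s := g (segC (Phi x) (tc R c) s).
  have sxs s : in01 s -> surf X (xs s) by move=> hs; apply: (homeo_S hg); exact: Tri_seg.
  have x0E : xs 0 = x by rewrite /xs /segC subr0 mul1r mul0r addr0 (homeo_K hg sx).
  have x1E : xs 1 = P (mv v1 v2 v3 c).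
    by rewrite /xs /segC subrr mul0r mul1r add0r -(fk_mv HF) (homeo_K hg (surfV TD _)).
  (* One signed distance per chord, positive inside the cell; a missing chord gets the constant 1,
     which never vanishes. *)
  pose f (vb : 'I_(nV X) * bool) s : R := if vb.2 then (if 0 < h vb.1 then hat vb.1 (xs s) - cl vb.1 else 1)
     else (if h vb.1 < 1 then cu vb.1 - hat vb.1 (xs s) else 1).
  have cc (a : R) : pcont (fun=> a) by move=> t _ ee ee0; exists 1 => // ? _ _; rewrite subrr normr0.
  have hp v : pcont (fun s => hat v (xs s)) by exact: (pcont_seg hg (scont_hat TD v) TPx (Ttc c)).
  have [||| s hs [[[v b] _ fz] fge]] := @ivt_min R _ (enum {: 'I_(nV X) * bool}) f.
  - move=> [v [|]] _; rewrite /f /=.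
      by case: (0 < h v); [exact: (pcontB (hp v) (cc (cl v)))|exact: cc].
    by case: (h v < 1); [exact: (pcontB (cc (cu v)) (hp v))|exact: cc].
  - move=> [v [|]] _; rewrite /f /= x0E; case: ifP => hv //; have := hx v; rewrite ltr_norml => /andP[? ?].
      by have [/andP[? ?] _] := hcl v hv; lra.
    by have [/andP[? ?] _] := hcu v hv; lra.
  - exists (mv v1 v2 v3 c, false); first by rewrite mem_enum.
    rewrite /f /= (hmv c) x1E hat_vertex// eqxx; have [/andP[? ?] _] := hcu _ (hmv c).
    by have := hhi _ (hmv c); rewrite mulr1n; lra.
  have uz : cn (Phi (xs s) - Psi (xs s)) <= e1.
    move: fz; rewrite /f /=; case: b; case: ifP => hv.
    - by move=> /eqP; rewrite subr_eq0 => /eqP E; apply: (hcl v hv).2 => //; exact: sxs.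
    - by move=> /eqP; rewrite oner_eq0.
    - by move=> /eqP; rewrite subr_eq0 => /eqP E; apply: (hcu v hv).2 => //; exact: sxs.
    - by move=> /eqP; rewrite oner_eq0.
  have zz : cn (Psi (xs s) - y0) <= e1.
    apply: Hr1; first exact: sxs.
    move=> w; have ge1 := fge (w, true); have ge2 := fge (w, false).
    rewrite !mem_enum /f /= in ge1 ge2; have {}ge1 := ge1 isT; have {}ge2 := ge2 isT.
    have sw := sxs s hs; have w0 := hat_ge0 TD w sw; have w1 := hat_le1 TD w sw.
    rewrite -/(h w) ler_norml; apply/andP; split.
      move: ge1; case: ifP => hv; last by move=> _; have := h0 w; move/negbT: hv; rewrite -leNgt; lra.
      by have [/andP[? ?] _] := hcl w hv; lra.
    move: ge2; case: ifP => hv; last by move=> _; move/negbT: hv; rewrite -leNgt; lra.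
    by have [/andP[? ?] _] := hcu w hv; lra.
  have m1 : mu c (Phi x) <= mu c (Phi (xs s)).
    rewrite /xs (homeo_Ki hg); last exact: Tri_seg.
    rewrite mu_seg mu_tc eqxx mulr1n mulr1; have := mu_le1 c TPx; have /andP[s0 s1] := hs.
    by move=> hm; have := ler_wpM2l s0 hm; lra.
  have m2 : mu c (Phi (xs s)) - mu c y0 <= C * (2 * e1).
    rewrite mu_sub; apply: le_trans (ler_norm _) _; apply: le_trans (HC _ _) _.
    apply: ler_wpM2l; first exact: ltW.
    by apply: le_trans (cn_tri (Psi (xs s)) _ _) _; move: uz zz; lra.
  have m3 : mu c y0 - mu c y <= C * e1.
    rewrite mu_sub; apply: le_trans (ler_norm _) _; apply: le_trans (HC _ _) _.
    by apply: ler_wpM2l; [exact: ltW|rewrite cnC ltW].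
  by move: m1 m2 m3; lra.
have sm : \sum_(c < 3) muL c (Phi x - y) = 0.
  transitivity (\sum_(c < 3) (mu c (Phi x) - mu c y)); last by rewrite sumrB !mu_sum subrr.
  by apply: eq_bigr => c _; rewrite mu_sub.
have kk c : muL c (Phi x - y) <= 3 * C * e1 by rewrite -mu_sub; have := key c; lra.
have ke : 18 * (C * e1) = e by rewrite /e1; field; rewrite gt_eqF.
apply: le_trans (cn_mul _) _; rewrite -/x; move: sm; rewrite !(sum3 0).
have := kk 0; have := kk (succ3 0); have := kk (succ3 (succ3 0)).
move: (muL 0 _) (muL (succ3 0) _) (muL (succ3 (succ3 0)) _) => a b c h3 h2 h1' s0.
have Ce : 0 < 3 * C * e1 by apply: mulr_gt0 => //; exact: mulr_gt0.
by apply: le_trans (norm3_le Ce s0 h1' h2 h3) _; rewrite -ke; move: Ce; lra.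
Qed.
End Convergence.

(** The exponential is bounded below by [1 + x], which makes the threshold on [q] explicit. *)
Lemma powR_small (R : realType) (C kappa e : R) : 0 < kappa -> 0 < e ->
  exists N, forall q : nat, (N <= q)%N -> C * 2 `^ (- (q%:R * kappa)) <= e.
Proof.
move=> k0 e0; have l2 : 0 < ln (2 : R) by rewrite ln_gt0// ltr1n.
have kl : 0 < kappa * ln 2 by exact: mulr_gt0.
exists (Num.trunc (`|C| / e / (kappa * ln 2))).+1 => q hq.
have hq' : `|C| / e / (kappa * ln 2) <= q%:R.
  by apply: le_trans (ltW (truncnS_gt _)) _; rewrite ler_nat.
rewrite ler_pdivrMr// in hq'.
have E : 2 `^ (- (q%:R * kappa)) = (expR (q%:R * (kappa * ln 2)))^-1 :> R.
  by rewrite /powR ifF; [rewrite -expRN; congr expR; ring|rewrite pnatr_eq0].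
rewrite E; have ex0 := expR_gt0 (q%:R * (kappa * ln 2) : R).
rewrite ler_pdivrMr//; have := expR_ge1Dx (q%:R * (kappa * ln 2) : R) => h.
apply: le_trans (ler_norm _) _.
apply: (@le_trans _ _ (e * (q%:R * (kappa * ln 2)))); first by rewrite -ler_pdivrMl// mulrC.
by apply: ler_wpM2l; [exact: ltW|lra].
Qed.

Lemma interior_not_corner (R : realType) (y : R[i]^o) : interior (@Tri R) y -> forall c, y <> tc R c.
Proof.
move=> /nbhs_cn[e e0 H] c yc.
pose h : R[i] := tc R c - tc R (succ3 c).
have hn : 0 <= cn h := cn_ge0 _; pose s := e / (cn h + 1) / 2.
have s0 : 0 < s by rewrite !divr_gt0// ltr_wpDl.
have sh : s * (cn h + 1) = e / 2 by rewrite /s; field; rewrite gt_eqF// ltr_wpDl.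
have /TriP/(_ (succ3 c)) : Tri (y + s%:C * h).
  apply: H; rewrite (_ : _ - y = s%:C * h); last by rewrite addrC addKr.
  by rewrite cnM cnR gtr0_norm//; move: sh; rewrite mulrDr mulr1; lra.
rewrite yc muD mulZ mu_tc /h -mu_sub !mu_tc eqxx succ3_neq mulr0n mulr1n; lra.
Qed.

Unset Implicit Arguments.

Theorem theorem4p1 (R : realType) (d : nat) (X : TriSurf R d)
    (v1 v2 v3 : 'I_(nV X)) (zeta : R)
    (phi : 'I_(nV X) -> 'rV[R]_d -> R[i]^o)
    (chart : 'I_(nF X) -> seq 'I_4 -> 'I_(nV X))
    (Psi : 'rV[R]_d -> R[i]^o) (Psiinv : R[i]^o -> 'rV[R]_d)
    (kappa : R) (Q : nat) (K : nat -> R) (Phi : nat -> 'rV[R]_d -> R[i]^o) :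
  triangulated_disk X ->
  marked_vertices X v1 v2 v3 ->
  0 < zeta < 4^-1 ->
  standing_assumption X v1 v2 v3 ->
  (forall i, is_chart X v1 v2 v3 zeta i (phi i)) ->
  chart_assignment X zeta chart ->
  is_Psi X v1 v2 v3 zeta phi Psi Psiinv ->
  0 < kappa ->
  (2 <= Q)%N ->
  (exists (Cst : R) (N : nat), forall q : nat, (N <= q)%N ->
      `|K q - 1| <= Cst * 2 `^ (- (q%:R * kappa))) ->
  (forall q : nat, (Q <= q)%N -> in_FK X v1 v2 v3 phi chart (K q) q (Phi q)) ->
  forall Kc : set R[i]^o, compact Kc -> Kc `<=` interior (@Tri R) ->
  forall eps : R, 0 < eps -> exists N : nat, forall q : nat, (N <= q)%N ->
    forall y, Kc y -> `|Phi q (Psiinv y) - y| < eps%:C.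
Proof.
move=> TD _ /andP[zeta0 zeta1] SA CH CA PS kappa0 Q2 [Cst [N0 HK]] HF Kc cK Ki eps eps0.
have ES := fk_edge_side TD zeta0 zeta1 SA CH PS (HF Q (leqnn Q)).
have K1 N : exists N1, forall q, (N1 <= q)%N -> K q - 1 <= N.+1%:R^-1.
  have [N1 HN1] := @powR_small R Cst kappa N.+1%:R^-1 kappa0 ltac:(by rewrite invr_gt0 ltr0n).
  exists (N0 + N1)%N => q hq; apply: le_trans (ler_norm _) _; apply: le_trans (HK q _) _.
    by apply: leq_trans hq; exact: leq_addr.
  by apply: HN1; apply: leq_trans hq; exact: leq_addl.
have e20 : 0 < eps / 2 by exact: divr_gt0.
(* The points that are bad at some level from [N] on. If no [N] works, these sets generate a proper
   filter on [Kc]; a cluster point of it contradicts [local_convergence], whose thresholds depend on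
   the point. *)
pose S N : set R[i]^o := [set y | Kc y /\ exists2 q, (N <= q)%N & ~ cn (Phi q (Psiinv y) - y) < eps].
apply: contrapT => /forallNP bad.
have SN N : S N !=set0.
  have /existsNP[q /not_implyP[hq /existsNP[y /not_implyP[hy hb]]]] := bad N.
  by exists y; split=> //; exists q => //; rewrite -ltC_cn; exact: hb.
have FS : ProperFilter (filter_from setT S).
  apply: filter_from_proper => [|N _]; last exact: SN.
  apply: filter_from_filter; first by exists 0%N.
  move=> N N' _ _; exists (maxn N N') => // y [hy [q hq hb]].
  by split; split=> //; exists q => //; apply: leq_trans hq; [exact: leq_maxl|exact: leq_maxr].
have [|y0 [Ky0 cl]] := cK (filter_from setT S) FS; first by exists 0%N => // y [].
have iy0 := Ki _ Ky0.
have Ty0 : Tri y0 by exact: nbhs_singleton iy0.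
have [de de0 [N HN]] := local_convergence TD zeta0 zeta1 SA CH PS CA ES e20 Ty0 (interior_not_corner iy0).
have [N1 HN1] := K1 N.
have [||y [[hy [q hq hb]] yn]] := cl (S (N + N1 + Q)%N) [set y | cn (y - y0) < de].
- by exists (N + N1 + Q)%N.
- by apply/nbhs_cn; exists de.
apply: hb; apply: le_lt_trans (HN q (K q) (Phi q) _ _ _ _ y _ yn) _.
- by apply: leq_trans hq; rewrite -addnA leq_addr.
- by apply: HN1; apply: leq_trans hq; rewrite -addnA addnCA leq_addr.
- by apply: leq_trans Q2 (leq_trans _ hq); exact: leq_addl.
- by apply: HF; apply: leq_trans hq; exact: leq_addl.
- exact: nbhs_singleton (Ki _ hy).
by rewrite ltr_pdivrMr// ltr_pMr// ltr1n.
Qed.
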